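(* Let $\mathcal{N}$ be a network with $k$ asymmetric inputs, $\mu$ a defective network eigenvalue, $f\in\mathcal{V}_\mu(\mathcal{N})$ generic, and $\Delta$ a $\mu$-submaximal synchrony subspace of $\mathcal{N}$ on which $\mu$ has multiplicity $(1,2)$. Write $J$ for $J_f^{\mathcal{N}}$ restricted to $\Delta$, let $\Delta_1\subsetneq\Delta$ be the $\mu$-maximal synchrony subspace contained in $\Delta$, and let $v_1,v_2\in\ker(J^2)$ and $v_1^*,v_2^*\in(\mathrm{range}(J^2))^\perp$ be such that $v_1,v_1^*\in\Delta_1$, $Jv_2=v_1$, $\langle v_1^*,v_1\rangle=1$, $\langle v_2^*,v_2\rangle=1$ and $\langle v_1^*,v_2^*\rangle=0$. Let $P$ be the projection onto $\mathrm{range}(J^2)$ with kernel $(\mathrm{range}(J^2))^\perp$. Suppose that there are $p,q\in\{0,1,\dots,k\}$ such that $$\big\langle v_2^*,\ [A_p(v_2-(PJ)^{-1}Pv_1)]*[A_q(v_2-(PJ)^{-1}Pv_1)]\big\rangle\neq0,$$ where $A_0=\mathrm{Id}$, $A_1,\dots,A_k$ are the adjacency matrices, $(PJ)^{-1}$ is the inverse of $PJ:\mathrm{range}(J^2)\to\mathrm{range}(J^2)$, and $*$ is the componentwise product. Then there exists a bifurcation branch of $f^{\mathcal{N}}$ with synchrony $\Delta$.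
   Context: **Networks.** An $n$-cell network $\mathcal{N}$ with $k$ asymmetric inputs has cells $1,\dots,n$ and edges of $k$ types, such that each cell receives exactly one edge of each type. It is given by $n\times n$ adjacency matrices $A_1,\dots,A_k$, where $(A_l)_{ij}=1$ if the edge of type $l$ ending at cell $i$ starts at cell $j$, and $(A_l)_{ij}=0$ otherwise. All networks are assumed connected (there is an undirected path between any two cells). **Coupled cell systems.** Each cell has phase space $\mathbb{R}$. A smooth $f:\mathbb{R}\times\mathbb{R}^k\times\mathbb{R}\to\mathbb{R}$ defines $f^{\mathcal{N}}:\mathbb{R}^n\times\mathbb{R}\to\mathbb{R}^n$, $f^{\mathcal{N}}_i(x,\lambda)=f(x_i,x_{i_1},\dots,x_{i_k},\lambda)$, where $i_j$ is the source of the type-$j$ edge ending at cell $i$. Write $f_j$ ($0\le j\le k$) for the derivative of $f$ at the origin with respect to its $(j+1)$-th variable. The Jacobian at the origin is $J_f^{\mathcal{N}}=f_0\,\mathrm{Id}_n+\sum_{j=1}^k f_jA_j$. **Network eigenvalues.** These are continuous functions $\mu_1,\dots,\mu_s:\mathbb{R}^{k+1}\to\mathbb{C}$ such that $\mu_i(f_0,\dots,f_k)$ are the distinct eigenvalues of $J_f^{\mathcal{N}}$ ($f$ generic). A network eigenvalue is *simple* if it has algebraic multiplicity one for generic $f$, and *defective with multiplicity $(m,n)$*, $m<n$, if for generic $f$ it has geometric multiplicity $m$ and algebraic multiplicity $n$. **Synchrony subspaces.** A polydiagonal (subspace of $\mathbb{R}^n$ defined by equalities $x_i=x_j$) is a synchrony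 subspace if it is invariant under all admissible vector fields, equivalently under $A_1,\dots,A_k$. The restriction of $f^{\mathcal{N}}$ to a synchrony subspace $\Delta$ is the coupled cell system defined by the same $f$ on the quotient network determined by $\Delta$ (cells are the classes of synchronized cells, edge types preserved). Network eigenvalues of the quotient are called eigenvalues of $\Delta$, and the multiplicity of $\mu$ on $\Delta$ is its multiplicity as an eigenvalue of the quotient. $\Delta$ is identified with Euclidean space via the cell coordinates of the quotient network; inner products, orthogonal complements, componentwise products, and the matrices $A_p$ and $J$ in the claim are taken on $\Delta$ under this identification (so the $A_p$ act as the adjacency matrices of the quotient network). For a synchrony subspace $\Delta$ having $\mu$ as an eigenvalue: - $\Delta$ is *$\mu$-maximal* if $\mu$ is not an eigenvalue of any synchrony subspace $\overline\Delta\subsetneq\Delta$; - $\Delta$ is *$\mu$-submaximal of order $j\ge1$* if there are $j$ synchrony subspaces $\Delta_1,\dots,\Delta_j\subsetneq\Delta$ that are $\mu$-maximal and on which $\mu$ is simple and, for any generic $f\in\mathcal{V}_\mu(\mathcal{N})$ and any synchrony subspace $\overline\Delta\subsetneq\Delta$, $\ \overline\Delta\cap\bigcup_l\ker((J_f^{\mathcal{N}})^l)\subsetneq\Delta\cap\bigcup_l\ker((J_f^{\mathcal{N}})^l)$. When $\mu$ has multiplicity $(1,2)$ on $\Delta$ the order is necessarily $1$. **Bifurcation problems.** $\mathcal{V}_\mu(\mathcal{N})$ is the set of such $f$ with $\mu(f_0,\dots,f_k)=0$, $(f_0,\dots,f_k)\in\mathrm{int}(\mu^{-1}(\mathbb{R}))$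 and $f(0,\lambda)=0$ for all $\lambda$. *Generic* $f$ means: $f$ satisfies a suitable finite number of non-degeneracy conditions, i.e. non-trivial inequalities ($\neq$) on the derivatives of $f$ at the origin (not involving $f_0$, determined by $\mu=0$) not contradicting the bifurcation condition. **Branches.** A bifurcation branch of $f^{\mathcal{N}}$ is a function $b:R\to\mathbb{R}^n$, $b\not\equiv0$, with $f^{\mathcal{N}}(b(\lambda),\lambda)=0$ for $\lambda\in R$, where $R\subseteq\mathbb{R}$ is a (nondegenerate) connected region containing $0$. Bifurcation is local at $(0,0)$: $b$ is continuous with $b(0)=0$, and $R$ may be shrunk. The branch has synchrony $\Delta$ if $\Delta$ is the smallest synchrony subspace containing $b(R)$. *)

(* Defs.v *)
From HB Require Import structures.
From mathcomp Require Import all_boot all_order all_algebra.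
From mathcomp Require Import complex.
From mathcomp Require mpoly.
From mathcomp Require Import all_classical all_reals all_analysis.

Set Implicit Arguments.
Unset Strict Implicit.
Unset Printing Implicit Defensive.

Import Order.TTheory GRing.Theory Num.Theory.
Import numFieldNormedType.Exports.

Local Open Scope classical_set_scope.
Local Open Scope complex_scope.
Local Open Scope ring_scope.

(* [N l i] is the source of the unique edge of type l ending at cell i. *)
Definition network (n k : nat) := 'I_k -> 'I_n -> 'I_n.

Definition net_connected (n k : nat) (N : network n k) : Prop :=
  forall i j : 'I_n,
    connect (fun a b => [exists l, (N l a == b) || (N l b == a)]) i j.

Section CoupledCells.
Variable R : realType.

Section Functions.
Variable k : nat.

(* An internal dynamics f : R x R^k x R -> R is a function of k + 2 variables:
   variable 0 is the state of the cell itself, variables 1, ..., k are the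
   states of its inputs, and variable k + 1 (= ord_max) is the parameter. *)
Definition dynamics := 'rV[R]_k.+2 -> R.

Definition partial (i : 'I_k.+2) (f : dynamics) : dynamics :=
  fun x => 'D_(delta_mx 0 i) f x.

Definition partials (s : seq 'I_k.+2) (f : dynamics) : dynamics :=
  foldr partial f s.

Definition smooth : set dynamics :=
  [set f | forall s : seq 'I_k.+2, continuous (partials s f) /\
     forall i x, derivable (partials s f) x (delta_mx 0 i)].

(* (f_0, ..., f_k); [lift ord_max j : 'I_k.+2] has the same value as j. *)
Definition jet1 (f : dynamics) : 'rV[R]_k.+1 :=
  \row_j partial (lift ord_max j) f 0.

(* A non-degeneracy condition: [ndc_poly], evaluated at the partial derivatives
   of f at the origin indexed by [ndc_idx], is nonzero. The derivative f_0,
   indexed by [:: ord0], is excluded: it is determined by mu = 0. *)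
Record nondeg_cond := NondegCond {
  ndc_size : nat;
  ndc_idx : 'I_ndc_size -> seq 'I_k.+2;
  ndc_poly : mpoly.mpoly ndc_size R;
  _ : forall i, ndc_idx i != [::] /\ ndc_idx i != [:: ord0] }.

Definition nondeg (C : nondeg_cond) (f : dynamics) : Prop :=
  mpoly.meval (fun i => partials (@ndc_idx C i) f 0) (ndc_poly C) != 0.

(* P holds for generic f in S: finitely many conditions, none of which
   contradicts membership in S, suffice for P. *)
Definition generic (S : set dynamics) (P : dynamics -> Prop) : Prop :=
  exists (r : nat) (C : 'I_r -> nondeg_cond),
    (forall i, exists2 f, S f & nondeg (C i) f) /\
    (forall f, S f -> (forall i, nondeg (C i) f) -> P f).

Definition bif_problem (mu : 'rV[R]_k.+1 -> R[i]) : set dynamics :=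
  [set f | [/\ smooth f,
      mu (jet1 f) = 0,
      ([set a | complex.Im (mu a) = 0])° (jet1 f) &
      forall t : R, f (t *: delta_mx 0 ord_max) = 0]].

End Functions.

Section Networks.
Variables (n k : nat).
Implicit Types (N : network n k) (f : dynamics k) (a : 'rV[R]_k.+1).
Implicit Types (mu : 'rV[R]_k.+1 -> R[i]) (D : set 'cV[R]_n).

Definition adjmx N (l : 'I_k) : 'M[R]_n := \matrix_(i, j) (N l i == j)%:R.

(* A_0 = Id, A_1, ..., A_k *)
Definition adjmx0 N (p : 'I_k.+1) : 'M[R]_n :=
  if unlift ord0 p is Some l then adjmx N l else 1%:M.

Definition admissible N f (x : 'cV[R]_n) (t : R) : 'cV[R]_n :=
  \col_i f (\row_j
    match unlift ord_max j with
    | None => t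
    | Some j' => if unlift ord0 j' is Some l then x (N l i) 0 else x i 0
    end).

Definition netmx N a : 'M[R]_n :=
  (a 0 ord0)%:M + \sum_(l < k) a 0 (lift ord0 l) *: adjmx N l.

Definition net_jacobian N f : 'M[R]_n := netmx N (jet1 f).

Definition cjacobian N f : 'M[R[i]]_n := map_mx (real_complex R) (net_jacobian N f).

Definition network_eigenvalues N (s : nat)
    (mus : 'I_s -> 'rV[R]_k.+1 -> R[i]) : Prop :=
  (forall i, continuous (fun a => complex.Re (mus i a)) /\
             continuous (fun a => complex.Im (mus i a))) /\
  generic (@smooth k) (fun f =>
    injective (fun i => mus i (jet1 f)) /\
    forall z : R[i], eigenvalue (cjacobian N f) z <->
                     exists i, z = mus i (jet1 f)).

Definition network_eigenvalue N mu : Prop :=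
  exists (s : nat) (mus : 'I_s -> 'rV[R]_k.+1 -> R[i]),
    network_eigenvalues N mus /\ exists i, mu = mus i.

(* [eigenspace] consists of row vectors, hence the transpose. *)
Definition geom_mult N f (z : R[i]) : nat :=
  \rank (eigenspace (cjacobian N f)^T z).

Definition alg_mult N f (z : R[i]) : nat := mup z (char_poly (cjacobian N f)).

Definition simple_eigenvalue N mu : Prop :=
  generic (@smooth k) (fun f => alg_mult N f (mu (jet1 f)) = 1%N).

Definition has_multiplicity N mu (g m : nat) : Prop :=
  generic (@smooth k) (fun f => geom_mult N f (mu (jet1 f)) = g /\
                                alg_mult N f (mu (jet1 f)) = m).

Definition defective N mu : Prop :=
  exists g m : nat, (g < m)%N /\ has_multiplicity N mu g m.

Definition polydiagonal D : Prop :=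
  exists e : rel 'I_n, D = [set x | forall i j, e i j -> x i 0 = x j 0].

Definition synchrony N D : Prop :=
  polydiagonal D /\
  forall f, smooth f -> forall x t, D x -> D (admissible N f x t).

(* The inclusion of the synchrony subspace into R^n, in the cell coordinates of
   the quotient: c maps each cell to its class. *)
Definition sync_incl (m : nat) (c : 'I_n -> 'I_m) (y : 'cV[R]_m) : 'cV[R]_n :=
  \col_i y (c i) 0.

Definition quotient_network N D (m : nat) (Q : network m k)
    (c : 'I_n -> 'I_m) : Prop :=
  [/\ forall q, exists i, c i = q,
      D = range (sync_incl c) &
      forall l i, Q l (c i) = c (N l i)].

End Networks.

Section Synchrony.
Variables (n k : nat).
Implicit Types (N : network n k) (f : dynamics k) (mu : 'rV[R]_k.+1 -> R[i]).
Implicit Types (D : set 'cV[R]_n).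

(* A network property transferred to a synchrony subspace through its quotient
   network, which is unique up to the numbering of its cells. *)
Definition on_quotient N D (P : forall m : nat, network m k -> Prop) : Prop :=
  exists (m : nat) (Q : network m k) (c : 'I_n -> 'I_m),
    quotient_network N D Q c /\ P m Q.

Definition eigenvalue_on N D mu : Prop :=
  on_quotient N D (fun m Q => network_eigenvalue Q mu).

Definition simple_on N D mu : Prop :=
  on_quotient N D (fun m Q => simple_eigenvalue Q mu).

Definition multiplicity_on N D mu (g a : nat) : Prop :=
  on_quotient N D (fun m Q => has_multiplicity Q mu g a).

Definition mu_maximal N mu D : Prop :=
  [/\ synchrony N D, eigenvalue_on N D mu &
      forall D', synchrony N D' -> D' `<` D -> ~ eigenvalue_on N D' mu].

Definition gen_kernel N f : set 'cV[R]_n :=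
  [set x | exists l : nat, iter l (mulmx (net_jacobian N f)) x = 0].

Definition submaximal_order N mu D (j : nat) : Prop :=
  [/\ synchrony N D, eigenvalue_on N D mu,
      exists Ds : 'I_j -> set 'cV[R]_n, injective Ds /\
        forall i, [/\ Ds i `<` D, mu_maximal N mu (Ds i) & simple_on N (Ds i) mu] &
      generic (bif_problem mu) (fun f =>
        forall D', synchrony N D' -> D' `<` D ->
          D' `&` gen_kernel N f `<` D `&` gen_kernel N f)].

Definition mu_submaximal N mu D : Prop :=
  exists j : nat, (0 < j)%N /\ submaximal_order N mu D j.

Definition region (T : set R) : Prop :=
  [/\ connected T, T 0 & exists2 t, T t & t != 0].

Definition branch N f (T : set R) (b : R -> 'cV[R]_n) : Prop :=
  [/\ region T, {within T, continuous b}, b 0 = 0,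
      exists2 t, T t & b t != 0 &
      forall t, T t -> admissible N f (b t) t = 0].

Definition branch_synchrony N (T : set R) (b : R -> 'cV[R]_n) D : Prop :=
  [/\ synchrony N D, b @` T `<=` D &
      forall D', synchrony N D' -> b @` T `<=` D' -> D `<=` D'].

(* Bifurcation being local at (0, 0), non-triviality of the branch and its
   synchrony must persist when its domain is shrunk. *)
Definition has_branch_with_synchrony N f D : Prop :=
  exists (T : set R) (b : R -> 'cV[R]_n), region T /\
    forall T', T' `<=` T -> region T' ->
      branch N f T' b /\ branch_synchrony N T' b D.

End Synchrony.

Section LinearAlgebra.
Variable m : nat.
Implicit Types (u v x : 'cV[R]_m) (M K P : 'M[R]_m) (U W : set 'cV[R]_m).

Definition dot u v : R := \sum_i u i 0 * v i 0.

Definition orthc U : set 'cV[R]_m := [set u | forall x, U x -> dot u x = 0].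

Definition rangemx M : set 'cV[R]_m := range (mulmx M).

Definition is_projection P U W : Prop :=
  [/\ P *m P = P, rangemx P = U & [set x | P *m x = 0] = W].

(* M maps U bijectively to itself, and K acts on U as the inverse. *)
Definition is_inverse_on U M K : Prop :=
  forall x, U x -> [/\ U (M *m x), U (K *m x),
                       M *m (K *m x) = x & K *m (M *m x) = x].

Definition cmul u v : 'cV[R]_m := map2_mx *%R u v.

End LinearAlgebra.

End CoupledCells.

(* Main.v *)
(* At a generic [f], the restriction [J] of the Jacobian to [Delta] has a single
   Jordan block for the eigenvalue 0. It has size two, with eigenvector [v1] in
   [Delta_1], while [v2] lies in no synchrony subspace strictly inside [Delta]
   that contains [v1]. Write a state as [u + b eta] with [u] in [Delta_1] and
   [eta] in a complement. The equations transversal to [Delta_1] are divisible by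
   [b]; after division the system is nonsingular, and Hensel's lemma solves it by
   power series in the amplitude along [v1].

   Generically the parameter and the Jacobian determinant along this formal
   branch do not vanish to infinite order. Indeed, nonvanishing of a coefficient
   is a polynomial condition on the jet of [f], and it is met at the dynamics
   [L x + x_0 lambda + phi (x_0)] with the same 1-jet, for a suitable polynomial
   [phi]. A condition must not involve [f_0], but [f_0] is an eigenvalue of
   [B = - (f_1 A_1 + ... + f_k A_k)], so that a polynomial in [f_0] is replaced
   by a rank condition on the same polynomial in [B].

   As in Tougeron's implicit function theorem, Newton's method started at a
   truncation of high order yields an actual branch, tangent to [v1]. If it were
   contained in a smaller synchrony subspace, it would be annihilated by the left
   kernel of [J]; but the formal branch is not. *)

Require Import Defs.
From HB Require Import structures.
From mathcomp Require Import all_boot all_order all_algebra.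
From mathcomp Require Import complex separable.
From mathcomp Require Import all_classical all_reals all_analysis.
From mathcomp Require polyrcf mpoly.
From mathcomp Require Import ring lra zify.
Set Implicit Arguments.
Unset Strict Implicit.
Unset Printing Implicit Defensive.
Import Order.TTheory GRing.Theory Num.Theory.
Import numFieldNormedType.Exports.
Local Open Scope classical_set_scope.
Local Open Scope complex_scope.
Local Open Scope ring_scope.

(** * Formal power series *)

(** Genericity allows finitely many polynomial conditions that are fixed before [f] is known, so
    solving the equations for one [f] at a time is not enough. The equations are therefore syntax
    trees ([pexp]) with constants depending on the dynamics. One tree is evaluated in the reals, in
    power series and in polynomials, and the coefficients of the formal solution are rational in the
    jet.

    The amplitude is the independent variable; [lambda] and [b] are unknowns, so that no order of
    either has to be guessed. What makes the divided system regular at the test dynamics is the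
    Jordan block: [J eta] lies in [Delta_1] but outside [J Delta_1], so [b] enters the equations of
    [Delta_1] at first order, whereas [lambda] enters the transversal ones through [lambda eta],
    which the left kernel of [J] detects.

    Regularity yields a formal solution but no branch yet, since [b] or [lambda] might vanish
    identically. These are the only two dangers: differentiating along the solution bounds the order
    of the Jacobian determinant by those of [b] and of the derivative of [lambda]. *)

Section PowerSeries.
Variable R : comNzRingType.

Definition fps := nat -> R.
HB.instance Definition _ := GRing.Zmodule.on fps.

Implicit Types f g h : fps.

Definition trunc n f : {poly R} := \poly_(i < n) f i.

Definition fps_of (p : {poly R}) : fps := fun n => p`_n.

Definition fps_mul f g : fps := fun n => \sum_(i < n.+1) f i * g (n - i)%N.

Lemma coef_trunc n f i : (trunc n f)`_i = if (i < n)%N then f i else 0.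
Proof. by rewrite coef_poly. Qed.

(** A coefficient of a product sees only finitely many terms of the factors, so the ring axioms are
    transported from polynomials by truncation. *)
Lemma fps_mulE n k f g : (n < k)%N ->
  fps_mul f g n = (trunc k f * trunc k g)`_n.
Proof.
move=> nk; rewrite coefM; apply: eq_bigr => -[i /= ilt] _.
by rewrite !coef_trunc !ifT //; lia.
Qed.

Lemma coefM_eq (p q p' q' : {poly R}) n :
  (forall i, (i <= n)%N -> p`_i = p'`_i) ->
  (forall i, (i <= n)%N -> q`_i = q'`_i) -> (p * q)`_n = (p' * q')`_n.
Proof.
move=> pp qq; rewrite !coefM; apply: eq_bigr => -[i /= ilt] _.
by rewrite pp 1?qq //; lia.
Qed.

Lemma trunc_mul f g n i : (i < n)%N ->
  (trunc n (fps_mul f g))`_i = (trunc n f * trunc n g)`_i.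
Proof. by move=> iltn; rewrite coef_trunc iltn (fps_mulE _ _ iltn). Qed.

Lemma fps_mulA : associative fps_mul.
Proof.
move=> f g h; apply/funext => n.
rewrite !(fps_mulE _ _ (ltnSn n)).
transitivity ((trunc n.+1 f * (trunc n.+1 g * trunc n.+1 h))`_n).
  by apply: coefM_eq => // i ile; rewrite trunc_mul.
by rewrite mulrA; apply: coefM_eq => // i ile; rewrite trunc_mul.
Qed.

Lemma fps_mulC : commutative fps_mul.
Proof.
by move=> f g; apply/funext => n; rewrite !(fps_mulE _ _ (ltnSn n)) mulrC.
Qed.

Lemma fps_mul1 : left_id (fps_of 1) fps_mul.
Proof.
move=> f; apply/funext => n; rewrite (fps_mulE _ _ (ltnSn n)).
rewrite (@coefM_eq _ _ 1 (trunc n.+1 f)) //.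
  by rewrite mul1r coef_trunc ltnSn.
by move=> i ile; rewrite coef_trunc ifT.
Qed.

Lemma fps_mulDl : left_distributive fps_mul +%R.
Proof.
move=> f g h; apply/funext => n.
have -> : (fps_mul f h + fps_mul g h) n = fps_mul f h n + fps_mul g h n by [].
rewrite /fps_mul -big_split; apply: eq_bigr => i _.
by have -> : (f + g) i = f i + g i by []; rewrite mulrDl.
Qed.

Lemma fps_oner_neq0 : fps_of 1 != 0.
Proof.
apply/eqP => /(congr1 (fun f : fps => f 0%N)).
by rewrite /fps_of coef1 /=; exact/eqP/oner_neq0.
Qed.

HB.instance Definition _ := GRing.Zmodule_isComNzRing.Build fps
  fps_mulA fps_mulC fps_mul1 fps_mulDl fps_oner_neq0.

Lemma fps_coefD f g n : (f + g) n = f n + g n. Proof. by []. Qed.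
Lemma fps_coefN f n : (- f) n = - f n. Proof. by []. Qed.
Lemma fps_coefB f g n : (f - g) n = f n - g n. Proof. by []. Qed.
Lemma fps_coef0 n : (0 : fps) n = 0. Proof. by []. Qed.
Lemma fps_coef1 n : (1 : fps) n = (n == 0%N)%:R.
Proof. exact: coef1. Qed.
Lemma fps_coefM f g n : (f * g) n = \sum_(i < n.+1) f i * g (n - i)%N.
Proof. by []. Qed.
Lemma fps_coefM0 f g : (f * g) 0%N = f 0%N * g 0%N.
Proof. by rewrite fps_coefM big_ord1. Qed.

Lemma fps_coef_sum (I : Type) (r : seq I) (P : pred I) (F : I -> fps) n :
  (\sum_(i <- r | P i) F i) n = \sum_(i <- r | P i) F i n.
Proof. by elim/big_rec2: _ => // i y x _ <-. Qed.

Lemma fps_of_is_zmod_morphism : zmod_morphism fps_of.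
Proof. by move=> p q; apply/funext => n; rewrite /fps_of coefB. Qed.

Lemma fps_of_is_monoid_morphism : monoid_morphism fps_of.
Proof. by split=> // p q; apply/funext => n; rewrite /fps_of coefM. Qed.

HB.instance Definition _ := GRing.isZmodMorphism.Build {poly R} fps fps_of
  fps_of_is_zmod_morphism.
HB.instance Definition _ := GRing.isMonoidMorphism.Build {poly R} fps fps_of
  fps_of_is_monoid_morphism.

Definition fpsC (c : R) : fps := fps_of c%:P.

Lemma fpsC_is_zmod_morphism : zmod_morphism fpsC.
Proof. by move=> a b; rewrite /fpsC !rmorphB. Qed.

Lemma fpsC_is_monoid_morphism : monoid_morphism fpsC.
Proof. by split=> [|a b]; rewrite /fpsC ?rmorph1 // !rmorphM. Qed.

HB.instance Definition _ := GRing.isZmodMorphism.Build R fps fpsC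
  fpsC_is_zmod_morphism.
HB.instance Definition _ := GRing.isMonoidMorphism.Build R fps fpsC
  fpsC_is_monoid_morphism.

Definition fpsX : fps := fps_of 'X.

Lemma fps_coefC c n : fpsC c n = if n == 0%N then c else 0.
Proof. by rewrite /fpsC /fps_of coefC. Qed.

Lemma fps_coefCM c f n : (fpsC c * f) n = c * f n.
Proof.
rewrite fps_coefM (bigD1 ord0) //= subn0 fps_coefC eqxx big1 ?addr0 //.
by move=> i i0; rewrite fps_coefC ifF ?mul0r //; apply/negbTE.
Qed.

Lemma fps_coefXn k n : (fpsX ^+ k) n = (n == k)%:R.
Proof. by rewrite /fpsX -rmorphXn /= /fps_of coefXn. Qed.

Lemma fps_coefXnM k f n :
  (fpsX ^+ k * f) n = if (n < k)%N then 0 else f (n - k)%N.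
Proof.
rewrite fps_coefM; case: ltnP => nk.
  apply: big1 => -[i /= ilt] _.
  by rewrite fps_coefXn (_ : (i == k) = false) ?mul0r //; lia.
have kn : (k < n.+1)%N by rewrite ltnS.
rewrite (bigD1 (Ordinal kn)) //= fps_coefXn eqxx mul1r big1 ?addr0 //.
move=> i /eqP ni; rewrite fps_coefXn (_ : (nat_of_ord i == k) = false) ?mul0r //.
by apply/eqP => e; apply: ni; apply/val_inj.
Qed.

Lemma fps_coef0_is_zmod_morphism : zmod_morphism (fun f : fps => f 0%N).
Proof. by []. Qed.

Lemma fps_coef0_is_monoid_morphism : monoid_morphism (fun f : fps => f 0%N).
Proof. by split=> [|f g]; rewrite ?fps_coef1 ?fps_coefM0. Qed.

Definition fps_coef0_rmorph := fun f : fps => f 0%N.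
HB.instance Definition _ := GRing.isZmodMorphism.Build fps R fps_coef0_rmorph
  fps_coef0_is_zmod_morphism.
HB.instance Definition _ := GRing.isMonoidMorphism.Build fps R fps_coef0_rmorph
  fps_coef0_is_monoid_morphism.

Definition lowz n f := forall i, (i < n)%N -> f i = 0.

Lemma lowz_dvd n f : lowz n f -> exists g, f = fpsX ^+ n * g.
Proof.
move=> fz; exists (fun i => f (i + n)%N); apply/funext => i.
by rewrite fps_coefXnM; case: ltnP => [/fz //|ni]; rewrite subnK.
Qed.

Lemma lowzXM n f : lowz n (fpsX ^+ n * f).
Proof. by move=> i iltn; rewrite fps_coefXnM iltn. Qed.

Lemma lowzD n f g : lowz n f -> lowz n g -> lowz n (f + g).
Proof. by move=> fz gz i iltn; rewrite fps_coefD fz ?gz ?addr0. Qed.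

Lemma lowzN n f : lowz n f -> lowz n (- f).
Proof. by move=> fz i iltn; rewrite fps_coefN fz ?oppr0. Qed.

Lemma lowzB n f g : lowz n f -> lowz n g -> lowz n (f - g).
Proof. by move=> fz gz; apply/lowzD/lowzN. Qed.

Lemma lowzM n k f g : lowz n f -> lowz k g -> lowz (n + k) (f * g).
Proof.
move=> /lowz_dvd[f' ->] /lowz_dvd[g' ->].
by rewrite mulrACA -exprD; exact: lowzXM.
Qed.

Lemma lowz0 f : lowz 0 f. Proof. by []. Qed.

Lemma lowzMl n f g : lowz n f -> lowz n (f * g).
Proof. by move=> fz; rewrite -(addn0 n); apply: lowzM. Qed.

Lemma lowzMr n f g : lowz n g -> lowz n (f * g).
Proof. by move=> fz; rewrite mulrC; apply: lowzMl. Qed.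

Lemma lowz_sum n (I : Type) (r : seq I) (P : pred I) (F : I -> fps) :
  (forall i, P i -> lowz n (F i)) -> lowz n (\sum_(i <- r | P i) F i).
Proof. by move=> Fz; elim/big_rec: _ => // i x Pi; apply: lowzD; apply: Fz. Qed.

Lemma lowzW n k f : (k <= n)%N -> lowz n f -> lowz k f.
Proof. by move=> kn fz i ik; apply: fz; apply: leq_trans kn. Qed.

Definition fps_deriv f : fps := fun n => f n.+1 *+ n.+1.

Lemma fps_derivD f g : fps_deriv (f + g) = fps_deriv f + fps_deriv g.
Proof. by apply/funext => n; rewrite /fps_deriv !fps_coefD mulrnDl. Qed.

Lemma fps_derivC c : fps_deriv (fpsC c) = 0.
Proof. by apply/funext => n; rewrite /fps_deriv fps_coefC /= mul0rn. Qed.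

Lemma fps_derivM f g :
  fps_deriv (f * g) = fps_deriv f * g + f * fps_deriv g.
Proof.
apply/funext => n; rewrite fps_coefD.
have E h k i : (i <= k)%N -> (trunc k.+1 (fps_deriv h))`_i = (trunc k.+2 h)^`()`_i.
  by move=> ik; rewrite coef_deriv !coef_trunc !ltnS ik.
have E2 h i : (i <= n)%N -> (trunc n.+1 h)`_i = (trunc n.+2 h)`_i.
  by move=> ik; rewrite !coef_trunc !ifT //; lia.
rewrite [fps_deriv f * g]/GRing.mul /= [f * fps_deriv g]/GRing.mul /=.
rewrite !(fps_mulE _ _ (ltnSn n)).
rewrite (@coefM_eq _ _ (trunc n.+2 f)^`() (trunc n.+2 g)); try by auto.
rewrite (@coefM_eq (trunc n.+1 f) _ (trunc n.+2 f) (trunc n.+2 g)^`()); try by auto.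
rewrite -coefD -derivM coef_deriv /fps_deriv.
by rewrite [f * g]/GRing.mul /= (fps_mulE _ _ (ltnSn n.+1)).
Qed.

End PowerSeries.

Arguments fpsX {R}.
Arguments fpsC {R}.

Section Order.
Variable R : idomainType.
Implicit Types f g : fps R.

(** An upper bound on the order of vanishing, which in particular excludes zero. Bounds are handier
    than exact orders, as they pass from a product to each factor ([ordle_Ml]). *)
Definition ordle f (k : nat) := exists2 i, (i <= k)%N & f i != 0.

Lemma ordleP f k : ordle f k ->
  exists2 i, (i <= k)%N & lowz i f /\ f i != 0.
Proof.
case=> i ik fi; have : exists i, f i != 0 by exists i.
move=> /ex_minnP[j fj jmin]; exists j.
  by rewrite (leq_trans _ ik) ?jmin.
split=> // l lj; apply/eqP/negPn/negP => /jmin; lia.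
Qed.

Lemma ordle_neq0 f k : ordle f k -> f <> 0.
Proof. by move=> [i _ fi] f0; rewrite f0 eqxx in fi. Qed.

Lemma neq0_ordle f : f <> 0 -> exists k, ordle f k.
Proof.
move=> f0; apply: contrapT => nf; apply: f0; apply/funext => i.
by apply/eqP/negPn/negP => fi; apply: nf; exists i; exists i.
Qed.

Lemma ordleM f g k l : ordle f k -> ordle g l -> ordle (f * g) (k + l).
Proof.
move=> /ordleP[i ik [/lowz_dvd[f' ->] fi]] /ordleP[j jl [/lowz_dvd[g' ->] gj]].
exists (i + j)%N; first by lia.
rewrite mulrACA -exprD fps_coefXnM ltnn subnn fps_coefM0.
by move: fi gj; rewrite !fps_coefXnM !ltnn !subnn => fi gj; rewrite mulf_neq0.
Qed.

Lemma ordleX f k n : ordle f k -> ordle (f ^+ n) (n * k).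
Proof.
move=> fk; elim: n => [|n IH].
  by exists 0%N => //; rewrite expr0 fps_coef1 oner_neq0.
by rewrite exprS mulSn; apply: ordleM.
Qed.

Lemma ordle_Ml f g k : ordle (f * g) k -> ordle f k.
Proof.
case=> i ik; apply: contra_neqP => nf; apply: lowzMl (ltnSn i) => j ji.
by apply/eqP/negPn/negP => fj; apply: nf; exists j => //; lia.
Qed.

Lemma ordle_Mr f g k : ordle (f * g) k -> ordle g k.
Proof. by rewrite mulrC; apply: ordle_Ml. Qed.

Lemma fps_mul_eq0 f g : f * g = 0 -> f = 0 \/ g = 0.
Proof.
move=> fg; apply: contrapT => /not_orP[/neq0_ordle[k fk] /neq0_ordle[l gl]].
exact: ordle_neq0 (ordleM fk gl) fg.
Qed.

Lemma ordle_prod (I : Type) (r : seq I) (P : pred I) (F : I -> fps R) k :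
  (forall i, P i -> ordle (F i) k) ->
  ordle (\prod_(i <- r | P i) F i) (size r * k).
Proof.
move=> Fk; elim: r => [|i r IH].
  by exists 0%N => //; rewrite big_nil fps_coef1 oner_neq0.
rewrite big_cons /= mulSn; case: ifP => Pi; first by apply: ordleM; first exact: Fk.
by have [j jk fj] := IH; exists j => //; lia.
Qed.

End Order.

(** * Polynomial expressions and Hensel's lemma *)

(* Polynomial expressions, evaluated below in several rings. The coefficients [K]
   will be functions of the dynamics, so that an expression depends uniformly on
   the jet. *)
Inductive pexp (K V : Type) : Type :=
| PVar of V
| PCst of K
| PAdd of pexp K V & pexp K V
| PMul of pexp K V & pexp K V.
Arguments PVar {K V}.
Arguments PCst {K V}.

Fixpoint ev (K V : Type) (S : comNzRingType) (io : K -> S) (v : V -> S)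
    (e : pexp K V) : S :=
  match e with
  | PVar i => v i
  | PCst c => io c
  | PAdd e1 e2 => ev io v e1 + ev io v e2
  | PMul e1 e2 => ev io v e1 * ev io v e2
  end.

(** The derivative of [e] at [v] in the direction [w], taken on the syntax and hence available in
    every ring. *)
Fixpoint dev (K V : Type) (S : comNzRingType) (io : K -> S) (v w : V -> S)
    (e : pexp K V) : S :=
  match e with
  | PVar i => w i
  | PCst _ => 0
  | PAdd e1 e2 => dev io v w e1 + dev io v w e2
  | PMul e1 e2 => dev io v w e1 * ev io v e2 + ev io v e1 * dev io v w e2
  end.

Fixpoint psub (K V V' : Type) (s : V -> pexp K V') (e : pexp K V) : pexp K V' :=
  match e with
  | PVar i => s i
  | PCst c => PCst c
  | PAdd e1 e2 => PAdd (psub s e1) (psub s e2)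
  | PMul e1 e2 => PMul (psub s e1) (psub s e2)
  end.

(* The quotient by [b] of the increment of [e] from [s] to [s + b t]. *)
Fixpoint pdd (K : nmodType) (V V' : Type) (s t : V -> pexp K V')
    (b : pexp K V') (e : pexp K V) : pexp K V' :=
  match e with
  | PVar i => t i
  | PCst _ => PCst 0
  | PAdd e1 e2 => PAdd (pdd s t b e1) (pdd s t b e2)
  | PMul e1 e2 =>
      PAdd (PMul (pdd s t b e1) (psub (fun i => PAdd (s i) (PMul b (t i))) e2))
           (PMul (psub s e1) (pdd s t b e2))
  end.

Fixpoint pcsts (K V : Type) (C : K -> Prop) (e : pexp K V) : Prop :=
  match e with
  | PVar _ => True
  | PCst c => C c
  | PAdd e1 e2 => pcsts C e1 /\ pcsts C e2
  | PMul e1 e2 => pcsts C e1 /\ pcsts C e2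
  end.

Section Eval.
Variables (K V : Type) (S : comNzRingType) (io : K -> S).
Implicit Types (v w : V -> S) (e : pexp K V).

Lemma eq_ev v v' e : (forall i, v i = v' i) -> ev io v e = ev io v' e.
Proof. by move=> vv'; elim: e => //= e1 -> e2 ->. Qed.

Lemma eq_dev v v' w w' e : (forall i, v i = v' i) -> (forall i, w i = w' i) ->
  dev io v w e = dev io v' w' e.
Proof.
by move=> vv' ww'; elim: e => //= e1 -> e2 -> //; rewrite !(eq_ev _ vv').
Qed.

Lemma ev_taylor v w (h : S) e : exists q,
  ev io (fun i => v i + h * w i) e = ev io v e + h * dev io v w e + h ^+ 2 * q.
Proof.
elim: e => /= [i|c|e1 [q1 ->] e2 [q2 ->]|e1 [q1 ->] e2 [q2 ->]].
- by exists 0; rewrite mulr0 addr0.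
- by exists 0; rewrite !mulr0 !addr0.
- by exists (q1 + q2); ring.
- exists (ev io v e1 * q2 + q1 * ev io v e2 + dev io v w e1 * dev io v w e2
    + h * (dev io v w e1 * q2 + q1 * dev io v w e2) + h ^+ 2 * (q1 * q2)).
  ring.
Qed.

Lemma devD v w w' e :
  dev io v (fun i => w i + w' i) e = dev io v w e + dev io v w' e.
Proof. by elim: e => //= [c|e1 -> e2 ->|e1 -> e2 ->]; ring. Qed.

Lemma devZ v (c : S) w e : dev io v (fun i => c * w i) e = c * dev io v w e.
Proof. by elim: e => //= [k|e1 -> e2 ->|e1 -> e2 ->]; ring. Qed.

Lemma dev0 v e : dev io v (fun=> 0) e = 0.
Proof. by elim: e => //= [e1 -> e2 ->|e1 -> e2 ->]; ring. Qed.

Lemma dev_sum (I : Type) (r : seq I) v (c : I -> S) (w : I -> V -> S) e :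
  dev io v (fun i => \sum_(q <- r) c q * w q i) e =
  \sum_(q <- r) c q * dev io v (w q) e.
Proof.
elim: r => [|q r IH].
  by rewrite big_nil -[RHS](dev0 v e); apply: eq_dev => // i; rewrite big_nil.
rewrite big_cons -IH -devZ -devD; apply: eq_dev => // i; exact: big_cons.
Qed.

End Eval.

Lemma ev_morph (K V : Type) (S S' : comNzRingType) (h : {rmorphism S -> S'})
    (io : K -> S) (v : V -> S) e :
  h (ev io v e) = ev (h \o io) (h \o v) e.
Proof. by elim: e => //= e1 <- e2 <-; rewrite ?rmorphD ?rmorphM. Qed.

Lemma dev_morph (K V : Type) (S S' : comNzRingType) (h : {rmorphism S -> S'})
    (io : K -> S) (v w : V -> S) e :
  h (dev io v w e) = dev (h \o io) (h \o v) (h \o w) e.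
Proof.
elim: e => //= [c|e1 <- e2 <-|e1 <- e2 <-]; first exact: rmorph0.
  exact: rmorphD.
by rewrite rmorphD !rmorphM !ev_morph.
Qed.

Section Subst.
Variables (K : nmodType) (V V' : Type) (S : comNzRingType) (io : K -> S).
Hypothesis io0 : io 0 = 0.
Implicit Types (s t : V -> pexp K V') (b : pexp K V') (v w : V' -> S).

Lemma ev_psub s v e : ev io v (psub s e) = ev io (fun i => ev io v (s i)) e.
Proof. by elim: e => //= e1 -> e2 ->. Qed.

Lemma dev_psub s v w e : dev io v w (psub s e) =
  dev io (fun i => ev io v (s i)) (fun i => dev io v w (s i)) e.
Proof. by elim: e => //= e1 -> e2 ->; rewrite ?ev_psub. Qed.

Lemma ev_pdd s t b v e :
  ev io (fun i => ev io v (s i) + ev io v b * ev io v (t i)) e =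
  ev io (fun i => ev io v (s i)) e + ev io v b * ev io v (pdd s t b e).
Proof.
elim: e => //= [c|e1 -> e2 ->|e1 IH1 e2 IH2].
- by rewrite io0 mulr0 addr0.
- by ring.
- rewrite !ev_psub /= IH1 IH2; ring.
Qed.

Lemma dev_pdd s t b v w e :
  dev io (fun i => ev io v (s i) + ev io v b * ev io v (t i))
         (fun i => dev io v w (s i) + (dev io v w b * ev io v (t i)
                                       + ev io v b * dev io v w (t i))) e =
  dev io (fun i => ev io v (s i)) (fun i => dev io v w (s i)) e +
  (dev io v w b * ev io v (pdd s t b e) + ev io v b * dev io v w (pdd s t b e)).
Proof.
elim: e => //= [c|e1 -> e2 ->|e1 IH1 e2 IH2].
- by rewrite io0; ring.
- by ring.
- rewrite IH1 IH2 !ev_psub !dev_psub !ev_pdd /=.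
  have -> : dev io (fun i => ev io v (s i) + ev io v b * ev io v (t i))
         (fun i => dev io v w (s i) + (dev io v w b * ev io v (t i)
                                       + ev io v b * dev io v w (t i))) e2 =
  dev io (fun i => ev io v (s i)) (fun i => dev io v w (s i)) e2 +
  (dev io v w b * ev io v (pdd s t b e2) + ev io v b * dev io v w (pdd s t b e2)).
    exact: IH2.
  ring.
Qed.

(** Where [b] vanishes, the divided difference degenerates to the derivative in the direction [t].
    This is what remains of a transversal equation on the locus [b = 0]. *)
Lemma ev_pdd0 s t b v e : ev io v b = 0 ->
  ev io v (pdd s t b e) =
  dev io (fun i => ev io v (s i)) (fun i => ev io v (t i)) e.
Proof.
move=> b0; elim: e => //= [e1 -> e2 ->|e1 IH1 e2 IH2] //.
rewrite IH1 IH2 !ev_psub /=; congr (_ * _ + _).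
by apply: eq_ev => i; rewrite b0 mul0r addr0.
Qed.

End Subst.

Section Csts.
Variables (K : nmodType) (C : K -> Prop).
Hypothesis C0 : C 0.

Lemma pcsts_psub (V V' : Type) (s : V -> pexp K V') e :
  (forall i, pcsts C (s i)) -> pcsts C e -> pcsts C (psub s e).
Proof. by move=> Cs; elim: e => //= e1 IH1 e2 IH2 [/IH1 ? /IH2 ?]. Qed.

Lemma pcsts_pdd (V V' : Type) (s t : V -> pexp K V') b e :
  (forall i, pcsts C (s i)) -> (forall i, pcsts C (t i)) -> pcsts C b ->
  pcsts C e -> pcsts C (pdd s t b e).
Proof.
move=> Cs Ct Cb; elim: e => //= e1 IH1 e2 IH2 [Ce1 Ce2]; split; auto.
all: by split; auto; apply: pcsts_psub => // i; split => //; split.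
Qed.

End Csts.

Section EvalPowerSeries.
Variables (R : comNzRingType) (K V : Type) (io : K -> fps R).
Implicit Types (v w : V -> fps R) (e : pexp K V).

Lemma ev_lowz n v v' e : (forall i, lowz n (v i - v' i)) ->
  lowz n (ev io v e - ev io v' e).
Proof.
move=> vv'; elim: e => //= [c|e1 IH1 e2 IH2|e1 IH1 e2 IH2].
- by rewrite subrr => i.
- by rewrite opprD addrACA; apply: lowzD.
- have -> : ev io v e1 * ev io v e2 - ev io v' e1 * ev io v' e2 =
     (ev io v e1 - ev io v' e1) * ev io v e2
     + ev io v' e1 * (ev io v e2 - ev io v' e2) by ring.
  by apply: lowzD; [apply: lowzMl|apply: lowzMr].
Qed.

Lemma ev_deriv v e : (forall c, fps_deriv (io c) = 0) ->
  fps_deriv (ev io v e) = dev io v (fun i => fps_deriv (v i)) e.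
Proof.
move=> ioc; elim: e => //= e1 IH1 e2 IH2.
  by rewrite fps_derivD IH1 IH2.
by rewrite fps_derivM IH1 IH2.
Qed.

End EvalPowerSeries.

Section ConstantTerm.
Variables (R : comNzRingType) (K V : Type) (io : K -> R).

Lemma ev_coef0 (v : V -> fps R) e :
  ev (fun c => fpsC (io c)) v e 0%N = ev io (fun i => v i 0%N) e.
Proof.
elim: e => //= [c|e1 <- e2 <-|e1 <- e2 <-]; rewrite ?fps_coefC //.
by rewrite fps_coefM0.
Qed.

Lemma dev_coef0 (v w : V -> fps R) e :
  dev (fun c => fpsC (io c)) v w e 0%N =
  dev io (fun i => v i 0%N) (fun i => w i 0%N) e.
Proof.
elim: e => //= [e1 <- e2 <-|e1 <- e2 <-] //.
by rewrite fps_coefD !fps_coefM0 !ev_coef0.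
Qed.

End ConstantTerm.

Section Hensel.
Variables (R : fieldType) (K : Type) (m : nat) (io : K -> R).
Variable G : 'I_m -> pexp K (option 'I_m).

Let ioC : K -> fps R := fun c => fpsC (io c).

Definition henv (xi : 'I_m -> fps R) (i : option 'I_m) : fps R :=
  if i is Some p then xi p else fpsX.

Definition hjac : 'M[R]_m :=
  \matrix_(p, q) dev io (fun=> 0) (fun i => (i == Some q)%:R) (G p).

(** The Jacobian is frozen at the origin. Each step gains only one order, but [invmx hjac] is the
    only inverse that ever occurs, which keeps the coefficients of the solution rational in the
    constants. *)
Definition newton (xi : 'I_m -> fps R) (p : 'I_m) : fps R :=
  xi p - \sum_q fpsC (invmx hjac p q) * ev ioC (henv xi) (G q).

(** The iterate number [n] is final modulo [X^(n+1)] ([hensel_iter]), so coefficient [s] can be read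
    off after [s] steps. *)
Definition hensel (p : 'I_m) : fps R := fun s => iter s newton (fun=> 0) p s.

Hypothesis G0 : forall p, ev io (fun=> 0) (G p) = 0.
Hypothesis Gu : hjac \in unitmx.

Lemma henv0 xi : (forall p, lowz 1 (xi p)) -> forall i, henv xi i 0%N = 0.
Proof.
by move=> xi0 [p|]; [exact: xi0|rewrite /= /fpsX /fps_of coefX].
Qed.

Lemma ev_henv0 xi p : (forall p, lowz 1 (xi p)) ->
  ev ioC (henv xi) (G p) 0%N = 0.
Proof.
move=> xi0; rewrite ev_coef0 -[RHS](G0 p).
by apply: eq_ev => i; rewrite henv0.
Qed.

Lemma ev_henv_step n xi (w : 'I_m -> fps R) p : (forall p, lowz 1 (xi p)) ->
  (0 < n)%N -> exists q,
  ev ioC (henv (fun q => xi q + fpsX ^+ n * w q)) (G p) =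
  ev ioC (henv xi) (G p) + fpsX ^+ n * q /\
  q 0%N = \sum_q hjac p q * w q 0%N.
Proof.
move=> xi0 n0; pose w' i := if i is Some q then w q else 0 : fps R.
have [q qE] := ev_taylor ioC (henv xi) w' (fpsX ^+ n) (G p).
exists (dev ioC (henv xi) w' (G p) + fpsX ^+ n * q); split.
  rewrite mulrDr addrA mulrA -expr2 -qE; apply: eq_ev => -[i|] //=.
  by rewrite mulr0 addr0.
rewrite fps_coefD fps_coefXnM n0 addr0.
rewrite dev_coef0.
under [RHS]eq_bigr do rewrite mxE mulrC.
rewrite -(@dev_sum _ _ _ _ _ _ _ (fun q => w q 0%N)); apply: eq_dev => i.
  by rewrite henv0.
case: i => [i|] /=.
  rewrite (bigD1 i) //= eqxx mulr1 big1 ?addr0 // => j ji.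
  by rewrite (_ : (Some i == Some j) = false) ?mulr0 //; apply/negbTE; rewrite eq_sym.
by rewrite big1 // => j _; rewrite mulr0.
Qed.

Lemma newton_step n xi : (0 < n)%N -> (forall p, lowz 1 (xi p)) ->
  (forall p, lowz n (ev ioC (henv xi) (G p))) ->
  [/\ forall p, lowz 1 (newton xi p),
      forall p, lowz n (newton xi p - xi p) &
      forall p, lowz n.+1 (ev ioC (henv (newton xi)) (G p))].
Proof.
move=> n0 xi0 Gn.
have d p : lowz n (newton xi p - xi p).
  rewrite /newton addrAC subrr add0r; apply/lowzN/lowz_sum => q _.
  exact/lowzMr/Gn.
split=> // [p|p].
  by rewrite -[newton xi p](subrK (xi p)); apply: lowzD => //; apply: lowzW (d p).
pose g p := projT1 (cid (lowz_dvd (Gn p))).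
have gE q : ev ioC (henv xi) (G q) = fpsX ^+ n * g q by rewrite /g; case: cid.
pose w p := - \sum_q fpsC (invmx hjac p q) * g q.
have -> : newton xi = (fun q => xi q + fpsX ^+ n * w q).
  apply/funext => q; rewrite /newton /w mulrN mulr_sumr; congr (_ - _).
  by apply: eq_bigr => j _; rewrite gE mulrCA.
have [q [-> q0]] := ev_henv_step w p xi0 n0.
rewrite gE -mulrDr -addn1; apply: lowzM; first by rewrite -[X in lowz _ X]mulr1; apply: lowzXM.
case=> // _; rewrite fps_coefD q0.
have -> : \sum_q hjac p q * w q 0%N = - (hjac *m (invmx hjac *m \col_j g j 0%N)) p 0.
  rewrite mxE -sumrN; apply: eq_bigr => j _; rewrite /w fps_coefN mulrN.
  congr (- (_ * _)); rewrite mxE fps_coef_sum.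
  by apply: eq_bigr => l _; rewrite fps_coefCM !mxE.
by rewrite mulmxA mulmxV // mul1mx mxE subrr.
Qed.

Lemma hensel_iter n : let xi := iter n newton (fun=> 0) in
  [/\ forall p, lowz 1 (xi p), forall p, lowz n.+1 (ev ioC (henv xi) (G p)) &
      forall p, lowz n.+1 (newton xi p - xi p)].
Proof.
elim: n => [|n /= [IH1 IH2 IH3]] /=.
  have h0 (p : 'I_m) : lowz 1 (0 : fps R) by move=> i.
  have h1 p : lowz 1 (ev ioC (henv (fun=> 0)) (G p)).
    by case=> // _; apply: ev_henv0.
  by split=> // p; have [] := @newton_step 1 (fun=> 0) isT h0 h1.
have [h1 h2 h3] := newton_step (ltn0Sn n) IH1 IH2.
by split=> // p; have [] := newton_step (ltn0Sn n.+1) h1 h3.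
Qed.

Lemma hensel_approx n p : lowz n.+1 (hensel p - iter n newton (fun=> 0) p).
Proof.
move=> s; rewrite ltnS => sn; rewrite fps_coefB /hensel.
rewrite -(subnK sn); elim: (n - s)%N => [|d IH]; first by rewrite add0n subrr.
rewrite addSn iterS.
have [_ _ /(_ p s)] := hensel_iter (d + s).
rewrite ltnS leq_addl => /(_ isT); rewrite fps_coefB => /eqP.
by rewrite subr_eq0 => /eqP ->.
Qed.

Lemma hensel0 p : lowz 1 (hensel p).
Proof. by case=> // _; rewrite /hensel. Qed.

Lemma henselP p : ev ioC (henv hensel) (G p) = 0.
Proof.
apply/funext => n.
have [_ /(_ p n (ltnSn n)) E _] := hensel_iter n.
have := @ev_lowz _ _ _ ioC n.+1 (henv hensel) (henv (iter n newton (fun=> 0))) (G p).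
move=> /(_ _ n (ltnSn n)); rewrite fps_coefB E subr0; apply=> -[q|] /=.
  exact: hensel_approx.
by rewrite subrr => i.
Qed.

Lemma hensel_unique n xi xi' : (forall p, lowz 1 (xi p)) ->
  (forall p, lowz 1 (xi' p)) ->
  (forall p, lowz n (ev ioC (henv xi') (G p) - ev ioC (henv xi) (G p))) ->
  forall p, lowz n (xi' p - xi p).
Proof.
move=> xi0 xi'0; elim: n => [|n IH] Gn p; first exact: lowz0.
have {}IH : forall p, lowz n (xi' p - xi p).
  by apply: IH => q; apply: lowzW (Gn q).
have [->|n0] := posnP n.
  by apply: lowzB.
pose w q := projT1 (cid (lowz_dvd (IH q))).
have wE q : xi' q - xi q = fpsX ^+ n * w q by rewrite /w; case: cid.
have xi'E : xi' = (fun q => xi q + fpsX ^+ n * w q).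
  by apply/funext => q; rewrite -wE addrC subrK.
suff w0 : hjac *m (\col_j w j 0%N) = 0.
  rewrite wE -addn1; apply: lowzM; first by rewrite -[X in lowz _ X]mulr1; apply: lowzXM.
  case=> // _; have : invmx hjac *m (hjac *m (\col_j w j 0%N)) = 0 by rewrite w0 mulmx0.
  by rewrite mulmxA mulVmx // mul1mx => /matrixP/(_ p 0); rewrite !mxE.
apply/matrixP => i j; rewrite ord1 [LHS]mxE [RHS]mxE.
have [q [qE q0]] := ev_henv_step w i xi0 n0.
have := Gn i n (ltnSn n); rewrite xi'E qE addrAC subrr add0r.
by rewrite fps_coefXnM ltnn subnn q0 => E; rewrite -[RHS]E; apply: eq_bigr => l _; congr (_ * _); rewrite mxE.
Qed.

End Hensel.

Section HenselParam.
Variables (R : fieldType) (T : Type) (m : nat).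
Variable G : 'I_m -> pexp (T -> R) (option 'I_m).
Variable C : (T -> R) -> Prop.
Hypothesis CD : forall g h, C g -> C h -> C (fun t => g t + h t).
Hypothesis CM : forall g h, C g -> C h -> C (fun t => g t * h t).
Hypothesis CC : forall c, C (fun=> c).

Lemma closed_sum (I : Type) (r : seq I) (P : pred I) (g : I -> T -> R) :
  (forall i, C (g i)) -> C (fun t => \sum_(i <- r | P i) g i t).
Proof.
move=> Cg; elim: r => [|i r IH].
  by under eq_fun do rewrite big_nil; exact: CC.
under eq_fun do rewrite big_cons.
by case: (P i) => //; apply: CD.
Qed.

Lemma closed_prod (I : Type) (r : seq I) (P : pred I) (g : I -> T -> R) :
  (forall i, C (g i)) -> C (fun t => \prod_(i <- r | P i) g i t).
Proof.
move=> Cg; elim: r => [|i r IH].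
  by under eq_fun do rewrite big_nil; exact: CC.
under eq_fun do rewrite big_cons.
by case: (P i) => //; apply: CM.
Qed.

(** The class [C] of coefficient functions is left abstract because two are needed: rational
    functions of the jet, and rational functions of a real perturbation parameter. *)
Definition cfam (x : T -> fps R) := forall n, C (fun t => x t n).

Lemma cfamD x y : cfam x -> cfam y -> cfam (fun t => x t + y t).
Proof. by move=> Cx Cy n; apply: CD. Qed.

Lemma cfamM x y : cfam x -> cfam y -> cfam (fun t => x t * y t).
Proof.
move=> Cx Cy n; under eq_fun do rewrite fps_coefM.
by apply: closed_sum => i; apply: CM.
Qed.

Lemma cfamC (g : T -> R) : C g -> cfam (fun t => fpsC (g t)).
Proof.
move=> Cg n; under eq_fun do rewrite fps_coefC.
by case: (n == 0%N).
Qed.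

Lemma cfam_cst (f : fps R) : cfam (fun=> f). Proof. by move=> n; apply: CC. Qed.

Lemma cfam_sum (I : Type) (r : seq I) (P : pred I) (x : I -> T -> fps R) :
  (forall i, cfam (x i)) -> cfam (fun t => \sum_(i <- r | P i) x i t).
Proof.
move=> Cx n; under eq_fun do rewrite fps_coef_sum.
by apply: closed_sum => i; apply: Cx.
Qed.

Lemma cfam_ev (V : Type) (v : T -> V -> fps R) (e : pexp (T -> R) V) :
  pcsts C e -> (forall i, cfam (fun t => v t i)) ->
  cfam (fun t => ev (fun g => fpsC (g t)) (v t) e).
Proof.
move=> + Cv; elim: e => //= [c Cc|e1 IH1 e2 IH2 [Ce1 Ce2]|e1 IH1 e2 IH2 [Ce1 Ce2]].
- exact: cfamC.
- by apply: cfamD; auto.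
- by apply: cfamM; auto.
Qed.

Hypothesis CG : forall p, pcsts C (G p).
Hypothesis CA : forall p q, C (fun t => invmx (hjac (fun g => g t) G) p q).

Lemma cfam_hensel p : cfam (fun t => hensel (fun g => g t) G p).
Proof.
move=> s; rewrite /hensel.
suff H q n : cfam (fun t => iter n (newton (fun g => g t) G) (fun=> 0) q).
  exact: (H p s s).
elim: n q => [|n IH] q; first exact: cfam_cst.
under eq_fun do rewrite iterS /newton.
apply: cfamD; first exact: IH.
move=> k; under eq_fun do rewrite fps_coefN -mulN1r.
apply: CM; first exact: CC.
move: k; apply: cfam_sum => j; apply: cfamM; first exact/cfamC/CA.
by apply: cfam_ev => // -[i|] /=; [exact: IH|exact: cfam_cst].
Qed.

End HenselParam.

(** * The blown-up equations *)

Definition psum (K : nmodType) (V I : Type) (r : seq I) (F : I -> pexp K V) :=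
  foldr (fun i e => PAdd (F i) e) (PCst 0) r.

Section Psum.
Variables (K : nmodType) (V : Type).

Lemma ev_psum (S : comNzRingType) (io : K -> S) (v : V -> S) I (r : seq I) F :
  io 0 = 0 -> ev io v (psum r F) = \sum_(i <- r) ev io v (F i).
Proof.
by move=> io0; elim: r => [|i r IH] /=; rewrite ?big_nil ?big_cons // IH.
Qed.

Lemma dev_psum (S : comNzRingType) (io : K -> S) (v w : V -> S) I (r : seq I) F :
  dev io v w (psum r F) = \sum_(i <- r) dev io v w (F i).
Proof.
by elim: r => [|i r IH] /=; rewrite ?big_nil ?big_cons // IH.
Qed.

Lemma pcsts_psum (C : K -> Prop) I (r : seq I) (F : I -> pexp K V) : C 0 ->
  (forall i, pcsts C (F i)) -> pcsts C (psum r F).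
Proof. by move=> C0 CF; elim: r => //= i r IH; split. Qed.

End Psum.

Section Taylor.
Variables (R : fieldType) (T : Type) (k : nat).
Notation K := (T -> R).
Implicit Type j : seq 'I_k.+2 -> K.

Fixpoint homog (n : nat) (j : seq 'I_k.+2 -> K) : pexp K 'I_k.+2 :=
  if n is n'.+1 then
    psum (enum 'I_k.+2) (fun i => PMul (PVar i) (homog n' (fun s => j (i :: s))))
  else PCst (j [::]).

(** Summation starts in degree 1 because a bifurcation problem vanishes at the origin. The factor is
    [1/n!] since [homog] runs over sequences of indices and not over multi-indices. *)
Definition taylor M j : pexp K 'I_k.+2 :=
  psum (iota 1 M) (fun n => PMul (PCst (fun=> n`!%:R^-1)) (homog n j)).

End Taylor.

Section Blowup.
Variables (R : fieldType) (T : Type) (k m : nat).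
Variables (Q : 'I_k -> 'I_m -> 'I_m) (r : 'I_m -> 'I_m).
Hypothesis rr : forall p, r (r p) = r p.
Hypothesis rQ : forall l p, r (Q l p) = r (Q l (r p)).
Notation K := (T -> R).
Notation V := (option 'I_m).
Variable tay : pexp K 'I_k.+2.

Definition cell_arg (p : 'I_m) (i : 'I_k.+2) : V :=
  if unlift ord_max i is Some j then
    Some (if unlift ord0 j is Some l then Q l p else p)
  else None.

Definition cell_eq (p : 'I_m) : pexp K V := psub (fun i => PVar (cell_arg p i)) tay.

Variables (vv ee : 'I_m -> K) (p1 p2 : 'I_m).

(* The unknowns of the blown-up system: [None] is the amplitude along the
   eigenvector [vv], [Some p1] is the factor [b], [Some p2] is the parameter, and
   the others are the coordinates of [u] (at representatives) and of [eta] (at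
   the other cells); the state of the system is [u + b eta]. *)
Definition bu_u (p : 'I_m) : pexp K V :=
  PAdd (PMul (PVar None) (PCst (vv (r p))))
       (if r p == p1 then PCst 0 else PVar (Some (r p))).

Definition bu_b : pexp K V := PVar (Some p1).

Definition bu_eta (p : 'I_m) : pexp K V :=
  if r p == p then PCst 0 else
  PAdd (PCst (ee p)) (if p == p2 then PCst 0 else PVar (Some p)).

Definition bu_s (i : V) : pexp K V := if i is Some p then bu_u p else PVar (Some p2).
Definition bu_t (i : V) : pexp K V := if i is Some p then bu_eta p else PCst 0.

(** A representative cell carries its equation as it stands. Any other cell carries the difference
    with its representative, which vanishes on [Delta_1] and is therefore divisible by [b]. *)
Definition bu_G (p : 'I_m) : pexp K V :=
  if r p == p then psub (fun i => PAdd (bu_s i) (PMul bu_b (bu_t i))) (cell_eq p)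
  else pdd bu_s bu_t bu_b
         (PAdd (cell_eq p) (PMul (PCst (fun=> -1)) (cell_eq (r p)))).

Section Semantics.
Variables (S : comNzRingType) (io : K -> S).
Hypothesis io0 : io 0 = 0.
Hypothesis ioN1 : io (fun=> -1) = -1.
Implicit Types (w y : V -> S).

Lemma ev_cell p y : ev io y (cell_eq p) = ev io (fun i => y (cell_arg p i)) tay.
Proof. exact: ev_psub. Qed.

Lemma dev_cell p y w : dev io y w (cell_eq p) =
  dev io (fun i => y (cell_arg p i)) (fun i => w (cell_arg p i)) tay.
Proof. exact: dev_psub. Qed.

(** The map [r] picks one cell in each class of cells that are synchronized on [Delta_1], so this is
    membership in [Delta_1]; [rQ] says that the partition into classes is balanced. *)
Definition sync y := forall p, y (Some (r p)) = y (Some p).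

Lemma sync_arg y p i : sync y -> y (cell_arg (r p) i) = y (cell_arg p i).
Proof.
move=> sy; rewrite /cell_arg; case: (unlift ord_max i) => [j|] //.
case: (unlift ord0 j) => [l|]; last exact: sy.
by rewrite -[RHS]sy rQ sy.
Qed.

Lemma ev_cell_sync y p : sync y -> ev io y (cell_eq (r p)) = ev io y (cell_eq p).
Proof. by move=> sy; rewrite !ev_cell; apply: eq_ev => i; apply: sync_arg. Qed.

Lemma dev_cell_sync y w p : sync y -> sync w ->
  dev io y w (cell_eq (r p)) = dev io y w (cell_eq p).
Proof.
by move=> sy sw; rewrite !dev_cell; apply: eq_dev => i; apply: sync_arg.
Qed.

Definition bu_x w (i : V) : S :=
  ev io w (bu_s i) + ev io w bu_b * ev io w (bu_t i).

Definition bu_dx w w' (i : V) : S :=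
  dev io w w' (bu_s i) + (dev io w w' bu_b * ev io w (bu_t i)
                          + ev io w bu_b * dev io w w' (bu_t i)).

Lemma sync_bu_s w : sync (fun i => ev io w (bu_s i)).
Proof. by move=> p; rewrite /= rr. Qed.

Lemma sync_dbu_s w w' : sync (fun i => dev io w w' (bu_s i)).
Proof. by move=> p; rewrite /= rr. Qed.

Lemma ev_bu_G_rep w p : r p = p -> ev io w (bu_G p) = ev io (bu_x w) (cell_eq p).
Proof. by move=> rp; rewrite /bu_G rp eqxx ev_psub. Qed.

Lemma ev_bu_G_nrep w p : r p != p -> ev io w bu_b * ev io w (bu_G p) =
  ev io (bu_x w) (cell_eq p) - ev io (bu_x w) (cell_eq (r p)).
Proof.
move=> /negbTE rp; rewrite /bu_G rp.
have := ev_pdd io0 bu_s bu_t bu_b w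
  (PAdd (cell_eq p) (PMul (PCst (fun=> -1)) (cell_eq (r p)))).
rewrite [X in X = _ -> _]/= [X in _ = X + _ -> _]/= ioN1.
rewrite (ev_cell_sync p (@sync_bu_s w)) mulN1r mulN1r subrr add0r => <-.
by rewrite /bu_x.
Qed.

Lemma dev_bu_G_rep w w' p : r p = p ->
  dev io w w' (bu_G p) = dev io (bu_x w) (bu_dx w w') (cell_eq p).
Proof. by move=> rp; rewrite /bu_G rp eqxx dev_psub. Qed.

Lemma dev_bu_G_nrep w w' p : r p != p ->
  dev io w w' bu_b * ev io w (bu_G p) + ev io w bu_b * dev io w w' (bu_G p) =
  dev io (bu_x w) (bu_dx w w') (cell_eq p)
  - dev io (bu_x w) (bu_dx w w') (cell_eq (r p)).
Proof.
move=> /negbTE rp; rewrite /bu_G rp.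
have := dev_pdd io0 bu_s bu_t bu_b w w'
  (PAdd (cell_eq p) (PMul (PCst (fun=> -1)) (cell_eq (r p)))).
rewrite [X in X = _ -> _]/= [X in _ = X + _ -> _]/= ioN1.
rewrite !mul0r !add0r !mulN1r.
rewrite (@dev_cell_sync _ _ p (@sync_bu_s w) (@sync_dbu_s w w')) subrr add0r => <-.
by rewrite /bu_x /bu_dx.
Qed.

Lemma dev_cell_lin p y w : dev io y w (cell_eq p) =
  \sum_q dev io y (fun i => (i == Some q)%:R) (cell_eq p) * w (Some q)
  + dev io y (fun i => (i == None)%:R) (cell_eq p) * w None.
Proof.
under eq_bigr do rewrite mulrC.
rewrite -(dev_sum _ _ _ (fun q => w (Some q))) mulrC -devZ -devD.
apply: eq_dev => // -[q|] /=; last first.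
  by rewrite mulr1 big1 ?add0r // => q _; rewrite mulr0.
rewrite mulr0 addr0 (bigD1 q) //= eqxx mulr1 big1 ?addr0 // => q' qq'.
rewrite (_ : (Some q == Some q') = false) ?mulr0 //.
by apply/negbTE; rewrite eq_sym.
Qed.

Definition cell_jac y : 'M[S]_m :=
  \matrix_(p, q) dev io y (fun i => (i == Some q)%:R) (cell_eq p).

Definition bu_jac w : 'M[S]_m :=
  \matrix_(p, q) dev io w (fun i => (i == Some q)%:R) (bu_G p).

Lemma bu_solution w : (forall p, ev io w (bu_G p) = 0) ->
  forall p, ev io (bu_x w) (cell_eq p) = 0.
Proof.
move=> Gw p; have [rp|rp] := eqVneq (r p) p.
  by rewrite -(ev_bu_G_rep w rp).
have := ev_bu_G_nrep w rp; rewrite Gw mulr0 => /esym/eqP.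
by rewrite subr_eq0 => /eqP ->; rewrite -(ev_bu_G_rep w (rr p)).
Qed.

(** Chain rule for the blow-up: [L] subtracts the equations of the representatives, which produces
    the factors [b], and [W] is [kap] times the derivative of the state in the unknowns. The unknown
    [Some p2] also moves the parameter; the hypothesis on [z] rewrites this contribution as the
    state Jacobian applied to [z], so that column [p2] of [W] is corrected by [z]. Along a solution
    one may take for [kap] the derivative of the parameter, and for [z] minus that of the state. *)
Lemma bu_det_identity w (z : 'I_m -> S) (kap : S) :
  (forall p, ev io w (bu_G p) = 0) ->
  (forall p, \sum_q cell_jac (bu_x w) p q * z q =
     kap * dev io (bu_x w) (fun i => (i == None)%:R) (cell_eq p)) ->
  exists L W : 'M[S]_m, \det L * \det (cell_jac (bu_x w)) * \det W =
    kap ^+ m * \prod_p (if r p == p then 1 else ev io w bu_b) * \det (bu_jac w).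
Proof.
move=> Gw zE.
pose del q : V -> S := fun i => (i == Some q)%:R.
pose L : 'M[S]_m := \matrix_(p, q) ((p == q)%:R - (r p != p)%:R * (q == r p)%:R).
pose W : 'M[S]_m :=
  \matrix_(q', q) (kap * bu_dx w (del q) (Some q') + z q' * (q == p2)%:R).
exists L, W; rewrite -!det_mulmx.
suff -> : L *m cell_jac (bu_x w) *m W = kap *:
    (diag_mx (\row_p (if r p == p then 1 else ev io w bu_b)) *m bu_jac w).
  rewrite detZ det_mulmx det_diag mulrA; congr (_ * _ * _).
  by apply: eq_bigr => p _; rewrite mxE.
apply/matrixP => p q; rewrite -mulmxA [LHS]mxE.
have dnone : bu_dx w (del q) None = (q == p2)%:R.
  rewrite /bu_dx /= io0 !mulr0 !addr0 /del.
  by rewrite (inj_eq Some_inj) eq_sym.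
have E p' : (cell_jac (bu_x w) *m W) p' q =
    kap * dev io (bu_x w) (bu_dx w (del q)) (cell_eq p').
  rewrite mxE.
  under eq_bigr do rewrite [in X in _ * X]mxE mulrDr mulrCA [X in _ + X]mulrA.
  rewrite big_split /= -mulr_sumr dev_cell_lin mulrDr dnone; congr (_ + _).
    by congr (_ * _); apply: eq_bigr => i _; rewrite mxE.
  by rewrite -mulr_suml zE mulrA.
under eq_bigr do rewrite E [in X in X * _]mxE mulrBl.
rewrite sumrB (bigD1 p) //= eqxx mul1r big1 ?addr0; last first.
  by move=> i ip; rewrite eq_sym (negbTE ip) mul0r.
rewrite (bigD1 (r p)) //= eqxx mulr1 big1 ?addr0; last first.
  by move=> i ip; rewrite (negbTE ip) mulr0 mul0r.
rewrite mul_diag_mx !mxE; have [rp|rp] := eqVneq (r p) p.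
  by rewrite mul0r subr0 mul1r (dev_bu_G_rep _ _ rp).
rewrite mul1r -mulrBr -(dev_bu_G_nrep _ _ rp) Gw mulr0 add0r.
by [].
Qed.

End Semantics.
End Blowup.

Section TaylorFacts.
Variables (R : fieldType) (T : Type) (k : nat).
Notation K := (T -> R).
Variables (S : comNzRingType) (io : K -> S).
Hypothesis io0 : io 0 = 0.
Implicit Types (j : seq 'I_k.+2 -> K) (v w : 'I_k.+2 -> S).

Lemma ev_homogS n j v : ev io v (homog n.+1 j) =
  \sum_i v i * ev io v (homog n (fun s => j (i :: s))).
Proof. by rewrite [homog _ _]/= ev_psum // big_enum. Qed.

Lemma dev_homogS n j v w : dev io v w (homog n.+1 j) =
  \sum_i (w i * ev io v (homog n (fun s => j (i :: s)))
          + v i * dev io v w (homog n (fun s => j (i :: s)))).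
Proof. by rewrite [homog _ _]/= dev_psum big_enum. Qed.

Lemma ev_taylor_sum M j v : ev io v (taylor M j) =
  \sum_(1 <= n < M.+1) io (fun=> n`!%:R^-1) * ev io v (homog n j).
Proof. by rewrite ev_psum // /index_iota subn1. Qed.

Lemma ev_taylor_at0 M j : ev io (fun=> 0) (taylor M j) = 0.
Proof.
rewrite ev_taylor_sum big_nat big1 // => -[//|n] _.
by rewrite ev_homogS big1 ?mulr0 // => i _; rewrite mul0r.
Qed.

Lemma dev_taylor_at0 M j w : dev io (fun=> 0) w (taylor M.+1 j) =
  io (fun=> 1`!%:R^-1) * \sum_i w i * io (j [:: i]).
Proof.
rewrite dev_psum big_cons [dev _ _ _ (PMul _ _)]/= mul0r add0r -/(homog 1 j) dev_homogS [X in _ + X]big1_seq ?addr0.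
  by congr (_ * _); apply: eq_bigr => i _ /=; rewrite mul0r addr0.
move=> n; rewrite mem_iota => /andP[_ /andP[n2 _]].
rewrite /= mul0r add0r; case: n n2 => [|[|n]] // _.
rewrite dev_homogS big1 ?mulr0 // => i _.
rewrite mul0r addr0 ev_homogS big1 ?mulr0 //.
by move=> l _; rewrite mul0r.
Qed.

Lemma pcsts_homog (C : K -> Prop) n j : C 0 -> (forall s, size s = n -> C (j s)) ->
  pcsts C (homog n j).
Proof.
move=> C0; elim: n j => [|n IH] j Cj /=; first exact: Cj.
apply: pcsts_psum => // i; split=> //; apply: IH => s sn; apply: Cj => /=.
by rewrite sn.
Qed.

Lemma pcsts_taylor (C : K -> Prop) M j : (forall c, C (fun=> c)) ->
  (forall s, s != [::] -> C (j s)) -> pcsts C (taylor M j).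
Proof.
move=> C0 Cj; rewrite /taylor; have : all (leq 1) (iota 1 M).
  by apply/allP => n; rewrite mem_iota => /andP[].
elim: (iota 1 M) => [|n l IH] /=; first by move=> _; exact: C0.
move=> /andP[n0 /IH Hl]; split=> //; split; first exact: C0.
apply: pcsts_homog; first exact: C0.
by move=> s sn; apply: Cj; rewrite -size_eq0 sn -lt0n.
Qed.

End TaylorFacts.

Lemma unitmx_inj (F : fieldType) m (A : 'M[F]_m) :
  (forall y : 'cV_m, A *m y = 0 -> y = 0) -> A \in unitmx.
Proof.
move=> Ay; rewrite unitmxE unitfE -det_tr; apply/negP => /det0P[v v0 vA].
case/eqP: v0; apply: trmx_inj; rewrite trmx0; apply: Ay; apply: trmx_inj.
by rewrite trmx_mul trmxK trmx0.
Qed.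

(** * Polynomial formulas for the kernel vector and the transversal vector *)

Section Pointwise.
Variables (R : realFieldType) (T : Type) (k m : nat).
Variables (Q : 'I_k -> 'I_m -> 'I_m) (r : 'I_m -> 'I_m).
Hypothesis rr : forall p, r (r p) = r p.
Hypothesis rQ : forall l p, r (Q l p) = r (Q l (r p)).
Notation K := (T -> R).
Notation V := (option 'I_m).
Variable jet : seq 'I_k.+2 -> K.

Definition jac (t : T) : 'M[R]_m :=
  \matrix_(p, q) \sum_i (cell_arg Q p i == Some q)%:R * jet [:: i] t.

Definition vsync (y : 'cV[R]_m) := forall p, y (r p) 0 = y p 0.

(* [J] has a Jordan block of size two for the eigenvalue 0, with the
   eigenvector in the invariant subspace [vsync] and the generalized
   eigenvector outside. *)
Record jordan_data (J : 'M[R]_m) (v1 v2 : 'cV[R]_m) (l0 ls : 'rV[R]_m) : Prop :=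
  JordanData {
  jd_v1 : J *m v1 = 0;
  jd_v1_neq0 : v1 != 0;
  jd_v1_sync : vsync v1;
  jd_ker : forall y, J *m y = 0 -> exists c, y = c *: v1;
  jd_l0 : l0 *m J = 0;
  jd_l0_sync : forall y, vsync y -> l0 *m y = 0;
  jd_coker : forall l, l *m J = 0 -> exists c, l = c *: l0;
  jd_v2 : J *m v2 = v1;
  jd_l0v2 : l0 *m v2 != 0;
  jd_quot : forall y, vsync (J *m y) -> exists a d, vsync d /\ y = a *: v2 + d;
  jd_ls_sync : forall y, vsync y -> ls *m (J *m y) = 0;
  jd_ls_v1 : ls *m v1 != 0 }.

Lemma vsyncD y z : vsync y -> vsync z -> vsync (y + z).
Proof. by move=> hy hz p; rewrite !mxE hy hz. Qed.
Lemma vsyncZ c y : vsync y -> vsync (c *: y).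
Proof. by move=> hy p; rewrite !mxE hy. Qed.

Lemma jac_mulE t (y : 'cV[R]_m) p : (jac t *m y) p 0 =
  \sum_i (if cell_arg Q p i is Some q then y q 0 else 0) * jet [:: i] t.
Proof.
rewrite mxE (eq_bigr (fun q =>
   \sum_i (cell_arg Q p i == Some q)%:R * jet [:: i] t * y q 0)); last first.
  by move=> q _; rewrite mxE mulr_suml.
rewrite exchange_big; apply: eq_bigr => i _ /=.
case: (cell_arg Q p i) => [q|]; last first.
  by rewrite big1 ?mul0r // => q _; rewrite !mul0r.
rewrite (bigD1 q) //= eqxx mul1r mulrC big1 ?addr0 // => q' qq'.
rewrite (_ : (Some q == Some q') = false) ?mul0r //.
by apply/negbTE; rewrite eq_sym.
Qed.

Lemma vsync_jac t y : vsync y -> vsync (jac t *m y).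
Proof.
move=> sy p; rewrite !jac_mulE; apply: eq_bigr => i _; congr (_ * _).
exact: (@sync_arg _ _ Q r rQ R (fun o => if o is Some q then y q 0 else 0)).
Qed.

(** A suitable unit added to one entry makes the corank-one matrix [jac t] invertible, and a column
    of the adjugate is then a kernel vector. Unlike a chosen kernel vector it is polynomial in the
    jet. *)
Definition piv1 (i1 p1 : 'I_m) (t : T) : 'M[R]_m := jac t + delta_mx i1 p1.

(** The same device for the action of the Jacobian modulo [Delta_1]: identity rows suppress the
    coordinates at representatives, and the other rows are differences with the row of the
    representative. *)
Definition piv2 (i2 p2 : 'I_m) (t : T) : 'M[R]_m := \matrix_(p, q)
  ((if r p == p then (p == q)%:R else
    if r q == q then 0 else jac t p q - jac t (r p) q)
   + (p == i2)%:R * (q == p2)%:R).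

Definition bu_v i1 p1 (p : 'I_m) : K := fun t => \adj (piv1 i1 p1 t) p i1.
Definition bu_e i2 p2 (p : 'I_m) : K := fun t => \adj (piv2 i2 p2 t) p i2.

Section AtPoint.
Variable t : T.
Variables (v1 v2 : 'cV[R]_m) (l0 ls : 'rV[R]_m).
Hypothesis jd : jordan_data (jac t) v1 v2 l0 ls.
Let J := jac t.

Lemma l0_neq0 : l0 != 0.
Proof. by apply: contraNneq (jd_l0v2 jd) => ->; rewrite mul0mx. Qed.

Lemma mulmx_adj_col (B : 'M[R]_m) p i :
  (B *m col i (\adj B)) p 0 = \det B * (p == i)%:R.
Proof.
have -> : (B *m col i (\adj B)) p 0 = (B *m \adj B) p i.
  by rewrite [LHS]mxE [RHS]mxE; apply: eq_bigr => q _; rewrite [col _ _ _ _]mxE.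
by rewrite mul_mx_adj mxE mulr_natr.
Qed.

(** The adjugate column [v] is mapped by the pivoted matrix to a multiple of the basis vector at
    [i1], and removing the pivot only changes this multiple. It must be zero, because [l0]
    annihilates the range of [J] and is nonzero at [i1]. *)
Lemma piv1P i1 p1 : \det (piv1 i1 p1 t) != 0 ->
  bu_v i1 p1 p1 t != 0 /\ J *m \col_p bu_v i1 p1 p t = 0.
Proof.
move=> B0; set v := \col_p _.
have vE : v = col i1 (\adj (piv1 i1 p1 t)) by apply/matrixP => p q; rewrite !mxE.
have l0i : l0 0 i1 != 0.
  apply/negP => /eqP li; case/negP: B0; apply/det0P; exists l0; first exact: l0_neq0.
  rewrite /piv1 mulmxDr (jd_l0 jd) add0r; apply/matrixP => a b.
  by rewrite mxE big1 ?mxE // => i _; rewrite ord1 mxE; case: eqP => [->|]; rewrite ?li ?mul0r ?mulr0.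
have E p : (J *m v) p 0 = (\det (piv1 i1 p1 t) - v p1 0) * (p == i1)%:R.
  rewrite mulrBl vE -(mulmx_adj_col _ p i1) -vE /piv1 mulmxDl [in RHS]mxE -/J.
  rewrite -addrA [X in _ + X](_ : _ = 0) ?addr0 //.
  rewrite mxE (bigD1 p1) //= mxE eqxx andbT big1 ?addr0.
    by rewrite mulrC subrr.
  by move=> q qp; rewrite mxE (negbTE qp) andbF mul0r.
have : (l0 *m (J *m v)) 0 0 = 0 by rewrite mulmxA (jd_l0 jd) mul0mx mxE.
rewrite mxE (bigD1 i1) //= big1 ?addr0; last first.
  by move=> i ii; rewrite E (negbTE ii) !mulr0.
rewrite E eqxx mulr1 => /eqP; rewrite mulf_eq0 (negbTE l0i) /= subr_eq0 => /eqP dv.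
split; first by move: B0; rewrite dv mxE.
by apply/matrixP => p q; rewrite ord1 E dv subrr mul0r mxE.
Qed.

Lemma l0_fold p : r p = p -> \sum_(q | r q == p) l0 0 q = 0.
Proof.
move=> rp; have sy : vsync (\col_q (r q == p)%:R) by move=> q; rewrite !mxE rr.
have /matrixP/(_ 0 0) := jd_l0_sync jd sy; rewrite [LHS]mxE [RHS]mxE => E0.
rewrite -[RHS]E0 big_mkcond; by apply: eq_bigr => q _; rewrite mxE; case: eqP; rewrite ?mulr1 ?mulr0.
Qed.

(** As [l0] annihilates [Delta_1], subtracting the values at representatives does not change the
    pairing. Hence the restriction of [l0] to the other cells is a left null vector of the
    transversal block. *)
Lemma l0_nrep_sum (g : 'I_m -> R) :
  \sum_(p | r p != p) l0 0 p * (g p - g (r p)) = \sum_p l0 0 p * g p.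
Proof.
under eq_bigr do rewrite mulrBr.
rewrite sumrB [RHS](bigID (fun p => r p != p)) /=; congr (_ + _).
apply/eqP; rewrite -subr_eq0 -opprD oppr_eq0; apply/eqP.
transitivity (\sum_p l0 0 p * g (r p)).
  rewrite [RHS](bigID (fun p => r p != p)) /=; congr (_ + _).
  by apply: eq_bigr => p; rewrite negbK => /eqP ->.
rewrite (partition_big r (fun p => r p == p)) /=; last by move=> p _; rewrite rr.
apply: big1 => p /eqP rp; under eq_bigr => q /eqP -> do [].
by rewrite -mulr_suml l0_fold // mul0r.
Qed.

Lemma l0_nrep : exists2 p, r p != p & l0 0 p != 0.
Proof.
apply: contrapT => H; have l0z p : r p != p -> l0 0 p = 0.
  by move=> rp; apply/eqP/negPn/negP => lp; apply: H; exists p.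
case/eqP: l0_neq0; apply/matrixP => a p; rewrite ord1 mxE.
have [rp|/l0z//] := eqVneq (r p) p.
have := l0_fold rp; rewrite (bigD1 p) ?rp //= big1 ?addr0 // => q /andP[/eqP rq qp].
by apply: l0z; rewrite rq eq_sym.
Qed.

Lemma piv2P i2 p2 : r i2 != i2 -> r p2 != p2 -> \det (piv2 i2 p2 t) != 0 ->
  [/\ bu_e i2 p2 p2 t != 0, forall p, r p = p -> bu_e i2 p2 p t = 0 &
      vsync (J *m \col_p bu_e i2 p2 p t)].
Proof.
move=> ri rp2 B0; set v := \col_p _.
have vE : v = col i2 (\adj (piv2 i2 p2 t)) by apply/matrixP => p q; rewrite !mxE.
have E p : (piv2 i2 p2 t *m v) p 0 = \det (piv2 i2 p2 t) * (p == i2)%:R.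
  by rewrite vE mulmx_adj_col.
have vz p : r p = p -> v p 0 = 0.
  move=> rp; have := E p; have pi : (p == i2) = false.
    by apply: contraNF ri => /eqP <-; rewrite rp.
  rewrite pi mulr0 [LHS]mxE (bigD1 p) //= [X in X * _]mxE rp !eqxx pi mul0r addr0.
  rewrite mul1r big1 ?addr0 // => q qp.
  by rewrite [X in X * _]mxE rp eqxx pi mul0r addr0 eq_sym (negbTE qp) mul0r.
have F p : r p != p -> (J *m v) p 0 - (J *m v) (r p) 0 =
    (\det (piv2 i2 p2 t) - v p2 0) * (p == i2)%:R.
  move=> rp; rewrite mulrBl -(E p) [in RHS]mxE.
  under [in RHS]eq_bigr => q _ do rewrite mxE (negbTE rp) mulrDl.
  rewrite big_split /= [X in _ = _ + X - _](bigD1 p2) //= eqxx mulr1.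
  rewrite [X in _ = _ + (_ + X) - _]big1; last first.
    by move=> q /negbTE ->; rewrite mulr0 mul0r.
  rewrite addr0 [_ * v p2 0]mulrC addrK ![(J *m v) _ _]mxE -sumrB.
  apply: eq_bigr => q _; rewrite -mulrBl; case: eqP => [rq|//].
  by rewrite vz // !mulr0.
have G : \sum_(p | r p != p) l0 0 p * ((J *m v) p 0 - (J *m v) (r p) 0) = 0.
  have /matrixP/(_ 0 0) : l0 *m (J *m v) = 0 by rewrite mulmxA (jd_l0 jd) mul0mx.
  by rewrite mxE (l0_nrep_sum (fun p => (J *m v) p 0)) mxE.
have l0i : l0 0 i2 != 0.
  apply/negP => /eqP li; have [p rp lp] := l0_nrep.
  case/negP: B0; apply/det0P.
  exists (\row_p (if r p == p then 0 else l0 0 p)).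
    by apply/negP => /eqP/matrixP/(_ 0 p); rewrite !mxE (negbTE rp) => /eqP; exact/negP.
  apply/matrixP => a q; rewrite !mxE.
  have [rq|rq] := eqVneq (r q) q.
    apply: big1 => i _; rewrite !mxE; case: eqP => ri'; first by rewrite mul0r.
    rewrite rq eqxx add0r; have -> : (q == p2) = false.
      by apply: contraNF rp2 => /eqP <-; rewrite rq.
    by rewrite !mulr0.
  have /matrixP/(_ 0 q) := jd_l0 jd; rewrite !mxE -(l0_nrep_sum (fun p => jac t p q)).
  rewrite big_mkcond /= => E0; rewrite -[RHS]E0; apply: eq_bigr => i _; rewrite !mxE.
  case: eqP => //= ri'; first by rewrite mul0r.
  rewrite (negbTE rq) mulrDr; case: eqP => [->|_]; first by rewrite li !mul0r addr0.
  by rewrite mul0r mulr0 addr0.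
move: G; rewrite (bigD1 i2) //= big1 ?addr0; last first.
  by move=> p /andP[rp pi]; rewrite F // (negbTE pi) !mulr0.
rewrite F // eqxx mulr1 => /eqP; rewrite mulf_eq0 (negbTE l0i) /= subr_eq0 => /eqP dv.
split; first by move: B0; rewrite dv mxE.
- by move=> p rp; have := vz p rp; rewrite mxE.
move=> p; have [-> //|rp] := eqVneq (r p) p.
by apply/esym/eqP; rewrite -subr_eq0 F // dv subrr mul0r.
Qed.

(** It suffices that [l0] is nonzero at [i1] and [v1] at [p1]; since [v1] is synchronous, [p1] can
    be moved to its representative. *)
Lemma piv1_ex : exists i1 p1, r p1 = p1 /\ \det (piv1 i1 p1 t) != 0.
Proof.
have /rV0Pn[i1 li] := l0_neq0.
have [p1 vp] : exists p, v1 p 0 != 0 by apply/cV0Pn/(jd_v1_neq0 jd).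
exists i1, (r p1); split; first exact: rr.
have := @unitmx_inj _ _ (piv1 i1 (r p1) t); rewrite unitmxE unitfE; apply => y.
move=> By; have D : delta_mx i1 (r p1) *m y = y (r p1) 0 *: delta_mx i1 0.
  apply/matrixP => a b; rewrite ord1 !mxE (bigD1 (r p1)) //= !mxE !eqxx !andbT.
  by rewrite big1 ?addr0 1?mulrC // => q qp; rewrite mxE (negbTE qp) andbF mul0r.
move: By; rewrite /piv1 mulmxDl D => By.
have : l0 *m (jac t *m y + y (r p1) 0 *: delta_mx i1 0) = 0 by rewrite By mulmx0.
rewrite mulmxDr mulmxA (jd_l0 jd) mul0mx add0r -scalemxAr => /matrixP/(_ 0 0).
rewrite !mxE (bigD1 i1) //= mxE !eqxx mulr1 big1 ?addr0; last first.
  by move=> i ii; rewrite mxE (negbTE ii) mulr0.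
move/eqP; rewrite mulf_eq0 (negbTE li) orbF => /eqP y0.
move: By; rewrite y0 scale0r addr0 => /(jd_ker jd)[c yc].
move: y0; rewrite yc mxE (jd_v1_sync jd) => /eqP; rewrite mulf_eq0 (negbTE vp) orbF.
by move=> /eqP ->; rewrite scale0r.
Qed.

(** Here [i2] is taken from the support of [l0] off the representatives, and [p2] is a cell where
    [v2] differs from its representative; it exists because [l0] does not annihilate [v2]. *)
Lemma piv2_ex : exists i2 p2, [/\ r i2 != i2, r p2 != p2 & \det (piv2 i2 p2 t) != 0].
Proof.
have [i2 ri li] := l0_nrep.
have [p2 vp] : exists p, v2 (r p) 0 != v2 p 0.
  apply: contrapT => H; case/eqP: (jd_l0v2 jd); apply: (jd_l0_sync jd) => p.
  by apply/eqP/negPn/negP => hp; apply: H; exists p.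
have rp2 : r p2 != p2 by apply: contraNneq vp => ->.
exists i2, p2; split=> //.
have := @unitmx_inj _ _ (piv2 i2 p2 t); rewrite unitmxE unitfE; apply => y By.
have E p : (piv2 i2 p2 t *m y) p 0 = 0 by rewrite By mxE.
have yz p : r p = p -> y p 0 = 0.
  move=> rp; have := E p; have pi : (p == i2) = false.
    by apply: contraNF ri => /eqP <-; rewrite rp.
  rewrite [LHS]mxE (bigD1 p) //= [X in X * _]mxE rp !eqxx pi mul0r addr0.
  rewrite mul1r big1 ?addr0 // => q qp.
  by rewrite [X in X * _]mxE rp eqxx pi mul0r addr0 eq_sym (negbTE qp) mul0r.
have F p : r p != p -> (J *m y) p 0 - (J *m y) (r p) 0 = - y p2 0 * (p == i2)%:R.
  move=> rp; have := E p; rewrite [in LHS]mxE.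
  under [in LHS]eq_bigr => q _ do rewrite mxE (negbTE rp) mulrDl.
  rewrite big_split /= [X in _ + X = _](bigD1 p2) //= eqxx mulr1.
  rewrite [X in _ + (_ + X) = _]big1; last first.
    by move=> q /negbTE ->; rewrite mulr0 mul0r.
  rewrite addr0 => /eqP; rewrite addr_eq0 mulNr [_ * y p2 0]mulrC => /eqP <-.
  rewrite ![(J *m y) _ _]mxE -sumrB.
  apply: eq_bigr => q _; rewrite -mulrBl; case: eqP => [rq|//].
  by rewrite yz // !mulr0.
have /matrixP/(_ 0 0) : l0 *m (J *m y) = 0 by rewrite mulmxA (jd_l0 jd) mul0mx.
rewrite mxE -(l0_nrep_sum (fun p => (J *m y) p 0)) [RHS]mxE.
rewrite (bigD1 i2) //= big1 ?addr0; last first.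
  by move=> p /andP[rp pi]; rewrite F // (negbTE pi) !mulr0.
rewrite F // eqxx mulr1 => /eqP; rewrite mulf_eq0 (negbTE li) oppr_eq0 /= => /eqP y0.
have [a [d [sd yE]]] : exists a d, vsync d /\ y = a *: v2 + d.
  apply: (jd_quot jd) => p; have [-> //|rp] := eqVneq (r p) p.
  by apply/esym/eqP; rewrite -subr_eq0 F // y0 oppr0 mul0r.
have a0 : a = 0.
  have := yz (r p2) (rr p2); rewrite -[RHS]y0 yE !mxE sd => /addIr/eqP.
  rewrite -subr_eq0 -mulrBr mulf_eq0 subr_eq0 (negbTE vp) orbF.
  by move=> /eqP.
apply/matrixP => p q; rewrite ord1 mxE -(yz (r p) (rr p)) yE a0 !mxE.
by rewrite sd !mul0r.
Qed.

End AtPoint.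
End Pointwise.

Lemma dev_addcM (K V : Type) (S : comNzRingType) (io : K -> S) (v w : V -> S)
    (e1 e2 : pexp K V) c :
  dev io v w (PAdd e1 (PMul (PCst c) e2)) = dev io v w e1 + io c * dev io v w e2.
Proof. by rewrite /= mul0r add0r. Qed.

(** * Formal solutions and bounds on their orders *)

Section FormalBranch.
Variables (R : realFieldType) (T : Type) (k m : nat).
Variables (Q : 'I_k -> 'I_m -> 'I_m) (r : 'I_m -> 'I_m).
Hypothesis rr : forall p, r (r p) = r p.
Hypothesis rQ : forall l p, r (Q l p) = r (Q l (r p)).
Notation K := (T -> R).
Notation V := (option 'I_m).
Variable jet : seq 'I_k.+2 -> K.

Definition fenv (x : 'I_m -> fps R) (lam : fps R) (o : V) : fps R :=
  if o is Some p then x p else lam.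

Definition feq (t : T) (M : nat) (x : 'I_m -> fps R) (lam : fps R) (p : 'I_m) :=
  ev (fun g : K => fpsC (g t)) (fenv x lam) (cell_eq Q (taylor M jet) p).

Definition fjac (t : T) (M : nat) (x : 'I_m -> fps R) (lam : fps R) : 'M[fps R]_m :=
  cell_jac Q (taylor M jet) (fun g : K => fpsC (g t)) (fenv x lam).

(* The parameter is a power series [lam] of order at most [d], and [x] solves
   the Taylor-truncated equations; [d] is small with respect to the degree of
   the truncation. *)
Definition formal_branch (t : T) : Prop :=
  exists d M (x : 'I_m -> fps R) (lam : fps R),
  [/\ (3 * d + 3 <= M)%N,
      (forall p, x p 0%N = 0) /\ lam 0%N = 0,
      forall p, feq t M x lam p = 0,
      ordle lam d /\ ordle (\det (fjac t M x lam)) d &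
      (exists p, x p 1%N != 0) /\
      forall l : 'rV[R]_m, l != 0 -> l *m jac Q jet t = 0 ->
        ordle (\sum_p fpsC (l 0 p) * x p) d].

Section AtPoint.
Variable t : T.
Variables (v1 v2 : 'cV[R]_m) (l0 ls : 'rV[R]_m).
Hypothesis jd : jordan_data r (jac Q jet t) v1 v2 l0 ls.
Hypothesis jetmax : jet [:: ord_max] t = 0.
Variables (i1 p1 i2 p2 : 'I_m).
Hypothesis rp1 : r p1 = p1.
Hypothesis ri2 : r i2 != i2.
Hypothesis rp2 : r p2 != p2.
Hypothesis det1 : \det (piv1 Q jet i1 p1 t) != 0.
Hypothesis det2 : \det (piv2 Q r jet i2 p2 t) != 0.

Let J := jac Q jet t.
Let vv := bu_v Q jet i1 p1.
Let ee := bu_e Q r jet i2 p2.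
Let io : K -> R := fun g => g t.
Let ioC : K -> fps R := fun g => fpsC (g t).

Let ioC0 : ioC 0 = 0. Proof. exact: rmorph0. Qed.
Let ioCN1 : ioC (fun=> -1) = -1. Proof. exact: rmorphN1. Qed.

Definition bu_eqs M := bu_G Q r (taylor M jet) vv ee p1 p2.

Lemma dev_cell_at0 M w p : dev io (fun=> 0) w (cell_eq Q (taylor M.+1 jet) p) =
  \sum_i w (cell_arg Q p i) * jet [:: i] t.
Proof.
rewrite dev_cell dev_taylor_at0 // /io.
have -> : (1`!)%:R^-1 = 1 :> R by exact: invr1.
by rewrite mul1r.
Qed.

Lemma dev_cell_at0_jac M (y : 'cV[R]_m) l p :
  dev io (fun=> 0) (fun o => if o is Some q then y q 0 else l)
      (cell_eq Q (taylor M.+1 jet) p) = (J *m y) p 0.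
Proof.
rewrite dev_cell_at0 jac_mulE; apply: eq_bigr => i _.
case: (unliftP ord_max i) => [j ->|->].
  by rewrite /cell_arg liftK; case: unlift.
by rewrite jetmax !mulr0.
Qed.

(** At the origin a divided equation says that [J eta] is synchronous, which is how the constant
    term [ee] of [eta] was chosen. *)
Lemma bu_eqs0 M p : (0 < M)%N -> ev io (fun=> 0) (bu_eqs M p) = 0.
Proof.
case: M => // M _; rewrite /bu_eqs.
have E p' : ev io (fun=> 0) (cell_eq Q (taylor M.+1 jet) p') = 0.
  by rewrite ev_cell ev_taylor_at0.
have [rp|rp] := eqVneq (r p) p.
  rewrite ev_bu_G_rep // -[RHS](E p); apply: eq_ev => -[q|]; rewrite /bu_x /=.
    by rewrite !mul0r add0r addr0; case: ifP => _ /=.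
  by rewrite mul0r addr0.
rewrite /bu_G (negbTE rp) ev_pdd0 //.
set s := fun i : V => ev io (fun=> 0) (bu_s r vv p1 p2 i).
set s' := fun i : V => ev io (fun=> 0) (bu_t r ee p2 i).
transitivity (dev io s s' (cell_eq Q (taylor M.+1 jet) p)
              - dev io s s' (cell_eq Q (taylor M.+1 jet) (r p))).
  by rewrite dev_addcM mulN1r.
have sE q : dev io s s' (cell_eq Q (taylor M.+1 jet) q) =
  (J *m \col_p ee p t) q 0.
  rewrite -(dev_cell_at0_jac M _ 0); apply: eq_dev => -[q'|]; rewrite /s /s' //=.
    by rewrite mul0r add0r; case: ifP => _ /=.
  have [_ ez _] := piv2P rr jd ri2 rp2 det2.
  rewrite mxE /bu_eta; case: eqP => [/ez|_] /=; first by rewrite /ee => ->.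
  by case: ifP; rewrite /= addr0.
rewrite !sE; have [_ _ es] := piv2P rr jd ri2 rp2 det2.
by rewrite es subrr.
Qed.

Section Solution.
Variable M : nat.
Hypothesis M0 : (0 < M)%N.
Hypothesis hju : hjac io (bu_eqs M) \in unitmx.

Let xi := hensel io (bu_eqs M).
Let w := henv xi.

Definition bu_sol (p : 'I_m) : fps R := bu_x r vv ee p1 p2 ioC w (Some p).

Lemma bu_xiP p : ev ioC w (bu_eqs M p) = 0.
Proof. by apply: henselP => // q; apply: bu_eqs0. Qed.

Lemma bu_xi0 p : xi p 0%N = 0. Proof. exact: hensel0. Qed.

Lemma bu_sol_env o : bu_x r vv ee p1 p2 ioC w o = fenv bu_sol (xi p2) o.
Proof.
case: o => [p|] //=; rewrite /bu_x /=.
by rewrite ioC0 mulr0 addr0.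
Qed.

Lemma bu_sol_eq p : feq t M bu_sol (xi p2) p = 0.
Proof.
rewrite /feq -(@bu_solution _ _ _ _ Q r rr rQ (taylor M jet) vv ee p1 p2 _ ioC
  ioC0 ioCN1 w bu_xiP p).
by apply: eq_ev => o; rewrite bu_sol_env.
Qed.

Lemma bu_sol_coef0 p : bu_sol p 0%N = 0.
Proof.
rewrite /bu_sol /bu_x fps_coefD fps_coefM0 [ev _ _ (bu_b _ _ _)]/= bu_xi0 mul0r addr0.
rewrite [ev _ _ _]/= fps_coefD fps_coefM0 /fpsX /fps_of coefX mul0r add0r.
by case: ifP => _ /=; [rewrite ioC0|rewrite bu_xi0].
Qed.

Lemma bu_sol_coef1 : bu_sol p1 1%N = vv p1 t.
Proof.
rewrite /bu_sol /bu_x /= /bu_eta rp1 eqxx /= ioC0 mulr0 !addr0.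
by rewrite -[fpsX]expr1 fps_coefXnM /= /ioC fps_coefC eqxx.
Qed.

Lemma det_bu_jac : \det (bu_jac Q r (taylor M jet) vv ee p1 p2 ioC w) 0%N != 0.
Proof.
rewrite -[X in X != _]/(fps_coef0_rmorph (\det _)) -det_map_mx.
move: hju; rewrite unitmxE unitfE; congr (\det _ != 0).
apply/matrixP => p q; rewrite !mxE.
transitivity (dev ioC w (fun i => (i == Some q)%:R) (bu_eqs M p) 0%N); last by [].
rewrite /ioC dev_coef0; apply: eq_dev => o; last first.
  by case: (o == _) => //; rewrite mulr1n [RHS]fps_coef1.
by rewrite /w henv0 // => p' [] // _; rewrite bu_xi0.
Qed.

Lemma bu_det_order (z : 'I_m -> fps R) kap a c :
  (forall p, \sum_q fjac t M bu_sol (xi p2) p q * z q =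
    kap * dev ioC (fenv bu_sol (xi p2)) (fun o => (o == None)%:R)
                  (cell_eq Q (taylor M jet) p)) ->
  ordle kap a -> ordle (xi p1) c ->
  ordle (\det (fjac t M bu_sol (xi p2))) (m * a + m * c).
Proof.
move=> zE kapa xic.
have jE : fjac t M bu_sol (xi p2) =
   cell_jac Q (taylor M jet) ioC (bu_x r vv ee p1 p2 ioC w).
  by apply/matrixP => p q; rewrite !mxE; apply: eq_dev => // o; rewrite bu_sol_env.
have [|L [W]] := @bu_det_identity _ _ _ _ Q r rr rQ (taylor M jet) vv ee p1 p2 _ ioC
  ioC0 ioCN1 w z kap bu_xiP.
  move=> p; rewrite -jE zE; congr (_ * _).
  by apply: eq_dev => // o; rewrite bu_sol_env.
rewrite -jE => E.
have : ordle (kap ^+ m * \prod_p (if r p == p then 1 else ev ioC w (bu_b R T p1))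
     * \det (bu_jac Q r (taylor M jet) vv ee p1 p2 ioC w)) (m * a + m * c + 0).
  apply: ordleM; last by exists 0%N => //; exact: det_bu_jac.
  apply: ordleM; first exact: ordleX.
  rewrite -[X in (X * c)%N](card_ord m) cardE /index_enum -enumT.
  apply: ordle_prod => p _; case: ifP => // _.
  by exists 0%N => //; rewrite fps_coef1 oner_neq0.
by rewrite -E addn0 => /ordle_Ml/ordle_Mr.
Qed.

(** In characteristic zero the derivative of the nonzero parameter is nonzero, so it can serve as
    the factor [kap] of the determinant identity. A left null vector of [J] annihilates [u]; it sees
    the branch through [b eta], hence up to the order of [b], because it does not annihilate the
    constant term of [eta]. *)
Lemma formal_branch_of c : ordle (xi p1) c -> ordle (xi p2) c ->
  (3 * (2 * m * c + c) + 3 <= M)%N -> formal_branch t.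
Proof.
(* The determinant has order at most [m c' + m c], where [c' <= c] bounds the order of the
   derivative of the parameter; the other series have order at most [c]. *)
move=> xi1 xi2 cM; exists (2 * m * c + c)%N, M, bu_sol, (xi p2).
have [v0 _] := piv1P jd det1; have [e0 ez es] := piv2P rr jd ri2 rp2 det2.
split=> //.
- by split=> [p|]; rewrite ?bu_sol_coef0 ?bu_xi0.
- exact: bu_sol_eq.
- split; first by case: xi2 => i ic h; exists i => //; lia.
  have [c' [cc' xi2']] : exists c', (c' <= c)%N /\ ordle (fps_deriv (xi p2)) c'.
    case: xi2 => -[|i] ic h; first by rewrite bu_xi0 eqxx in h.
    exists i; split; first by lia.
    exists i => //; rewrite /fps_deriv -mulr_natr mulf_neq0 // pnatr_eq0 //.
  have [] := @bu_det_order (fun p => - fps_deriv (bu_sol p)) (fps_deriv (xi p2)) c' c.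
  + move=> p.
    have := ev_deriv (fenv bu_sol (xi p2)) (cell_eq Q (taylor M jet) p)
      (fun g : K => fps_derivC (g t)).
    rewrite -/(feq t M bu_sol (xi p2) p) bu_sol_eq.
    have -> : fps_deriv (0 : fps R) = 0 by apply/funext => n; rewrite /fps_deriv mul0rn.
    rewrite dev_cell_lin => /esym/eqP; rewrite addr_eq0 => /eqP E.
    under eq_bigr do rewrite mulrN.
    rewrite sumrN mulrC -[RHS]opprK -E; congr (- _); apply: eq_bigr => q _.
    by rewrite [in LHS]mxE.
  + by [].
  + by [].
  + by move=> i h1 h2; exists i => //; nia.
- split; first by exists p1; rewrite bu_sol_coef1.
  move=> l l0' lJ; have [a la] := jd_coker jd lJ.
  have a0 : a != 0 by apply: contraNneq l0' => a0; rewrite la a0 scale0r.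
  have lsync (y : 'cV[R]_m) : vsync r y -> \sum_p l 0 p * y p 0 = 0.
    move=> sy; have /matrixP/(_ 0 0) := jd_l0_sync jd sy.
    rewrite [LHS]mxE [RHS]mxE => E; rewrite la.
    under eq_bigr do rewrite mxE -mulrA.
    by rewrite -mulr_sumr E mulr0.
  have E : \sum_p fpsC (l 0 p) * bu_sol p =
      xi p1 * \sum_p fpsC (l 0 p) * ev ioC w (bu_eta r ee p2 p).
    rewrite mulr_sumr /bu_sol /bu_x.
    under eq_bigr do rewrite mulrDr [X in _ + X]mulrCA.
    rewrite big_split /= [X in X + _](_ : _ = 0) ?add0r //.
    apply/funext => n; rewrite fps_coef_sum.
    have /(lsync) : vsync r (\col_p ev ioC w (bu_u r vv p1 p) n).
      by move=> p; rewrite !mxE /bu_u rr.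
    rewrite fps_coef0 => E; rewrite -[RHS]E; apply: eq_bigr => p _.
    by rewrite fps_coefCM mxE.
  suff : ordle (\sum_p fpsC (l 0 p) * bu_sol p) (c + 0).
    by case=> i ic h; exists i => //; lia.
  rewrite E; apply: ordleM => //; exists 0%N => //.
  have -> : (\sum_p fpsC (l 0 p) * ev ioC w (bu_eta r ee p2 p)) 0%N =
      (l *m \col_p ee p t) 0 0.
    rewrite fps_coef_sum [RHS]mxE; apply: eq_bigr => p _.
    rewrite fps_coefCM mxE /bu_eta; congr (_ * _).
    case: eqP => [/ez E0|_] /=; first by rewrite ioC0 /ee E0.
    rewrite fps_coefD [ioC (ee p)]/ioC fps_coefC /=; case: ifP => _ /=.
      by rewrite ioC0 addr0.
    by rewrite bu_xi0 addr0.
  have [b [d [sd eE]]] := jd_quot jd es.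
  have b0 : b != 0.
    apply: contraNneq e0 => b0; move: eE; rewrite b0 scale0r add0r => eE.
    have := ez (r p2) (rr p2); have := sd p2; rewrite -eE !mxE => -> ->.
    exact/eqP.
  rewrite /ee eE la -scalemxAl mulmxDr (jd_l0_sync jd sd) addr0 -scalemxAr.
  have l0v2 : (l0 *m v2) 0 0 != 0.
    apply: contraNneq (jd_l0v2 jd) => E0; apply/eqP/matrixP => i j.
    by rewrite !ord1 E0 mxE.
  by rewrite !mxE /=; move: l0v2; rewrite mxE => l0v2; rewrite !mulf_neq0.
Qed.

End Solution.
End AtPoint.
End FormalBranch.

(** * The formal branch of a test dynamics *)

Section DerivativeFromValues.
Variables (K V : Type) (S : comNzRingType) (io : K -> S).

(** The test dynamics is known through its values in all rings ([taylor_tau]). Evaluating on a line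
    in the polynomial ring recovers its derivatives as well. *)
Lemma dev_coef1 (v w : V -> S) e :
  (ev (fun c => (io c)%:P) (fun i => (v i)%:P + (w i)%:P * 'X) e)`_1 = dev io v w e.
Proof.
have H : (ev (fun c => (io c)%:P) (fun i => (v i)%:P + (w i)%:P * 'X) e)`_0 = ev io v e
  /\ (ev (fun c => (io c)%:P) (fun i => (v i)%:P + (w i)%:P * 'X) e)`_1 = dev io v w e.
  elim: e => /= [i|c|e1 [IH1 IH2] e2 [IH3 IH4]|e1 [IH1 IH2] e2 [IH3 IH4]].
  - by rewrite !coefD !coefC !coefMX /= coefC addr0 add0r.
  - by rewrite !coefC.
  - by rewrite !coefD IH1 IH2 IH3 IH4.
  - by rewrite !coefM !big_ord_recl !big_ord0 /= /bump /= IH1 IH2 IH3 IH4 !addr0 addrC.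
by have [] := H.
Qed.

End DerivativeFromValues.

Section NiceFunctions.
Variable R : realFieldType.

(** Rational functions without real poles. They include the coefficients of the formal solution
    along a line of test dynamics, allow division by the variable, and obey an identity
    principle. *)
Definition nice (g : R -> R) : Prop := exists q d : {poly R},
  (forall e, d.[e] != 0) /\ forall e, g e = q.[e] / d.[e].

Lemma niceD g h : nice g -> nice h -> nice (fun e => g e + h e).
Proof.
move=> [q [d [d0 gE]]] [q' [d' [d'0 hE]]].
exists (q * d' + q' * d), (d * d'); split=> e.
  by rewrite hornerM mulf_neq0.
by rewrite gE hE addf_div // !hornerE.
Qed.

Lemma niceM g h : nice g -> nice h -> nice (fun e => g e * h e).
Proof.
move=> [q [d [d0 gE]]] [q' [d' [d'0 hE]]].
exists (q * q'), (d * d'); split=> e.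
  by rewrite hornerM mulf_neq0.
by rewrite gE hE mulf_div !hornerE.
Qed.

Lemma niceC c : nice (fun=> c).
Proof.
by exists c%:P, 1; split=> e; rewrite !hornerE ?oner_neq0 // invr1 mulr1.
Qed.

Lemma nice_div g : nice g -> exists2 g1, nice g1 & forall e, g e = g 0 + e * g1 e.
Proof.
move=> [q [d [d0 gE]]].
have : root (q * (d.[0])%:P - (q.[0])%:P * d) 0.
  by rewrite /root !hornerE mulrC subrr.
move=> /factor_theorem[s sE]; rewrite subr0 in sE.
exists (fun e => (s.[e] / (d.[0] * d.[e]))).
  exists s, ((d.[0])%:P * d); split=> e; last by rewrite !hornerE.
  by rewrite !hornerE mulf_neq0.
move=> e; rewrite !gE.
have : q.[e] * d.[0] - q.[0] * d.[e] = s.[e] * e.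
  by have := congr1 (horner^~ e) sE; rewrite !hornerE.
move=> /eqP; rewrite subr_eq => /eqP qe.
apply/(mulIf (d0 0))/(mulIf (d0 e)).
rewrite mulrDl [RHS]mulrDl mulrAC divfK // qe.
rewrite -[X in _ = X + _]mulrA -[X in _ = _ + X]mulrA.
by rewrite mulrA divfK // -mulrA divfK ?mulf_neq0 // addrC [e * _]mulrC.
Qed.

Lemma poly_zero_infinite (p : {poly R}) :
  (forall e, e != 0 -> p.[e] = 0) -> p = 0.
Proof.
move=> p0; apply/eqP/negPn/negP => pn.
have := max_poly_roots pn (rs := [seq i.+1%:R | i <- iota 0 (size p)]).
rewrite size_map size_iota ltnn => H; suff : false by [].
apply: H.
  apply/allP => x /mapP[i _ ->]; rewrite /root p0 // pnatr_eq0 //.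
rewrite map_inj_uniq ?iota_uniq // => i j /eqP; rewrite eqr_nat => /eqP[].
by [].
Qed.

(** The product of the two numerators is a polynomial that vanishes off 0, hence identically. *)
Lemma nice_zero g h : nice g -> nice h -> h 0 != 0 ->
  (forall e, e != 0 -> h e != 0 -> g e = 0) -> g 0 = 0.
Proof.
move=> [q [d [d0 gE]]] [q' [d' [d'0 hE]]] h0 gh.
have qz : q * q' = 0.
  apply: poly_zero_infinite => e e0; rewrite hornerM.
  have [he|he] := eqVneq (h e) 0.
    move/eqP: he; rewrite hE mulf_eq0 invr_eq0 (negbTE (d'0 e)) orbF => /eqP ->.
    by rewrite mulr0.
  move/eqP: (gh e e0 he); rewrite gE mulf_eq0 invr_eq0 (negbTE (d0 e)) orbF.
  by move=> /eqP ->; rewrite mul0r.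
have : q.[0] * q'.[0] = 0 by rewrite -hornerM qz horner0.
move/eqP; rewrite mulf_eq0 gE => /orP[/eqP ->|]; first by rewrite mul0r.
by move: h0; rewrite hE mulf_eq0 negb_or => /andP[/negbTE ->].
Qed.

End NiceFunctions.

(* Take [X - q v], where [q] is the separable polynomial with roots 0 and the
   nodes, and [u q + v q' = 1]. *)
Lemma flat_interpolation (R : realFieldType) (ns : seq R) :
  exists p : {poly R}, [/\ p`_0 = 0, p`_1 = 0,
    forall a, a \in ns -> p.[a] = a & forall a, a \in ns -> p^`().[a] = 0].
Proof.
pose s := undup (0 :: ns); pose q := \prod_(a <- s) ('X - a%:P).
have : separable_poly q by rewrite separable_prod_XsubC undup_uniq.
rewrite separable_poly.unlock => /Bezout_eq1_coprimepP[[u v] /= uv].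
have q0 a : a \in s -> q.[a] = 0.
  by move=> ain; apply/eqP; rewrite -/(root q a) root_prod_XsubC.
have pa a : a \in s -> ('X - q * v).[a] = a /\ ('X - q * v)^`().[a] = 0.
  move=> ain; rewrite derivB derivX derivM !hornerE (q0 _ ain) !mul0r addr0 subr0.
  split=> //; have := congr1 (horner^~ a) uv; rewrite !hornerE (q0 _ ain) mulr0 add0r.
  by rewrite mulrC => ->; rewrite subrr.
have s0 : 0 \in s by rewrite mem_undup mem_head.
exists ('X - q * v); split.
- by rewrite -horner_coef0; have [] := pa _ s0.
- by have [_] := pa _ s0; rewrite horner_coef0 coef_deriv mulr1n.
- by move=> a ain; have [] := pa a; rewrite // mem_undup inE ain orbT.
- by move=> a ain; have [] := pa a; rewrite // mem_undup inE ain orbT.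
Qed.

Lemma coef1_horner_line (R S : comNzRingType) (io : {rmorphism R -> S})
    (p : {poly R}) (a b : S) :
  (map_poly (polyC \o io) p).[a%:P + b%:P * 'X]`_1 = (map_poly io p^`()).[a] * b.
Proof.
rewrite map_poly_comp; set q := map_poly io p.
have -> : (map_poly polyC q).[a%:P + b%:P * 'X] = q \Po (a%:P + b%:P * 'X) by [].
rewrite -deriv_map -/q.
have -> : forall s : {poly S}, s`_1 = s^`()`_0 by move=> s; rewrite coef_deriv mulr1n.
rewrite deriv_comp -horner_coef0 hornerM horner_comp.
by rewrite derivD derivM derivX !derivC !hornerE /= mulr1.
Qed.

(** * Nonvanishing of [b] and of the parameter for some test dynamics *)

Section Nonvanishing.
Variables (R : realFieldType) (T : Type) (k m : nat).
Variables (Q : 'I_k -> 'I_m -> 'I_m) (r : 'I_m -> 'I_m).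
Hypothesis rr : forall p, r (r p) = r p.
Hypothesis rQ : forall l p, r (Q l p) = r (Q l (r p)).
Notation K := (T -> R).
Notation V := (option 'I_m).
Variable jet : seq 'I_k.+2 -> K.
Variables (t0 : T) (tau : {poly R} -> T).

(** Under these bounds the Taylor polynomial of degree [M] reproduces the test dynamics exactly,
    including its quadratic term in the state and the parameter, and [phi] does not disturb the
    1-jet. *)
Definition nonlin_ok (phi : {poly R}) (M : nat) :=
  [/\ phi`_0 = 0, phi`_1 = 0, (size phi <= M.+1)%N & (2 <= M)%N].

Hypothesis jetmax : jet [:: ord_max] t0 = 0.
Hypothesis jet_tau : forall phi i, jet [:: i] (tau phi) = jet [:: i] t0.
Hypothesis taylor_tau : forall phi M, nonlin_ok phi M ->
  forall (S : comNzRingType) (io : {rmorphism R -> S}) (y : 'I_k.+2 -> S),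
  ev (fun g : K => io (g (tau phi))) y (taylor M jet) =
  \sum_i io (jet [:: i] t0) * y i + y ord0 * y ord_max
  + (map_poly io phi).[y ord0].

Variables (v1 v2 : 'cV[R]_m) (l0 ls : 'rV[R]_m).
Let J := jac Q jet t0.
Hypothesis jd : jordan_data r J v1 v2 l0 ls.
Variables (i1 p1 i2 p2 : 'I_m).
Hypothesis rp1 : r p1 = p1.
Hypothesis ri2 : r i2 != i2.
Hypothesis rp2 : r p2 != p2.
Hypothesis det1 : \det (piv1 Q jet i1 p1 t0) != 0.
Hypothesis det2 : \det (piv2 Q r jet i2 p2 t0) != 0.

Lemma jac_tau phi : jac Q jet (tau phi) = J.
Proof.
by apply/matrixP => p q; rewrite !mxE; apply: eq_bigr => i _; rewrite jet_tau.
Qed.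

Lemma jd_tau phi : jordan_data r (jac Q jet (tau phi)) v1 v2 l0 ls.
Proof. by rewrite jac_tau. Qed.

Lemma piv1_tau phi : piv1 Q jet i1 p1 (tau phi) = piv1 Q jet i1 p1 t0.
Proof. by rewrite /piv1 jac_tau. Qed.

Lemma piv2_tau phi : piv2 Q r jet i2 p2 (tau phi) = piv2 Q r jet i2 p2 t0.
Proof. by rewrite /piv2 jac_tau. Qed.

Lemma bu_v_tau phi p : bu_v Q jet i1 p1 p (tau phi) = bu_v Q jet i1 p1 p t0.
Proof. by rewrite /bu_v piv1_tau. Qed.

Lemma bu_e_tau phi p : bu_e Q r jet i2 p2 p (tau phi) = bu_e Q r jet i2 p2 p t0.
Proof. by rewrite /bu_e piv2_tau. Qed.

Lemma sum_cell_arg (S : comNzRingType) (io : {rmorphism R -> S}) (y : V -> S) p :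
  \sum_i io (jet [:: i] t0) * y (cell_arg Q p i) =
  \sum_q io (J p q) * y (Some q).
Proof.
rewrite [RHS](eq_bigr (fun q => \sum_i io (jet [:: i] t0) *
   ((cell_arg Q p i == Some q)%:R * y (Some q)))); last first.
  move=> q _; rewrite mxE rmorph_sum mulr_suml; apply: eq_bigr => i _.
  by rewrite rmorphM rmorph_nat -mulrA mulrCA.
rewrite exchange_big /=; apply: eq_bigr => i _; rewrite -mulr_sumr.
case: (unliftP ord_max i) => [j ->|->]; last first.
  by rewrite jetmax rmorph0 !mul0r.
congr (_ * _); rewrite /cell_arg liftK; set q := if _ is Some _ then _ else _.
rewrite (bigD1 q) //= eqxx mul1r big1 ?addr0 // => q' qq'.
rewrite (_ : (Some q == Some q') = false) ?mul0r //.
by apply/negbTE; rewrite eq_sym.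
Qed.

Lemma cell_arg_ord0 p : cell_arg Q p ord0 = Some p.
Proof.
rewrite /cell_arg; case: unliftP => [j /(congr1 val) /= e|//].
case: unliftP => [l je|//]; move: e; rewrite je /= /bump /=.
by case: leqP; rewrite ?addn1.
Qed.

Lemma cell_arg_max p : cell_arg Q p ord_max = None.
Proof. by rewrite /cell_arg unlift_none. Qed.

Section AtTau.
Variables (phi : {poly R}) (M : nat).
Hypothesis ok : nonlin_ok phi M.

Lemma tau_ev (S : comNzRingType) (io : {rmorphism R -> S}) (y : V -> S) p :
  ev (fun g : K => io (g (tau phi))) y (cell_eq Q (taylor M jet) p) =
  \sum_q io (J p q) * y (Some q) + y (Some p) * y None
  + (map_poly io phi).[y (Some p)].
Proof.
by rewrite ev_cell taylor_tau // sum_cell_arg cell_arg_ord0 cell_arg_max.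
Qed.

Lemma tau_dev (S : comNzRingType) (io : {rmorphism R -> S}) (y w : V -> S) p :
  dev (fun g : K => io (g (tau phi))) y w (cell_eq Q (taylor M jet) p) =
  \sum_q io (J p q) * w (Some q) + (y (Some p) * w None + w (Some p) * y None)
  + (map_poly io phi^`()).[y (Some p)] * w (Some p).
Proof.
rewrite -dev_coef1 (@tau_ev _ (polyC \o io)) !coefD coef1_horner_line.
congr (_ + _ + _).
  rewrite coef_sum; apply: eq_bigr => q _ /=.
  by rewrite coefCM coefD coefC coefCM coefX mulr1 add0r.
rewrite coefM !big_ord_recl big_ord0 /= /bump /= !coefD !coefC !coefCM !coefX /=.
by rewrite !mulr0 !mulr1 !addr0 !add0r.
Qed.

Let vv := bu_v Q jet i1 p1.
Let ee := bu_e Q r jet i2 p2.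
Let io : K -> R := fun g => g (tau phi).
Let ioC : K -> fps R := fun g => fpsC (g (tau phi)).
Let eqs := bu_eqs Q r jet i1 p1 i2 p2 M.

Let ioC0 : ioC 0 = 0. Proof. exact: rmorph0. Qed.
Let ioCN1 : ioC (fun=> -1) = -1. Proof. exact: rmorphN1. Qed.

(** By [jd_quot] both vectors are multiples of [v2] modulo [Delta_1]. A suitable combination is
    therefore synchronous, and it vanishes at the representatives. *)
Lemma nonrep_kernel (y : 'cV[R]_m) : (forall p, r p = p -> y p 0 = 0) ->
  vsync r (J *m y) -> exists c, forall p, y p 0 = c * ee p t0.
Proof.
move=> yz sy; have [e0 ez es] := piv2P rr jd ri2 rp2 det2.
have [a [d [sd yE]]] := jd_quot jd sy.
have [b [d' [sd' eE]]] := jd_quot jd es.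
have b0 : b != 0.
  apply: contraNneq e0 => b0; move: eE; rewrite b0 scale0r add0r => eE.
  have := ez (r p2) (rr p2); have := sd' p2; rewrite -eE !mxE => -> ->.
  exact/eqP.
exists (a / b) => p.
have h q : y q 0 - a / b * ee q t0 = d q 0 - a / b * d' q 0.
  have -> : ee q t0 = (\col_p ee p t0) q 0 by rewrite mxE.
  rewrite /ee eE yE !mxE; field.
  exact: b0.
have hr : y (r p) 0 - a / b * ee (r p) t0 = 0.
  by rewrite yz ?rr // /ee ez ?rr // mulr0 subr0.
by apply/eqP; rewrite -subr_eq0 h -sd -sd' -h hr.
Qed.

Lemma l0_ee : \sum_p l0 0 p * ee p t0 != 0.
Proof.
have [e0 ez es] := piv2P rr jd ri2 rp2 det2.
have [b [d' [sd' eE]]] := jd_quot jd es.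
have b0 : b != 0.
  apply: contraNneq e0 => b0; move: eE; rewrite b0 scale0r add0r => eE.
  have := ez (r p2) (rr p2); have := sd' p2; rewrite -eE !mxE => -> ->.
  exact/eqP.
have -> : \sum_p l0 0 p * ee p t0 = (l0 *m \col_p ee p t0) 0 0.
  by rewrite mxE; apply: eq_bigr => p _; rewrite mxE.
rewrite /ee eE mulmxDr (jd_l0_sync jd sd') addr0 -scalemxAr mxE mulf_neq0 //.
apply: contraNneq (jd_l0v2 jd) => E0; apply/eqP/matrixP => i j.
by rewrite !ord1 E0 mxE.
Qed.

(** Let [y] be in the kernel. The rows at representatives, together with the choice of [ee], put the
    variation [dx] of [u + b eta] into the kernel of [J], that is, on the line of [v1]. Being
    synchronous, [dx] has no component along [eta], so [b] does not vary; the normalization at [p1]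
    then gives [dx = 0]. What is left of the other rows says that [J y2] plus the variation of the
    parameter times [ee] is synchronous. Pairing with [l0] removes the parameter, and
    [nonrep_kernel] removes [y2]. *)
Lemma hjac_tau_unit : hjac io eqs \in unitmx.
Proof.
have [phi0 phi1 _ M2] := ok.
apply: unitmx_inj => y hy.
pose y' (o : V) : R := if o is Some q then y q 0 else 0.
have E p : dev io (fun=> 0) y' (eqs p) = 0.
  have /matrixP/(_ p 0) := hy; rewrite [LHS]mxE [RHS]mxE => E0; rewrite -[RHS]E0.
  under [RHS]eq_bigr do rewrite mxE mulrC.
  rewrite -(dev_sum _ _ _ (fun q => y q 0)); apply: eq_dev => // -[q|] /=.
    rewrite (bigD1 q) //= eqxx mulr1 big1 ?addr0 // => j ji.
    by rewrite (_ : (Some q == Some j) = false) ?mulr0 //; apply/negbTE; rewrite eq_sym.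
  by rewrite big1 // => j _; rewrite mulr0.
have [v0 Jv] := piv1P jd det1; have [e0 ez es] := piv2P rr jd ri2 rp2 det2.
pose dx : 'cV[R]_m := \col_p
  ((if r p == p1 then 0 else y (r p) 0) + y p1 0 * ee p t0).
have Jdx p : r p = p -> (J *m dx) p 0 = 0.
  move=> rp; have jm : jet [:: ord_max] (tau phi) = 0 by rewrite jet_tau.
  rewrite -(jac_tau phi) -(dev_cell_at0_jac Q jm M.-1 dx (y p2 0)).
  rewrite (ltn_predK M2) -[RHS](E p) dev_bu_G_rep //.
  apply: eq_dev => -[q|]; rewrite /bu_x /bu_dx /=.
  - by rewrite !mul0r add0r addr0; case: ifP.
  - by rewrite mul0r addr0.
  - rewrite mxE !mul0r !add0r addr0; congr (_ + _ * _).
      by case: ifP.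
    rewrite /bu_eta; case: eqP => [/ez|_] /=; first by rewrite /ee => ->.
    by rewrite -/ee /io /ee bu_e_tau; case: ifP; rewrite /= addr0.
  - by rewrite mulr0 mul0r !addr0.
have sdx : vsync r (J *m dx).
  have -> : dx = (\col_p (if r p == p1 then 0 else y (r p) 0))
                 + y p1 0 *: \col_p ee p t0.
    by apply/matrixP => p q; rewrite !mxE.
  rewrite mulmxDr -scalemxAr; apply: vsyncD; last exact: vsyncZ.
  by apply: vsync_jac => // p; rewrite !mxE rr.
have [c dxE] : exists c, dx = c *: v1.
  apply: (jd_ker jd); apply/matrixP => p q; rewrite ord1 [RHS]mxE -sdx.
  exact/Jdx/rr.
have sdx' : vsync r dx by rewrite dxE; apply/vsyncZ/(jd_v1_sync jd).
have yp1 : y p1 0 = 0.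
  have := sdx' p2; rewrite !mxE rr /ee (ez _ (rr p2)) => /addrI/eqP.
  rewrite -subr_eq0 -mulrBr mulf_eq0 sub0r oppr_eq0 (negbTE e0) orbF.
  by move=> /eqP.
have dx0 : dx = 0.
  have [c' vE] := jd_ker jd Jv.
  have v1p : v1 p1 0 != 0.
    apply: contraNneq v0 => v10; have := congr1 (fun u : 'cV[R]_m => u p1 0) vE.
    by rewrite !mxE v10 mulr0 => ->.
  have : dx p1 0 = 0 by rewrite mxE rp1 eqxx yp1 mul0r addr0.
  rewrite dxE mxE => /eqP; rewrite mulf_eq0 (negbTE v1p) orbF => /eqP ->.
  by rewrite scale0r.
have yrep p : r p = p -> y p 0 = 0.
  move=> rp; have := congr1 (fun u : 'cV[R]_m => u p 0) dx0.
  rewrite !mxE rp yp1 mul0r addr0; case: eqP => [->|//].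
  by rewrite yp1.
(* The remaining rows are read off the first-order coefficient of the divided
   difference along the line [X y]. *)
pose W (o : V) : fps R := fpsX * fpsC (y' o).
have devW p : ev ioC W (eqs p) 1%N = 0.
  have [q qE] := ev_taylor ioC (fun=> 0) (fun o => fpsC (y' o)) fpsX (eqs p).
  have -> : ev ioC W (eqs p) = ev ioC (fun i => 0 + fpsX * fpsC (y' i)) (eqs p).
    by apply: eq_ev => o; rewrite add0r.
  rewrite qE !fps_coefD fps_coefXnM addr0 -[fpsX]expr1 fps_coefXnM /=.
  rewrite /ioC dev_coef0.
  have -> : ev (fun c : K => fpsC (c (tau phi))) (fun=> 0) (eqs p) 1%N = 0.
    rewrite (_ : ev _ _ _ = fpsC (ev io (fun=> 0) (eqs p))).
      by rewrite fps_coefC.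
    by rewrite ev_morph; apply: eq_ev => o; rewrite /= rmorph0.
  rewrite add0r -[RHS](E p); apply: eq_dev => o //.
  by rewrite fps_coefC.
pose eta q : fps R := ev ioC W (bu_eta r ee p2 q).
have etaz q : r q = q -> eta q = 0.
  by move=> rq; rewrite /eta /bu_eta rq eqxx /= ioC0.
have devG p : r p != p -> ev ioC W (eqs p) =
   (\sum_q fpsC (J p q) * eta q + eta p * (fpsX * fpsC (y p2 0)))
   - (\sum_q fpsC (J (r p) q) * eta q).
  move=> rp; rewrite /eqs /bu_eqs /bu_G (negbTE rp) ev_pdd0 //; last first.
    by rewrite /= /W /y' yp1 rmorph0 mulr0.
  set s := fun i : V => ev _ _ (bu_s _ _ _ _ i).
  set s' := fun i : V => ev _ _ (bu_t _ _ _ i).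
  have sN : s None = fpsX * fpsC (y p2 0) by [].
  have sS q : s (Some q) = 0.
    have W0 : W None = 0 by rewrite /W /y' /= rmorph0 mulr0.
    rewrite /s /= W0 mul0r add0r; case: ifP => _ /=; first exact: ioC0.
    by rewrite /W /y' /= yrep ?rr // rmorph0 mulr0.
  have s'S q : s' (Some q) = eta q by [].
  have s'N : s' None = 0 by exact: ioC0.
  have D q : dev ioC s s' (cell_eq Q (taylor M jet) q) =
     \sum_j fpsC (J q j) * eta j + eta q * (fpsX * fpsC (y p2 0)).
    rewrite tau_dev sS s'N sN mul0r add0r s'S [X in _ + X](_ : _ = 0) ?addr0.
      by congr (_ + _); apply: eq_bigr => j _; rewrite s'S.
    have d0 : phi^`()`_0 = 0 by rewrite coef_deriv phi1 mul0rn.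
    by rewrite horner_coef0 coef_map d0 /= rmorph0 mul0r.
  rewrite dev_addcM !D (etaz (r p)) ?rr // mul0r addr0.
  by rewrite (_ : ioC (fun=> -1) = -1) // mulN1r.
have eta0 q : eta q 0%N = ee q t0.
  rewrite /eta /bu_eta; case: eqP => [/ez|_] /=; first by rewrite ioC0 /ee => ->.
  rewrite fps_coefD {1}/ioC fps_coefC /= [ee q _]bu_e_tau -/ee.
  case: ifP => _ /=; first by rewrite ioC0 addr0.
  by rewrite /W fps_coefM0 /fpsX /fps_of coefX mul0r addr0.
have yp20 : forall p, r p = p -> y p 0 = 0 := yrep.
pose y2 : 'cV[R]_m := \col_p (if (r p == p) || (p == p2) then 0 else y p 0).
have eta1 q : eta q 1%N = y2 q 0.
  rewrite /eta /bu_eta mxE; case: eqP => [_|_] /=; first by rewrite ioC0.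
  rewrite fps_coefD {1}/ioC fps_coefC /= add0r.
  case: eqP => _ /=; first by rewrite ioC0.
  by rewrite /W -[fpsX]expr1 fps_coefXnM /= fps_coefC.
have F p : r p != p ->
   (J *m y2) p 0 + y p2 0 * ee p t0 - (J *m y2) (r p) 0 = 0.
  move=> rp; rewrite -[RHS](devW p) devG // fps_coefB fps_coefD.
  rewrite mulrCA -[fpsX]expr1 fps_coefXnM /= [_ * fpsC _]mulrC fps_coefCM eta0.
  rewrite !fps_coef_sum !mxE; congr (_ + _ - _).
    by apply: eq_bigr => j _; rewrite fps_coefCM eta1.
  by apply: eq_bigr => j _; rewrite fps_coefCM eta1.
have sF : vsync r (J *m y2 + y p2 0 *: \col_p ee p t0).
  have L q : (J *m y2 + y p2 0 *: \col_p ee p t0) q 0 =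
      (J *m y2) q 0 + y p2 0 * ee q t0.
    by rewrite mxE; congr (_ + _); rewrite !mxE.
  move=> p; have [-> //|rp] := eqVneq (r p) p.
  rewrite !L {1}/ee ez ?rr // mulr0 addr0.
  by apply/esym/eqP; rewrite -subr_eq0 F.
have yp2 : y p2 0 = 0.
  have /matrixP/(_ 0 0) := jd_l0_sync jd sF.
  rewrite mulmxDr mulmxA (jd_l0 jd) mul0mx add0r -scalemxAr !mxE.
  move/eqP; rewrite mulf_eq0 => /orP[/eqP //|/eqP E0].
  case/eqP: l0_ee; rewrite -[RHS]E0; apply: eq_bigr => q _; by rewrite [in RHS]mxE.
have sy2 : vsync r (J *m y2) by move: sF; rewrite yp2 scale0r addr0.
have [|c' yE] := nonrep_kernel _ sy2; first by move=> p rp; rewrite mxE rp eqxx.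
have c0 : c' = 0.
  have := yE p2; rewrite mxE eqxx orbT => /esym/eqP; rewrite mulf_eq0 => /orP[/eqP//|].
  by rewrite (negbTE e0).
apply/matrixP => p q; rewrite ord1 mxE.
have [/yrep //|rp] := eqVneq (r p) p; have [-> //|pp] := eqVneq p p2.
by have := yE p; rewrite mxE (negbTE rp) (negbTE pp) c0 mul0r.
Qed.

Let xi := hensel io eqs.
Let w := henv xi.
Let x := bu_sol Q r jet (tau phi) i1 p1 i2 p2 M.
Let u p := ev ioC w (bu_u r vv p1 p).
Let eta p := ev ioC w (bu_eta r ee p2 p).

Let M0 : (0 < M)%N. Proof. by have [_ _ _ M2] := ok; apply: ltnW. Qed.
Let jmtau : jet [:: ord_max] (tau phi) = 0. Proof. by rewrite jet_tau. Qed.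
Let det2tau : \det (piv2 Q r jet i2 p2 (tau phi)) != 0.
Proof. by rewrite piv2_tau. Qed.

Lemma tau_sol_eq p :
  \sum_q fpsC (J p q) * x q + x p * xi p2 + (map_poly fpsC phi).[x p] = 0.
Proof.
rewrite -(tau_ev fpsC (fenv x (xi p2))).
exact: (bu_sol_eq rr rQ (jd_tau phi) jmtau ri2 rp2 det2tau M0 hjac_tau_unit).
Qed.

Lemma tau_bu_xiP p : ev ioC w (eqs p) = 0.
Proof.
exact: (bu_xiP rr (jd_tau phi) jmtau ri2 rp2 det2tau M0 hjac_tau_unit).
Qed.

Lemma tau_sol_decomp p : x p = u p + xi p1 * eta p. Proof. by []. Qed.

Lemma tau_uE p : u p =
  fpsX * fpsC (vv (r p) t0) + (if r p == p1 then 0 else xi (r p)).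
Proof.
rewrite /u [LHS]/=; congr (_ + _); first by rewrite /ioC /vv bu_v_tau.
by case: ifP => _ //=; exact: ioC0.
Qed.

Lemma tau_etaE p : eta p = if r p == p then 0 else
  fpsC (ee p t0) + (if p == p2 then 0 else xi p).
Proof.
rewrite /eta /bu_eta; case: eqP => _ /=; first exact: ioC0.
congr (_ + _); first by rewrite /ioC /ee bu_e_tau.
by case: ifP => _ //=; exact: ioC0.
Qed.

Lemma tau_eta_coef0 p : eta p 0%N = ee p t0.
Proof.
have [_ ez _] := piv2P rr jd ri2 rp2 det2.
rewrite tau_etaE; case: eqP => [/ez|_]; first by rewrite /ee => ->.
rewrite fps_coefD fps_coefC; case: ifP => _ /=; first exact: addr0.
by rewrite [xi p 0%N]hensel0 // addr0.
Qed.

Lemma tau_u_sync p : u (r p) = u p.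
Proof. by rewrite !tau_uE rr. Qed.

Lemma tau_fjac_mul (z : 'I_m -> fps R) p :
  \sum_q fjac Q jet (tau phi) M x (xi p2) p q * z q =
  \sum_q fpsC (J p q) * z q + z p * xi p2 + (map_poly fpsC phi^`()).[x p] * z p.
Proof.
have := tau_dev fpsC (fenv x (xi p2)) (fenv z 0) p.
rewrite dev_cell_lin /= mulr0 mulr0 addr0 add0r => <-.
by apply: eq_bigr => q _; rewrite mxE.
Qed.

Lemma tau_dlam p : dev ioC (fenv x (xi p2)) (fun o => (o == None)%:R)
  (cell_eq Q (taylor M jet) p) = x p.
Proof.
rewrite (tau_dev fpsC) /= mulr1 mul0r addr0 mulr0 addr0 big1 ?add0r //.
by move=> q _; rewrite mulr0.
Qed.

(** If [b] vanishes identically, the divided equations linearize the original ones along [u] in the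
    direction [eta]; they say that the result is synchronous. *)
Lemma tau_nrep_eq p : xi p1 = 0 ->
  let D p := \sum_q fpsC (J p q) * eta q + eta p * xi p2
             + (map_poly fpsC phi^`()).[u p] * eta p in
  D (r p) = D p.
Proof.
move=> b0 D; have [->//|rp] := eqVneq (r p) p.
have := tau_bu_xiP p; rewrite /eqs /bu_eqs /bu_G (negbTE rp) ev_pdd0 //.
set s := fun i : V => ev _ _ (bu_s _ _ _ _ i).
set s' := fun i : V => ev _ _ (bu_t _ _ _ i).
have E q : dev ioC s s' (cell_eq Q (taylor M jet) q) = D q.
  rewrite (tau_dev fpsC) (_ : s' None = 0) ?mulr0 ?add0r //.
rewrite dev_addcM !E (_ : ioC (fun=> -1) = -1) // mulN1r => /eqP.
by rewrite subr_eq0 => /eqP.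
Qed.

End AtTau.

Lemma fps_sync_pair (l : 'rV[R]_m) (y : 'I_m -> fps R) :
  (forall z : 'cV[R]_m, vsync r z -> l *m z = 0) -> (forall p, y (r p) = y p) ->
  \sum_p fpsC (l 0 p) * y p = 0.
Proof.
move=> ly ys; apply/funext => n; rewrite fps_coef_sum.
have /ly/matrixP/(_ 0 0) : vsync r (\col_p y p n) by move=> p; rewrite !mxE ys.
rewrite [LHS]mxE [RHS]mxE fps_coef0 => E; rewrite -[RHS]E; apply: eq_bigr => p _.
by rewrite fps_coefCM mxE.
Qed.

Lemma fps_mul_pair (l : 'rV[R]_m) (y : 'I_m -> fps R) :
  \sum_p fpsC (l 0 p) * (\sum_q fpsC (J p q) * y q) =
  \sum_q fpsC ((l *m J) 0 q) * y q.
Proof.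
under eq_bigr do rewrite mulr_sumr.
rewrite exchange_big /=; apply: eq_bigr => q _.
rewrite mxE rmorph_sum mulr_suml; apply: eq_bigr => p _.
by rewrite rmorphM mulrA.
Qed.

(** Suppose that [b = 0] for every power [X^s], so that the solution [u] stays in [Delta_1]. Pairing
    the equations with [ls], and their transversal linearization with [l0], gives two expressions
    for the parameter. Comparing leading terms yields a relation that is linear in the nonlinearity,
    hence valid for all polynomials without constant and linear terms; a flat interpolation
    polynomial violates it. *)
Lemma tau_transversal_nonzero : exists N, forall M, (N <= M)%N ->
  exists2 s, nonlin_ok 'X^s M &
    hensel (fun g : K => g (tau 'X^s)) (bu_eqs Q r jet i1 p1 i2 p2 M) p1 <> 0.
Proof.
pose Vv p := bu_v Q jet i1 p1 p t0; pose ee p := bu_e Q r jet i2 p2 p t0.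
(* At each entry of the kernel vector, [P] has the value of [X] and derivative zero: in the final
   relation only the term with [ls] survives. *)
have [P [P0 P1 Pn Pd]] := flat_interpolation [seq Vv p | p <- enum 'I_m].
exists (size P).+2 => M PM; apply: contrapT => H.
have {}H s : (2 <= s <= M)%N ->
  hensel (fun g : K => g (tau 'X^s)) (bu_eqs Q r jet i1 p1 i2 p2 M) p1 = 0
  /\ nonlin_ok 'X^s M.
  move=> /andP[s2 sM]; have ok : nonlin_ok 'X^s M.
    split; rewrite ?coefXn ?size_polyXn //; last by lia.
      by case: s s2 sM => [|[|s]].
    by case: s s2 sM => [|[|s]].
  by split=> //; apply: contrapT => H'; apply: H; exists s.
pose A := \sum_p ls 0 p * Vv p; pose E := \sum_p l0 0 p * ee p.
have [v0 Jv] := piv1P jd det1; have [c vE] := jd_ker jd Jv.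
have Vc p : Vv p = c * v1 p 0.
  by have := congr1 (fun y : 'cV[R]_m => y p 0) vE; rewrite !mxE.
have c0 : c != 0 by apply: contraNneq v0 => c0; rewrite -/(Vv p1) Vc c0 mul0r.
have v1p : v1 p1 0 != 0.
  by apply: contraNneq v0 => v10; rewrite -/(Vv p1) Vc v10 mulr0.
have A0 : A != 0.
  have -> : A = c * (ls *m v1) 0 0.
    rewrite /A mxE mulr_sumr; apply: eq_bigr => p _; rewrite Vc; ring.
  rewrite mulf_neq0 //; apply: contraNneq (jd_ls_v1 jd) => E0.
  by apply/eqP/matrixP => i j; rewrite !ord1 E0 mxE.
have key s : (2 <= s <= M)%N ->
   E * (\sum_p ls 0 p * Vv p ^+ s) = s%:R * (\sum_p l0 0 p * (Vv p ^+ s.-1 * ee p)) * A.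
  move=> s2M; have [b0 ok] := H s s2M.
  set xi := hensel _ _ in b0.
  pose io : K -> fps R := fun g => fpsC (g (tau 'X^s)).
  pose u p := ev io (henv xi) (bu_u r (bu_v Q jet i1 p1) p1 p).
  pose eta p := ev io (henv xi) (bu_eta r (bu_e Q r jet i2 p2) p2 p).
  have xu p : bu_sol Q r jet (tau 'X^s) i1 p1 i2 p2 M p = u p.
    by rewrite tau_sol_decomp -/xi b0 mul0r addr0.
  have us p : u (r p) = u p by exact: tau_u_sync.
  have eta0 p : eta p 0%N = ee p by exact: tau_eta_coef0.
  have ueq p : \sum_q fpsC (J p q) * u q + u p * xi p2 + u p ^+ s = 0.
    have := tau_sol_eq ok p; rewrite xu map_polyXn hornerXn => E0.
    rewrite -[RHS]E0; congr (_ + _ + _).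
    by apply: eq_bigr => q _; rewrite xu.
  have u0 p : u p 0%N = 0 by rewrite -xu; apply: bu_sol_coef0.
  have xi0 p : xi p 0%N = 0 by apply: hensel0.
  have uL p : lowz 1 (u p) by case.
  pose u' p := projT1 (cid (lowz_dvd (@uL p))).
  have u'E p : u p = fpsX * u' p by rewrite /u'; case: cid => /= y; rewrite expr1.
  have u1 p : u' p 0%N = u p 1%N by rewrite u'E -[fpsX]expr1 fps_coefXnM.
  (* To first order the equations read [J u = 0], and the coordinate [p1] of [u] is normalized to
     that of the kernel vector. *)
  have u'0 p : u' p 0%N = Vv p.
    have : J *m \col_p u p 1%N = 0.
      apply/matrixP => i j; rewrite [LHS]mxE [RHS]mxE.
      have := congr1 (fun f : fps R => f 1%N) (ueq i).
      rewrite !fps_coefD fps_coef_sum fps_coef0.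
      have -> : (u i * xi p2) 1%N = 0.
        have : lowz 2 (u i * xi p2).
          by apply: (@lowzM _ 1 1) => // -[] // _; apply: xi0.
        exact.
      have -> : (u i ^+ s) 1%N = 0.
        rewrite u'E exprMn_comm; last exact: mulrC.
        by rewrite fps_coefXnM ifT //; case/andP: s2M.
      rewrite !addr0 => E0; rewrite -[RHS]E0; apply: eq_bigr => q _.
      by rewrite fps_coefCM; congr (_ * _); rewrite mxE.
    move=> /(jd_ker jd)[c' cE].
    have uc q : u q 1%N = c' * v1 q 0.
      by have := congr1 (fun y : 'cV[R]_m => y q 0) cE; rewrite !mxE.
    have up1 : u p1 1%N = Vv p1.
      rewrite /u tau_uE rp1 eqxx addr0 -[fpsX]expr1 fps_coefXnM /=.
      by rewrite fps_coefC.
    rewrite u1 uc Vc; congr (_ * _); apply: (mulIf v1p).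
    by rewrite -uc -Vc.
  pose fA := \sum_p fpsC (ls 0 p) * u' p.
  pose fB := \sum_p fpsC (ls 0 p) * u' p ^+ s.
  pose fE := \sum_p fpsC (l0 0 p) * eta p.
  pose fD := \sum_p fpsC (l0 0 p) * (u' p ^+ s.-1 * eta p).
  have e1 : fpsX * (fA * xi p2) + fpsX ^+ s * fB = 0.
    have : \sum_p fpsC (ls 0 p) *
        (\sum_q fpsC (J p q) * u q + u p * xi p2 + u p ^+ s) = 0.
      by rewrite big1 // => p _; rewrite ueq mulr0.
    under eq_bigr do rewrite !mulrDr.
    rewrite !big_split /= fps_mul_pair.
    rewrite (@fps_sync_pair (ls *m J) u) ?add0r //; last first.
      by move=> z zs; rewrite -mulmxA (jd_ls_sync jd zs).
    move=> E0; rewrite -[RHS]E0 /fA /fB mulr_suml !mulr_sumr; congr (_ + _).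
      by apply: eq_bigr => p _; rewrite u'E; ring.
    by apply: eq_bigr => p _; rewrite u'E exprMn; ring.
  have e2 : fE * xi p2 + s%:R * fpsX ^+ s.-1 * fD = 0.
    have ds (y : fps R) : (map_poly fpsC ('X^s)^`()).[y] = s%:R * y ^+ s.-1.
      by rewrite derivXn raddfMn /= map_polyXn hornerMn hornerXn mulr_natl.
    pose D p := \sum_q fpsC (J p q) * eta q + eta p * xi p2
                + s%:R * u p ^+ s.-1 * eta p.
    have Ds p : D (r p) = D p.
      by have h := tau_nrep_eq ok p b0; cbv zeta beta in h; rewrite !ds in h.
    have := @fps_sync_pair l0 D (jd_l0_sync jd) Ds; rewrite /D.
    under eq_bigr do rewrite !mulrDr.
    rewrite !big_split /= fps_mul_pair.
    rewrite [X in X + _ + _](_ : _ = 0) ?add0r; last first.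
      by rewrite big1 // => q _; rewrite (jd_l0 jd) mxE rmorph0 mul0r.
    move=> E0; rewrite -[RHS]E0 /fE /fD mulr_suml mulr_sumr; congr (_ + _).
      by apply: eq_bigr => p _; rewrite mulrA.
    by apply: eq_bigr => p _; rewrite u'E exprMn; ring.
  (* The parameter is eliminated from [e1] and [e2]. *)
  have e3 : fpsX ^+ s * (fE * fB - s%:R * fD * fA) = 0.
    have sE : fpsX ^+ s = fpsX * fpsX ^+ s.-1 :> fps R.
      by rewrite -exprS prednK //; case/andP: s2M => /ltnW.
    have -> : fpsX ^+ s * (fE * fB - s%:R * fD * fA) =
      fE * (fpsX * (fA * xi p2) + fpsX ^+ s * fB)
      - fpsX * fA * (fE * xi p2 + s%:R * fpsX ^+ s.-1 * fD) by rewrite sE; ring.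
    by rewrite e1 e2 !mulr0 subrr.
  have := congr1 (fun f : fps R => f s) e3.
  rewrite fps_coefXnM ltnn subnn fps_coefB !fps_coefM0 fps_coef0 => /eqP.
  rewrite subr_eq0 => /eqP.
  have -> : (s%:R : fps R) 0%N = s%:R by rewrite -[LHS]/(fps_coef0_rmorph _) rmorph_nat.
  have X0 (f g : fps R) : (f * g) 0%N = f 0%N * g 0%N := fps_coefM0 f g.
  have Xn (f : fps R) n : (f ^+ n) 0%N = f 0%N ^+ n.
    by rewrite -[LHS]/(fps_coef0_rmorph _) rmorphXn.
  have -> : fE 0%N = E.
    by rewrite /fE fps_coef_sum; apply: eq_bigr => p _; rewrite X0 fps_coefC /= eta0.
  have -> : fB 0%N = \sum_p ls 0 p * Vv p ^+ s.
    by rewrite /fB fps_coef_sum; apply: eq_bigr => p _; rewrite X0 fps_coefC /= Xn u'0.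
  have -> : fD 0%N = \sum_p l0 0 p * (Vv p ^+ s.-1 * ee p).
    rewrite /fD fps_coef_sum; apply: eq_bigr => p _.
    by rewrite !X0 fps_coefC /= Xn u'0 eta0.
  have -> : fA 0%N = A.
    by rewrite /fA fps_coef_sum; apply: eq_bigr => p _; rewrite X0 fps_coefC /= u'0.
  by [].
(* The relation [key] as a linear functional of the nonlinearity, to be extended from the powers of
   [X] to [P]. *)
pose F (p : {poly R}) := E * (\sum_q ls 0 q * p.[Vv q])
    - (\sum_q l0 0 q * (p^`().[Vv q] * ee q)) * A.
have FD p q : F (p + q) = F p + F q.
  rewrite /F; under eq_bigr do rewrite hornerD mulrDr.
  rewrite big_split /= derivD.
  under [X in _ - X * _]eq_bigr do rewrite hornerD mulrDl mulrDr.
  rewrite big_split /=; ring.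
have FZ a p : F (a *: p) = a * F p.
  rewrite /F derivZ mulrBr; congr (_ - _).
    rewrite [RHS]mulrCA [a * _]mulr_sumr; congr (_ * _).
    by apply: eq_bigr => q _; rewrite hornerZ; ring.
  rewrite [RHS]mulrA [a * _]mulr_sumr; congr (_ * _).
  by apply: eq_bigr => q _; rewrite hornerZ; ring.
have FX s : (2 <= s <= M)%N -> F 'X^s = 0.
  move=> s2M; rewrite /F; under eq_bigr do rewrite hornerXn.
  rewrite key //; apply/eqP; rewrite subr_eq0; apply/eqP; congr (_ * _).
  rewrite mulr_sumr; apply: eq_bigr => q _.
  rewrite derivXn hornerMn hornerXn -mulr_natl; ring.
have : F P = 0.
  rewrite -[P]coefK poly_def; elim/big_rec: _ => [|i q _ qE].
    by rewrite -(scale0r (0 : {poly R})) FZ mul0r.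
  rewrite FD FZ qE addr0; case: i => -[|[|i]] iP /=; rewrite ?P0 ?P1 ?mul0r //.
  by rewrite FX ?mulr0 //; lia.
have Vin q : Vv q \in [seq Vv p | p <- enum 'I_m] by apply/map_f; rewrite mem_enum.
rewrite /F [X in _ - X * _]big1 ?mul0r ?subr0 => [|q _]; last first.
  by rewrite Pd // mul0r mulr0.
have -> : \sum_q ls 0 q * P.[Vv q] = A by apply: eq_bigr => q _; rewrite Pn.
move/eqP; rewrite mulf_eq0 (negbTE A0) orbF => /eqP E0.
by move: l0_ee => /eqP; apply.
Qed.

Notation eqsM M := (bu_eqs Q r jet i1 p1 i2 p2 M).
Notation xiM M phi := (hensel (fun g : K => g (tau phi)) (eqsM M)).
Notation solM M phi := (bu_sol Q r jet (tau phi) i1 p1 i2 p2 M).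

Hypothesis nice_hensel : forall phi psi M p n,
  (forall e, nonlin_ok (phi + e *: psi) M) ->
  nice (fun e : R => xiM M (phi + e *: psi) p n).

Lemma solE M phi p : solM M phi p =
  (fpsX * fpsC (bu_v Q jet i1 p1 (r p) t0)
   + (if r p == p1 then 0 else xiM M phi (r p)))
  + xiM M phi p1 * (if r p == p then 0 else
      fpsC (bu_e Q r jet i2 p2 p t0) + (if p == p2 then 0 else xiM M phi p)).
Proof.
rewrite tau_sol_decomp tau_uE.
by congr (_ + _ * _); exact: tau_etaE.
Qed.

Lemma nonlin_okX s M : (2 <= s <= M)%N -> nonlin_ok ('X^s : {poly R}) M.
Proof.
move=> /andP[s2 sM]; split; rewrite ?coefXn ?size_polyXn //; last by lia.
  by case: s s2 sM => [|[|s]].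
by case: s s2 sM => [|[|s]].
Qed.

Lemma nonlin_okDZ phi psi M e : nonlin_ok phi M -> nonlin_ok psi M ->
  nonlin_ok (phi + e *: psi) M.
Proof.
move=> [a0 a1 a2 a3] [b0 b1 b2 b3]; split=> //.
- by rewrite coefD coefZ a0 b0 mulr0 addr0.
- by rewrite coefD coefZ a1 b1 mulr0 addr0.
- rewrite (leq_trans (size_polyD _ _)) // geq_max a2 /=.
  by rewrite (leq_trans (size_scale_leq _ _)).
Qed.

(* Differentiating the solution in [e], when the parameter component vanishes
   identically, puts [x ^ n] in the range of the Jacobian. *)
Lemma tau_variation M s n : (2 <= s <= M)%N -> (2 <= n <= M)%N ->
  xiM M 'X^s p1 <> 0 ->
  (forall phi, nonlin_ok phi M -> xiM M phi p1 <> 0 -> xiM M phi p2 = 0) ->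
  exists z : 'I_m -> fps R, forall p,
    \sum_q fjac Q jet (tau 'X^s) M (solM M 'X^s) (xiM M 'X^s p2) p q * z q =
    - solM M 'X^s p ^+ n.
Proof.
move=> sM nM b0 lam0.
have oks := nonlin_okX sM; have okn := nonlin_okX nM.
pose ph e : {poly R} := 'X^s + e *: 'X^n.
have okp e : nonlin_ok (ph e) M by exact: nonlin_okDZ.
have ph0 : ph 0 = 'X^s by rewrite /ph scale0r addr0.
pose x e p := solM M (ph e) p.
have nx p : cfam (fun g : R -> R => nice g) (fun e => x e p).
  have nxi q : cfam (fun g : R -> R => nice g) (fun e => xiM M (ph e) q).
    by move=> i; apply: nice_hensel.
  rewrite (_ : (fun e => x e p) = (fun e =>
  (fpsX * fpsC (bu_v Q jet i1 p1 (r p) t0)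
   + (if r p == p1 then 0 else xiM M (ph e) (r p)))
  + xiM M (ph e) p1 * (if r p == p then 0 else
      fpsC (bu_e Q r jet i2 p2 p t0) + (if p == p2 then 0 else xiM M (ph e) p)))); last first.
    by apply/funext => e; rewrite /x solE.
  apply: (cfamD (@niceD R)).
    apply: (cfamD (@niceD R)); first exact: (cfam_cst (@niceC R)).
    by case: (r p == p1); [exact: (cfam_cst (@niceC R))|exact: nxi].
  apply: (cfamM (@niceD R) (@niceM R) (@niceC R)) => //.
  case: (r p == p); first exact: (cfam_cst (@niceC R)).
  apply: (cfamD (@niceD R)); first exact: (cfam_cst (@niceC R)).
  by case: (p == p2); [exact: (cfam_cst (@niceC R))|exact: nxi].
pose d p i := cid2 (nice_div (nx p i)).
pose z e p : fps R := fun i => projT1 (d p i) e.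
have nz p : cfam (fun g : R -> R => nice g) (fun e => z e p).
  by move=> i; rewrite /z; case: (d p i).
have xz e p : x e p = x 0 p + fpsC e * z e p.
  apply/funext => i; rewrite fps_coefD fps_coefCM /z.
  by case: (d p i) => g1 _ /= ->.
(* The quotient by [e] of the difference between the equations for [ph e] and [ph 0]. It vanishes
   for [e] nonzero, by cancelling [e], and its value at [e = 0] is the linearized equation. *)
pose N e p : fps R := \sum_q fpsC (J p q) * z e q
  + z e p * (\sum_(i < s) x e p ^+ (s.-1 - i) * x 0 p ^+ i) + x e p ^+ n.
(* Coefficient [c] of [b] is nonzero at [e = 0]. Wherever it is nonzero the hypothesis on the
   parameter applies, and [nice_zero] carries the identity over to [e = 0]. *)
have [_ [c _ bc]] := neq0_ordle b0.
have sE (y : fps R) : (map_poly fpsC ('X^s : {poly R})).[y] = y ^+ s.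
  by rewrite map_polyXn hornerXn.
have eqn e : xiM M (ph e) p2 = 0 -> forall p,
    \sum_q fpsC (J p q) * x e q + x e p ^+ s + fpsC e * x e p ^+ n = 0.
  move=> l0e p; have := tau_sol_eq (okp e) p; rewrite l0e mulr0 addr0 => E0.
  rewrite -[RHS]E0 -addrA; congr (_ + _).
  rewrite /ph rmorphD /= hornerD sE; congr (_ + _).
  by rewrite map_polyZ hornerZ map_polyXn hornerXn.
have l00 : xiM M (ph 0) p2 = 0 by rewrite ph0; apply: lam0.
have NP e p : e != 0 -> xiM M (ph e) p1 c != 0 -> N e p = 0.
  move=> e0 be; have le0 : xiM M (ph e) p2 = 0.
    by apply: lam0 => // bz; move: be; rewrite bz fps_coef0 eqxx.
  have H : fpsC e * N e p = 0.
    have := eqn e le0 p; have := eqn 0 l00 p.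
    rewrite rmorph0 mul0r addr0 => h0 h1.
    have ez q : fpsC e * z e q = x e q - x 0 q.
      by rewrite [x e q]xz addrAC subrr add0r.
    rewrite /N !mulrDr [fpsC e * (z e p * _)]mulrA ez -subrXX mulr_sumr.
    have -> : \sum_q fpsC e * (fpsC (J p q) * z e q) =
        \sum_q fpsC (J p q) * x e q - \sum_q fpsC (J p q) * x 0 q.
      by rewrite -sumrB; apply: eq_bigr => q _; rewrite mulrCA ez mulrBr.
    have -> (a b c' d' g : fps R) : a - b + (c' - d') + g = a + c' + g - (b + d').
      ring.
    by rewrite h0 h1 subrr.
  apply/funext => i; have := congr1 (fun f : fps R => f i) H.
  rewrite fps_coefCM fps_coef0 => /eqP; rewrite mulf_eq0 (negbTE e0) /=.
  by move=> /eqP.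
have nN p : cfam (fun g : R -> R => nice g) (fun e => N e p).
  have nE := @niceD R; have mE := @niceM R; have cE := @niceC R.
  have nX q i : cfam (fun g : R -> R => nice g) (fun e => x e q ^+ i).
    elim: i => [|i IH]; first exact: (cfam_cst (@niceC R)).
    rewrite (_ : (fun e => _) = (fun e => x e q * x e q ^+ i)); first exact: cfamM.
    by apply/funext => e; rewrite exprS.
  apply: cfamD => //; apply: cfamD => //.
    by apply: cfam_sum => // q; apply: cfamM => //; exact: (cfam_cst (@niceC R)).
  apply: cfamM => //; apply: cfam_sum => // i.
  by apply: cfamM => //.
have N0 p : N 0 p = 0.
  apply/funext => i; rewrite fps_coef0.
  apply: (nice_zero (nN p i) (nice_hensel p1 c okp)); first by rewrite -/(ph 0) ph0.
  by move=> e e0 be; rewrite NP.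
exists (z 0) => p; rewrite (tau_fjac_mul oks) lam0 // mulr0 addr0.
have := N0 p; rewrite /N => /eqP; rewrite addr_eq0 => /eqP.
rewrite /x ph0 => <-; congr (_ + _).
rewrite mulrC; congr (_ * _).
rewrite derivXn raddfMn /= map_polyXn hornerMn hornerXn.
under eq_bigr => i _.
  rewrite -exprD subnK; last by have := ltn_ord i; case/andP: sM; lia.
  over.
by rewrite sumr_const card_ord.
Qed.

(** Otherwise the parameter vanishes for all test dynamics with [b] nonzero, and by [tau_variation]
    the powers [x ^ n] with [n >= 2] lie in the range of the Jacobian [F]. A polynomial that
    vanishes at all components of [x] expresses a nonzero multiple of [x] by these powers. Since [x]
    is the derivative of the equations in the parameter, the determinant identity makes [det F]
    nonzero. With a constant parameter, however, the velocity of the branch lies in the kernel of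
    [F]. *)
Lemma tau_parameter_nonzero : exists phi M, [/\ nonlin_ok phi M,
  xiM M phi p1 <> 0 & xiM M phi p2 <> 0].
Proof.
have [N0 HN] := tau_transversal_nonzero.
(* The annihilating polynomial below has degree at most [m + 1], and the perturbations by all powers
   from 2 to this degree have to fit into the truncation. *)
pose M := (maxn N0 m.+2).
have [s oks b0] := HN M (leq_maxl _ _).
apply: contrapT => H.
have lam0 phi : nonlin_ok phi M -> xiM M phi p1 <> 0 -> xiM M phi p2 = 0.
  by move=> ok b; apply: contrapT => l; apply: H; exists phi, M.
have sM : (2 <= s <= M)%N.
  have [h0 h1 h2 _] := oks; rewrite size_polyXn ltnS in h2; rewrite h2 andbT.
  by case: s h0 h1 {oks b0 h2} => [|[|s]] //; rewrite !coefXn /= => h0 h1;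
    [move/eqP: h0|move/eqP: h1]; rewrite oner_eq0.
have mM i : (i < m)%N -> (2 <= i.+2 <= M)%N.
  by move=> im /=; rewrite leq_max orbC; apply/orP; left; lia.
pose x p := solM M 'X^s p; pose lam := xiM M 'X^s p2.
have l0' : lam = 0 by exact: lam0.
pose F := fjac Q jet (tau 'X^s) M x lam.
have zex (i : 'I_m) : exists z : 'I_m -> fps R,
    forall p, \sum_q F p q * z q = - x p ^+ i.+2.
  exact: (tau_variation sM (mM _ (ltn_ord i)) b0 lam0).
pose z i := projT1 (cid (zex i)).
have zE i p : \sum_q F p q * z i q = - x p ^+ i.+2 by rewrite /z; case: cid.
pose sx := [seq x q | q <- enum 'I_m & x q != 0].
(* The factor ['X] accounts for zero components and removes the constant term. The linear
   coefficient is, up to sign, the product of the nonzero components. *)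
pose P : {poly fps R} := 'X * \prod_(a <- sx) ('X - a%:P).
have szP : (size P <= m.+2)%N.
  have szp : (size (\prod_(a <- sx) ('X - a%:P))%R <= m.+1)%N.
    rewrite size_prod_XsubC ltnS size_map -[m in (_ <= m)%N]card_ord cardE.
    by rewrite size_filter count_size.
  apply: leq_trans (size_polyMleq _ _) _; rewrite size_polyX add2n.
  exact: szp.
have Px q : P.[x q] = 0.
  rewrite hornerM hornerX; have [->|xq] := eqVneq (x q) 0; first by rewrite mul0r.
  rewrite (_ : _.[x q] = 0) ?mulr0 //.
  have : x q \in sx by apply/map_f; rewrite mem_filter xq mem_enum.
  move=> /(nthP 0)[i isx xi]; rewrite (big_nth 0) big_mkord (bigD1 (Ordinal isx)) //=.
  by rewrite hornerM hornerXsubC xi subrr mul0r.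
have P0 : P`_0 = 0 by rewrite coefXM.
have [a Pa] : exists a, ordle P`_1 a.
  apply: neq0_ordle; rewrite coefXM /= -horner_coef0 horner_prod.
  have : all (fun y : fps R => y != 0) sx.
    by apply/allP => y /mapP[q]; rewrite mem_filter => /andP[xq _] ->.
  elim: (sx) => [|y l IH] /=; first by move=> _; rewrite big_nil; exact/eqP/oner_neq0.
  move=> /andP[y0 /IH l0z]; rewrite big_cons hornerXsubC sub0r => /fps_mul_eq0[|//].
  by move=> /eqP; rewrite oppr_eq0; exact/negP.
pose zt q := \sum_(i < m) P`_(i.+2) * z i q.
have M0 : (0 < M)%N by rewrite leq_max orbC.
have jmt : jet [:: ord_max] (tau 'X^s) = 0 by rewrite jet_tau.
have det2t : \det (piv2 Q r jet i2 p2 (tau 'X^s)) != 0 by rewrite piv2_tau.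
have [c bc] := neq0_ordle b0.
have : ordle (\det F) (m * a + m * c).
  apply: (bu_det_order rr rQ (jd_tau 'X^s) jmt ri2 rp2 det2t M0
     (hjac_tau_unit oks) (z := zt) (kap := P`_1)) => //.
  move=> p; rewrite (tau_dlam oks).
  rewrite /zt; under eq_bigr do rewrite mulr_sumr.
  rewrite exchange_big /=.
  rewrite (eq_bigr (fun i : 'I_m => P`_(i.+2) * (- x p ^+ i.+2))); last first.
    move=> i _; rewrite -zE mulr_sumr; apply: eq_bigr => q _; exact: mulrCA.
  have := Px p; rewrite (horner_coef_wide _ szP) !big_ord_recl /= P0 mul0r add0r.
  rewrite expr1 => /eqP; rewrite addr_eq0 => /eqP ->.
  by rewrite -sumrN; apply: eq_bigr => i _; rewrite mulrN.
move=> /ordle_neq0; apply.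
(* The velocity of the branch; its component at [p1] has a nonzero constant term by the
   normalization of the amplitude. *)
pose x' : 'cV[fps R]_m := \col_q fps_deriv (x q).
have Fx : F *m x' = 0.
  apply/matrixP => p j; rewrite [LHS]mxE [RHS]mxE.
  have := ev_deriv (fenv x lam) (cell_eq Q (taylor M jet) p)
      (fun g : K => fps_derivC (g (tau 'X^s))).
  rewrite -/(feq Q jet (tau 'X^s) M x lam p).
  rewrite (bu_sol_eq rr rQ (jd_tau 'X^s) jmt ri2 rp2 det2t M0 (hjac_tau_unit oks)).
  have -> : fps_deriv (0 : fps R) = 0 by apply/funext => n; rewrite /fps_deriv mul0rn.
  rewrite dev_cell_lin /= l0'.
  have -> : fps_deriv (0 : fps R) = 0 by apply/funext => n; rewrite /fps_deriv mul0rn.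
  rewrite mulr0 addr0 => E0; rewrite [RHS]E0; apply: eq_bigr => q _.
  by rewrite /F l0' !mxE.
have : \det F * fps_deriv (x p1) = 0.
  have : \adj F *m (F *m x') = 0 by rewrite Fx mulmx0.
  rewrite mulmxA mul_adj_mx mul_scalar_mx => /matrixP/(_ p1 0).
  by rewrite !mxE.
move=> /fps_mul_eq0[//|] /(congr1 (fun f : fps R => f 0%N)).
have [v0 _] := piv1P jd det1.
rewrite /fps_deriv mulr1n /x bu_sol_coef1 // fps_coef0 bu_v_tau => E0.
by rewrite E0 eqxx in v0.
Qed.

(** Both truncations give the same equations for a polynomial dynamics, and as [b] is nonzero they
    remain the same after division; uniqueness in Hensel's lemma concludes. This resolves a
    circularity: [M] must be large compared with orders that are only known once [M] has been
    chosen. *)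
Lemma tau_stable M M' phi p : nonlin_ok phi M -> (M <= M')%N ->
  xiM M phi p1 <> 0 -> xiM M' phi p = xiM M phi p.
Proof.
move=> ok MM' b0.
have ok' : nonlin_ok phi M'.
  have [h0 h1 h2 h3] := ok; split=> //; last exact: leq_trans MM'.
  exact: leq_trans h2 _.
pose ioC : K -> fps R := fun g => fpsC (g (tau phi)).
have ioC0 : ioC 0 = 0 by exact: rmorph0.
have ioCN1 : ioC (fun=> -1) = -1 by exact: rmorphN1.
pose w := henv (xiM M phi).
pose xx := bu_x r (bu_v Q jet i1 p1) (bu_e Q r jet i2 p2) p1 p2 ioC w.
have F0 q : ev ioC xx (cell_eq Q (taylor M' jet) q) = 0.
  rewrite (tau_ev ok' fpsC) -(tau_ev ok fpsC).
  by apply: (bu_solution rr rQ ioC0 ioCN1) => q'; exact: (tau_bu_xiP ok).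
have G0 q : ev ioC w (eqsM M' q) = 0.
  have [rq|rq] := eqVneq (r q) q; first by rewrite ev_bu_G_rep.
  have := ev_bu_G_nrep rr rQ (taylor M' jet) (bu_v Q jet i1 p1)
    (bu_e Q r jet i2 p2) p1 p2 ioC0 ioCN1 w rq.
  by rewrite -/xx !F0 subrr => /fps_mul_eq0[/b0|].
apply/funext => n; apply/eqP; rewrite -subr_eq0; apply/eqP.
have H' : forall q, ev ioC (henv (xiM M' phi)) (eqsM M' q) = 0 by exact: tau_bu_xiP.
have := @hensel_unique R K m (fun g => g (tau phi)) (eqsM M')
  (hjac_tau_unit ok') n.+1 (xiM M phi) (xiM M' phi).
move=> /(_ (@hensel0 _ _ _ _ _) (@hensel0 _ _ _ _ _)) /(_ _ p n (ltnSn n)).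
by apply=> q i _; rewrite fps_coefB G0 H' subrr.
Qed.

Lemma tau_orders : exists phi M c, [/\ nonlin_ok phi M,
  ordle (xiM M phi p1) c, ordle (xiM M phi p2) c &
  (3 * (2 * m * c + c) + 3 <= M)%N].
Proof.
have [phi [M [ok b0 l0']]] := tau_parameter_nonzero.
have [a [i ia ba]] := neq0_ordle b0; have [a' [j ja la]] := neq0_ordle l0'.
pose c := maxn a a'; pose M' := maxn M (3 * (2 * m * c + c) + 3).
exists phi, M', c; split.
- have [h0 h1 h2 h3] := ok; split=> //; last by rewrite leq_max h3.
  by apply: leq_trans h2 _; rewrite ltnS leq_maxl.
- rewrite (tau_stable _ ok) ?leq_maxl //; exists i => //.
  by rewrite leq_max ia.
- rewrite (tau_stable _ ok) ?leq_maxl //; exists j => //.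
  by rewrite leq_max ja orbT.
- exact: leq_maxr.
Qed.

End Nonvanishing.

(** * Polynomial functions of the jet *)

Section PolyFun.
Variables (R : realFieldType) (T : Type) (k : nat).
Variable jet : seq 'I_k.+2 -> T -> R.

Inductive polyfun (A : seq 'I_k.+2 -> Prop) : (T -> R) -> Prop :=
| pf_const c : polyfun A (fun=> c)
| pf_jet s : A s -> polyfun A (jet s)
| pf_add g h : polyfun A g -> polyfun A h -> polyfun A (fun t => g t + h t)
| pf_mul g h : polyfun A g -> polyfun A h -> polyfun A (fun t => g t * h t).

Lemma pf_sum A (I : Type) (r : seq I) (P : pred I) (g : I -> T -> R) :
  (forall i, polyfun A (g i)) -> polyfun A (fun t => \sum_(i <- r | P i) g i t).
Proof. exact: (closed_sum (@pf_add A) (@pf_const A)). Qed.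

Lemma pf_prod A (I : Type) (r : seq I) (P : pred I) (g : I -> T -> R) :
  (forall i, polyfun A (g i)) -> polyfun A (fun t => \prod_(i <- r | P i) g i t).
Proof. exact: (closed_prod (@pf_mul A) (@pf_const A)). Qed.

Lemma pf_exp A g n : polyfun A g -> polyfun A (fun t => g t ^+ n).
Proof.
move=> Ag; elim: n => [|n IH].
  rewrite (_ : (fun t => _) = (fun=> 1)); first exact: pf_const.
  by apply/funext => t; rewrite expr0.
rewrite (_ : (fun t => _) = (fun t => g t * g t ^+ n)); first exact: pf_mul.
by apply/funext => t; rewrite exprS.
Qed.

Lemma pf_det A m (B : T -> 'M[R]_m) : (forall p q, polyfun A (fun t => B t p q)) ->
  polyfun A (fun t => \det (B t)).
Proof.
move=> HB; apply: pf_sum => s; apply: pf_mul; first exact: pf_const.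
by apply: pf_prod => p.
Qed.

Lemma pf_adj A m (B : T -> 'M[R]_m) : (forall p q, polyfun A (fun t => B t p q)) ->
  forall p q, polyfun A (fun t => \adj (B t) p q).
Proof.
move=> HB p q; rewrite (_ : (fun t => _) = (fun t => (-1) ^+ (q + p) *
   \det (row' q (col' p (B t))))); last by apply/funext => t; rewrite mxE.
apply: pf_mul; first exact: pf_const.
apply: pf_det => i j; rewrite (_ : (fun t => _) = (fun t => B t (lift q i) (lift p j))) //.
by apply/funext => t; rewrite !mxE.
Qed.

Lemma pf_ev A (V : Type) (v : V -> R) (e : pexp (T -> R) V) :
  pcsts (polyfun A) e -> polyfun A (fun t => ev (fun g => g t) v e).
Proof.
elim: e => /= [i _|c //|e1 IH1 e2 IH2 [/IH1 h1 /IH2 h2]|e1 IH1 e2 IH2 [/IH1 h1 /IH2 h2]].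
- exact: pf_const.
- exact: pf_add.
- exact: pf_mul.
Qed.

Lemma pf_dev A (V : Type) (v w : V -> R) (e : pexp (T -> R) V) :
  pcsts (polyfun A) e -> polyfun A (fun t => dev (fun g => g t) v w e).
Proof.
elim: e => /= [i _|c _|e1 IH1 e2 IH2 [h1 h2]|e1 IH1 e2 IH2 [h1 h2]].
- exact: pf_const.
- exact: pf_const.
- by apply: pf_add; auto.
- by apply: pf_add; apply: pf_mul; auto; apply: pf_ev.
Qed.

Variable A : seq 'I_k.+2 -> Prop.
Variable del : T -> R.
Hypothesis del_pf : polyfun A del.

(** Polynomials localized at [del]: nothing is required of [g] where [del] vanishes. *)
Definition ratfun (g : T -> R) : Prop := exists (n : nat) (q : T -> R),
  polyfun A q /\ forall t, del t != 0 -> g t = q t / del t ^+ n.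

Lemma ratfun_pf g : polyfun A g -> ratfun g.
Proof. by move=> Ag; exists 0%N, g; split=> // t _; rewrite expr0 divr1. Qed.

Lemma ratfunD g h : ratfun g -> ratfun h -> ratfun (fun t => g t + h t).
Proof.
move=> [n [q [Aq gE]]] [n' [q' [Aq' hE]]].
exists (n + n')%N, (fun t => q t * del t ^+ n' + q' t * del t ^+ n); split.
  by apply: pf_add; apply: pf_mul => //; apply: pf_exp.
move=> t d0; rewrite gE // hE // exprD addf_div ?expf_neq0 //.
Qed.

Lemma ratfunM g h : ratfun g -> ratfun h -> ratfun (fun t => g t * h t).
Proof.
move=> [n [q [Aq gE]]] [n' [q' [Aq' hE]]].
exists (n + n')%N, (fun t => q t * q' t); split; first exact: pf_mul.
by move=> t d0; rewrite gE // hE // exprD mulf_div.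
Qed.

Lemma ratfunC c : ratfun (fun=> c).
Proof. exact/ratfun_pf/pf_const. Qed.

Lemma ratfun_inv g h : polyfun A h -> (forall t, del t = g t * h t) ->
  ratfun (fun t => (g t)^-1).
Proof.
move=> Ah dE; exists 1%N, h; split=> // t; rewrite expr1 dE mulf_eq0 negb_or.
by move=> /andP[g0 h0]; rewrite invfM mulrCA divff // mulr1.
Qed.

Lemma ratfun_eq g h : (forall t, del t != 0 -> g t = h t) -> ratfun g -> ratfun h.
Proof.
by move=> gh [n [q [Aq gE]]]; exists n, q; split=> // t d0; rewrite -gh // gE.
Qed.

Lemma ratfun_nice (gam : R -> T) g :
  (forall s, A s -> exists P : {poly R}, forall e, jet s (gam e) = P.[e]) ->
  (forall e, del (gam e) != 0) -> ratfun g -> nice (fun e => g (gam e)).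
Proof.
move=> jP d0 [n [q [Aq gE]]].
have pP h : polyfun A h -> exists P : {poly R}, forall e, h (gam e) = P.[e].
  elim=> [c|s /jP//|g1 g2 _ [P1 E1] _ [P2 E2]|g1 g2 _ [P1 E1] _ [P2 E2]].
  - by exists c%:P => e; rewrite hornerC.
  - by exists (P1 + P2) => e; rewrite hornerD E1 E2.
  - by exists (P1 * P2) => e; rewrite hornerM E1 E2.
have [P PE] := pP _ Aq; have [D DE] := pP _ del_pf.
exists P, (D ^+ n); split=> e; rewrite horner_exp -DE; first by rewrite expf_neq0.
by rewrite gE // PE.
Qed.

End PolyFun.

(** * A polynomial condition on the jet for the existence of a formal branch *)

Section Theta.
Variables (R : realFieldType) (T : Type) (k m : nat).
Variables (Q : 'I_k -> 'I_m -> 'I_m) (r : 'I_m -> 'I_m).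
Hypothesis rr : forall p, r (r p) = r p.
Hypothesis rQ : forall l p, r (Q l p) = r (Q l (r p)).
Notation K := (T -> R).
Variable jet : seq 'I_k.+2 -> K.

Definition nontriv_jet (s : seq 'I_k.+2) : Prop := s <> [::].
Notation PF := (polyfun jet nontriv_jet).

Lemma pf_jac p q : PF (fun t => jac Q jet t p q).
Proof.
rewrite (_ : (fun t => _) = (fun t =>
   \sum_i (cell_arg Q p i == Some q)%:R * jet [:: i] t)); last first.
  by apply/funext => t; rewrite mxE.
by apply: pf_sum => i; apply: pf_mul; [exact: pf_const|exact: pf_jet].
Qed.

Lemma pf_piv1 i1 p1 p q : PF (fun t => piv1 Q jet i1 p1 t p q).
Proof.
rewrite (_ : (fun t => _) = (fun t => jac Q jet t p q + delta_mx i1 p1 p q)).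
  by apply: pf_add; [exact: pf_jac|exact: pf_const].
by apply/funext => t; rewrite mxE.
Qed.

Lemma pf_piv2 i2 p2 p q : PF (fun t => piv2 Q r jet i2 p2 t p q).
Proof.
rewrite (_ : (fun t => _) = (fun t => (if r p == p then (p == q)%:R else
    if r q == q then 0 else jac Q jet t p q + -1 * jac Q jet t (r p) q)
   + (p == i2)%:R * (q == p2)%:R)); last first.
  by apply/funext => t; rewrite mxE mulN1r.
apply: pf_add; last exact: pf_const.
case: (r p == p); first exact: pf_const.
case: (r q == q); first exact: pf_const.
apply: pf_add; first exact: pf_jac.
by apply: pf_mul; [exact: pf_const|exact: pf_jac].
Qed.

Lemma pcsts_bu_eqs i1 p1 i2 p2 M p : pcsts PF (bu_eqs Q r jet i1 p1 i2 p2 M p).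
Proof.
have c0 : PF 0 by exact: (pf_const _ _ 0).
have cv q : PF (bu_v Q jet i1 p1 q) by apply: pf_adj; exact: pf_piv1.
have ce q : PF (bu_e Q r jet i2 p2 q) by apply: pf_adj; exact: pf_piv2.
have cc q : pcsts PF (cell_eq Q (taylor M jet) q).
  apply: pcsts_psub => //; apply: pcsts_taylor; first exact: pf_const.
  by move=> s /eqP s0; apply: pf_jet.
have cs i : pcsts PF (bu_s r (bu_v Q jet i1 p1) p1 p2 i).
  by case: i => [q|] //=; split; [split=> //|case: ifP].
have ct i : pcsts PF (bu_t r (bu_e Q r jet i2 p2) p2 i).
  case: i => [q|] //=; rewrite /bu_eta; case: ifP => //= _; split => //.
  by case: ifP.
rewrite /bu_eqs /bu_G; case: ifP => _.
  by apply: pcsts_psub => // i /=; split=> //; split.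
apply: pcsts_pdd => //=; split=> //; split=> //; exact: (pf_const _ _ (-1)).
Qed.

Lemma pf_hjac i1 p1 i2 p2 M p q :
  PF (fun t => hjac (fun g => g t) (bu_eqs Q r jet i1 p1 i2 p2 M) p q).
Proof.
rewrite (_ : (fun t => _) = (fun t => dev (fun g => g t) (fun=> 0)
   (fun i => (i == Some q)%:R) (bu_eqs Q r jet i1 p1 i2 p2 M p))).
  by apply: pf_dev; apply: pcsts_bu_eqs.
by apply/funext => t; rewrite mxE.
Qed.

Definition bu_del i1 p1 i2 p2 M (t : T) : R :=
  \det (hjac (fun g => g t) (bu_eqs Q r jet i1 p1 i2 p2 M))
  * (\det (piv1 Q jet i1 p1 t) * \det (piv2 Q r jet i2 p2 t)).

Lemma pf_del i1 p1 i2 p2 M : PF (bu_del i1 p1 i2 p2 M).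
Proof.
apply: pf_mul; first by apply: pf_det => p q; apply: pf_hjac.
by apply: pf_mul; apply: pf_det => p q; [exact: pf_piv1|exact: pf_piv2].
Qed.

Lemma ratfun_hensel i1 p1 i2 p2 M p n : ratfun jet nontriv_jet (bu_del i1 p1 i2 p2 M)
  (fun t => hensel (fun g => g t) (bu_eqs Q r jet i1 p1 i2 p2 M) p n).
Proof.
set del := bu_del _ _ _ _ _.
have dpf : PF del by exact: pf_del.
apply: (cfam_hensel (ratfunD dpf) (@ratfunM _ _ _ _ _ _) (ratfunC _ _ _)).
  move=> q; have := pcsts_bu_eqs i1 p1 i2 p2 M q.
  elim: (bu_eqs _ _ _ _ _ _ _ _ _) => //= [c|e1 IH1 e2 IH2 [/IH1 ? /IH2 ?]|
    e1 IH1 e2 IH2 [/IH1 ? /IH2 ?]] //.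
  exact: ratfun_pf.
move=> a b; pose B t := hjac (fun g => g t) (bu_eqs Q r jet i1 p1 i2 p2 M).
apply: (@ratfun_eq _ _ _ _ _ _ (fun t => (\det (B t))^-1 * \adj (B t) a b)).
  move=> t; rewrite mulf_eq0 negb_or => /andP[B0 _].
  have Bu : B t \in unitmx by rewrite unitmxE unitfE.
  by rewrite -/(B t) /invmx Bu [RHS]mxE.
apply: ratfunM; last by apply/ratfun_pf/pf_adj => p' q'; apply: pf_hjac.
apply: (ratfun_inv (h := fun t => \det (piv1 Q jet i1 p1 t) * \det (piv2 Q r jet i2 p2 t))) => //.
by apply: pf_mul; apply: pf_det => p' q'; [exact: pf_piv1|exact: pf_piv2].
Qed.

Definition jordan_at (t : T) : Prop :=
  exists v1 v2 l0 ls, jordan_data r (jac Q jet t) v1 v2 l0 ls.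

Variables (t0 : T) (tau : {poly R} -> T).
Hypothesis jetmax : jet [:: ord_max] t0 = 0.
Hypothesis jet_tau : forall phi i, jet [:: i] (tau phi) = jet [:: i] t0.
Hypothesis taylor_tau : forall phi M, nonlin_ok phi M ->
  forall (S : comNzRingType) (io : {rmorphism R -> S}) (y : 'I_k.+2 -> S),
  ev (fun g : K => io (g (tau phi))) y (taylor M jet) =
  \sum_i io (jet [:: i] t0) * y i + y ord0 * y ord_max
  + (map_poly io phi).[y ord0].
Hypothesis tau_line : forall phi psi s, s <> [::] ->
  exists P : {poly R}, forall e, jet s (tau (phi + e *: psi)) = P.[e].
Hypothesis jd0 : jordan_at t0.

Lemma exists_theta : exists Theta : T -> R, [/\ PF Theta,
  forall t, jet [:: ord_max] t = 0 -> jordan_at t -> Theta t != 0 ->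
    formal_branch Q jet t &
  exists phi, Theta (tau phi) != 0].
Proof.
have [v1 [v2 [l0 [ls jd]]]] := jd0.
have [i1 [p1 [rp1 det1]]] := piv1_ex rr jd.
have [i2 [p2 [ri2 rp2 det2]]] := piv2_ex rr jd.
have delt phi M : nonlin_ok phi M -> bu_del i1 p1 i2 p2 M (tau phi) != 0.
  move=> ok; rewrite !mulf_neq0 //.
  - rewrite -unitfE -unitmxE.
    exact: (hjac_tau_unit rr rQ jetmax jet_tau taylor_tau jd rp1 ri2 rp2 det1 det2 ok).
  - by rewrite (piv1_tau Q jet_tau).
  - by rewrite (piv2_tau Q r jet_tau).
have nh phi psi M p n : (forall e, nonlin_ok (phi + e *: psi) M) ->
    nice (fun e : R => hensel (fun g => g (tau (phi + e *: psi)))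
       (bu_eqs Q r jet i1 p1 i2 p2 M) p n).
  move=> ok; apply: (ratfun_nice (pf_del i1 p1 i2 p2 M)
    (gam := fun e => tau (phi + e *: psi)) _ _ (ratfun_hensel i1 p1 i2 p2 M p n)).
    by move=> s; apply: tau_line.
  by move=> e; apply: delt.
have [phi [M [c [ok [i ic bi] [j jc lj] cM]]]] :=
  tau_orders rr rQ jetmax jet_tau taylor_tau jd rp1 ri2 rp2 det1 det2 nh.
pose G t := bu_eqs Q r jet i1 p1 i2 p2 M.
have [n [q [Aq qE]]] := ratfunM (ratfun_hensel i1 p1 i2 p2 M p1 i)
                                (ratfun_hensel i1 p1 i2 p2 M p2 j).
exists (fun t => bu_del i1 p1 i2 p2 M t * q t); split.
- by apply: pf_mul => //; apply: pf_del.
- move=> t jm [w1 [w2 [k0 [ks jdt]]]]; rewrite mulf_eq0 negb_or => /andP[d0 q0].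
  have : hensel (fun g => g t) (bu_eqs Q r jet i1 p1 i2 p2 M) p1 i *
    hensel (fun g => g t) (bu_eqs Q r jet i1 p1 i2 p2 M) p2 j != 0.
    by rewrite qE // mulf_neq0 // invr_eq0 expf_neq0.
  move: d0; rewrite /bu_del !mulf_eq0 !negb_or => /andP[h0 /andP[d1 d2]] /andP[b0 b1].
  apply: (formal_branch_of rr rQ jdt jm rp1 ri2 rp2 d1 d2 _ _ (c := c) _ _ cM).
  + by have [_ _ _ /ltnW] := ok.
  + by rewrite unitmxE unitfE.
  + by exists i.
  + by exists j.
- exists phi; rewrite mulf_neq0 ?delt //.
  have := qE _ (delt _ _ ok); apply: contraPneq => q0; rewrite q0 mul0r => /eqP.
  by rewrite mulf_eq0 (negbTE bi) (negbTE lj).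
Qed.

End Theta.

(** * Taylor polynomials of smooth dynamics *)

Section PolynomialFunctions.
Variables (R : realType) (n : nat).
Implicit Types (e : pexp R 'I_n) (x v : 'rV[R]_n).

Definition pfun e : 'rV[R]_n -> R := fun x => ev id (fun i => x 0 i) e.

Lemma is_derive_coord x v (i : 'I_n) : is_derive x v (fun y : 'rV[R]_n => y 0 i) (v 0 i).
Proof.
have E : (fun h : R => h^-1 *: (((h *: v + x) 0 i : R) - x 0 i)) @ 0^' --> v 0 i.
  apply: (@cvg_trans _ ((cst (v 0 i) : R -> R) @ 0^')); last exact: cvg_cst.
  apply: near_eq_cvg; near=> h.
  have h0 : h != 0 by near: h; exact: nbhs_dnbhs_neq.
  by rewrite /= !mxE addrK scalerA mulVf // scale1r.
apply: DeriveDef; first by apply/cvg_ex; exists (v 0 i).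
exact: (cvg_lim _ E).
Unshelve. all: by end_near. Qed.

Lemma is_derive_pfun e x v :
  is_derive x v (pfun e) (dev id (fun i => x 0 i) (fun i => v 0 i) e).
Proof.
elim: e => [i|c|e1 IH1 e2 IH2|e1 IH1 e2 IH2] /=.
- exact: is_derive_coord.
- exact: is_derive_cst.
- exact: (is_deriveD IH1 IH2).
- have -> : pfun (PMul e1 e2) = pfun e1 * pfun e2 by [].
  have H := is_deriveM IH1 IH2; apply: (is_derive_eq H).
  by rewrite addrC /GRing.scale /= mulrC.
Qed.

Lemma continuous_pfun e : continuous (pfun e).
Proof.
elim: e => [i|c|e1 IH1 e2 IH2|e1 IH1 e2 IH2] x.
- exact: coord_continuous.
- have -> : pfun (PCst c) = cst c by [].
  exact: cst_continuous.
- have -> : pfun (PAdd e1 e2) = pfun e1 + pfun e2 by [].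
  by apply: continuousD; [exact: IH1|exact: IH2].
- have -> : pfun (PMul e1 e2) = pfun e1 * pfun e2 by [].
  by apply: continuousM; [exact: IH1|exact: IH2].
Qed.

Fixpoint pder (i : 'I_n) e : pexp R 'I_n :=
  match e with
  | PVar l => PCst (i == l)%:R
  | PCst _ => PCst 0
  | PAdd e1 e2 => PAdd (pder i e1) (pder i e2)
  | PMul e1 e2 => PAdd (PMul (pder i e1) e2) (PMul e1 (pder i e2))
  end.

Lemma ev_pder i e (y : 'I_n -> R) :
  ev id y (pder i e) = dev id y (fun l => (delta_mx 0 i : 'rV[R]_n) 0 l) e.
Proof.
elim: e => //= [l|e1 -> e2 ->|e1 -> e2 ->] //.
by rewrite mxE eqxx /= eq_sym.
Qed.

Fixpoint psumv (a : 'I_n -> R) (s : seq 'I_n) : pexp R 'I_n :=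
  if s is i :: s' then PAdd (PMul (PCst (a i)) (PVar i)) (psumv a s') else PCst 0.

Lemma pfun_psumv a s x : pfun (psumv a s) x = \sum_(i <- s) a i * x 0 i.
Proof.
elim: s => [|i s IH]; first by rewrite big_nil.
by rewrite big_cons -IH.
Qed.

Lemma pfun_pder_psumv a l x : pfun (pder l (psumv a (enum 'I_n))) x = a l.
Proof.
transitivity (\sum_(i <- enum 'I_n) a i * (l == i)%:R).
  elim: (enum _) => [|i s IH]; first by rewrite big_nil.
  by rewrite big_cons -IH /pfun /= mul0r add0r.
rewrite big_enum (bigD1 l) //= eqxx mulr1 big1 ?addr0 // => i /negbTE il.
by rewrite eq_sym il mulr0.
Qed.

End PolynomialFunctions.

Section Smooth.
Variables (R : realType) (k : nat).
Implicit Types (f g : dynamics R k) (s : seq 'I_k.+2).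

Lemma partial_pfun i (e : pexp R 'I_k.+2) : partial i (pfun e) = pfun (pder i e).
Proof.
apply/funext => x; rewrite /partial.
have := is_derive_pfun e x (delta_mx 0 i) => /@derive_val ->.
by rewrite /pfun ev_pder.
Qed.

Lemma partials_pfun s (e : pexp R 'I_k.+2) :
  partials s (pfun e) = pfun (foldr (@pder R k.+2) e s).
Proof. by elim: s => //= i s ->; rewrite partial_pfun. Qed.

Lemma smooth_pfun (e : pexp R 'I_k.+2) : smooth (pfun e : dynamics R k).
Proof.
move=> s; rewrite partials_pfun; split; first exact: continuous_pfun.
by move=> i x; have [] := is_derive_pfun (foldr (@pder R k.+2) e s) x (delta_mx 0 i).
Qed.

Lemma smooth_partial f i : smooth f -> smooth (partial i f).
Proof.
move=> sf s; have -> : partials s (partial i f) = partials (rcons s i) f.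
  by rewrite /partials foldr_rcons.
exact: sf.
Qed.

Lemma partials_lin f g (c : R) : smooth f -> smooth g -> forall s,
  partials s (fun x => f x + c * g x) = (fun x => partials s f x + c * partials s g x).
Proof.
move=> sf sg; elim=> //= i s ->; apply/funext => x.
have [_ df] := sf s; have [_ dg] := sg s.
rewrite /partial; have H1 := derivableP (df i x); have H2 := derivableP (dg i x).
have := is_deriveD H1 (is_deriveZ c H2) => /@derive_val.
by [].
Qed.

Lemma smooth_lin f g (c : R) : smooth f -> smooth g ->
  smooth (fun x => f x + c * g x).
Proof.
move=> sf sg s; rewrite partials_lin //.
have [cf df] := sf s; have [cg dg] := sg s; split=> [x|i x].
  have -> : (fun x => partials s f x + c * partials s g x) =
     partials s f + cst c * partials s g by [].
  apply: continuousD; first exact: cf.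
  by apply: continuousM; [exact: cst_continuous|exact: cg].
by apply: derivableD => //; apply: derivableZ.
Qed.

End Smooth.

Lemma half_split_dist (R : realFieldType) (A B Z e : R) :
  `|A - Z| < e / 2 -> `|B - Z| < e / 2 -> `|A - B| <= e.
Proof.
move=> a1 a2; have -> : A - B = (A - Z) - (B - Z) by rewrite opprB addrA subrK.
by rewrite (le_trans (ler_normB _ _)) // [leRHS]splitr lerD // ltW.
Qed.

(** * Mean value estimates and symmetry of second derivatives *)

Section CoordinateLines.
Variables (R : realType) (n : nat).
Implicit Types (f : 'rV[R]_n -> R) (x v : 'rV[R]_n).

Lemma is_derive_line f x v (h : R) : derivable f (h *: v + x) v ->
  is_derive h 1 (fun t : R => f (t *: v + x)) ('D_v f (h *: v + x)).
Proof.
move=> df.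
have E : (fun t : R => t^-1 *: (f ((t *: 1 + h) *: v + x) - f (h *: v + x))) =
         (fun t : R => t^-1 *: (f (t *: v + (h *: v + x)) - f (h *: v + x))).
  by apply/funext => t; rewrite [_ *: 1]mulr1 scalerDl addrA.
apply: DeriveDef; first by rewrite /derivable /= E; exact: df.
by rewrite /derive /= E.
Qed.

Lemma mvt_line f x v (a b : R) : a <= b -> (forall y, derivable f y v) ->
  exists2 c, a <= c <= b &
    f (b *: v + x) - f (a *: v + x) = 'D_v f (c *: v + x) * (b - a).
Proof.
move=> ab df; have D (c : R) : is_derive c 1 (fun t : R => f (t *: v + x)) ('D_v f (c *: v + x)).
  exact: is_derive_line.
have [|c cab E] := @MVT_segment R (fun t => f (t *: v + x))
  (fun c => 'D_v f (c *: v + x)) a b ab (fun c _ => D c).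
  apply: continuous_subspaceT => c; apply: differentiable_continuous.
  by apply/derivable1_diffP; have [] := D c.
by exists c => //; move: cab; rewrite in_itv.
Qed.

(** Smoothness provides derivatives along the axes only, so [X] and [Y] are joined by changing one
    coordinate at a time, with the mean value theorem on each piece. *)
Lemma lipschitz_box f (c : 'rV[R]_n) (rho L : R) :
  (forall (i : 'I_n) (y : 'rV[R]_n), derivable f y (delta_mx 0 i)) ->
  (forall (i : 'I_n) (y : 'rV[R]_n), (forall j, `|y 0 j - c 0 j| <= rho) -> `|'D_(delta_mx 0 i) f y| <= L) ->
  forall X Y : 'rV[R]_n, (forall j, `|X 0 j - c 0 j| <= rho) -> (forall j, `|Y 0 j - c 0 j| <= rho) ->
  `|f X - f Y| <= L * \sum_i `|X 0 i - Y 0 i|.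
Proof.
move=> df dL X Y Xb Yb.
pose Z (j : nat) : 'rV[R]_n := \row_i (if (i < j)%N then X 0 i else Y 0 i).
have Z0 : Z 0%N = Y by apply/matrixP => a i; rewrite ord1 mxE.
have Zn : Z n = X by apply/matrixP => a i; rewrite ord1 mxE ltn_ord.
have step (j : 'I_n) : `|f (Z j.+1) - f (Z j)| <= L * `|X 0 j - Y 0 j|.
  pose W : 'rV[R]_n := \row_i (if i == j then 0 else Z j 0 i).
  have ZE1 : Z j.+1 = X 0 j *: delta_mx 0 j + W.
    apply/matrixP => a i; rewrite ord1 !mxE eqxx /=; have [->|ij] := eqVneq i j.
      by rewrite ltnSn mulr1 addr0.
    by rewrite mulr0 add0r ltnS leq_eqVlt (inj_eq val_inj) (negbTE ij).
  have ZE0 : Z j = Y 0 j *: delta_mx 0 j + W.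
    apply/matrixP => a i; rewrite ord1 !mxE eqxx /=; have [->|ij] := eqVneq i j.
      by rewrite ltnn mulr1 addr0.
    by rewrite mulr0 add0r.
  have Wb (t : R) : `|t - c 0 j| <= rho ->
      forall i, `|(t *: delta_mx 0 j + W) 0 i - c 0 i| <= rho.
    move=> tb i; rewrite !mxE eqxx /=; have [->|ij] := eqVneq i j.
      by rewrite mulr1 addr0.
    by rewrite mulr0 add0r; case: ifP.
  have main (s t : R) : s <= t -> `|s - c 0 j| <= rho -> `|t - c 0 j| <= rho ->
      `|f (t *: delta_mx 0 j + W) - f (s *: delta_mx 0 j + W)| <= L * `|t - s|.
    move=> st sb tb.
    have [d /andP[sd dt] ->] := mvt_line W st (df j).
    rewrite normrM ler_wpM2r //; apply: dL; apply: Wb.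
    move: sb tb; rewrite !ler_norml => /andP[h1 h2] /andP[h3 h4].
    by apply/andP; split; lra.
  rewrite ZE1 ZE0; case: (leP (Y 0 j) (X 0 j)) => [h|/ltW h]; first exact: main.
  by rewrite distrC [`|X 0 j - _|]distrC; apply: main.
rewrite -Zn -Z0.
have -> : f (Z n) - f (Z 0%N) = \sum_(j < n) (f (Z j.+1) - f (Z j)).
  by rewrite -(big_mkord xpredT (fun j => f (Z j.+1) - f (Z j))) telescope_sumr.
rewrite (le_trans (ler_norm_sum _ _ _)) // mulr_sumr Zn Z0.
by apply: ler_sum => j _; exact: step.
Qed.

Lemma second_difference f x (u v : 'rV[R]_n) (h : R) : 0 <= h ->
  (forall y, derivable f y u) -> (forall y, derivable ('D_u f) y v) ->
  exists s t, [/\ 0 <= s <= h, 0 <= t <= h &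
    f (h *: u + (h *: v + x)) - f (h *: u + x) - (f (h *: v + x) - f x) =
    'D_v ('D_u f) (t *: v + (s *: u + x)) * h ^+ 2].
Proof.
move=> h0 du dv.
pose g (y : 'rV[R]_n) := f (y + h *: v) - f y.
have gd y : is_derive y u g ('D_u f (y + h *: v) - 'D_u f y).
  have D1 : is_derive y u (fun y => f (y + h *: v)) ('D_u f (y + h *: v)).
    have E : (fun t : R => t^-1 *: (f (t *: u + y + h *: v) - f (y + h *: v))) =
         (fun t : R => t^-1 *: (f (t *: u + (y + h *: v)) - f (y + h *: v))).
      by apply/funext => t; rewrite addrA.
    apply: DeriveDef; first by rewrite /derivable /= E; exact: du.
    by rewrite /derive /= E.
  exact: (is_deriveB D1 (derivableP (du y))).
have [s sh E1] := mvt_line x h0 (fun y => let: DeriveDef d _ := gd y in d).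
have [t th E2] := mvt_line (s *: u + x) h0 dv.
exists s, t; split=> //.
have Eg : 'D_u g (s *: u + x) = 'D_u f (s *: u + x + h *: v) - 'D_u f (s *: u + x).
  exact: (@derive_val _ _ _ _ _ _ _ (gd (s *: u + x))).
have -> : f (h *: u + (h *: v + x)) - f (h *: u + x) - (f (h *: v + x) - f x) =
    g (h *: u + x) - g (0 *: u + x).
  by rewrite /g scale0r add0r -[h *: u + x + _]addrA [x + _]addrC.
rewrite E1 Eg [s *: u + x + _]addrC.
move: E2; rewrite scale0r add0r => ->.
by rewrite !subr0 expr2 mulrA.
Qed.

(** The second difference is symmetric in [u] and [v], and by [second_difference] it equals [h ^ 2]
    times either mixed derivative at a nearby point. The symmetry matters because jets are indexed
    by sequences. *)
Lemma clairaut f (u v : 'rV[R]_n) x :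
  (forall y, derivable f y u) -> (forall y, derivable f y v) ->
  (forall y, derivable ('D_u f) y v) -> (forall y, derivable ('D_v f) y u) ->
  {for x, continuous ('D_v ('D_u f))} -> {for x, continuous ('D_u ('D_v f))} ->
  'D_v ('D_u f) x = 'D_u ('D_v f) x.
Proof.
move=> du dv duv dvu c1 c2.
apply/eqP; rewrite -subr_eq0 -normr_le0; apply/ler_addgt0Pr => e e0; rewrite add0r.
have e2 : 0 < e / 2 by rewrite divr_gt0.
have /cvgrPdist_lt/(_ _ e2) := c1; have /cvgrPdist_lt/(_ _ e2) := c2.
move=> /nbhs_normP[d2 /= d20 H2] /nbhs_normP[d1 /= d10 H1].
pose C := `|u| + `|v| + 1.
have C0 : 0 < C by rewrite ltr_wpDl ?addr_ge0.
pose h := Num.min d1 d2 / 2 / C.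
have m0 : 0 < Num.min d1 d2 by rewrite lt_min d10 d20.
have h0 : 0 < h by rewrite !divr_gt0.
have near (s t : R) : 0 <= s <= h -> 0 <= t <= h ->
    `|x - (t *: v + (s *: u + x))| < Num.min d1 d2 /\
    `|x - (s *: u + (t *: v + x))| < Num.min d1 d2.
  move=> /andP[s0 sh] /andP[t0 th].
  have B : `|t *: v + s *: u| < Num.min d1 d2.
    rewrite (le_lt_trans (ler_normD _ _)) // !normrZ !ger0_norm //.
    rewrite (@le_lt_trans _ _ (h * C)) //.
      rewrite /C !mulrDr mulr1 addrC -[leLHS]addr0 lerD ?(ltW h0) //.
      by rewrite lerD // ler_wpM2r.
    by rewrite divfK ?gt_eqF // ltr_pdivrMr // ltr_pMr // ltr1n.
  have N y : `|x - (y + x)| = `|y| by rewrite opprD addrCA subrr addr0 normrN.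
  split; first by rewrite addrA N.
  by rewrite addrA N addrC.
have [s [t [sh th E1]]] := second_difference x (ltW h0) du duv.
have [s' [t' [sh' th' E2]]] := second_difference x (ltW h0) dv dvu.
have E : 'D_v ('D_u f) (t *: v + (s *: u + x)) = 'D_u ('D_v f) (t' *: u + (s' *: v + x)).
  have hh : h ^+ 2 != 0 by rewrite expf_neq0 // gt_eqF.
  have R4 (a b c d : R) : a - b - (c - d) = a - c - (b - d) by ring.
  have P : h *: u + (h *: v + x) = h *: v + (h *: u + x) by rewrite addrCA.
  rewrite P in E1; apply: (mulIf hh).
  exact: (etrans (esym E1) (etrans (R4 _ _ _ _) E2)).
have [n1 _] := near s t sh th; have [_ n2] := near t' s' th' sh'.
move: n1 n2; rewrite !lt_min => /andP[n1 _] /andP[_ n2].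
pose F1 := 'D_v ('D_u f); pose F2 := 'D_u ('D_v f).
have a1 : `|F1 x - F1 (t *: v + (s *: u + x))| < e / 2 by exact: (H1 _ n1).
have a2 : `|F2 x - F2 (t' *: u + (s' *: v + x))| < e / 2 by exact: (H2 _ n2).
exact: (half_split_dist a1
  (eq_ind_r (fun z => `|F2 x - z| < e / 2) a2 E)).
Qed.

End CoordinateLines.

Section FiniteCommon.
Variables (R : realType) (I : finType).

Lemma uniform_constants (P : I -> R -> R -> Prop) :
  (forall l (d C d' C' : R), P l d C -> 0 < d' <= d -> C <= C' -> P l d' C') ->
  (forall l, exists2 d : R, 0 < d & exists2 C : R, 0 <= C & P l d C) ->
  exists2 d : R, 0 < d & exists2 C : R, 0 <= C & forall l, P l d C.
Proof.
move=> Pm HP.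
pose d l := projT1 (cid2 (HP l)).
have d0 l : 0 < d l by rewrite /d; case: cid2.
have HC l : exists2 C, 0 <= C & P l (d l) C by rewrite /d; case: cid2.
pose C l := projT1 (cid2 (HC l)).
have C0 l : 0 <= C l by rewrite /C; case: cid2.
have PC l : P l (d l) (C l) by rewrite /C; case: cid2.
exists (\big[Num.min/1]_l d l).
  by elim/big_ind: _ => // a b a0 b0; rewrite lt_min a0 b0.
exists (\sum_l C l); first exact: sumr_ge0.
move=> l; apply: Pm (PC l) _ _.
  apply/andP; split; last exact: bigmin_le_cond.
  by elim/big_ind: _ => // a b a0 b0; rewrite lt_min a0 b0.
by rewrite (bigD1 l) //= lerDl sumr_ge0.
Qed.

End FiniteCommon.


Fixpoint pmap (K K' V : Type) (h : K -> K') (e : pexp K V) : pexp K' V :=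
  match e with
  | PVar i => PVar i
  | PCst c => PCst (h c)
  | PAdd e1 e2 => PAdd (pmap h e1) (pmap h e2)
  | PMul e1 e2 => PMul (pmap h e1) (pmap h e2)
  end.

Lemma ev_pmap (K K' V : Type) (S : comNzRingType) (h : K -> K') (io : K' -> S)
    (v : V -> S) e : ev io v (pmap h e) = ev (io \o h) v e.
Proof. by elim: e => //= e1 -> e2 ->. Qed.

Lemma dev_pmap (K K' V : Type) (S : comNzRingType) (h : K -> K') (io : K' -> S)
    (v w : V -> S) e : dev io v w (pmap h e) = dev (io \o h) v w e.
Proof. by elim: e => //= e1 -> e2 -> //; rewrite !ev_pmap. Qed.

Section SymmetricJets.
Variables (R : fieldType) (T : Type) (k : nat).
Variables (S : comNzRingType) (io : (T -> R) -> S).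
Hypothesis io0 : io 0 = 0.
Implicit Types (j : seq 'I_k.+2 -> T -> R) (v w : 'I_k.+2 -> S).

Lemma ev_homog_eq n j j' v : (forall s, io (j s) = io (j' s)) ->
  ev io v (homog n j) = ev io v (homog n j').
Proof.
elim: n j j' => [|n IH] j j' jj' /=; first exact: jj'.
rewrite !ev_psum //; apply: eq_bigr => i _ /=; congr (_ * _).
by apply: IH => s; apply: jj'.
Qed.

Definition jets_sym j := forall s1 i l s2,
  io (j (s1 ++ i :: l :: s2)) = io (j (s1 ++ l :: i :: s2)).

(** The derivative falls on one of [n + 1] positions of the index sequence; symmetry moves this
    position to the front, so all positions contribute equally. *)
Lemma dev_homog_sym n j v w : jets_sym j -> dev io v w (homog n.+1 j) =
  \sum_l w l * n.+1%:R * ev io v (homog n (fun s => j (l :: s))).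
Proof.
elim: n j => [|n IH] j js; rewrite dev_homogS.
  by apply: eq_bigr => i _ /=; rewrite mulr0 addr0 mulr1.
have jsi i : jets_sym (fun s => j (i :: s)) by move=> s1 a b s2; apply: (js (i :: s1)).
transitivity (\sum_l (w l * ev io v (homog n.+1 (fun s => j (l :: s)))
   + \sum_i v i * (w l * n.+1%:R * ev io v (homog n (fun s => j (i :: l :: s)))))).
  rewrite [RHS]big_split [X in _ = _ + X]exchange_big -[RHS]big_split.
  by apply: eq_bigr => i _; rewrite (IH _ (jsi i)) mulr_sumr.
apply: eq_bigr => l _.
rewrite (eq_bigr (fun i => w l * n.+1%:R *
   (v i * ev io v (homog n (fun s => j (l :: i :: s)))))).
  rewrite -mulr_sumr -(ev_homogS io0 n (fun s => j (l :: s))) // -[n.+2]addn1 natrD.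
  ring.
move=> i _; rewrite mulrCA; congr (_ * (_ * _)).
by apply: ev_homog_eq => s; apply: (js [::]).
Qed.

End SymmetricJets.

(** * Taylor's formula with remainder *)

Section TaylorRemainder.
Variables (R : realType) (k : nat).
Implicit Types (f g : dynamics R k) (s : seq 'I_k.+2) (x : 'rV[R]_k.+2).

Definition jet s f : R := partials s f 0.

Lemma partials_cat s s' f : partials (s ++ s') f = partials s (partials s' f).
Proof. exact: foldr_cat. Qed.

Lemma smooth_partials s f : smooth f -> smooth (partials s f).
Proof. by move=> sf s'; rewrite -partials_cat; apply: sf. Qed.

Lemma partial_comm i l f : smooth f -> partial i (partial l f) = partial l (partial i f).
Proof.
move=> sf; apply/funext => x; apply: clairaut.
- by move=> y; have [_] := sf [::]; apply.
- by move=> y; have [_] := sf [::]; apply.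
- by move=> y; have [_] := sf [:: l]; apply.
- by move=> y; have [_] := sf [:: i]; apply.
- by have [c _] := sf [:: i; l]; apply: c.
- by have [c _] := sf [:: l; i]; apply: c.
Qed.

Lemma partials_partial s l f : smooth f ->
  partials s (partial l f) = partial l (partials s f).
Proof.
move=> sf; elim: s => [//|i s /= ->]; rewrite partial_comm; first by [].
exact: smooth_partials.
Qed.

Lemma jet_sym f : smooth f -> jets_sym (fun g : dynamics R k -> R => g f) jet.
Proof.
move=> sf s1 i l s2; rewrite /jet !partials_cat /=.
rewrite partial_comm; first by [].
exact: smooth_partials.
Qed.

Definition taylor_poly M f : dynamics R k := fun x =>
  ev (fun g : dynamics R k -> R => g f) (fun i => x 0 i) (taylor M jet).

Definition taylor_deriv M f x (l : 'I_k.+2) : R :=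
  dev (fun g : dynamics R k -> R => g f) (fun i => x 0 i)
      (fun i => (i == l)%:R) (taylor M jet).

Lemma taylor_poly_pfun M f :
  taylor_poly M f = pfun (pmap (fun g : dynamics R k -> R => g f) (taylor M jet)).
Proof. by apply/funext => x; rewrite /pfun ev_pmap. Qed.

Lemma smooth_taylor_poly M f : smooth (taylor_poly M f).
Proof. by rewrite taylor_poly_pfun; apply: smooth_pfun. Qed.

Lemma partial_taylor_poly M f l x :
  partial l (taylor_poly M f) x = taylor_deriv M f x l.
Proof.
rewrite taylor_poly_pfun /partial.
rewrite (@derive_val _ _ _ _ _ _ _ (is_derive_pfun _ x (delta_mx 0 l))).
rewrite dev_pmap; apply: eq_dev => // i.
by rewrite mxE eqxx.
Qed.

Lemma taylor_deriv0 f x l : taylor_deriv 0 f x l = 0.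
Proof. by []. Qed.

Lemma taylor_derivS M f x l : smooth f ->
  taylor_deriv M.+1 f x l = partial l f 0 + taylor_poly M (partial l f) x.
Proof.
move=> sf; rewrite /taylor_deriv /taylor_poly.
have H n : dev (fun g : dynamics R k -> R => g f) (fun i => x 0 i)
     (fun i => (i == l)%:R) (homog n.+1 jet) =
  n.+1%:R * ev (fun g : dynamics R k -> R => g (partial l f)) (fun i => x 0 i)
    (homog n jet).
  rewrite dev_homog_sym //; last exact: jet_sym.
  rewrite (bigD1 l) //= eqxx mul1r big1 ?addr0; last first.
    by move=> i /negbTE ->; rewrite !mul0r.
  congr (_ * _).
  have E (j : seq 'I_k.+2 -> dynamics R k -> R) (j' : seq 'I_k.+2 -> dynamics R k -> R) :
     (forall s, j s f = j' s (partial l f)) ->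
     ev (fun g : dynamics R k -> R => g f) (fun i => x 0 i) (homog n j) =
     ev (fun g : dynamics R k -> R => g (partial l f)) (fun i => x 0 i) (homog n j').
    elim: n j j' => [|n IH] j j' jj'; first exact: jj'.
    rewrite !ev_homogS //; apply: eq_bigr => i _; congr (_ * _).
    by apply: IH => s; apply: jj'.
  by apply: E => s; rewrite /jet /= partials_partial.
rewrite dev_psum ev_psum // (iotaDl 1 0 M.+1) big_map.
rewrite (eq_bigr (fun n => ev (fun g : dynamics R k -> R => g (partial l f))
   (fun i => x 0 i) (PMul (PCst (fun=> n`!%:R^-1)) (homog n jet)))); last first.
  move=> n _; rewrite [LHS]/= (H n) mul0r add0r [RHS]/= factS natrM invfM.
  rewrite mulrACA mulVf ?mul1r // pnatr_eq0 //.
by rewrite big_cons /= fact0 invr1 mul1r.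
Qed.

Lemma locally_bounded f : {for 0, continuous f} -> exists2 d : R, 0 < d &
  exists2 C, 0 <= C & forall x, (forall j, `|x 0 j| <= d) -> `|f x| <= C.
Proof.
move=> /cvgrPdist_lt/(_ _ ltr01)/nbhs_normP[d /= d0 H].
exists (d / 2); first by rewrite divr_gt0.
exists (`|f 0| + 1); first by rewrite addr_ge0.
move=> x xd; have /H /= h : `|0 - x| < d.
  rewrite sub0r normrN (@le_lt_trans _ _ (d / 2)) //; last first.
    by rewrite ltr_pdivrMr // ltr_pMr // ltr1n.
  rewrite [`|x|]mx_normrE; apply/bigmax_leP; split; first by rewrite ltW ?divr_gt0.
  by move=> [i j] _ /=; rewrite (ord1 i).
rewrite -[f x](subrK (f 0)) addrC (le_trans (ler_normD _ _)) // lerD2l.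
by rewrite distrC ltW.
Qed.

Lemma taylor_poly0 M f : taylor_poly M f 0 = 0.
Proof.
rewrite /taylor_poly -[RHS](@ev_taylor_at0 R _ k R (fun g : dynamics R k -> R => g f)
  erefl M jet).
by apply: eq_ev => i; rewrite mxE.
Qed.

Lemma continuous_smooth f : smooth f -> continuous f.
Proof. by move=> sf; have [] := sf [::]. Qed.

(* The Taylor remainder at order [M], with the convention that the polynomial of
   order 0 is zero and the one of order [M.+1] has degree [M]. *)
Lemma taylor_remainder_aux M f : smooth f ->
  exists2 d, 0 < d & exists2 C, 0 <= C & forall (rho : R) x, 0 <= rho <= d ->
    (forall j, `|x 0 j| <= rho) ->
    `|f x - (if M is M'.+1 then f 0 + taylor_poly M' f x else 0)| <= C * rho ^+ M.
Proof.
elim: M f => [|M IH] f sf.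
  have [d d0 [C C0 H]] := locally_bounded (continuous_smooth sf (x := 0)).
  exists d => //; exists C => // rho x /andP[r0 rd] xr.
  rewrite subr0 expr0 mulr1; apply: H => j; exact: le_trans (xr j) rd.
have [d d0 [C C0 H]] : exists2 d, 0 < d & exists2 C, 0 <= C & forall l,
    (fun l d C => forall (rho : R) x, 0 <= rho <= d -> (forall j, `|x 0 j| <= rho) ->
      `|partial l f x - (if M is M'.+1 then partial l f 0
           + taylor_poly M' (partial l f) x else 0)| <= C * rho ^+ M) l d C.
  apply: uniform_constants => [l d C d' C' H /andP[d'0 dd] CC rho x /andP[r0 rd] xr|l].
    apply: le_trans (H rho x _ xr) _; first by rewrite r0 (le_trans rd).
    by rewrite ler_wpM2r // exprn_ge0.
  exact/IH/smooth_partial.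
exists d => //; exists (C * k.+2%:R); first by rewrite mulr_ge0.
move=> rho x /andP[r0 rd] xr.
pose g : dynamics R k := fun x => f x + -1 * taylor_poly M f x.
have sg : smooth g by exact: (smooth_lin _ sf (smooth_taylor_poly M f)).
have gE l y : partial l g y = partial l f y - (if M is M'.+1 then partial l f 0
           + taylor_poly M' (partial l f) y else 0).
  have -> : partial l g = partials [:: l] g by [].
  rewrite (partials_lin _ sf (smooth_taylor_poly M f)) /= mulN1r partial_taylor_poly; case: (M) => [|M'].
    by rewrite taylor_deriv0.
  by rewrite taylor_derivS.
have := @lipschitz_box R k.+2 g 0 rho (C * rho ^+ M) _ _ x 0.
have b0 (y : 'rV[R]_k.+2) : (forall j, `|y 0 j| <= rho) <->
    (forall j, `|y 0 j - (0 : 'rV[R]_k.+2) 0 j| <= rho).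
  by split=> h j; have := h j; rewrite mxE subr0.
move=> L; have {L} : `|g x - g 0| <= C * rho ^+ M * (\sum_i `|x 0 i - (0 : 'rV[R]_k.+2) 0 i|).
  apply: L.
  - by move=> i y; have [_] := sg [::]; apply.
  - move=> i y yr0; have yr := (b0 y).2 yr0.
    by rewrite -/(partial i g y) gE; apply: H => //; rewrite r0.
  - exact: (b0 x).1 xr.
  - by move=> j; rewrite subrr normr0.
have -> : g x - g 0 = f x - (f 0 + taylor_poly M f x).
  by rewrite /g taylor_poly0; ring.
move=> h; apply: le_trans h _.
rewrite exprSr -!mulrA ler_wpM2l // mulrCA ler_wpM2l ?exprn_ge0 //.
have -> : k.+2%:R * rho = \sum_(i < k.+2) rho.
  by rewrite sumr_const card_ord mulr_natl.
by apply: ler_sum => i _; rewrite mxE subr0.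
Qed.

Lemma taylor_remainder M f : smooth f ->
  exists2 d, 0 < d & exists2 C, 0 <= C & forall (rho : R) x, 0 <= rho <= d ->
    (forall j, `|x 0 j| <= rho) ->
    `|f x - (f 0 + taylor_poly M f x)| <= C * rho ^+ M.+1.
Proof. exact: (@taylor_remainder_aux M.+1). Qed.

Lemma taylor_remainder_deriv M f l : smooth f ->
  exists2 d, 0 < d & exists2 C, 0 <= C & forall (rho : R) x, 0 <= rho <= d ->
    (forall j, `|x 0 j| <= rho) ->
    `|partial l f x - taylor_deriv M f x l| <= C * rho ^+ M.
Proof.
move=> sf; have [d d0 [C C0 H]] := taylor_remainder_aux M (smooth_partial l sf).
exists d => //; exists C => // rho x hr xr; have := H rho x hr xr.
by case: (M) => [|M']; rewrite ?taylor_deriv0 ?taylor_derivS.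
Qed.

End TaylorRemainder.

(** * Test dynamics *)

Section ModelDynamics.
Variables (R : realType) (k : nat).
Implicit Types (f g : dynamics R k) (x : 'rV[R]_k.+2).

Lemma smooth_sum (I : Type) (r : seq I) (c : I -> R) (F : I -> dynamics R k) :
  (forall i, smooth (F i)) -> smooth (fun x => \sum_(i <- r) c i * F i x).
Proof.
move=> sF; elim: r => [|i r IH].
  rewrite (_ : (fun x => _) = pfun (PCst 0)); first exact: smooth_pfun.
  by apply/funext => x; rewrite big_nil.
rewrite (_ : (fun x => _) = (fun x => \sum_(i <- r) c i * F i x + c i * F i x)).
  exact: smooth_lin IH (sF i).
by apply/funext => x; rewrite big_cons addrC.
Qed.

Section HomogeneousPart.
Variables (S : comNzRingType) (io : {rmorphism R -> S}) (y : 'I_k.+2 -> S).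

(** This is [n!] times the homogeneous part of degree [n] of the Taylor polynomial, evaluated in an
    arbitrary ring; [hpartS] computes it from the partial derivatives. *)
Definition hpart n f : S :=
  ev (fun g : dynamics R k -> R => io (g f)) y (homog n (@jet R k)).

Let io0 f : io ((0 : dynamics R k -> R) f) = 0. Proof. exact: rmorph0. Qed.

Lemma hpart0 f : hpart 0 f = io (f 0). Proof. by []. Qed.

Lemma hpartS n f : smooth f -> hpart n.+1 f = \sum_i y i * hpart n (partial i f).
Proof.
move=> sf; rewrite /hpart ev_homogS //; apply: eq_bigr => i _; congr (_ * _).
have E (j j' : seq 'I_k.+2 -> dynamics R k -> R) :
   (forall s, j s f = j' s (partial i f)) ->
   ev (fun g : dynamics R k -> R => io (g f)) y (homog n j) =
   ev (fun g : dynamics R k -> R => io (g (partial i f))) y (homog n j').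
  elim: n j j' => [|n IH] j j' jj' /=; first by rewrite jj'.
  by rewrite !ev_psum //; apply: eq_bigr => l _ /=; congr (_ * _); apply: IH.
by apply: E => s; rewrite /jet /= partials_partial.
Qed.

Lemma hpart_lin n f g c : smooth f -> smooth g ->
  hpart n (fun x => f x + c * g x) = hpart n f + io c * hpart n g.
Proof.
elim: n f g => [|n IH] f g sf sg; first by rewrite !hpart0 rmorphD rmorphM.
rewrite (hpartS _ sf) (hpartS _ sg) (hpartS _ (smooth_lin c sf sg)).
rewrite mulr_sumr -big_split; apply: eq_bigr => i _.
have -> : partial i (fun x => f x + c * g x) =
    (fun x => partial i f x + c * partial i g x).
  exact: (partials_lin c sf sg [:: i]).
rewrite IH; try exact: smooth_partial.
by rewrite mulrDr mulrCA.
Qed.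

Lemma hpart_cst n c : hpart n (fun=> c) = if n == 0%N then io c else 0.
Proof.
have sc d : smooth ((fun=> d) : dynamics R k) by exact: (smooth_pfun (PCst d)).
elim: n c => [|n IH] c; first by rewrite hpart0.
rewrite hpartS // big1 // => i _.
have -> : partial i ((fun=> c) : dynamics R k) = (fun=> 0).
  exact: (partial_pfun i (PCst c)).
by rewrite IH rmorph0 if_same mulr0.
Qed.

Lemma hpart_sum n (I : Type) (r : seq I) (c : I -> R) (F : I -> dynamics R k) :
  (forall i, smooth (F i)) ->
  hpart n (fun x => \sum_(i <- r) c i * F i x) = \sum_(i <- r) io (c i) * hpart n (F i).
Proof.
move=> sF; elim: r => [|i r IH].
  rewrite big_nil (_ : (fun x => _) = (fun=> 0)) ?hpart_cst ?rmorph0 ?if_same //.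
  by apply/funext => x; rewrite big_nil.
rewrite (_ : (fun x => _) = (fun x => \sum_(i <- r) c i * F i x + c i * F i x)).
  rewrite hpart_lin // ?IH ?big_cons 1?addrC //; exact: smooth_sum.
by apply/funext => x; rewrite big_cons addrC.
Qed.

Lemma hpart_coord n i :
  hpart n (fun x => x 0 i) = if n == 1%N then y i else 0.
Proof.
have sc : smooth ((fun x => x 0 i) : dynamics R k) by exact: (smooth_pfun (PVar i)).
case: n => [|n]; first by rewrite hpart0 mxE rmorph0.
rewrite hpartS // (bigD1 i) //=.
have P l : partial l ((fun x => x 0 i) : dynamics R k) = (fun=> (l == i)%:R).
  exact: (partial_pfun l (PVar i)).
rewrite P hpart_cst eqxx rmorph1 big1 ?addr0.
  by case: n => [|n]; rewrite ?mulr1 ?mulr0.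
by move=> l /negbTE li; rewrite P hpart_cst li rmorph0 if_same mulr0.
Qed.

Lemma hpart_prod n i l : hpart n (fun x => x 0 i * x 0 l) =
  if n == 2%N then 2%:R * (y i * y l) else 0.
Proof.
have sc : smooth ((fun x => x 0 i * x 0 l) : dynamics R k).
  exact: (smooth_pfun (PMul (PVar i) (PVar l))).
case: n => [|n]; first by rewrite hpart0 !mxE mulr0 rmorph0.
rewrite hpartS //.
have sX a : smooth ((fun x => x 0 a) : dynamics R k) by exact: (smooth_pfun (PVar a)).
have s0 a b : smooth ((fun x => 0 + a * x 0 b) : dynamics R k).
  exact: (smooth_pfun (PAdd (PCst 0) (PMul (PCst a) (PVar b)))).
have P b : hpart n (partial b ((fun x => x 0 i * x 0 l) : dynamics R k)) =
   if n == 1%N then (b == i)%:R * y l + (b == l)%:R * y i else 0.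
  have -> : partial b ((fun x => x 0 i * x 0 l) : dynamics R k) =
     (fun x => (fun x => 0 + (b == i)%:R * x 0 l) x + (b == l)%:R * x 0 i).
    rewrite (partial_pfun b (PMul (PVar i) (PVar l))); apply/funext => x.
    by rewrite /pfun /= add0r [_ * (b == l)%:R]mulrC.
  rewrite (hpart_lin _ _ (s0 (b == i)%:R l) (sX i)) (hpart_lin _ _ (smooth_pfun (PCst 0)) (sX l)).
  rewrite hpart_cst !hpart_coord rmorph0 if_same add0r !rmorph_nat.
  by case: (n == 1%N); rewrite ?mulr0 ?addr0.
under eq_bigr do rewrite P.
case: n {P} => [|[|n]] /=; try by rewrite big1 // => b _; rewrite mulr0.
under eq_bigr do rewrite mulrDr.
rewrite big_split /= (bigD1 i) //= eqxx big1 => [|b /negbTE ->]; last first.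
  by rewrite mul0r mulr0.
rewrite (bigD1 l) //= eqxx big1 => [|b /negbTE ->]; last by rewrite mul0r mulr0.
by rewrite !mul1r !addr0 [y l * _]mulrC mulr_natl mulr2n.
Qed.

Fixpoint ppow (i : 'I_k.+2) n : pexp R 'I_k.+2 :=
  if n is n'.+1 then PMul (PVar i) (ppow i n') else PCst 1.

Lemma pfun_ppow i n x : pfun (ppow i n) x = x 0 i ^+ n.
Proof. by elim: n => [|n IH] //; rewrite exprS -IH. Qed.

Lemma partial_ppow b i n :
  partial b (pfun (ppow i n.+1)) =
  (fun x => 0 + (b == i)%:R * n.+1%:R * pfun (ppow i n) x).
Proof.
elim: n => [|n IH].
  rewrite partial_pfun; apply/funext => x.
  by rewrite /pfun /= !mulr1 mulr0 addr0 add0r.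
rewrite partial_pfun; apply/funext => x.
have H : pfun (pder b (ppow i n.+1)) x = (b == i)%:R * n.+1%:R * x 0 i ^+ n.
  by rewrite -partial_pfun IH add0r pfun_ppow.
have -> : pfun (pder b (ppow i n.+2)) x =
   (b == i)%:R * pfun (ppow i n.+1) x + x 0 i * pfun (pder b (ppow i n.+1)) x.
  by [].
rewrite H !pfun_ppow add0r exprS [n.+2%:R]mulrS; ring.
Qed.

Lemma hpart_pow q n i : hpart q (pfun (ppow i n)) =
  if q == n then n`!%:R * y i ^+ n else 0.
Proof.
elim: q n => [|q IH] n.
  rewrite hpart0 pfun_ppow mxE; case: n => [|n].
    by rewrite expr0 rmorph1 mulr1.
  by rewrite expr0n rmorph0.
rewrite hpartS; last exact: smooth_pfun.
case: n => [|n].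
  rewrite big1 // => b _; have -> : partial b (pfun (ppow i 0)) = (fun=> 0).
    exact: (partial_pfun b (PCst 1)).
  by rewrite hpart_cst rmorph0 if_same mulr0.
have P b : hpart q (partial b (pfun (ppow i n.+1))) =
   (b == i)%:R * (n.+1%:R * hpart q (pfun (ppow i n))).
  rewrite partial_ppow hpart_lin; last exact: smooth_pfun.
    by rewrite hpart_cst rmorph0 if_same add0r rmorphM !rmorph_nat mulrA.
  exact: (smooth_pfun (PCst 0)).
under eq_bigr do rewrite P.
rewrite (bigD1 i) //= eqxx mul1r big1 ?addr0; last first.
  by move=> b /negbTE ->; rewrite mul0r mulr0.
rewrite IH eqSS; case: eqP => _; last by rewrite !mulr0.
by rewrite factS natrM exprS; ring.
Qed.

End HomogeneousPart.

End ModelDynamics.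
Arguments ppow {R k} i n.

Section Model.
Variables (R : realType) (k : nat).
Implicit Types (x : 'rV[R]_k.+2) (phi psi : {poly R}).
Variable (f0 : dynamics R k).
Let a i : R := jet [:: i] f0.
Hypothesis a_max : a ord_max = 0.

Fixpoint phorner (c : seq R) : pexp R 'I_k.+2 :=
  if c is d :: c' then PAdd (PMul (phorner c') (PVar ord0)) (PCst d) else PCst 0.

(** The linear part prescribes the 1-jet, the mixed term makes the parameter shift the Jacobian by a
    multiple of the identity, and [phi] is the freedom left. The factor 1 matches the shape of
    [smooth_lin]. *)
Definition tau (phi : {poly R}) : dynamics R k := fun x =>
  pfun (PAdd (psumv a (enum 'I_k.+2)) (PMul (PVar ord0) (PVar ord_max))) x
  + 1 * pfun (phorner phi) x.

Lemma pfun_phorner (phi : {poly R}) x : pfun (phorner phi) x = phi.[x 0 ord0].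
Proof. by rewrite /horner; case: phi => s /= _; elim: s => //= d c <-. Qed.

Lemma tauE phi x : tau phi x = \sum_i a i * x 0 i + x 0 ord0 * x 0 ord_max + phi.[x 0 ord0].
Proof.
rewrite /tau mul1r pfun_phorner; congr (_ + _).
rewrite -[RHS]/(_ + pfun (PMul (PVar ord0) (PVar ord_max)) x).
by rewrite -big_enum -pfun_psumv.
Qed.

Lemma smooth_tau phi : smooth (tau phi).
Proof. by apply: smooth_lin; apply: smooth_pfun. Qed.

Lemma tau_sum phi : tau phi =
  (fun x => (fun x => \sum_(i <- enum 'I_k.+2) a i * x 0 i) x
    + 1 * (fun x => (fun x => x 0 ord0 * x 0 ord_max) x
    + 1 * (fun x => \sum_(i <- iota 0 (size phi)) phi`_i * pfun (ppow ord0 i) x) x) x).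
Proof.
apply/funext => x; rewrite tauE !mul1r -addrA big_enum; congr (_ + (_ + _)).
rewrite horner_coef -(big_mkord xpredT (fun i => phi`_i * x 0 ord0 ^+ i)) /index_iota subn0.
by apply: eq_bigr => i _; rewrite pfun_ppow.
Qed.

Lemma hpart_tau (S : comNzRingType) (io : {rmorphism R -> S}) y n phi :
  hpart io y n (tau phi) =
   (if n == 1%N then \sum_i io (a i) * y i else 0)
   + (if n == 2%N then 2%:R * (y ord0 * y ord_max) else 0)
   + n`!%:R * (io phi`_n * y ord0 ^+ n).
Proof.
have sX b : smooth ((fun x => x 0 b) : dynamics R k) by exact: (smooth_pfun (PVar b)).
have sP : smooth ((fun x => x 0 ord0 * x 0 ord_max) : dynamics R k).
  exact: (smooth_pfun (PMul (PVar ord0) (PVar ord_max))).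
have sS : smooth ((fun x => \sum_(i <- iota 0 (size phi)) phi`_i * pfun (ppow ord0 i) x)
   : dynamics R k).
  by apply: smooth_sum => i; exact: smooth_pfun.
have s1 : smooth ((fun x => \sum_(i <- enum 'I_k.+2) a i * x 0 i) : dynamics R k).
  by apply: smooth_sum => i; exact: sX.
rewrite tau_sum (hpart_lin _ _ _ _ s1); last exact: (smooth_lin _ sP sS).
rewrite (hpart_lin _ _ _ _ sP sS) rmorph1 !mul1r hpart_prod addrA.
rewrite (hpart_sum _ _ _ _ _ sX) big_enum.
rewrite (hpart_sum _ _ _ _ _ (fun i => smooth_pfun (ppow ord0 i))).
congr (_ + _ + _).
  case: eqP => [->|/eqP/negbTE n1]; first by apply: eq_bigr => i _; rewrite hpart_coord.
  by rewrite big1 // => i _; rewrite hpart_coord n1 mulr0.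
case: (ltnP n (size phi)) => ns.
  rewrite (bigD1_seq n) /= ?mem_iota ?iota_uniq //= hpart_pow eqxx big1 ?addr0.
    by rewrite mulrCA.
  by move=> i /negbTE ni; rewrite hpart_pow eq_sym ni mulr0.
rewrite nth_default // rmorph0 mul0r mulr0 big1_seq // => i; rewrite mem_iota /= add0n.
by move=> il; rewrite hpart_pow gtn_eqF ?mulr0 // (leq_trans il).
Qed.

Lemma tau_axis phi t : phi`_0 = 0 -> tau phi (t *: delta_mx 0 ord_max) = 0.
Proof.
move=> p0; rewrite tauE !mxE /= !(mulr0,mul0r) addr0 horner_coef0 p0 addr0.
rewrite big1 // => i _; rewrite !mxE /=.
case: (i =P ord_max) => [->|_]; first by rewrite a_max mul0r.
by rewrite !mulr0.
Qed.

Lemma jet1_tau phi i : phi`_1 = 0 -> jet [:: i] (tau phi) = a i.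
Proof.
move=> p1; have := @hpart_tau R idfun (fun l => (i == l)%:R) 1 phi.
have sm := smooth_tau phi.
rewrite hpartS // (bigD1 i) //= eqxx mul1r big1 => [|l /negbTE li]; last first.
  by rewrite eq_sym li mul0r.
rewrite hpart0 !addr0 p1 mul0r mulr0 addr0 => /= h.
rewrite /jet /= h (bigD1 i) //= eqxx mulr1 big1 ?addr0 // => l /negbTE li.
by rewrite eq_sym li mulr0.
Qed.

Lemma taylor_tau phi M (S : comNzRingType) (io : {rmorphism R -> S}) (y : 'I_k.+2 -> S) :
  phi`_0 = 0 -> (size phi <= M.+1)%N -> (2 <= M)%N ->
  ev (fun g : dynamics R k -> R => io (g (tau phi))) y (taylor M (@jet R k)) =
  \sum_i io (a i) * y i + y ord0 * y ord_max + (map_poly io phi).[y ord0].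
Proof.
move=> p0 sp M2; rewrite ev_taylor_sum; last exact: rmorph0.
have unf n : io n`!%:R^-1 * n`!%:R = 1.
  rewrite -(rmorph_nat io) -rmorphM mulVf ?rmorph1 // pnatr_eq0 -lt0n fact_gt0.

rewrite (eq_bigr (fun n => io n`!%:R^-1 * hpart io y n (tau phi))); last by [].
under eq_bigr do rewrite hpart_tau mulrDr mulrDr (mulrA (io _) _`!%:R) unf mul1r.
rewrite !big_split /=; congr (_ + _ + _).
- have i1 : 1%N \in index_iota 1 M.+1 by rewrite mem_index_iota; lia.
  rewrite (bigD1_seq 1%N i1) ?iota_uniq //=.
  by rewrite invr1 rmorph1 mul1r [X in _ + X]big1 ?addr0 // => n /negbTE ->; rewrite mulr0.
- have i2 : 2%N \in index_iota 1 M.+1 by rewrite mem_index_iota; lia.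
  rewrite (bigD1_seq 2%N i2) ?iota_uniq //=.
  rewrite mulrA unf mul1r big1 ?addr0 // => n /negbTE ->; rewrite mulr0 //.
- rewrite (@horner_coef_wide _ M.+1); last exact: leq_trans (size_poly _ _) sp.
  rewrite big_ord_recl /= coef_map p0 [X in X * _](rmorph0 io : io 0 = 0) mul0r add0r.
  rewrite big_add1 big_mkord; apply: eq_bigr => i _.
  by rewrite coef_map.
Qed.

(* Dropping the constant and linear terms keeps the 1-jet of [tau] fixed. *)
Definition trunc2 phi : {poly R} := phi - (phi`_0)%:P - phi`_1 *: 'X.

Lemma trunc2_lin phi psi e : trunc2 (phi + e *: psi) = trunc2 phi + e *: trunc2 psi.
Proof.
rewrite /trunc2 !coefD !coefZ polyCD polyCM scalerDl -scalerA -!mul_polyC; ring.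
Qed.

Lemma trunc2_0 phi : (trunc2 phi)`_0 = 0.
Proof. by rewrite /trunc2 !coefB coefC coefZ coefX /= mulr0 subr0 subrr. Qed.

Lemma trunc2_1 phi : (trunc2 phi)`_1 = 0.
Proof. by rewrite /trunc2 !coefB coefC coefZ coefX /= mulr1 subr0 subrr. Qed.

Lemma trunc2_id phi : phi`_0 = 0 -> phi`_1 = 0 -> trunc2 phi = phi.
Proof. by move=> p0 p1; rewrite /trunc2 p0 p1 scale0r !subr0. Qed.

Lemma jet_tau_line phi psi (s : seq 'I_k.+2) (e : R) :
  jet s (tau (phi + e *: psi)) = jet s (tau phi) + e * jet s (pfun (phorner psi)).
Proof.
have -> : tau (phi + e *: psi) = (fun x => tau phi x + e * pfun (phorner psi) x).
  apply/funext => x; rewrite !tauE pfun_phorner hornerD hornerZ; ring.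
rewrite /jet (partials_lin _ (smooth_tau phi)) //; exact: smooth_pfun.
Qed.

End Model.

Section TestDynamics.
Variables (R : realType) (k m : nat) (Q : 'I_k -> 'I_m -> 'I_m) (r : 'I_m -> 'I_m).
Hypothesis rr : forall p, r (r p) = r p.
Hypothesis rQ : forall l p, r (Q l p) = r (Q l (r p)).

(** The witness [g] shares all first derivatives with [f0], so moving from [f0] to [g] changes
    neither the Jacobian nor the bifurcation condition. *)
Lemma formal_branch_polyfun (f0 : dynamics R k) :
  jet [:: ord_max] f0 = 0 -> jordan_at Q r (@jet R k) f0 ->
  exists Theta : dynamics R k -> R,
  [/\ polyfun (@jet R k) (@nontriv_jet k) Theta,
      forall f, jet [:: ord_max] f = 0 -> jordan_at Q r (@jet R k) f -> Theta f != 0 ->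
        formal_branch Q (@jet R k) f &
      exists g, [/\ smooth g, forall t, g (t *: delta_mx 0 ord_max) = 0,
        forall i, jet [:: i] g = jet [:: i] f0 & Theta g != 0]].
Proof.
move=> f0max jd0.
have [|phi M [p0 p1 sp M2] S io y|phi psi s _|Theta [pT HT [phi Tphi]]] :=
    exists_theta rr rQ (tau := fun phi => tau f0 (trunc2 phi)) f0max _ _ _ jd0.
- by move=> phi i; rewrite jet1_tau // trunc2_1.
- by rewrite trunc2_id // taylor_tau.
- exists ((jet s (tau f0 (trunc2 phi)))%:P + jet s (pfun (phorner k (trunc2 psi))) *: 'X) => e.
  by rewrite trunc2_lin jet_tau_line hornerD hornerC hornerZ hornerX mulrC.
exists Theta; split=> //; exists (tau f0 (trunc2 phi)); split=> //.
- exact: smooth_tau.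
- by move=> t; rewrite tau_axis // trunc2_0.
- by move=> i; rewrite jet1_tau // trunc2_1.
Qed.

End TestDynamics.

(** * From formal to actual branches *)

Section MatrixNorm.
Variables (R : realType) (m n : nat).
Implicit Types x : 'M[R]_(m, n).

Lemma mx_norm_leP x (e : R) : 0 <= e -> `|x| <= e <-> forall i j, `|x i j| <= e.
Proof.
move=> e0; rewrite [`|x|]mx_normrE; split.
  by move=> /bigmax_leP[_ h] i j; apply: (h (i, j)).
by move=> h; apply/bigmax_leP; split => // -[i j] _; exact: h.
Qed.

Lemma mx_norm_coord x i j : `|x i j| <= `|x|.
Proof. exact: (mx_norm_leP x (normr_ge0 x)).1. Qed.

End MatrixNorm.

Section FixedPointFamily.
Variables (R : realType) (m : nat).
Implicit Types (x y : 'cV[R]_m).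

Lemma ball_fixed_point (Phi : 'cV[R]_m -> 'cV[R]_m) (rho : R) : 0 < rho ->
  (forall x y, `|x| <= rho -> `|y| <= rho -> `|Phi x - Phi y| <= 2^-1 * `|x - y|) ->
  `|Phi 0| <= rho / 2 -> exists2 x, `|x| <= rho & Phi x = x.
Proof.
move=> rho0 lip Phi0.
pose U : set 'cV[R]_m := [set x | `|x| <= rho].
have PU x : U x -> U (Phi x).
  rewrite /U /= => xr; rewrite -[Phi x](subrK (Phi 0)) (le_trans (ler_normD _ _)) //.
  have z0 : `|0 : 'cV[R]_m| <= rho by rewrite normr0 ltW.
  by have := lip _ _ xr z0; rewrite subr0; lra.
pose f := HB.pack Phi (isFun.Build _ _ U U Phi PU) : {fun U >-> U}.
have cf : is_contraction f.
  have h0 : 0 <= 2^-1 :> R by rewrite invr_ge0.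
  exists (NngNum h0); split; first by rewrite /= invf_lt1 // ltr1n.
  by move=> [x y] [/= xU yU]; apply: lip.
have [||p Up pE] := @banach_fixed_point R (HB.pack_for (completeNormedModType R) 'cV[R]_m) U f cf; last by exists p.
- have -> : U = closed_ball_ Num.norm (0 : 'cV[R]_m) rho.
    by apply/seteqP; split=> x; rewrite /closed_ball_ /U /= sub0r normrN.
  exact: closed_closed_ball_.
- by exists 0; rewrite /U /= normr0 ltW.
Qed.

(** The contraction is required on a ball of twice the radius: for [a'] near [a] the fixed point at
    [a'] then lies in the domain of contraction of [Phi a]. Its distance to the fixed point at [a]
    is at most twice its defect under [Phi a], which [cP] makes small. *)
Lemma fixed_point_family (Phi : R -> 'cV[R]_m -> 'cV[R]_m) (rho : R -> R) (delta : R) :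
  (forall a : R, 0 < a <= delta -> [/\ 0 < rho a,
     forall x y, `|x| <= 2 * rho a -> `|y| <= 2 * rho a ->
       `|Phi a x - Phi a y| <= 2^-1 * `|x - y| & `|Phi a 0| <= rho a / 2]) ->
  continuous rho ->
  (forall a : R, 0 < a <= delta -> forall e : R, 0 < e -> exists2 eta : R, 0 < eta &
     forall (a' : R) x, 0 < a' <= delta -> `|a - a'| < eta -> `|x| <= rho a' ->
       Phi a' x = x -> `|Phi a x - x| <= e) ->
  exists xi : R -> 'cV[R]_m,
    (forall a : R, 0 < a <= delta -> `|xi a| <= rho a /\ Phi a (xi a) = xi a) /\
    (forall a : R, 0 < a <= delta -> forall e : R, 0 < e -> exists2 eta : R, 0 < eta &
      forall a' : R, 0 < a' <= delta -> `|a - a'| < eta -> `|xi a - xi a'| <= e).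
Proof.
move=> HP crho cP.
have fp (a : R) : 0 < a <= delta -> exists2 x, `|x| <= rho a & Phi a x = x.
  move=> /HP[r0 lip P0]; apply: ball_fixed_point => // x y xr yr.
  have r2 : rho a <= 2 * rho a by rewrite ler_peMl ?(ltW r0) // ler1n.
  by apply: lip; apply: le_trans r2.
have [xi P] : {xi : R -> 'cV[R]_m & forall a : R, 0 < a <= delta ->
    `|xi a| <= rho a /\ Phi a (xi a) = xi a}.
  apply: (@choice _ _ (fun a x => 0 < a <= delta -> `|x| <= rho a /\ Phi a x = x)) => a.
  by have [/fp[x xr xE]|] := boolP (0 < a <= delta); [exists x|exists 0].
exists xi; split=> // a ha e e0; have [xr xE] := P a ha; have [r0 lip _] := HP a ha.
have [eta1 eta10 H1] := cP a ha (e / 2) (divr_gt0 e0 (ltr0Sn R 1)).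
have /cvgrPdist_lt/(_ _ r0)/nbhs_normP[eta2 /= eta20 H2] := crho a.
exists (Num.min eta1 eta2); first by rewrite lt_min eta10.
move=> a' ha' aa'; move: (aa'); rewrite lt_min => /andP[aa1 aa2].
have [xr' xE'] := P a' ha'.
have h1 := H1 a' (xi a') ha' aa1 xr' xE'.
have rr : rho a' <= 2 * rho a.
  have := H2 _ aa2; rewrite /= ltr_norml => /andP[h _]; lra.
have h2 : `|xi a - Phi a (xi a')| <= 2^-1 * `|xi a - xi a'|.
  by rewrite -{1}xE; apply: lip; [lra|exact: le_trans rr].
have : `|xi a - xi a'| <= `|xi a - Phi a (xi a')| + `|Phi a (xi a') - xi a'|.
  by rewrite (le_trans _ (ler_normD _ _)) // addrA subrK.
by lra.
Qed.

End FixedPointFamily.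

Section PolynomialEstimates.
Variable R : realFieldType.
Implicit Types p q : {poly R}.

Lemma horner_bound p n : (forall i, (i < n)%N -> p`_i = 0) ->
  exists2 C, 0 <= C & forall a, 0 <= a <= 1 -> `|p.[a]| <= C * a ^+ n.
Proof.
move=> pn; exists (\sum_(i < size p) `|p`_i|); first exact: sumr_ge0.
move=> a /andP[a0 a1]; rewrite horner_coef (le_trans (ler_norm_sum _ _ _)) // mulr_suml.
apply: ler_sum => i _; rewrite normrM normrX (ger0_norm a0).
case: (ltnP i n) => [/pn ->|ni]; first by rewrite normr0 !mul0r.
by rewrite ler_wpM2l // -(subnK ni) exprD ler_piMl ?exprn_ge0 ?exprn_ile1.
Qed.

Lemma horner_lower p d : (exists2 i, (i <= d)%N & p`_i != 0) ->
  exists2 c, 0 < c & exists2 delta, 0 < delta <= 1 &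
    forall a, 0 <= a <= delta -> c * a ^+ d <= `|p.[a]|.
Proof.
move=> [i0 i0d pi0]; pose i := ex_minn (ex_intro (fun i => p`_i != 0) i0 pi0).
have [pi mi] : p`_i != 0 /\ forall j, p`_j != 0 -> (i <= j)%N.
  by rewrite /i; case: ex_minnP.
pose q := p - p`_i *: 'X^i.
have [|C C0 HC] := @horner_bound q i.+1.
  move=> j; rewrite ltnS coefB coefZ coefXn leq_eqVlt => /predU1P[->|ji].
    by rewrite eqxx mulr1 subrr.
  rewrite (ltn_eqF ji) mulr0 subr0; apply/eqP; apply: contraTT ji => /mi.
  by rewrite -leqNgt.
exists (`|p`_i| / 2); first by rewrite divr_gt0 // normr_gt0.
(* Up to [delta] the remaining terms, bounded by [C a^(i+1)], are at most half of the lowest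
   term. *)
pose delta := `|p`_i| / 2 / (C + `|p`_i|).
have pi0' : 0 < `|p`_i| by rewrite normr_gt0.
have s0 : 0 < C + `|p`_i| by rewrite ltr_wpDl.
exists delta.
  rewrite /delta !divr_gt0 //= ler_pdivrMr // mul1r; lra.
move=> a /andP[a0 ad].
have d1 : delta <= 1 by rewrite /delta ler_pdivrMr // mul1r; lra.
have h := HC a; rewrite a0 (le_trans ad d1) in h; have {}h := h isT.
have pE : p.[a] = p`_i * a ^+ i + q.[a].
  by rewrite /q hornerD hornerN hornerZ hornerXn; ring.
have ai0 : 0 <= a ^+ i by rewrite exprn_ge0.
have Ca : C * a <= `|p`_i| / 2.
  rewrite (@le_trans _ _ ((C + `|p`_i|) * delta)) //; last first.
    by rewrite /delta mulrC divfK // gt_eqF.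
  by apply: ler_pM => //; lra.
have l1 : `|p`_i| * a ^+ i - C * a ^+ i.+1 <= `|p.[a]|.
  rewrite pE -{1}(ger0_norm ai0) -normrM.
  have := lerB_normD (p`_i * a ^+ i) q.[a]; lra.
have l2 : C * a ^+ i.+1 <= `|p`_i| / 2 * a ^+ i.
  by rewrite exprS mulrA ler_wpM2r.
have l3 : a ^+ d <= a ^+ i.
  rewrite -(subnK (mi _ pi0)) in i0d.
  have id : (i <= d)%N by apply: leq_trans i0d; rewrite leq_addl.
  by rewrite -(subnK id) exprD ler_piMl // exprn_ile1 // (le_trans ad).
have l4 : `|p`_i| / 2 * a ^+ d <= `|p`_i| / 2 * a ^+ i by rewrite ler_wpM2l // divr_ge0.
lra.
Qed.

Lemma horner_lipschitz p : exists2 C, 0 <= C &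
  forall a b, 0 <= a <= 1 -> 0 <= b <= 1 -> `|p.[a] - p.[b]| <= C * `|a - b|.
Proof.
elim/poly_ind: p => [|p c [C C0 IH]].
  by exists 0 => // a b _ _; rewrite !horner0 subrr normr0 mul0r.
have [//|D D0 HD] := @horner_bound p 0.
exists (C + D) => [|a b ha hb]; first exact: addr_ge0.
have -> : (p * 'X + c%:P).[a] - (p * 'X + c%:P).[b] =
   (p.[a] - p.[b]) * a + p.[b] * (a - b) by rewrite !hornerE; ring.
rewrite (le_trans (ler_normD _ _)) // [leRHS]mulrDl !normrM; apply: lerD.
  have /andP[a0 a1] := ha; rewrite (ger0_norm a0).
  by rewrite (le_trans _ (IH a b ha hb)) // ler_piMr.
by rewrite ler_wpM2r //; have := HD b hb; rewrite expr0 mulr1.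
Qed.

End PolynomialEstimates.

Section Congruences.
Variables (R : comNzRingType) (K V : Type) (io : K -> fps R).

Lemma lowz_prod n (I : Type) (r : seq I) (F G : I -> fps R) :
  (forall i, lowz n (F i - G i)) ->
  lowz n (\prod_(i <- r) F i - \prod_(i <- r) G i).
Proof.
move=> FG; elim: r => [|i r IH]; first by rewrite !big_nil subrr => j.
rewrite !big_cons.
have -> : F i * \prod_(j <- r) F j - G i * \prod_(j <- r) G j =
  (F i - G i) * \prod_(j <- r) F j + G i * (\prod_(j <- r) F j - \prod_(j <- r) G j).
  ring.
by apply: lowzD; [apply: lowzMl|apply: lowzMr].
Qed.

Lemma lowz_det n m (A B : 'M[fps R]_m) :
  (forall i j, lowz n (A i j - B i j)) -> lowz n (\det A - \det B).
Proof.
move=> AB; rewrite /determinant -sumrB; apply: lowz_sum => s _.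
by rewrite -mulrBr; apply: lowzMr; apply: lowz_prod.
Qed.

Lemma dev_lowz n (v v' w : V -> fps R) (e : pexp K V) : (forall i, lowz n (v i - v' i)) ->
  lowz n (dev io v w e - dev io v' w e).
Proof.
move=> vv'; elim: e => //= [i|c|e1 IH1 e2 IH2|e1 IH1 e2 IH2].
- by rewrite subrr => j.
- by rewrite subrr => j.
- by rewrite opprD addrACA; apply: lowzD.
- have E (a b c d a' b' c' d' : fps R) : a * b + c * d - (a' * b' + c' * d') =
     (a - a') * b + a' * (b - b') + ((c - c') * d + c' * (d - d')) by ring.
  rewrite E; apply: lowzD; apply: lowzD.
  + exact: lowzMl.
  + by apply: lowzMr; apply: ev_lowz.
  + by apply: lowzMl; apply: ev_lowz.
  + exact: lowzMr.
Qed.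

End Congruences.

(** * Newton's method around a truncated branch *)

Section Tougeron.
Variables (R : realType) (k m : nat) (Q : network m k) (f : dynamics R k).
Hypothesis sf : smooth f.
Hypothesis f0 : f 0 = 0.
Variables (d M : nat) (yP : option 'I_m -> {poly R}).
Hypothesis dM : (3 * d + 3 <= M)%N.
Let dM' : (d.+1 <= M)%N. Proof. lia. Qed.
Let dM2 : (d.+1 <= M.+1 - d.+1)%N. Proof. lia. Qed.
Hypothesis yP0 : forall o, (yP o)`_0 = 0.
Local Notation jt := (@jet R k).
Let ioP (g : dynamics R k -> R) : {poly R} := (g f)%:P.
Let ioR (g : dynamics R k -> R) : R := g f.
Hypothesis resP : forall p i, (i <= M)%N ->
  (ev ioP yP (cell_eq Q (taylor M jt) p))`_i = 0.
Let AP : 'M[{poly R}]_m := cell_jac Q (taylor M jt) ioP yP.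
Hypothesis detP : exists2 i, (i <= d)%N & (\det AP)`_i != 0.
Implicit Types (a : R) (xi : 'cV[R]_m).

Let Y a p : 'rV[R]_k.+2 := \row_i (yP (cell_arg Q p i)).[a].
Let pert xi p : 'rV[R]_k.+2 := \row_i (if cell_arg Q p i is Some q then xi q 0 else 0).
Definition cell_map a xi : 'cV[R]_m := \col_p f (Y a p + pert xi p).
Let A a : 'M[R]_m := map_mx (horner_eval a) AP.

Let ev_horner a V (v : V -> {poly R}) (e : pexp (dynamics R k -> R) V) :
  (ev ioP v e).[a] = ev ioR (fun i => (v i).[a]) e.
Proof.
by elim: e => //= [c|e1 <- e2 <-|e1 <- e2 <-]; rewrite ?hornerC ?hornerD ?hornerM.
Qed.

Let dev_horner a V (v w : V -> {poly R}) (e : pexp (dynamics R k -> R) V) :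
  (dev ioP v w e).[a] = dev ioR (fun i => (v i).[a]) (fun i => (w i).[a]) e.
Proof.
elim: e => //= [c|e1 <- e2 <-|e1 <- e2 <-]; rewrite ?horner0 ?hornerD //.
by rewrite !hornerM !ev_horner.
Qed.

Let Amul a xi p : (A a *m xi) p 0 =
  \sum_i taylor_deriv M f (Y a p) i * pert xi p 0 i.
Proof.
have yE : (fun i => (yP (cell_arg Q p i)).[a]) = (fun i => Y a p 0 i).
  by apply/funext => i; rewrite mxE.
transitivity (dev ioR (fun i => Y a p 0 i) (fun i => pert xi p 0 i) (taylor M jt)).
  rewrite mxE.
  rewrite (eq_bigr (fun q => xi q 0 * dev ioR (fun i => Y a p 0 i)
     (fun i => (cell_arg Q p i == Some q)%:R) (taylor M jt))); last first.
    move=> q _; rewrite mulrC; congr (_ * _).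
    rewrite mxE /horner_eval mxE dev_cell dev_horner yE; apply: eq_dev => // i.
    by case: (_ == _); rewrite ?hornerC.
  rewrite -dev_sum; apply: eq_dev => // i; rewrite mxE.
  case: (cell_arg Q p i) => [q|]; last by rewrite big1 // => q _; rewrite mulr0.
  rewrite (bigD1 q) //= eqxx mulr1 big1 ?addr0 // => q' qq'.
  by rewrite (_ : Some q == Some q' = false) ?mulr0 //; apply/negbTE; rewrite eq_sym.
rewrite (eq_bigr (fun l => pert xi p 0 l * dev ioR (fun i => Y a p 0 i)
   (fun i => (i == l)%:R) (taylor M jt))); last by move=> l _; rewrite mulrC.
rewrite -dev_sum; apply: eq_dev => // i.
rewrite (bigD1 i) //= eqxx mulr1 big1 ?addr0 // => l /negbTE il.
by rewrite eq_sym il mulr0.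
Qed.

Let Y_bound : exists2 C, 0 <= C & forall a, 0 <= a <= 1 -> forall p i, `|Y a p 0 i| <= C * a.
Proof.
have [||e _ [C C0 H]] := @uniform_constants R (option 'I_m : finType) (fun o _ C =>
    forall a, 0 <= a <= 1 -> `|(yP o).[a]| <= C * a).
- move=> o e C e' C' H _ CC a ha; apply: le_trans (H a ha) _.
  by case/andP: ha => a0 _; rewrite ler_wpM2r.
- move=> o; exists 1 => //; have [|C C0 H] := @horner_bound R (yP o) 1.
    by move=> i; rewrite ltnS leqn0 => /eqP ->.
  by exists C.
- by exists C => // a ha p i; rewrite mxE; apply: H.
Qed.

Lemma lipschitz_smooth (g : dynamics R k) : smooth g ->
  exists2 rho : R, 0 < rho & exists2 L, 0 <= L & forall X Z : 'rV[R]_k.+2,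
    (forall j, `|X 0 j| <= rho) -> (forall j, `|Z 0 j| <= rho) ->
    `|g X - g Z| <= L * \sum_j `|X 0 j - Z 0 j|.
Proof.
move=> sg; have [||rho r0 [L L0 H]] := @uniform_constants R 'I_k.+2 (fun i (rho L : R) =>
    forall X : 'rV[R]_k.+2, (forall j, `|X 0 j| <= rho) -> `|partial i g X| <= L).
- move=> i rho L rho' L' H /andP[_ rr] LL X Xr; apply: le_trans LL; apply: H => j.
  exact: le_trans rr.
- by move=> i; apply: locally_bounded; apply: continuous_smooth; apply: smooth_partial.
have z (X : 'rV[R]_k.+2) : (forall j, `|X 0 j| <= rho) ->
    forall j, `|X 0 j - (0 : 'rV[R]_k.+2) 0 j| <= rho.
  by move=> h j; rewrite mxE subr0.
exists rho => //; exists L => // X Z Xr Zr.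
apply: (@lipschitz_box R k.+2 g 0 rho L) => //.
- by move=> i y; have [_] := sg [::]; apply.
- by move=> i y yr; apply: H => j; have := yr j; rewrite mxE subr0.
- exact: z.
- exact: z.
Qed.

Lemma cell_mapE a xi p : cell_map a xi p 0 = f (Y a p + pert xi p).
Proof. by rewrite mxE. Qed.

Let pertB xi xi' p : pert (xi - xi') p = pert xi p - pert xi' p.
Proof.
apply/matrixP => i j; rewrite !mxE; case: cell_arg => [q|]; last by rewrite subrr.
by rewrite !mxE.
Qed.

Let pert_le xi p i : `|pert xi p 0 i| <= `|xi|.
Proof.
by rewrite mxE; case: cell_arg => [q|]; [exact: mx_norm_coord|rewrite normr0].
Qed.

Let pert_sum xi p : \sum_i `|pert xi p 0 i| <= k.+2%:R * `|xi|.
Proof.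
have -> : k.+2%:R * `|xi| = \sum_(i < k.+2) `|xi| by rewrite sumr_const card_ord mulr_natl.
by apply: ler_sum => i _; apply: pert_le.
Qed.

(** Two errors are compared with [a^(d+1)]: the variation of the derivative of [f] on a ball of
    radius [2 a^(d+1)], and the Taylor error of that derivative, of order [a^M]. *)
Let lin_err : exists2 delta : R, 0 < delta <= 1 & exists2 C, 0 <= C &
  forall a, 0 <= a <= delta -> forall xi xi' : 'cV[R]_m,
    `|xi| <= 2 * a ^+ d.+1 -> `|xi'| <= 2 * a ^+ d.+1 ->
    `|cell_map a xi - cell_map a xi' - A a *m (xi - xi')|
      <= C * a ^+ d.+1 * `|xi - xi'|.
Proof.
have [B B0 YB] := Y_bound.
have [||rho r0 [C C0 H]] := @uniform_constants R 'I_k.+2 (fun i (rho C : R) =>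
    (forall X Z : 'rV[R]_k.+2, (forall j, `|X 0 j| <= rho) -> (forall j, `|Z 0 j| <= rho) ->
       `|partial i f X - partial i f Z| <= C * \sum_j `|X 0 j - Z 0 j|) /\
    (forall (r : R) (X : 'rV[R]_k.+2), 0 <= r <= rho -> (forall j, `|X 0 j| <= r) ->
       `|partial i f X - taylor_deriv M f X i| <= C * r ^+ M)).
- move=> i rho C rho' C' [H1 H2] /andP[_ rr] CC; split=> [X Z Xr Zr|r X /andP[r0 rr'] Xr].
    have h := H1 X Z (fun j => le_trans (Xr j) rr) (fun j => le_trans (Zr j) rr).
    apply: le_trans h _.
    by rewrite ler_wpM2r // sumr_ge0.
  apply: le_trans (H2 r X _ Xr) _; first by rewrite r0 (le_trans rr').
  by rewrite ler_wpM2r // exprn_ge0.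
- move=> i; have [rho1 r1 [C1 C10 H1]] := lipschitz_smooth (smooth_partial i sf).
  have [rho2 r2 [C2 C20 H2]] := taylor_remainder_deriv M i sf.
  exists (Num.min rho1 rho2); first by rewrite lt_min r1.
  exists (C1 + C2); first exact: addr_ge0.
  split=> [X Z Xr Zr|r X /andP[r0 rr'] Xr].
    have m1 : Num.min rho1 rho2 <= rho1 by rewrite ge_min lexx.
    have h := H1 X Z (fun j => le_trans (Xr j) m1) (fun j => le_trans (Zr j) m1).
    by apply: le_trans h _; rewrite ler_wpM2r ?sumr_ge0 // lerDl.
  apply: le_trans (H2 r X _ Xr) _; first by move: rr'; rewrite r0 le_min => /andP[].
  by rewrite ler_wpM2r ?exprn_ge0 // lerDr.
have B2 : 0 < B + 2 by rewrite ltr_wpDl.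
pose delta := Num.min 1 (rho / (B + 2)).
exists delta; first by rewrite /delta lt_min ltr01 divr_gt0 //= ge_min lexx.
pose C' := C * (2 * k.+2%:R + B ^+ M).
have C'0 : 0 <= C' by rewrite mulr_ge0 // addr_ge0 ?mulr_ge0 ?exprn_ge0.
exists (C' * k.+2%:R); first exact: mulr_ge0.
move=> a /andP[a0]; rewrite le_min => /andP[a1]; rewrite ler_pdivlMr // => arho.
move=> xi xi' xir xir'.
have ad : a ^+ d.+1 <= a by rewrite exprS ler_piMr // exprn_ile1.
have ad0 : 0 <= a ^+ d.+1 by rewrite exprn_ge0.
have e0 : 0 <= C' * k.+2%:R * a ^+ d.+1 * `|xi - xi'|.
  by do 2!apply: mulr_ge0 => //; apply: mulr_ge0.
apply/(mx_norm_leP _ e0) => p j.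
have mB (u v : 'cV[R]_m) : (u - v) p 0 = u p 0 - v p 0 by rewrite !mxE.
rewrite (ord1 j) {j} (mB (_ - _)) mB Amul pertB !cell_mapE.
have Ya i : `|Y a p 0 i| <= B * a by apply: YB; rewrite a0.
pose L i := taylor_deriv M f (Y a p) i.
(* Subtracting the derivative of the Taylor polynomial at [Y a p] turns the claim into a Lipschitz
   bound for [g], whose derivatives are small on the box. *)
pose g : dynamics R k := fun W => f W + -1 * pfun (psumv L (enum 'I_k.+2)) W.
have sg : smooth g by exact: (smooth_lin _ sf (smooth_pfun _)).
have gE i W : partial i g W = partial i f W - L i.
  have := partials_lin (-1) sf (smooth_pfun (psumv L (enum 'I_k.+2))) [:: i].
  move=> /(congr1 (fun h => h W)) /= ->.
  by rewrite partial_pfun pfun_pder_psumv mulN1r.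
have box (W : 'rV[R]_k.+2) : (forall j, `|W 0 j - Y a p 0 j| <= 2 * a ^+ d.+1) ->
    forall j, `|W 0 j| <= rho.
  move=> h j; rewrite -[W 0 j](subrK (Y a p 0 j)) (le_trans (ler_normD _ _)) //.
  have := h j; have := Ya j; lra.
have Yr j : `|Y a p 0 j| <= rho.
  by apply: box => i; rewrite subrr normr0 mulr_ge0.
have lip := @lipschitz_box R k.+2 g (Y a p) (2 * a ^+ d.+1) (C' * a ^+ d.+1) _ _
  (Y a p + pert xi p) (Y a p + pert xi' p).
have E : f (Y a p + pert xi p) - f (Y a p + pert xi' p)
    - (\sum_i L i * (pert xi p - pert xi' p) 0 i) =
    g (Y a p + pert xi p) - g (Y a p + pert xi' p).
  rewrite /g !pfun_psumv !big_enum !mulN1r opprD opprK addrACA; congr (_ + _).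
  rewrite addrC -sumrB -sumrN; apply: eq_bigr => i _.
  by rewrite !mxE -mulrN; ring.
rewrite [X in `|X|]E; apply: le_trans (lip _ _ _ _) _.
- by move=> i W; have [_] := sg [::]; apply.
- move=> i W hW; rewrite -/(partial i g W) gE.
  have -> : partial i f W - L i =
    (partial i f W - partial i f (Y a p)) + (partial i f (Y a p) - L i).
    by rewrite addrA subrK.
  rewrite (le_trans (ler_normD _ _)) //.
  have [H1 H2] := H i.
  have h1 := H1 W (Y a p) (box W hW) Yr.
  have h2 : `|partial i f (Y a p) - L i| <= C * (B * a) ^+ M.
    apply: H2 => //; rewrite mulr_ge0 //=; lra.
  have h3 : \sum_j `|W 0 j - Y a p 0 j| <= k.+2%:R * (2 * a ^+ d.+1).
    have -> : k.+2%:R * (2 * a ^+ d.+1) = \sum_(i < k.+2) (2 * a ^+ d.+1).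
      by rewrite sumr_const card_ord mulr_natl.
    by apply: ler_sum.
  have h4 : (B * a) ^+ M <= B ^+ M * a ^+ d.+1.
    rewrite exprMn ler_wpM2l ?exprn_ge0 //.
    by rewrite -(subnK dM') exprD ler_piMl // exprn_ile1.
  have h5 := ler_wpM2l C0 h3; have h6 := ler_wpM2l C0 h4.
  have -> : C' * a ^+ d.+1 = C * (k.+2%:R * (2 * a ^+ d.+1)) + C * (B ^+ M * a ^+ d.+1).
    by rewrite /C'; ring.
  apply: lerD; [exact: le_trans h1 h5|exact: le_trans h2 h6].
- by move=> j; rewrite mxE addrAC subrr add0r (le_trans (pert_le _ _ _)).
- by move=> j; rewrite mxE addrAC subrr add0r (le_trans (pert_le _ _ _)).
- have hS : \sum_i `|(Y a p + pert xi p) 0 i - (Y a p + pert xi' p) 0 i|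
      <= k.+2%:R * `|xi - xi'|.
    rewrite (eq_bigr (fun i => `|pert (xi - xi') p 0 i|)); first exact: pert_sum.
    by move=> i _; rewrite pertB !mxE; congr `|_|; ring.
  have -> : C' * k.+2%:R * a ^+ d.+1 * `|xi - xi'| =
     C' * a ^+ d.+1 * (k.+2%:R * `|xi - xi'|) by ring.
  by apply: ler_wpM2l hS; apply: mulr_ge0.
Qed.

Let residual : exists2 delta : R, 0 < delta & exists2 C, 0 <= C &
  forall a, 0 <= a <= delta -> a <= 1 -> forall p, `|cell_map a 0 p 0| <= C * a ^+ M.+1.
Proof.
have [B B0 YB] := Y_bound.
have [rho r0 [C1 C10 HT]] := taylor_remainder M sf.
have [||e _ [C2 C20 HP]] := @uniform_constants R 'I_m (fun p _ C => forall a, 0 <= a <= 1 ->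
   `|(ev ioP yP (cell_eq Q (taylor M jt) p)).[a]| <= C * a ^+ M.+1).
- move=> p e C e' C' H _ CC a ha; apply: le_trans (H a ha) _.
  by case/andP: ha => a0 _; rewrite ler_wpM2r ?exprn_ge0.
- move=> p; exists 1 => //.
  have [|C C0 H] := @horner_bound R (ev ioP yP (cell_eq Q (taylor M jt) p)) M.+1.
    by move=> i; rewrite ltnS; apply: resP.
  by exists C.
have B1 : 0 < B + 1 by rewrite ltr_wpDl.
exists (rho / (B + 1)); first by rewrite divr_gt0.
exists (C1 * B ^+ M.+1 + C2); first by rewrite addr_ge0 ?mulr_ge0 ?exprn_ge0.
move=> a /andP[a0]; rewrite ler_pdivlMr // => arho a1 p.
have ha : 0 <= a <= 1 by rewrite a0.
have p0 : pert 0 p = 0.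
  by apply/matrixP => i j; rewrite !mxE; case: cell_arg => // q; rewrite mxE.
rewrite cell_mapE p0 addr0.
have Ba : 0 <= B * a <= rho by rewrite mulr_ge0 //=; lra.
have := HT (B * a) (Y a p) Ba (fun j => YB a ha p j); rewrite f0 add0r.
have -> : taylor_poly M f (Y a p) = (ev ioP yP (cell_eq Q (taylor M jt) p)).[a].
  by rewrite ev_horner ev_cell; apply: eq_ev => i; rewrite mxE.
have := HP p a ha; set t := _.[a]; move=> h1 h2.
rewrite -[f _](subrK t) (le_trans (ler_normD _ _)) // mulrDl lerD //.
by rewrite -mulrA -exprMn.
Qed.

Let cell_map_lip : exists2 delta : R, 0 < delta & exists2 C, 0 <= C &
  forall a a', 0 <= a <= delta -> 0 <= a' <= delta -> a <= 1 -> a' <= 1 ->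
    forall xi, `|xi| <= delta ->
    `|cell_map a xi - cell_map a' xi| <= C * `|a - a'|.
Proof.
have [B B0 YB] := Y_bound.
have [rho r0 [L L0 HL]] := lipschitz_smooth sf.
have [||e _ [C C0 HP]] := @uniform_constants R (option 'I_m : finType) (fun o _ C =>
   forall a b, 0 <= a <= 1 -> 0 <= b <= 1 -> `|(yP o).[a] - (yP o).[b]| <= C * `|a - b|).
- move=> o e C e' C' H _ CC a b ha hb; apply: le_trans (H a b ha hb) _.
  by rewrite ler_wpM2r.
- by move=> o; exists 1 => //; exact: horner_lipschitz.
have B1 : 0 < B + 1 by rewrite ltr_wpDl.
pose delta := rho / (B + 1); have d0 : 0 < delta by rewrite divr_gt0.
have dE : B * delta + delta = rho by rewrite -[X in _ + X]mul1r -mulrDl mulrC /delta divfK // gt_eqF.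
exists delta => //; exists (L * (k.+2%:R * C)); first by rewrite !mulr_ge0.
move=> a a' /andP[a0 ar] /andP[a0' ar'] a1 a1' xi xr.
have ha : 0 <= a <= 1 by rewrite a0.
have ha' : 0 <= a' <= 1 by rewrite a0'.
have mx0 : 0 <= L * (k.+2%:R * C) * `|a - a'| by rewrite !mulr_ge0.
apply/(mx_norm_leP _ mx0) => p j.
have mB (u v : 'cV[R]_m) : (u - v) p 0 = u p 0 - v p 0 by rewrite !mxE.
rewrite (ord1 j) {j mx0} mB !cell_mapE.
have box b : 0 <= b <= 1 -> b <= delta -> forall j, `|(Y b p + pert xi p) 0 j| <= rho.
  move=> hb br j; rewrite mxE (le_trans (ler_normD _ _)) // -dE lerD //.
    by rewrite (le_trans (YB b hb p j)) // ler_wpM2l.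
  exact: le_trans (pert_le xi p j) xr.
apply: le_trans (HL _ _ (box a ha ar) (box a' ha' ar')) _.
rewrite -mulrA ler_wpM2l // -mulrA.
have -> : k.+2%:R * (C * `|a - a'|) = \sum_(i < k.+2) (C * `|a - a'|).
  by rewrite sumr_const card_ord mulr_natl.
apply: ler_sum => i _.
have -> : (Y a p + pert xi p) 0 i - (Y a' p + pert xi p) 0 i =
   (yP (cell_arg Q p i)).[a] - (yP (cell_arg Q p i)).[a'] by rewrite !mxE; ring.
exact: HP.
Qed.

Let mulmx_norm_le (U : 'M[R]_m) (v : 'cV[R]_m) (B : R) :
  0 <= B -> (forall i j, `|U i j| <= B) -> `|U *m v| <= m%:R * B * `|v|.
Proof.
move=> B0 UB; have e0 : 0 <= m%:R * B * `|v| by rewrite !mulr_ge0.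
apply/(mx_norm_leP _ e0) => i j; rewrite mxE (le_trans (ler_norm_sum _ _ _)) //.
have -> : m%:R * B * `|v| = \sum_(l < m) (B * `|v|).
  by rewrite sumr_const card_ord -mulrA mulr_natl.
by apply: ler_sum => l _; rewrite normrM ler_pM // mx_norm_coord.
Qed.

Let det_A a : \det (A a) = (\det AP).[a].
Proof. by rewrite /A det_map_mx. Qed.

Let adj_bound : exists2 B, 0 <= B & forall a, 0 <= a <= 1 ->
  forall i j, `|(\adj (A a)) i j| <= B.
Proof.
have [||e _ [C C0 H]] := @uniform_constants R ('I_m * 'I_m)%type (fun ij _ C =>
    forall a, 0 <= a <= 1 -> `|(\adj AP ij.1 ij.2).[a]| <= C).
- move=> ij e C e' C' H _ CC a ha; exact: le_trans (H a ha) CC.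
- move=> ij; exists 1 => //; have [//|C C0 H] := @horner_bound R (\adj AP ij.1 ij.2) 0.
  by exists C => // a ha; have := H a ha; rewrite expr0 mulr1.
exists C => // a ha i j; have := H (i, j) a ha.
by rewrite /A -map_mx_adj [X in _ -> `|X| <= _]mxE.
Qed.

(** The matrix is the Jacobian of the Taylor polynomial at the truncated branch and does not depend
    on [xi]. Its inverse is split into the adjugate, which is bounded, and the determinant, which is
    at least of size [a^d]. *)
Let newton_map a xi := xi - (\det (A a))^-1 *: (\adj (A a) *m cell_map a xi).

Let newton_map_fix a xi : \det (A a) != 0 -> newton_map a xi = xi -> cell_map a xi = 0.
Proof.
move=> D0 /(congr1 (fun z => xi - z)); rewrite /newton_map opprD opprK addrA subrr add0r.
move=> h; have {}h : A a *m ((\det (A a))^-1 *: (\adj (A a) *m cell_map a xi)) = 0.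
  by rewrite h mulmx0.
move: h; rewrite -scalemxAr mulmxA mul_mx_adj mul_scalar_mx scalerA mulVf //.
by rewrite scale1r.
Qed.

Let newton_map_diff a xi xi' : \det (A a) != 0 ->
  newton_map a xi - newton_map a xi' = - ((\det (A a))^-1 *:
    (\adj (A a) *m (cell_map a xi - cell_map a xi' - A a *m (xi - xi')))).
Proof.
move=> D0; have E (V : zmodType) (x y z w : V) : x - z - (y - w) = - (z - w - (x - y)).
  by rewrite !opprB addrACA [RHS]addrACA [- z - y]addrC.
rewrite /newton_map E mulmxBr [in RHS]mulmxA mul_adj_mx mul_scalar_mx.
by rewrite [in RHS]scalerBr scalerA mulVf // scale1r mulmxBr scalerBr.
Qed.

Let newton_bound (U : 'cV[R]_m) a (B c : R) : 0 <= B -> 0 < c ->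
  (forall i j, `|(\adj (A a)) i j| <= B) -> c <= `|\det (A a)| ->
  `|(\det (A a))^-1 *: (\adj (A a) *m U)| <= c^-1 * (m%:R * B * `|U|).
Proof.
move=> B0 c0 hB hc; rewrite normrZ normfV ler_pM ?invr_ge0 //.
  by rewrite lef_pV2 // posrE // (lt_le_trans c0).
exact: mulmx_norm_le.
Qed.

(** Inverting the Jacobian costs a factor [a^(-d)]. On the ball of radius [2 a^(d+1)] the
    linearization error is [O(a^(d+1))], so the contraction constant is [O(a)]. The initial residual
    [O(a^(M+1))] becomes [O(a^(M+1-d))], which is well inside the ball since [M >= 3 d + 3]. *)
Lemma tougeron : exists2 delta : R, 0 < delta <= 1 & exists xi : R -> 'cV[R]_m,
  (forall a, 0 <= a <= delta -> `|xi a| <= a ^+ d.+1 /\ cell_map a (xi a) = 0) /\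
  (forall a, 0 <= a <= delta -> forall e : R, 0 < e -> exists2 eta : R, 0 < eta &
     forall a', 0 <= a' <= delta -> `|a - a'| < eta -> `|xi a - xi a'| <= e).
Proof.
have [d1 /andP[d10 d11] [C1 C10 H1]] := lin_err.
have [d2 d20 [C2 C20 H2]] := residual.
have [d3 d30 [C3 C30 H3]] := cell_map_lip.
have [B B0 HB] := adj_bound.
have [kap kap0 [d4 /andP[d40 d41] H4]] := horner_lower detP.
pose E := m%:R * B * (C1 + C2).
have E0 : 0 <= E by rewrite !mulr_ge0 ?addr_ge0.
pose delta := Num.min (Num.min d1 d2) (Num.min (Num.min d3 d4) (kap / 2 / (E + 1))).
have E1 : 0 < E + 1 by rewrite ltr_wpDl.
have delta0 : 0 < delta by rewrite /delta !lt_min d10 d20 d30 d40 !divr_gt0.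
have [l1 l2] : delta <= d1 /\ delta <= d2 by rewrite /delta; split; rewrite !ge_min lexx ?orbT.
have [l3 l4] : delta <= d3 /\ delta <= d4 by rewrite /delta; split; rewrite !ge_min lexx ?orbT.
have l5 : delta <= kap / 2 / (E + 1) by rewrite /delta; rewrite !ge_min lexx ?orbT.
have dle1 : delta <= 1 by exact: le_trans l1 d11.
have Ea a : 0 <= a -> a <= delta -> E * a <= kap / 2.
  move=> a0 ad; have h : (E + 1) * a <= kap / 2.
    rewrite mulrC -ler_pdivlMr //; exact: le_trans ad l5.
  by apply: le_trans h; rewrite ler_wpM2r // lerDl.
have detge a : 0 < a -> a <= delta -> kap * a ^+ d <= `|\det (A a)|.
  by move=> a0 ad; rewrite det_A; apply: H4; rewrite (ltW a0) (le_trans ad).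
have kad a : 0 < a -> 0 < kap * a ^+ d by move=> a0; rewrite mulr_gt0 ?exprn_gt0.
have det0 a : 0 < a -> a <= delta -> \det (A a) != 0.
  by move=> a0 ad; rewrite -normr_gt0 (lt_le_trans (kad a a0)) // detge.
(* Of the [j > d] powers of [a], the determinant consumes [d]; one more is spent on absorbing all
   constants into the factor 1/2. *)
have cancel (a u : R) (U : 'cV[R]_m) j (C : R) : 0 < a -> a <= delta -> 0 <= C -> 0 <= u ->
    (d < j)%N -> C <= C1 + C2 -> `|U| <= C * a ^+ j * u ->
    `|(\det (A a))^-1 *: (\adj (A a) *m U)| <= 2^-1 * a ^+ (j - d.+1) * u.
  move=> a0 ad C0 u0 dj CC hU.
  apply: le_trans (newton_bound U B0 (kad a a0) (HB a _) (detge a a0 ad)) _.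
    by rewrite (ltW a0) (le_trans ad).
  have ajE : a ^+ j = a ^+ d * a * a ^+ (j - d.+1) by rewrite -exprSr -exprD subnKC.
  have h1 : m%:R * B * `|U| <= E * (a ^+ j * u).
    apply: le_trans (_ : m%:R * B * (C * a ^+ j * u) <= _); first by rewrite ler_wpM2l ?mulr_ge0.
    have -> : m%:R * B * (C * a ^+ j * u) = m%:R * B * C * (a ^+ j * u) by ring.
    rewrite ler_wpM2r ?mulr_ge0 ?exprn_ge0 ?(ltW a0) //.
    by rewrite /E ler_wpM2l ?mulr_ge0.
  rewrite mulrC ler_pdivrMr ?kad //; apply: le_trans h1 _; rewrite ajE.
  have h2 := Ea a (ltW a0) ad.
  have P0 : 0 <= a ^+ d * a ^+ (j - d.+1) * u by rewrite !mulr_ge0 ?exprn_ge0 ?(ltW a0).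
  have h3 := ler_wpM2r P0 h2.
  have e1 : E * (a ^+ d * a * a ^+ (j - d.+1) * u) = E * a * (a ^+ d * a ^+ (j - d.+1) * u).
    by ring.
  have e2 : 2^-1 * a ^+ (j - d.+1) * u * (kap * a ^+ d) =
    kap / 2 * (a ^+ d * a ^+ (j - d.+1) * u) by ring.
  by rewrite e1 e2.
have [|a|a ha e e0|xi [X1 X2]] := @fixed_point_family R m newton_map (fun a => a ^+ d.+1) delta.
- move=> a /andP[a0 ad]; have ha : 0 <= a <= d1 by rewrite (ltW a0) (le_trans ad).
  split; first exact: exprn_gt0.
  + move=> x y xr yr; rewrite newton_map_diff ?det0 // normrN.
    have := cancel a `|x - y| _ d.+1 C1 a0 ad C10 (normr_ge0 _) (ltnSn d) _ (H1 a ha x y xr yr).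
    by rewrite subnn expr0 mulr1; apply; rewrite lerDl.
  + rewrite /newton_map sub0r normrN.
    have hr : `|cell_map a 0| <= C2 * a ^+ M.+1 * 1.
      rewrite mulr1; apply/(mx_norm_leP _) => [|p j].
        by rewrite mulr_ge0 // exprn_ge0 // ltW.
      rewrite (ord1 j); apply: H2; last exact: le_trans ad dle1.
      by rewrite (ltW a0) (le_trans ad).
    have := cancel a 1 _ M.+1 C2 a0 ad C20 ler01 (leqW dM') _ hr.
    rewrite lerDr => /(_ C10) h; apply: le_trans h _.
    rewrite mulr1 mulrC ler_wpM2r ?invr_ge0 //.
    rewrite -(subnK dM2) exprD ler_piMl ?exprn_ge0 ?(ltW a0) // exprn_ile1 ?(ltW a0) //.
    exact: le_trans dle1.
- exact: exprn_continuous.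
- move: ha => /andP[a0 ad].
  pose F := (kap * a ^+ d)^-1 * (m%:R * B * C3).
  have F0 : 0 <= F by rewrite !mulr_ge0 // invr_ge0 ltW ?kad.
  have F1 : 0 < F + 1 by rewrite ltr_wpDl.
  exists (e / (F + 1)); first exact: divr_gt0.
  move=> a' x /andP[a0' ad']; rewrite ltr_pdivlMr // => aa xr fx.
  have cm0 := newton_map_fix (det0 a' a0' ad') fx.
  have xd : `|x| <= d3.
    apply: (le_trans xr); apply: (le_trans _ l3); apply: (le_trans _ ad').
    rewrite exprS ler_piMr ?(ltW a0') // exprn_ile1 ?(ltW a0') //.
    exact: le_trans ad' dle1.
  have ha3 : 0 <= a <= d3 by rewrite (ltW a0) (le_trans ad).
  have ha3' : 0 <= a' <= d3 by rewrite (ltW a0') (le_trans ad').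
  have h := H3 a a' ha3 ha3' (le_trans ad dle1) (le_trans ad' dle1) x xd.
  rewrite cm0 subr0 in h.
  have -> : newton_map a x - x = - ((\det (A a))^-1 *: (\adj (A a) *m cell_map a x)).
    by rewrite /newton_map addrAC subrr add0r.
  rewrite normrN; apply: le_trans (newton_bound _ B0 (kad a a0) (HB a _) (detge a a0 ad)) _.
    by rewrite (ltW a0) (le_trans ad).
  have h' : (kap * a ^+ d)^-1 * (m%:R * B * `|cell_map a x|) <= F * `|a - a'|.
    have -> : F * `|a - a'| = (kap * a ^+ d)^-1 * (m%:R * B * (C3 * `|a - a'|)).
      by rewrite /F; ring.
    apply: ler_wpM2l; first by rewrite invr_ge0 ltW ?kad.
    by rewrite ler_wpM2l ?mulr_ge0.
  apply: le_trans h' _; apply: le_trans (ltW aa); rewrite mulrC ler_wpM2l //.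
  by rewrite lerDl.
exists delta; first by rewrite delta0.
have zero_case : cell_map 0 0 = 0.
  apply/matrixP => p j; rewrite (ord1 j) [RHS]mxE; apply/eqP; rewrite -normr_le0.
  have := H2 0 _ ler01 p; rewrite lexx (ltW d20) => /(_ isT).
  by rewrite expr0n mulr0.
(* The contraction argument covers positive [a] only. At 0 the value is forced by the bound
   [a^(d+1)], which also gives continuity there. *)
exists (fun a => if 0 < a then xi a else 0); split=> [a /andP[a0 ad]|a /andP[a0 ad] e e0].
  case: ifPn => [a0'|]; last first.
    rewrite -leNgt => a0'; have -> : a = 0 by apply/eqP; rewrite eq_le a0 a0'.
    by rewrite normr0 expr0n.
  have [] := X1 a; first by rewrite a0'.
  by move=> h1 h2; split=> //; apply: newton_map_fix h2; exact: det0.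
case: ifPn => [a0'|]; last first.
  rewrite -leNgt => a0'; have -> : a = 0 by apply/eqP; rewrite eq_le a0 a0'.
  exists e => // a' /andP[b0 bd]; rewrite !sub0r !normrN (ger0_norm b0) => be.
  case: ifPn => [b0'|_]; last by rewrite normr0 ltW.
  have [] := X1 a'; first by rewrite b0'.
  move=> h _; apply: le_trans h _; apply: le_trans (ltW be).
  rewrite exprS ler_piMr // exprn_ile1 //; exact: le_trans bd dle1.
have [|eta eta0 h] := X2 a _ e e0; first by rewrite a0'.
exists (Num.min eta a); first by rewrite lt_min eta0.
move=> a' /andP[b0 bd]; rewrite lt_min => /andP[h1 h2].
have b0' : 0 < a'.
  by move: h2; rewrite ltr_norml => /andP[_]; lra.
by rewrite b0'; apply: h => //; rewrite b0'.
Qed.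

End Tougeron.

(** * From a formal branch to a branch over the parameter *)

Section RealBranch.
Variables (R : realType) (k m : nat) (Q : network m k) (f : dynamics R k).
Local Notation J := (jac Q (@jet R k) f).

(* A branch parametrized by [a] in [0, delta], the parameter of the coupled cell
   system being the injective function [Lam.[a]]. *)
Record real_branch (delta : R) (x : R -> 'cV[R]_m) (Lam : {poly R}) (u : 'cV[R]_m) : Prop :=
  RealBranch {
  rb_delta : 0 < delta <= 1;
  rb_zero : forall a, 0 <= a <= delta -> admissible Q f (x a) Lam.[a] = 0;
  rb_cont : forall a, 0 <= a <= delta -> forall e : R, 0 < e -> exists2 eta : R, 0 < eta &
     forall a', 0 <= a' <= delta -> `|a - a'| < eta -> `|x a - x a'| <= e;
  rb_Lam0 : Lam.[0] = 0;
  rb_inj : forall a b, 0 <= a <= delta -> 0 <= b <= delta -> Lam.[a] = Lam.[b] -> a = b;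
  rb_u : u != 0;
  rb_ker : J *m u = 0;
  rb_tangent : exists C, forall a, 0 <= a <= delta -> `|x a - a *: u| <= C * a ^+ 2;
  rb_transverse : forall l : 'rV[R]_m, l != 0 -> l *m J = 0 ->
    exists2 eta : R, 0 < eta & forall a, 0 < a < eta -> a <= delta -> l *m x a != 0 }.

Hypothesis sf : smooth f.
Hypothesis f_axis : forall t : R, f (t *: delta_mx 0 ord_max) = 0.

Let f0 : f 0 = 0. Proof. by rewrite -(f_axis 0) scale0r. Qed.

Lemma jet_axis : jet [:: ord_max] f = 0.
Proof.
rewrite /jet /= /partial /derive.
have -> : (fun h : R => h^-1 *: (f (h *: delta_mx 0 ord_max + 0) - f 0)) = (fun=> 0).
  by apply/funext => h; rewrite addr0 f_axis f0 subrr scaler0.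
exact: lim_cst.
Qed.

Section FromFormal.
Variables (d M : nat) (x : 'I_m -> fps R) (lam : fps R).
Hypothesis dM : (3 * d + 3 <= M)%N.
Hypothesis x0 : forall p, x p 0%N = 0.
Hypothesis lam0 : lam 0%N = 0.
Hypothesis eqs : forall p, feq Q (@jet R k) f M x lam p = 0.
Hypothesis lam_d : ordle lam d.
Hypothesis det_d : ordle (\det (fjac Q (@jet R k) f M x lam)) d.
Hypothesis x1 : exists p, x p 1%N != 0.
Hypothesis transv : forall l : 'rV[R]_m, l != 0 -> l *m J = 0 ->
  ordle (\sum_p fpsC (l 0 p) * x p) d.

Let yP o : {poly R} := trunc M.+1 (fenv x lam o).
Let ioP (g : dynamics R k -> R) : {poly R} := (g f)%:P.
Let ioF (g : dynamics R k -> R) : fps R := fpsC (g f).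

Let dM1 : (d < M.+1)%N. Proof. lia. Qed.
Let M_gt1 : (1 < M.+1)%N. Proof. lia. Qed.

Let yP_lowz o : lowz M.+1 (fps_of (yP o) - fenv x lam o).
Proof. by move=> i iM; rewrite fps_coefB /fps_of coef_trunc iM subrr. Qed.

Let yP0 o : (yP o)`_0 = 0.
Proof. by rewrite coef_trunc /=; case: o => [p|] /=; rewrite ?x0 ?lam0. Qed.

Let ev_fps V (v : V -> {poly R}) (e : pexp (dynamics R k -> R) V) :
  fps_of (ev ioP v e) = ev ioF (fps_of (R:=R) \o v) e.
Proof. exact: (ev_morph (fps_of (R:=R)) ioP v e). Qed.

Let dev_fps V (v w : V -> {poly R}) (e : pexp (dynamics R k -> R) V) :
  fps_of (dev ioP v w e) = dev ioF (fps_of (R:=R) \o v) (fps_of (R:=R) \o w) e.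
Proof. exact: (dev_morph (fps_of (R:=R)) ioP v w e). Qed.

Let resP p i : (i <= M)%N -> (ev ioP yP (cell_eq Q (taylor M (@jet R k)) p))`_i = 0.
Proof.
move=> iM; have h := @ev_lowz _ _ _ ioF M.+1 _ _ (cell_eq Q (taylor M (@jet R k)) p) yP_lowz.
have := h i iM; rewrite -[ev ioF (fun o => fps_of (yP o)) _]ev_fps.
by have := eqs p; rewrite /feq => ->; rewrite subr0.
Qed.

Let detP : exists2 i, (i <= d)%N &
  (\det (cell_jac Q (taylor M (@jet R k)) ioP yP))`_i != 0.
Proof.
have [i id hi] := det_d; exists i => //.
suff -> : (\det (cell_jac Q (taylor M (@jet R k)) ioP yP))`_i =
   (\det (fjac Q (@jet R k) f M x lam)) i by [].
apply/eqP; rewrite -subr_eq0; apply/eqP.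
have -> : (\det (cell_jac Q (taylor M (@jet R k)) ioP yP))`_i =
  (\det (map_mx (fps_of (R:=R)) (cell_jac Q (taylor M (@jet R k)) ioP yP))) i.
  by rewrite det_map_mx.
rewrite -fps_coefB; apply: (@lowz_det _ M.+1) (leq_ltn_trans id dM1) => p q.
rewrite !mxE dev_fps.
have -> : (fps_of (R:=R) \o (fun i0 : option 'I_m => (i0 == Some q)%:R)) = (fun o => (o == Some q)%:R).
  by apply/funext => o /=; rewrite rmorph_nat.
exact: dev_lowz yP_lowz.
Qed.

Let u : 'cV[R]_m := \col_p x p 1%N.

Let u_ker : J *m u = 0.
Proof.
apply/matrixP => p j; rewrite (ord1 j) [RHS]mxE.
have := eqs p => /(congr1 (fun g => fps_deriv g 0%N)).
rewrite /feq ev_deriv; last by move=> c; apply: fps_derivC.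
rewrite (dev_coef0 (fun g => g f)) => h.
rewrite -(@dev_cell_at0_jac R (dynamics R k) k m Q (@jet R k) f jet_axis M.-1 u (lam 1%N)).
have M0 : M.-1.+1 = M by case: (M) M_gt1.
rewrite M0; rewrite -[RHS](_ : fps_deriv (0 : fps R) 0%N = 0); last by rewrite /fps_deriv mul0rn.
rewrite -h; apply: eq_dev => -[q|] /=; rewrite ?x0 ?lam0 ?mxE /fps_deriv ?mulr1n //.
Qed.

Let X a : 'cV[R]_m := \col_p (yP (Some p)).[a].

Let admissible_cell_map a xi :
  admissible Q f (X a + xi) (yP None).[a] = cell_map Q f yP a xi.
Proof.
apply/matrixP => p j; rewrite /admissible /cell_map !mxE; congr f.
apply/matrixP => i0 i; rewrite !mxE /cell_arg {i0}.
case: (unlift ord_max i) => [j'|]; last by rewrite addr0.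
by case: (unlift ord0 _) => [l|] //; rewrite !mxE.
Qed.

Let d_gt0 : (0 < d)%N.
Proof.
case: lam_d => i id li; rewrite lt0n; apply/eqP => d0; move: id li.
by rewrite d0 leqn0 => /eqP ->; rewrite lam0 eqxx.
Qed.

Let Lam_coef : exists2 i, (i <= d)%N & (yP None)`_i != 0.
Proof.
case: lam_d => i id li; exists i => //.
by rewrite coef_trunc (leq_ltn_trans id dM1).
Qed.

(** By Rolle's theorem two equal values would produce a positive zero of the derivative, which near
    0 is bounded below by a multiple of [a^(d-1)]. *)
Let Lam_inj : exists2 delta : R, 0 < delta <= 1 & forall a b, 0 <= a <= delta ->
  0 <= b <= delta -> (yP None).[a] = (yP None).[b] -> a = b.
Proof.
have [|c c0 [delta hd H]] := @horner_lower R (yP None)^`() d.-1.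
  have [i id li] := Lam_coef; case: i id li => [|i] id li; first by rewrite yP0 eqxx in li.
  exists i; first by rewrite -ltnS prednK.
  by rewrite coef_deriv mulrn_eq0.
exists delta => //.
have W a b : 0 <= a <= delta -> 0 <= b <= delta -> a < b -> (yP None).[a] != (yP None).[b].
  move=> /andP[a0 ad] /andP[b0 bd] ab; apply/eqP => E.
  have [z /andP[/= az zb] dz] := polyrcf.poly_rolle ab E.
  have z0 : 0 < z by apply: le_lt_trans az.
  have := H z; rewrite (ltW z0) (le_trans (ltW zb) bd) dz normr0 => /(_ isT).
  by rewrite leNgt mulr_gt0 // exprn_gt0.
move=> a b ha hb E; case: (ltgtP a b) => // ab.
  by have := W a b ha hb ab; rewrite E eqxx.
by have := W b a hb ha ab; rewrite E eqxx.
Qed.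

Let X_tangent : exists2 C, 0 <= C & forall a, 0 <= a <= 1 -> `|X a - a *: u| <= C * a ^+ 2.
Proof.
have [||e _ [C C0 H]] := @uniform_constants R 'I_m (fun p _ C => forall a, 0 <= a <= 1 ->
   `|(yP (Some p)).[a] - a * x p 1%N| <= C * a ^+ 2).
- move=> p e C e' C' H _ CC a ha; apply: le_trans (H a ha) _.
  by rewrite ler_wpM2r // exprn_ge0 //; case/andP: ha.
- move=> p; exists 1 => //.
  have [|C C0 H] := @horner_bound R (yP (Some p) - x p 1%N *: 'X) 2.
    move=> [|[|//]] _; rewrite coefB coefZ coefX /=; first by rewrite yP0 mulr0 subr0.
    by rewrite mulr1 coef_trunc M_gt1 subrr.
  exists C => // a ha; have := H a ha.
  by rewrite hornerD hornerN hornerZ hornerX [a * _]mulrC.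
exists C => // a ha; have e0 : 0 <= C * a ^+ 2 by rewrite mulr_ge0 // sqr_ge0.
apply/(mx_norm_leP _ e0) => p j; rewrite (ord1 j) !mxE; exact: H.
Qed.

Lemma formal_real_branch : exists delta y Lam u, real_branch delta y Lam u.
Proof.
have [d1 /andP[d10 d11] [xi [X1 X2]]] := tougeron sf f0 dM yP0 resP detP.
have [d2 /andP[d20 d21] Linj] := Lam_inj.
have [C C0 XT] := X_tangent.
pose delta := Num.min d1 d2; pose y a := X a + xi a.
have delta0 : 0 < delta by rewrite lt_min d10.
have l1 : delta <= d1 by rewrite /delta ge_min lexx.
have l2 : delta <= d2 by rewrite /delta ge_min lexx orbT.
have in1 a : 0 <= a <= delta -> 0 <= a <= d1.
  by move=> /andP[-> ad]; exact: le_trans l1.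
have le1 a : 0 <= a <= delta -> 0 <= a <= 1.
  by move=> /in1/andP[-> ad]; exact: le_trans d11.
exists delta, y, (yP None), u; split.
- by rewrite delta0 (le_trans l1).
- by move=> a /in1/X1[_ h]; rewrite admissible_cell_map.
- move=> a ha e e0; have e2 : 0 < e / 2 by rewrite divr_gt0.
  have [eta1 eta10 h1] := X2 a (in1 a ha) (e / 2) e2.
  have [||_ _ [D D0 HD]] := @uniform_constants R 'I_m (fun p _ C => forall a b,
     0 <= a <= 1 -> 0 <= b <= 1 ->
     `|(yP (Some p)).[a] - (yP (Some p)).[b]| <= C * `|a - b|).
  + move=> p r D r' D' H _ DD a' b ha' hb; apply: le_trans (H a' b ha' hb) _.
    by rewrite ler_wpM2r.
  + by move=> p; exists 1 => //; exact: horner_lipschitz.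
  have D1 : 0 < D + 1 by rewrite ltr_wpDl.
  exists (Num.min eta1 (e / 2 / (D + 1))); first by rewrite lt_min eta10 divr_gt0.
  move=> a' ha'; rewrite lt_min => /andP[aa1 aa2].
  have -> : y a - y a' = (X a - X a') + (xi a - xi a') by rewrite /y opprD addrACA.
  rewrite (le_trans (ler_normD _ _)) // [leRHS]splitr lerD //; last first.
    by apply: h1 => //; exact: in1.
  apply/(mx_norm_leP _ (ltW e2)) => p j; rewrite (ord1 j) !mxE.
  apply: le_trans (HD p a a' (le1 a ha) (le1 a' ha')) _.
  move: aa2; rewrite ltr_pdivlMr // => aa2; apply: le_trans (ltW aa2).
  by rewrite mulrC ler_wpM2l // lerDl.
- by rewrite horner_coef0 yP0.
- by move=> a b /andP[a0 ad] /andP[b0 bd]; apply: Linj; rewrite ?a0 ?b0 /=; exact: le_trans l2.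
- have [p xp] := x1; apply: contraNneq xp => /matrixP/(_ p 0); rewrite !mxE => -> //.
- exact: u_ker.
- exists (C + 1) => a ha; have -> : y a - a *: u = (X a - a *: u) + xi a by rewrite /y addrAC.
  rewrite (le_trans (ler_normD _ _)) // mulrDl lerD ?XT ?le1 // mul1r.
  have [h _] := X1 a (in1 a ha); apply: le_trans h _.
  have /andP[a0 a1] := le1 a ha.
  have d2' : (2 <= d.+1)%N by [].
  by rewrite -(subnK d2') exprD ler_piMl ?exprn_ge0 // exprn_ile1.
- move=> l l0 lJ; have [i id hi] := transv l0 lJ.
  (* The pairing of [l] with the truncated branch is at least of size [a^d]; the correction [xi] is
     of size [a^(d+1)] and cannot cancel it. *)
  pose P : {poly R} := \sum_p l 0 p *: yP (Some p).
  have [|c c0 [d3 /andP[d30 _] H]] := @horner_lower R P d.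
    exists i => //; apply: contra_neq hi => hi.
    rewrite fps_coef_sum -[RHS]hi coef_sum; apply: eq_bigr => p _.
    by rewrite fps_coefCM coefZ coef_trunc (leq_ltn_trans id dM1).
  pose S := \sum_p `|l 0 p|; have S0 : 0 <= S by exact: sumr_ge0.
  have S1 : 0 < S + 1 by rewrite ltr_wpDl.
  exists (Num.min d3 (c / (S + 1))); first by rewrite lt_min d30 divr_gt0.
  move=> a /andP[a0]; rewrite lt_min => /andP[ad3]; rewrite ltr_pdivlMr // => ac ad.
  have ha : 0 <= a <= delta by rewrite (ltW a0).
  apply/eqP => /matrixP/(_ 0 0); rewrite mulmxDr [RHS]mxE [LHS]mxE.
  have -> : (l *m X a) 0 0 = P.[a].
    by rewrite mxE horner_sum; apply: eq_bigr => p _; rewrite !mxE hornerZ.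
  move=> E; have h1 : c * a ^+ d <= `|P.[a]| by apply: H; rewrite !ltW.
  have h2 : `|(l *m xi a) 0 0| <= S * a ^+ d.+1.
    rewrite mxE (le_trans (ler_norm_sum _ _ _)) // mulr_suml; apply: ler_sum => p _.
    rewrite normrM ler_wpM2l // (le_trans (mx_norm_coord _ _ _)) //.
    by have [] := X1 a (in1 a ha).
  have h3 : S * a ^+ d.+1 < c * a ^+ d.
    rewrite exprS mulrA ltr_pM2r ?exprn_gt0 //; apply: le_lt_trans ac.
    by rewrite mulrC ler_wpM2l ?(ltW a0) // lerDl.
  have E' : P.[a] = - (l *m xi a) 0 0 by apply/eqP; rewrite -addr_eq0 E.
  by move: h1; rewrite E' normrN => h1; move: (le_lt_trans (le_trans h1 h2) h3); rewrite ltxx.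
Qed.

End FromFormal.

Lemma real_branch_of_formal : formal_branch Q (@jet R k) f ->
  exists delta y Lam u, real_branch delta y Lam u.
Proof.
move=> [d [M [x [lam [dM [x0 lam0] eqs [lam_d det_d] [x1 tr]]]]]].
exact: formal_real_branch dM x0 lam0 eqs lam_d det_d x1 tr.
Qed.

End RealBranch.

Section PolynomialInverse.
Variables (R : realType) (Lam : {poly R}) (delta : R).
Hypothesis delta0 : 0 < delta.
Hypothesis Linj : forall a b, 0 <= a <= delta -> 0 <= b <= delta ->
  Lam.[a] = Lam.[b] -> a = b.

Let inI a : (a \in `[0, delta]) = (0 <= a <= delta).
Proof. by rewrite in_itv. Qed.

Let Lcont : {within `[0, delta], continuous (horner Lam)}.
Proof. by apply: continuous_subspaceT => a; apply: continuous_horner. Qed.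

Let Linj' : {in `[0, delta] &, injective (horner Lam)}.
Proof. by move=> a b; rewrite !inI; exact: Linj. Qed.

Definition param_range : set R := [set t | exists2 a, 0 <= a <= delta & t = Lam.[a]].

Lemma param_rangeE : param_range = [set` (horner Lam) @`[0, delta]].
Proof.
rewrite -(continuous_inj_image_segment (ltW delta0) Lcont Linj').
apply/seteqP; split=> t /= [a ha].
  by move=> ->; exists a => //=; rewrite inI.
by move=> <-; exists a => //; move: ha; rewrite /= inI.
Qed.

Lemma param_inverse : exists g : R -> R, (forall a, 0 <= a <= delta -> g Lam.[a] = a) /\
  forall t, param_range t -> forall e : R, 0 < e -> exists2 eta : R, 0 < eta &
    forall t', param_range t' -> `|t - t'| < eta -> `|g t - g t'| < e.
Proof.
have [g gP] : {g : R -> R & forall t, param_range t -> 0 <= g t <= delta /\ t = Lam.[g t]}.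
  apply: (@choice _ _ (fun t a => param_range t -> 0 <= a <= delta /\ t = Lam.[a])) => t.
  by have [[a ha E]|nt] := pselect (param_range t); [exists a|exists 0].
have gK a : 0 <= a <= delta -> g Lam.[a] = a.
  move=> ha; have [|h1 h2] := gP Lam.[a]; first by exists a.
  by apply: Linj.
exists g; split=> // t Tt e e0.
have cg : {within [set` (horner Lam) @`[0, delta]], continuous g}.
  by apply: segment_can_continuous (ltW delta0) Lcont _ => a; rewrite inI; exact: gK.
move: cg; rewrite -param_rangeE => /subspace_continuousP/(_ t Tt)/cvgrPdist_lt/(_ e e0).
rewrite near_withinE => /nbhs_normP[eta /= eta0 H].
by exists eta => // t' Tt' tt'; apply: H.
Qed.

(** An injective continuous function on a segment is monotone. Hence every shrunken region of
    parameters still contains a full interval of amplitudes starting at 0. *)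
Lemma param_between a b : 0 <= a <= delta -> 0 <= b <= a -> forall E : set R,
  connected E -> E Lam.[0] -> E Lam.[a] -> E Lam.[b].
Proof.
move=> /andP[a0 ad] /andP[b0 ba] E /connected_intervalP IE E0 Ea.
have z0 : 0 \in `[0, delta] by rewrite inI lexx ltW.
have ai : a \in `[0, delta] by rewrite inI a0.
have bi : b \in `[0, delta] by rewrite inI b0 (le_trans ba).
have [mono|mono] := itv_continuous_inj_mono Lcont Linj'.
  by apply: IE E0 Ea _ _; rewrite !(le_mono_in mono) // b0.
by apply: IE Ea E0 _ _; rewrite !(le_nmono_in mono) // b0 ba.
Qed.

End PolynomialInverse.

Section SynchronyIntersection.
Variables (R : realType) (n k : nat) (N : network n k).
Implicit Types D : set 'cV[R]_n.

Lemma synchronyI D D' : synchrony N D -> synchrony N D' -> synchrony N (D `&` D').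
Proof.
move=> [[e ->] i1] [[e' ->] i2]; split.
  exists (fun i j => e i j || e' i j); apply/seteqP; split=> x /=.
    by move=> [h1 h2] i j /orP[/h1|/h2].
  by move=> h; split=> i j eij; apply: h; rewrite eij ?orbT.
by move=> f sf x t [/i1 h1 /i2 h2]; split; [exact: h1|exact: h2].
Qed.

(** Applied to the tangent vector of a branch: if the branch stays in [D], then so does its tangent,
    by rescaling and passing to the limit. *)
Lemma polydiagonal_closed D (w : 'cV[R]_n) : polydiagonal D ->
  (forall e : R, 0 < e -> exists2 a, 0 < a & exists2 y, D y & `|y - a *: w| <= e * a) -> D w.
Proof.
move=> [e ->] H i j eij /=.
apply/eqP; rewrite -subr_eq0 -normr_le0; apply/ler_addgt0Pr => r r0; rewrite add0r.
have [a a0 [y Dy yw]] := H (r / 2) (divr_gt0 r0 (ltr0Sn R 1)).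
have B p : `|y p 0 - a * w p 0| <= r / 2 * a.
  by have := le_trans (mx_norm_coord (y - a *: w) p 0) yw; rewrite !mxE.
have E : a * (w i 0 - w j 0) = (y j 0 - a * w j 0) - (y i 0 - a * w i 0).
  by rewrite (Dy i j eij); ring.
rewrite -(ler_pM2l a0) -{1}(gtr0_norm a0) -normrM E (le_trans (ler_normB _ _)) //.
by have := B i; have := B j; lra.
Qed.

End SynchronyIntersection.

Section BranchWithSynchrony.
Variables (R : realType) (n k m : nat) (N : network n k) (Q : network m k).
Variables (D : set 'cV[R]_n) (c : 'I_n -> 'I_m) (f : dynamics R k).
Hypothesis qD : quotient_network N D Q c.
Hypothesis sD : synchrony N D.

Lemma admissible_sync_incl (y : 'cV[R]_m) t :
  admissible N f (sync_incl c y) t = sync_incl c (admissible Q f y t).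
Proof.
have [_ _ Qc] := qD; apply/matrixP => i j; rewrite /admissible /sync_incl !mxE; congr f.
apply/matrixP => a b; rewrite !mxE; case: (unlift ord_max b) => // j'.
by case: (unlift ord0 j') => [l|]; rewrite ?mxE ?Qc.
Qed.

Lemma sync_incl_inj : injective (sync_incl c : 'cV[R]_m -> 'cV[R]_n).
Proof.
have [cs _ _] := qD; move=> x y /matrixP h; apply/matrixP => q j; rewrite (ord1 j).
by have [i <-] := cs q; have := h i 0; rewrite !mxE.
Qed.

Lemma sync_inclB (x y : 'cV[R]_m) :
  sync_incl c (x - y) = sync_incl c x - sync_incl c y.
Proof. by apply/matrixP => i j; rewrite !mxE. Qed.

Lemma sync_inclZ (a : R) (x : 'cV[R]_m) : sync_incl c (a *: x) = a *: sync_incl c x.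
Proof. by apply/matrixP => i j; rewrite !mxE. Qed.

Lemma sync_incl_norm (x : 'cV[R]_m) : `|sync_incl c x| <= `|x|.
Proof. by apply/(mx_norm_leP _ (normr_ge0 x)) => i j; rewrite mxE mx_norm_coord. Qed.

Variables (delta : R) (x : R -> 'cV[R]_m) (Lam : {poly R}) (u v1 : 'cV[R]_m).
Variable l0 : 'rV[R]_m.
Local Notation J := (jac Q (@jet R k) f).
Hypothesis rb : real_branch Q f delta x Lam u.
Hypothesis ker1 : forall y, J *m y = 0 -> exists a, y = a *: v1.
Hypothesis l00 : l0 != 0.
Hypothesis l0J : l0 *m J = 0.
Hypothesis l0_sub : forall D', synchrony N D' -> D' `<` D -> D' (sync_incl c v1) ->
  forall y, D' (sync_incl c y) -> l0 *m y = 0.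

Lemma branch_with_synchrony : has_branch_with_synchrony N f D.
Proof.
have /andP[d0 d1] := rb_delta rb.
have Linj := rb_inj rb.
have [g [gK gc]] := param_inverse d0 Linj.
have [C HC] := rb_tangent rb.
have gT t : param_range Lam delta t -> 0 <= g t <= delta /\ Lam.[g t] = t.
  by move=> [a ha ->]; rewrite gK.
have z0 : 0 <= (0 : R) <= delta by rewrite lexx ltW.
have x0 : x 0 = 0.
  apply/eqP; rewrite -normr_le0; have := HC 0 z0.
  by rewrite expr0n mulr0 scale0r subr0.
have T0 : param_range Lam delta 0 by exists 0 => //; rewrite (rb_Lam0 rb).
have g0 : g 0 = 0 by rewrite -[in LHS](rb_Lam0 rb) gK.
pose b t := sync_incl c (x (g t)).
have Tcon : connected (param_range Lam delta).
  rewrite (param_rangeE d0 Linj); apply/connected_intervalP.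
  exact: interval_is_interval.
have T1 : exists2 t, param_range Lam delta t & t != 0.
  exists Lam.[delta]; first by exists delta => //; rewrite lexx ltW.
  apply/eqP => E; have hd : 0 <= delta <= delta by rewrite lexx ltW.
  have E' : delta = 0 by apply: (Linj _ _ hd z0); rewrite (rb_Lam0 rb).
  by move: d0; rewrite E' ltxx.
exists (param_range Lam delta), b; split; first by split.
move=> T' T'T rT'; have [conT' T'0 [t0 T't0 t00]] := rT'.
have [ha0 Lt0] := gT t0 (T'T _ T't0); set a0 := g t0 in ha0 Lt0.
have a0_gt0 : 0 < a0.
  have /andP[] := ha0; rewrite le_eqVlt => /predU1P[E|//] _.
  by move: t00; rewrite -Lt0 -E (rb_Lam0 rb) eqxx.
have small a : 0 <= a <= a0 -> T' Lam.[a] /\ 0 <= a <= delta.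
  move=> ha; split; last first.
    by have /andP[-> h] := ha; have /andP[_ h'] := ha0; exact: le_trans h h'.
  apply: (param_between d0 Linj ha0 ha) => //; first by rewrite (rb_Lam0 rb).
  by rewrite Lt0.
have bL a : 0 <= a <= a0 -> b Lam.[a] = sync_incl c (x a).
  by move=> ha; have [_ h] := small a ha; rewrite /b gK.
have u0 : 0 < `|u| by rewrite normr_gt0 (rb_u rb).
have tang (e : R) : 0 < e -> exists2 a, 0 < a <= a0 & `|x a - a *: u| <= e * a.
  move=> e0; pose C1 := Num.max C 1.
  have C10 : 0 < C1 by rewrite lt_max ltr01 orbT.
  exists (Num.min a0 (e / C1)).
    by rewrite lt_min a0_gt0 divr_gt0 //= ge_min lexx.
  set a := Num.min _ _; have ha : 0 <= a <= a0.
    by rewrite /a ge_min lexx le_min (ltW a0_gt0) (ltW (divr_gt0 e0 C10)).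
  have [_ hd] := small a ha; apply: le_trans (HC a hd) _.
  have /andP[a_ge0 _] := ha.
  rewrite expr2 mulrA ler_wpM2r // (@le_trans _ _ (C1 * a)) //.
    by rewrite ler_wpM2r // le_max lexx.
  by rewrite mulrC -ler_pdivlMr // /a ge_min lexx orbT.
split.
- split=> //.
  + apply/subspace_continuousP => t Tt; apply/cvgrPdist_le => e e0.
    have [hg Lg] := gT t (T'T _ Tt).
    have [eta eta0 H] := rb_cont rb hg e0.
    have [eta' eta'0 H'] := gc t (T'T _ Tt) eta eta0.
    rewrite near_withinE; apply/nbhs_normP; exists eta' => //= t' tt' Tt'.
    have [hg' _] := gT t' (T'T _ Tt').
    have -> : b t - b t' = sync_incl c (x (g t) - x (g t')).
      by rewrite sync_inclB.
    apply: le_trans (sync_incl_norm _) _; apply: H => //.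
    exact: H' (T'T _ Tt') tt'.
  + by rewrite /b g0 x0; apply/matrixP => i j; rewrite !mxE.
  + have [a /andP[a_gt0 aa0] ha] := tang (`|u| / 2) (divr_gt0 u0 (ltr0Sn R 1)).
    have ha' : 0 <= a <= a0 by rewrite ltW.
    exists Lam.[a]; first by have [] := small a ha'.
    rewrite bL //; apply/eqP => E; have xa0 : x a = 0.
      by apply: sync_incl_inj; rewrite E; apply/matrixP => i j; rewrite !mxE.
    move: ha; rewrite xa0 sub0r normrN normrZ gtr0_norm // mulrC ler_pM2r //.
    by lra.
  + move=> t Tt; have [hg Lg] := gT t (T'T _ Tt).
    have hz := rb_zero rb hg; rewrite Lg in hz; rewrite /b admissible_sync_incl hz.
    by apply/matrixP => i j; rewrite !mxE.
- have [_ DE _] := qD.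
  split=> //; first by move=> _ [t _ <-]; rewrite DE /b; exists (x (g t)).
  move=> D' sD' bD'; apply: contrapT => nDD'.
  (* The left kernel is known to annihilate only subspaces strictly inside [D], so an arbitrary
     competitor [D'] is first intersected with [D]. *)
  have sub : (D `&` D') `<` D.
    by split; [exact: subIsetl|move=> h; apply: nDD' => z /h[]].
  have sDD := synchronyI sD sD'.
  have inD a : 0 <= a <= a0 -> (D `&` D') (sync_incl c (x a)).
    move=> ha; split; first by rewrite DE; exists (x a).
    by rewrite -bL //; apply: bD'; exists Lam.[a] => //; have [] := small a ha.
  have [s uE] := ker1 (rb_ker rb).
  have s0 : s != 0 by apply: contraNneq (rb_u rb) => s0; rewrite uE s0 scale0r.
  have Du : (D `&` D') (sync_incl c u).
    apply: polydiagonal_closed; first by case: sDD.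
    move=> e e0; have [a /andP[a_gt0 aa0] ha] := tang e e0; exists a => //.
    exists (sync_incl c (x a)); first by apply: inD; rewrite ltW.
    apply: le_trans ha; apply: le_trans (sync_incl_norm _).
    by rewrite sync_inclB sync_inclZ.
  have Dv : (D `&` D') (sync_incl c v1).
    have -> : sync_incl c v1 = s^-1 *: sync_incl c u.
      by rewrite uE sync_inclZ scalerA mulVf // scale1r.
    have [[e DDE] _] := sDD; move: Du; rewrite DDE => Du i j eij.
    by have := Du i j eij; rewrite !mxE => ->.
  have [eta eta0 H] := rb_transverse rb l00 l0J.
  pose a := Num.min a0 (eta / 2).
  have ha : 0 < a <= a0 by rewrite /a ge_min lexx lt_min a0_gt0 divr_gt0.
  have ha' : 0 <= a <= a0 by have /andP[/ltW -> ->] := ha.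
  have [_ /andP[_ ad]] := small a ha'.
  have := H a _ ad; rewrite (l0_sub sDD sub Dv (inD a ha')) eqxx.
  have /andP[-> _] := ha; rewrite /a; move=> /(_ _)/negP; apply => //.
  by rewrite gt_min; apply/orP; right; rewrite ltr_pdivrMr // ltr_pMr // ltr1n.
Qed.

End BranchWithSynchrony.

(** * Generic conditions *)

Section Nondegeneracy.
Import (canonicals) mpoly.
Variables (R : realType) (k : nat).
Implicit Types (f g h : dynamics R k) (Th : dynamics R k -> R).
Local Notation jt := (@jet R k).

Definition free_jet (s : seq 'I_k.+2) : Prop := s <> [::] /\ s <> [:: ord0].
Notation PF := (polyfun jt free_jet).

(** The number of variables is quantified after the expression: any indexing that covers the
    derivatives in [s0] will do, so two subexpressions can be put over a common indexing. *)
Lemma polyfun_mpoly Th : PF Th -> exists s0 : seq (seq 'I_k.+2),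
  (forall s, s \in s0 -> free_jet s) /\
  forall n (idx : 'I_n -> seq 'I_k.+2), (forall s, s \in s0 -> exists i, idx i = s) ->
    exists p : mpoly.mpoly n R, forall f, mpoly.meval (fun i => partials (idx i) f 0) p = Th f.
Proof.
elim=> [c|s fs|g h _ [s1 [f1 H1]] _ [s2 [f2 H2]]|g h _ [s1 [f1 H1]] _ [s2 [f2 H2]]].
- by exists [::]; split=> // n idx _; exists (mpoly.mpolyC n c) => f; rewrite mpoly.mevalC.
- exists [:: s]; split=> [x|n idx H]; first by rewrite inE => /eqP ->.
  have [|i si] := H s; first by rewrite inE.
  exists (mpoly.mpolyX R (mpoly.mnm1 i)) => f; rewrite mpoly.mevalXU si //.
- exists (s1 ++ s2); split=> [x|n idx H]; first by rewrite mem_cat => /orP[/f1|/f2].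
  have [|p1 E1] := H1 n idx; first by move=> s hs; apply: H; rewrite mem_cat hs.
  have [|p2 E2] := H2 n idx; first by move=> s hs; apply: H; rewrite mem_cat hs orbT.
  by exists (p1 + p2) => f; rewrite mpoly.mevalD E1 E2.
- exists (s1 ++ s2); split=> [x|n idx H]; first by rewrite mem_cat => /orP[/f1|/f2].
  have [|p1 E1] := H1 n idx; first by move=> s hs; apply: H; rewrite mem_cat hs.
  have [|p2 E2] := H2 n idx; first by move=> s hs; apply: H; rewrite mem_cat hs orbT.
  by exists (p1 * p2) => f; rewrite mpoly.mevalM E1 E2.
Qed.

Lemma polyfun_nondeg Th : PF Th -> exists C : nondeg_cond R k, forall f, nondeg C f <-> Th f != 0.
Proof.
move=> /polyfun_mpoly[s0 [fs0 H]]; pose idx (i : 'I_(size s0)) := nth [::] s0 i.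
have [|p E] := H _ idx.
  move=> s hs; have hi : (index s s0 < size s0)%N by rewrite index_mem.
  by exists (Ordinal hi); rewrite /idx /= nth_index.
have P i : idx i != [::] /\ idx i != [:: ord0].
  by have [h1 h2] := fs0 (idx i) (mem_nth _ (ltn_ord i)); split; apply/eqP.
by exists (NondegCond p P) => f; rewrite /nondeg /= E.
Qed.

Lemma nondeg_polyfun (C : nondeg_cond R k) : exists2 Th, PF Th &
  forall f, nondeg C f <-> Th f != 0.
Proof.
case: C => n idx p P.
exists (fun f => mpoly.meval (fun i => partials (idx i) f 0) p); last by [].
rewrite (_ : (fun f => _) = (fun f => \sum_(m <- mpoly.msupp p)
   mpoly.mcoeff m p * \prod_i (jt (idx i) f) ^+ mpoly.fun_of_multinom m i)); last first.
  by apply/funext => f; rewrite mpoly.mevalE.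
apply: pf_sum => m; apply: pf_mul; first exact: pf_const.
apply: pf_prod => i; apply: pf_exp; apply: pf_jet.
by have [/eqP h1 /eqP h2] := P i.
Qed.

Lemma jet_lin s f g (t : R) : smooth f -> smooth g ->
  jt s (fun x => f x + t * g x) = jt s f + t * jt s g.
Proof. by move=> sf sg; rewrite /jet partials_lin. Qed.

Lemma polyfun_line (A : seq 'I_k.+2 -> Prop) Th f g : polyfun jt A Th -> smooth f -> smooth g ->
  exists p : {poly R}, forall t, Th (fun x => f x + t * g x) = p.[t].
Proof.
move=> HT sf sg.
elim: HT => [c|s _|Th1 Th2 _ [p1 E1] _ [p2 E2]|Th1 Th2 _ [p1 E1] _ [p2 E2]].
- by exists c%:P => t; rewrite hornerC.
- exists ((jt s f)%:P + (jt s g) *: 'X) => t.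
  by rewrite jet_lin // hornerD hornerC hornerZ hornerX mulrC.
- by exists (p1 + p2) => t; rewrite hornerD E1 E2.
- by exists (p1 * p2) => t; rewrite hornerM E1 E2.
Qed.

Lemma small_nonroot (p : {poly R}) (e : R) : p != 0 -> 0 < e ->
  exists2 t, 0 < t < e & p.[t] != 0.
Proof.
move=> p0 e0; have [|c c0 [d /andP[d0 _] H]] := @horner_lower R p (size p).-1.
  by exists (size p).-1 => //; rewrite -lead_coefE lead_coef_eq0.
pose t := Num.min d (e / 2).
have t0 : 0 < t by rewrite lt_min d0 divr_gt0.
exists t; first by rewrite t0 gt_min ltr_pdivrMr // ltr_pMr // ltr1n orbT.
rewrite -normr_gt0; apply: lt_le_trans (H t _); first by rewrite mulr_gt0 // exprn_gt0.
by rewrite (ltW t0) /t ge_min lexx.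
Qed.

(** Each condition has its own witness in [S], so that two lists of conditions can simply be
    concatenated. *)
Lemma generic_and (S : set (dynamics R k)) (P P' : dynamics R k -> Prop) :
  generic S P -> generic S P' -> generic S (fun f => P f /\ P' f).
Proof.
move=> [r [C [c H]]] [r' [C' [c' H']]].
exists (r + r')%N, (fun i => match fintype.split i with inl a => C a | inr b => C' b end); split.
  by move=> i; case: (fintype.split i) => a; [exact: c|exact: c'].
move=> f Sf hf; split; [apply: H => // i|apply: H' => // i].
  by have := hf (lshift r' i); rewrite (unsplitK (inl i)).
by have := hf (rshift r i); rewrite (unsplitK (inr i)).
Qed.

Lemma genericT (S : set (dynamics R k)) (P : dynamics R k -> Prop) :
  (forall f, S f -> P f) -> generic S P.
Proof. by move=> H; exists 0%N, (fun i : 'I_0 => False_rect _ (notF (ltn_ord i))); split=> [[]|f /H]. Qed.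

Lemma generic_sub (S : set (dynamics R k)) (P P' : dynamics R k -> Prop) :
  (forall f, S f -> P f -> P' f) -> generic S P -> generic S P'.
Proof.
by move=> PP [r [C [c H]]]; exists r, C; split=> // f Sf hf; apply: PP (H f Sf hf).
Qed.

Lemma generic_forall (S : set (dynamics R k)) (I : finType) (P : I -> dynamics R k -> Prop) :
  (forall i, generic S (P i)) -> generic S (fun f => forall i, P i f).
Proof.
move=> H; suff : generic S (fun f => forall i, i \in enum I -> P i f).
  by apply: generic_sub => f _ h i; apply: h; rewrite mem_enum.
elim: (enum I) => [|i s IH]; first exact: genericT.
apply: generic_sub (generic_and (H i) IH) => f _ [h1 h2] j.
by rewrite inE => /predU1P[->|/h2].
Qed.

End Nondegeneracy.

Section GenericOneJets.
Variables (R : realType) (k : nat).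
Implicit Types (f g h : dynamics R k) (Th : dynamics R k -> R) (a b : 'rV[R]_k.+1).
Local Notation jt := (@jet R k).
Notation PF := (polyfun jt (@free_jet k)).

Definition lin_dyn a : dynamics R k :=
  pfun (psumv (fun i => if unlift ord_max i is Some l then a 0 l else 0) (enum 'I_k.+2)).

Lemma smooth_lin_dyn a : smooth (lin_dyn a).
Proof. exact: smooth_pfun. Qed.

Lemma lin_dynE a x : lin_dyn a x = \sum_i (if unlift ord_max i is Some l then a 0 l else 0) * x 0 i.
Proof. by rewrite /lin_dyn pfun_psumv big_enum. Qed.

Lemma lin_dyn_lin a b t : lin_dyn (a + t *: b) = (fun x => lin_dyn a x + t * lin_dyn b x).
Proof.
apply/funext => x; rewrite !lin_dynE mulr_sumr -big_split; apply: eq_bigr => i _ /=.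
by case: unlift => [l|]; rewrite ?mxE; ring.
Qed.

Lemma lin_dyn_axis a (t : R) : lin_dyn a (t *: delta_mx 0 ord_max) = 0.
Proof.
rewrite lin_dynE big1 // => i _; rewrite !mxE /=.
case: (unliftP ord_max i) => [l ->|_]; last by rewrite mul0r.
by rewrite eq_sym (negbTE (neq_lift _ _)) !mulr0.
Qed.

Lemma partial_lin_dyn a i : partial i (lin_dyn a) =
  (fun=> if unlift ord_max i is Some l then a 0 l else 0).
Proof.
by rewrite partial_pfun; apply/funext => x; rewrite pfun_pder_psumv.
Qed.

Lemma jet_lin_dyn a (s : seq 'I_k.+2) : jt s (lin_dyn a) =
  if s is [:: i] then (if unlift ord_max i is Some l then a 0 l else 0) else 0.
Proof.
elim/last_ind: s => [|s i _].
  by rewrite /jet /= -(lin_dyn_axis a 0) scale0r.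
rewrite /jet -cats1 partials_cat /= partial_lin_dyn.
set c := (if unlift ord_max i is Some l then a 0 l else 0).
case: s => [//|i1 s] /=.
have -> : partials s ((fun=> c) : dynamics R k) = (fun=> (if s is [::] then c else 0)).
  elim: s => [//|j s /= ->]; exact: (partial_pfun j (PCst _)).
have -> d : partial i1 ((fun=> d) : dynamics R k) = (fun=> 0).
  exact: (partial_pfun i1 (PCst d)).
by case: s.
Qed.

Lemma jet1E f l : jet1 f 0 l = jt [:: lift ord_max l] f.
Proof. by rewrite mxE. Qed.

Lemma jet1_add f g (t : R) : smooth f -> smooth g ->
  jet1 (fun x => f x + t * g x) = jet1 f + t *: jet1 g.
Proof.
by move=> sf sg; apply/matrixP => i l; rewrite (ord1 i) [RHS]mxE [X in _ + X]mxE !jet1E jet_lin.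
Qed.

Lemma jet1_lin_dyn a : jet1 (lin_dyn a) = a.
Proof. by apply/matrixP => i l; rewrite (ord1 i) jet1E jet_lin_dyn liftK. Qed.

(** All derivatives other than the first ones are frozen at those of [g], which makes a polynomial
    condition on the jet a function of the 1-jet alone. *)
Definition set_jet1 g a : dynamics R k := fun x => g x + 1 * lin_dyn (a - jet1 g) x.

Lemma smooth_set_jet1 g a : smooth g -> smooth (set_jet1 g a).
Proof. by move=> sg; exact: (smooth_lin _ sg (smooth_lin_dyn _)). Qed.

Lemma jet1_set_jet1 g a : smooth g -> jet1 (set_jet1 g a) = a.
Proof.
move=> sg; rewrite (jet1_add _ sg (smooth_lin_dyn _)).
by rewrite jet1_lin_dyn scale1r addrC subrK.
Qed.

Lemma polyfun_set_jet1 Th g : PF Th -> smooth g -> PF (fun f => Th (set_jet1 g (jet1 f))).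
Proof.
move=> HT sg; elim: HT => [c|s [s0 s1]|? ? _ h1 _ h2|? ? _ h1 _ h2].
- exact: pf_const.
- rewrite (_ : (fun f => _) = (fun f => jt s g + (if s is [:: i] then
     (if unlift ord_max i is Some l then jt s f - jt s g else 0) else 0))); last first.
    apply/funext => f; rewrite (jet_lin _ _ sg (smooth_lin_dyn _)) mul1r jet_lin_dyn.
    congr (_ + _); case: s s0 s1 => [//|i [|//]] _ _.
    by case: (unliftP ord_max i) => [l ->|//]; rewrite !mxE.
  apply: pf_add; first exact: pf_const.
  case: s s0 s1 => [//|i [|j s]] s0 s1; last exact: pf_const.
  case: unlift => [l|]; last exact: pf_const.
  by apply: pf_add; [exact: pf_jet|exact: pf_const].
- exact: pf_add.
- exact: pf_mul.
Qed.

Lemma set_jet1_shift Th g a (t : R) : PF Th -> smooth g ->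
  Th (set_jet1 g (a + t *: delta_mx 0 ord0)) = Th (set_jet1 g a).
Proof.
move=> HT sg; elim: HT => [//|s [s0 s1]|? ? _ h1 _ h2|? ? _ h1 _ h2].
- rewrite !(jet_lin _ _ sg (smooth_lin_dyn _)) !mul1r !jet_lin_dyn.
  congr (_ + _); case: s s0 s1 => [//|i [|//]] _ s1.
  case: (unliftP ord_max i) => [l il|//]; rewrite !mxE eqxx /=.
  case: eqP => [l0|_]; last by rewrite mulr0 addr0.
  by case: s1; rewrite il l0; congr [:: _]; apply/val_inj.
- by rewrite h1 h2.
- by rewrite h1 h2.
Qed.

(** On the segment between a witness for some of the conditions and one for the next, each condition
    is a polynomial that is nonzero at one end; some point of the segment avoids all their roots. *)
Lemma common_witness (S : set (dynamics R k)) r (Th : 'I_r -> dynamics R k -> R) :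
  (forall i, PF (Th i)) -> (forall f, S f -> smooth f) ->
  (forall f g (t : R), S f -> S g -> S (fun x => f x + t * (g x + -1 * f x))) ->
  (exists f, S f) -> (forall i, exists2 f, S f & Th i f != 0) ->
  exists2 f, S f & forall i, Th i f != 0.
Proof.
move=> HP Ss Sl Sne HS; suff : exists2 f, S f & forall i, i \in enum 'I_r -> Th i f != 0.
  by move=> [f Sf h]; exists f => // i; apply: h; rewrite mem_enum.
elim: (enum 'I_r) => [|i s [f Sf hf]]; first by have [f Sf] := Sne; exists f.
have [g Sg hg] := HS i.
have sd : smooth (fun x => g x + -1 * f x) by apply: smooth_lin; exact: Ss.
pose line t : dynamics R k := fun x => f x + t * (g x + -1 * f x).
have l0 : line 0 = f by apply/funext => x; rewrite /line mul0r addr0.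
have l1 : line 1 = g by apply/funext => x; rewrite /line; ring.
have [P hP] : exists P : 'I_r -> {poly R}, forall j t, Th j (line t) = (P j).[t].
  have /choice[P hP] : forall j, exists p : {poly R}, forall t, Th j (line t) = p.[t].
    by move=> j; apply: polyfun_line (HP j) (Ss f Sf) sd.
  by exists P.
have nz : \prod_(j <- i :: s) P j != 0.
  rewrite big_cons mulf_neq0 //.
    by apply: contraNneq hg => h; rewrite -l1 hP h horner0.
  rewrite prodf_seq_neq0; apply/allP => j js /=.
  by apply: contraNneq (hf j js) => h; rewrite -l0 hP h horner0.
have [t _ ht] := small_nonroot nz ltr01.
exists (line t); first exact: Sl.
move=> j js; rewrite hP; apply: contraNneq ht => h.
by rewrite horner_prod (big_rem j) //= h mul0r.
Qed.

(** The given conditions may involve higher derivatives even though [P] does not. Freezing these at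
    a common witness leaves the function [Psi] of the 1-jet; as no condition involves [f_0], it is
    invariant under shifts of the first coordinate. *)
Lemma generic_jet1 (P : 'rV[R]_k.+1 -> Prop) :
  generic (@smooth R k) (fun f => P (jet1 f)) -> exists Psi : 'rV[R]_k.+1 -> R,
  [/\ PF (fun f => Psi (jet1 f)),
      forall a b, exists p : {poly R}, forall t, Psi (a + t *: b) = p.[t],
      exists a, Psi a != 0,
      forall a t, Psi (a + t *: delta_mx 0 ord0) = Psi a &
      forall a, Psi a != 0 -> P a].
Proof.
move=> [r [C [HC HP]]].
have /choice[Th HTh] : forall i, exists Th, PF Th /\ forall f, nondeg (C i) f <-> Th f != 0.
  by move=> i; have [Th h1 h2] := nondeg_polyfun (C i); exists Th.
have [|||||g sg hg] := @common_witness (@smooth R k) r Th.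
- by move=> i; have [] := HTh i.
- by [].
- by move=> f g t sf sg; exact: (smooth_lin t sf (smooth_lin _ sg sf)).
- by exists (pfun (PCst 0)); exact: smooth_pfun.
- by move=> i; have [f sf /(HTh i).2 h] := HC i; exists f.
pose T f := \prod_i Th i f.
have PT : PF T by apply: pf_prod => i; have [] := HTh i.
exists (fun a => T (set_jet1 g a)); split.
- exact: polyfun_set_jet1.
- move=> a b; have [p hp] := polyfun_line PT (smooth_set_jet1 a sg) (smooth_lin_dyn b).
  exists p => t; rewrite -hp; congr T; apply/funext => x.
  by rewrite /set_jet1 addrAC lin_dyn_lin; ring.
- exists (jet1 g); have -> : set_jet1 g (jet1 g) = g.
    apply/funext => x; rewrite /set_jet1 subrr lin_dynE big1 ?mulr0 ?addr0 // => i _.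
    by case: unlift => [l|]; rewrite ?mxE mul0r.
  by apply/prodf_neq0 => i _.
- by move=> a t; apply: set_jet1_shift.
- move=> a /prodf_neq0 h; rewrite -(jet1_set_jet1 a sg); apply: HP.
    exact: smooth_set_jet1.
  by move=> i; apply/(HTh i).2/h.
Qed.

End GenericOneJets.

(** * Continuity and translation of network eigenvalues *)

Section ComplexContinuity.
Variables (R : realType) (d : nat).
Local Notation V := 'rV[R]_d.
Implicit Types F G : V -> R[i].

Definition ccontinuous F := continuous (fun a => complex.Re (F a)) /\
  continuous (fun a => complex.Im (F a)).

Lemma ccont_real (g : V -> R) : continuous g -> ccontinuous (fun a => real_complex R (g a)).
Proof. by move=> cg; split=> //= x; apply: cst_continuous. Qed.

Lemma ccontD F G : ccontinuous F -> ccontinuous G -> ccontinuous (fun a => F a + G a).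
Proof.
move=> [f1 f2] [g1 g2]; split => x.
  have -> : (fun a => complex.Re (F a + G a)) = (fun a => complex.Re (F a)) + (fun a => complex.Re (G a)).
    by apply/funext => a; rewrite raddfD.
  by apply: continuousD; [exact: f1|exact: g1].
have -> : (fun a => complex.Im (F a + G a)) = (fun a => complex.Im (F a)) + (fun a => complex.Im (G a)).
  by apply/funext => a; rewrite raddfD.
by apply: continuousD; [exact: f2|exact: g2].
Qed.

Lemma ccontM F G : ccontinuous F -> ccontinuous G -> ccontinuous (fun a => F a * G a).
Proof.
have ReM (z w : R[i]) : complex.Re (z * w) =
    complex.Re z * complex.Re w - complex.Im z * complex.Im w by case: z w => [? ?] [? ?].
have ImM (z w : R[i]) : complex.Im (z * w) =
    complex.Re z * complex.Im w + complex.Im z * complex.Re w by case: z w => [? ?] [? ?].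
move=> [f1 f2] [g1 g2]; split => x.
  have -> : (fun a => complex.Re (F a * G a)) =
    (fun a => complex.Re (F a)) * (fun a => complex.Re (G a)) -
    (fun a => complex.Im (F a)) * (fun a => complex.Im (G a)).
    by apply/funext => a; rewrite ReM.
  by apply: continuousB; apply: continuousM; [exact: f1|exact: g1|exact: f2|exact: g2].
have -> : (fun a => complex.Im (F a * G a)) =
    (fun a => complex.Re (F a)) * (fun a => complex.Im (G a)) +
    (fun a => complex.Im (F a)) * (fun a => complex.Re (G a)).
  by apply/funext => a; rewrite ImM.
by apply: continuousD; apply: continuousM; [exact: f1|exact: g2|exact: f2|exact: g1].
Qed.

Lemma ccont_cst (z : R[i]) : ccontinuous (fun=> z).
Proof. by split=> x; apply: cst_continuous. Qed.

Lemma ccont_det n (A : V -> 'M[R[i]]_n) : (forall i j, ccontinuous (fun a => A a i j)) ->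
  ccontinuous (fun a => \det (A a)).
Proof.
move=> cA; rewrite /determinant.
have csum (I : Type) (r : seq I) (H : I -> V -> R[i]) : (forall i, ccontinuous (H i)) ->
    ccontinuous (fun a => \sum_(i <- r) H i a).
  move=> cH; elim: r => [|i r IH].
    by rewrite (_ : (fun a => _) = (fun=> 0)); [exact: ccont_cst|apply/funext => a; rewrite big_nil].
  rewrite (_ : (fun a => _) = (fun a => H i a + \sum_(i <- r) H i a)).
    exact: ccontD.
  by apply/funext => a; rewrite big_cons.
have cprod (I : Type) (r : seq I) (H : I -> V -> R[i]) : (forall i, ccontinuous (H i)) ->
    ccontinuous (fun a => \prod_(i <- r) H i a).
  move=> cH; elim: r => [|i r IH].
    by rewrite (_ : (fun a => _) = (fun=> 1)); [exact: ccont_cst|apply/funext => a; rewrite big_nil].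
  rewrite (_ : (fun a => _) = (fun a => H i a * \prod_(i <- r) H i a)).
    exact: ccontM.
  by apply/funext => a; rewrite big_cons.
apply: csum => s; apply: ccontM; first exact: ccont_cst.
by apply: cprod => i.
Qed.

End ComplexContinuity.

Section FiniteRange.
Variable R : realType.

Lemma finite_range_const (g : R -> R) (L : seq R) : continuous g ->
  (forall s, g s \in L) -> forall s t, g s = g t.
Proof.
move=> cg gL.
suff W s t : ~ g s < g t.
  by move=> s t; case: (ltgtP (g s) (g t)) => // h; [case: (W s t)|case: (W t s)].
move=> st; pose p : {poly R} := \prod_(l <- L) ('X - (l - g s)%:P).
have p0 : p != 0 by rewrite monic_neq0 // monic_prod_XsubC.
have [|w /andP[w0 wt] pw] := @small_nonroot R p (g t - g s) p0; first by rewrite subr_gt0.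
have wL : w + g s \notin L.
  apply: contra pw => h; rewrite /p horner_prod (big_rem _ h) /=.
  by rewrite hornerXsubC addrK subrr mul0r.
have ivt a b : a <= b -> Num.min (g a) (g b) <= w + g s <= Num.max (g a) (g b) ->
    w + g s \in L.
  move=> ab h; have [c _ <-] := IVT ab (continuous_subspaceT cg) h; exact: gL.
have h1 : g s <= w + g s by rewrite lerDr ltW.
have h2 : w + g s <= g t by rewrite -lerBrDr ltW.
move/negP: wL; apply; case: (leP s t) => [h|/ltW h]; apply: ivt h _.
  by rewrite ge_min le_max h1 h2 orbT.
by rewrite ge_min le_max h1 h2 !orbT.
Qed.

Lemma zero_limit (h : R -> R) : {for 0, continuous h} ->
  (forall e : R, 0 < e -> exists2 t, 0 < t < e & h t = 0) -> h 0 = 0.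
Proof.
move=> ch H; apply/eqP; rewrite -normr_le0; apply/ler_addgt0Pr => e e0; rewrite add0r.
have /cvgrPdist_lt/(_ e e0)/nbhs_normP[d /= d0 hd] := ch.
have [t /andP[t0 td] ht] := H d d0.
have := hd t; rewrite /= sub0r normrN gtr0_norm // ht subr0 => /(_ td)/ltW.
by [].
Qed.

End FiniteRange.

Lemma horner_char_poly (F : comNzRingType) n (A : 'M[F]_n) z :
  (char_poly A).[z] = \det (z%:M - A).
Proof.
rewrite /char_poly -/(horner_eval z _) -det_map_mx; congr (\det _).
apply/matrixP => i j; rewrite /char_poly_mx !mxE /= /horner_eval.
by rewrite hornerD hornerN hornerC hornerMn hornerX.
Qed.

Section NetworkEigenvalueTranslation.
Variables (R : realType) (n k : nat) (N : network n k).
Implicit Types (a b : 'rV[R]_k.+1) (mu : 'rV[R]_k.+1 -> R[i]).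

Let cnet a : 'M[R[i]]_n := map_mx (real_complex R) (netmx N a).

Lemma continuous_line (d : nat) (a b : 'rV[R]_d) : continuous (fun t : R => a + t *: b).
Proof.
move=> t; apply: cvgD; first exact: cvg_cst.
by apply: cvgZl; exact: cvg_id.
Qed.

Lemma netmx_coordE a i j : netmx N a i j = (i == j)%:R * a 0 ord0
   + \sum_(l < k) (N l i == j)%:R * a 0 (lift ord0 l).
Proof.
rewrite /netmx mxE summxE; congr (_ + _); first by rewrite mxE mulr_natl.
by apply: eq_bigr => l _; rewrite !mxE mulrC.
Qed.

Lemma netmx_shift a (s : R) : netmx N (a + s *: delta_mx 0 ord0) = netmx N a + s%:M.
Proof.
apply/matrixP => i j; rewrite [RHS]mxE !netmx_coordE !mxE eqxx /= mulr1.
rewrite mulrDr addrAC [_ * s]mulr_natl; congr (_ + _ + _).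
by apply: eq_bigr => l _; rewrite !mxE /= mulr0 addr0.
Qed.

(** A network eigenvalue is specified at generic jets only. On the line from any jet to one where
    [Psi] is nonzero these are dense near the starting point, and continuity extends the equation to
    it. *)
Lemma eigen_everywhere mu : network_eigenvalue N mu ->
  forall a, \det ((mu a)%:M - cnet a) = 0.
Proof.
move=> [s [mus [[cmu gmu] [i0 ->]]]].
have ceig a : eigenvalue (cnet a) (mus i0 a) -> \det ((mus i0 a)%:M - cnet a) = 0.
  by rewrite eigenvalue_root_char => /rootP; rewrite horner_char_poly.
have gdet : generic (@smooth R k) (fun f => \det ((mus i0 (jet1 f))%:M - cnet (jet1 f)) = 0).
  apply: generic_sub gmu => f _ [_ h]; apply: ceig.
  by apply/h; exists i0.
have [Psi [_ Psil [b b0] _ PsiP]] := generic_jet1 (P := fun a =>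
   \det ((mus i0 a)%:M - cnet a) = 0) gdet.
have cdet : ccontinuous (fun a => \det ((mus i0 a)%:M - cnet a)).
  apply: ccont_det => i j.
  rewrite (_ : (fun a => _) = (fun a => mus i0 a * (i == j)%:R + real_complex R (-1 * netmx N a i j))).
    apply: ccontD.
      by apply: ccontM; [have [] := cmu i0; split|exact: ccont_cst].
    apply: ccont_real; pose w q : R := if unlift ord0 q is Some l then (N l i == j)%:R else (i == j)%:R.
    rewrite (_ : (fun a => _) = pfun (PMul (PCst (-1)) (psumv w (enum 'I_k.+1)))).
      exact: continuous_pfun.
    apply/funext => a; rewrite netmx_coordE -[RHS]/(-1 * pfun (psumv w (enum 'I_k.+1)) a).
    rewrite pfun_psumv big_enum big_ord_recl /w unlift_none; congr (_ * (_ + _)).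
    by apply: eq_bigr => l _; rewrite liftK.
  by apply/funext => a; rewrite !mxE mulr_natr mulN1r rmorphN.
move=> a; have [p hp] := Psil a (b - a).
have p0 : p != 0.
  by apply: contraNneq b0 => h; have := hp 1; rewrite scale1r addrC subrK h horner0 => ->.
have Z (G : 'rV[R]_k.+1 -> R) : continuous G ->
    (forall t : R, p.[t] != 0 -> G (a + t *: (b - a)) = 0) -> G a = 0.
  move=> cG HG; have := @zero_limit R (fun t => G (a + t *: (b - a))); rewrite scale0r addr0; apply.
    by apply: continuous_comp; [exact: continuous_line|exact: cG].
  by move=> e e0; have [t te pt] := small_nonroot p0 e0; exists t => //; apply: HG.
have [c1 c2] := cdet.
have h1 := Z _ c1; have h2 := Z _ c2.
have HZ t : p.[t] != 0 -> \det ((mus i0 (a + t *: (b - a)))%:M - cnet (a + t *: (b - a))) = 0.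
  by rewrite -hp; apply: PsiP.
apply/eqP; rewrite eq_complex; apply/andP; split; apply/eqP.
  by apply: h1 => t /HZ ->.
by apply: h2 => t /HZ ->.
Qed.

(** Adding [s] to [f_0] shifts the spectrum by [s], so [mu (a + s e_0) - s] always belongs to the
    finite spectrum at [a]. Being continuous in [s], it is constant. *)
Lemma eigenvalue_shift mu : network_eigenvalue N mu ->
  forall a (s : R), mu (a + s *: delta_mx 0 ord0) = mu a + real_complex R s.
Proof.
move=> nmu a s; have He := eigen_everywhere nmu.
have [c1 c2] : ccontinuous mu.
  by move: nmu => [r [mus [[cmu _] [i0 ->]]]]; have [] := cmu i0.
have [rs Ers] := closed_field_poly_normal (char_poly (cnet a)).
have Hr t : mu (a + t *: delta_mx 0 ord0) - real_complex R t \in rs.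
  have := He (a + t *: delta_mx 0 ord0); rewrite /cnet netmx_shift => h.
  have : root (char_poly (cnet a)) (mu (a + t *: delta_mx 0 ord0) - real_complex R t).
    rewrite /root horner_char_poly -[X in _ == X]h; apply/eqP; congr (\det _).
    by rewrite raddfB /= map_mxD map_scalar_mx /= opprD addrA addrAC.
  rewrite Ers rootZ ?root_prod_XsubC //.
  by rewrite (monicP (char_poly_monic _)) oner_neq0.
pose g1 (t : R) := complex.Re (mu (a + t *: delta_mx 0 ord0)) - t.
pose g2 (t : R) := complex.Im (mu (a + t *: delta_mx 0 ord0)).
have cl : continuous (fun t : R => a + t *: delta_mx 0 ord0) by exact: continuous_line.
have e1 : g1 s = g1 0.
  apply: (@finite_range_const R g1 (map (fun z => complex.Re z) rs)).
    have -> : g1 = (fun t : R => complex.Re (mu (a + t *: delta_mx 0 ord0))) - (id : R -> R) by [].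
    move=> t; have ct : {for t, continuous (fun t : R => complex.Re (mu (a + t *: delta_mx 0 ord0)))}.
      exact: (@continuous_comp _ _ _ (fun t : R => a + t *: delta_mx 0 ord0) (fun b => complex.Re (mu b)) t (cl t) (c1 _)).
    exact: (continuousB ct (@cvg_id _ _)).
  move=> t; apply/mapP; exists (mu (a + t *: delta_mx 0 ord0) - real_complex R t) => //.
  by rewrite raddfB.
have e2 : g2 s = g2 0.
  apply: (@finite_range_const R g2 (map (fun z => complex.Im z) rs)).
    move=> t.
    exact: (@continuous_comp _ _ _ (fun t : R => a + t *: delta_mx 0 ord0) (fun b => complex.Im (mu b)) t (cl t) (c2 _)).
  move=> t; apply/mapP; exists (mu (a + t *: delta_mx 0 ord0) - real_complex R t) => //.
  by rewrite raddfB /= subr0.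
move: e1 e2; rewrite /g1 /g2 scale0r addr0 subr0 => e1 e2.
apply/eqP; rewrite eq_complex; apply/andP; split; apply/eqP.
  by rewrite raddfD /= -e1 subrK.
by rewrite raddfD /= addr0.
Qed.

End NetworkEigenvalueTranslation.

Section TransferGenericity.
Variables (R : realType) (n k : nat) (N : network n k).
Variable mu : 'rV[R]_k.+1 -> R[i].
Hypothesis nmu : network_eigenvalue N mu.

Lemma set_jet1_axis (f : dynamics R k) a : (forall t : R, f (t *: delta_mx 0 ord_max) = 0) ->
  forall t : R, set_jet1 f a (t *: delta_mx 0 ord_max) = 0.
Proof. by move=> f0 t; rewrite /set_jet1 f0 lin_dyn_axis mulr0 addr0. Qed.

(** A witness among all smooth dynamics need not satisfy [mu = 0]. Starting at the 1-jet of some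
    bifurcation problem, one moves a little towards a jet where [Psi] is nonzero and corrects [f_0]
    so that the real part of [mu] stays 0. The imaginary part stays 0 because the start is an
    interior point, and the correction does not affect [Psi]. *)
Lemma generic_transfer (P : 'rV[R]_k.+1 -> Prop) :
  generic (@smooth R k) (fun f => P (jet1 f)) ->
  generic (bif_problem mu) (fun f => P (jet1 f)).
Proof.
move=> /generic_jet1[Psi [PPsi Pl [b b0] Psh PP]].
have [[f0 [sf0 mu0 int0 ax0]]|nS] := pselect (exists f : dynamics R k, bif_problem mu f); last first.
  by apply: genericT => f Sf; case: nS; exists f.
have [C HC] := polyfun_nondeg PPsi.
exists 1%N, (fun=> C); split; last by move=> f _ /(_ ord0)/HC/PP.
move=> _; have [cr ci] : ccontinuous mu.
  by move: nmu => [r [mus [[cmu _] [i0 ->]]]]; have [] := cmu i0.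
pose a0 := jet1 f0; have [p hp] := Pl a0 (b - a0).
have p0 : p != 0.
  by apply: contraNneq b0 => h; have := hp 1; rewrite scale1r addrC subrK h horner0 => ->.
pose h (t : R) : R := complex.Re (mu (a0 + t *: (b - a0))).
pose c (t : R) := (a0 + t *: (b - a0)) + (- h t) *: delta_mx 0 ord0.
have cl : continuous (fun t : R => a0 + t *: (b - a0)) by exact: continuous_line.
have ch : continuous h.
  move=> t; exact: (@continuous_comp _ _ _ (fun t : R => a0 + t *: (b - a0))
    (fun b => complex.Re (mu b)) t (cl t) (cr _)).
have cc : continuous c.
  move=> t; apply: cvgD; first exact: cl.
  by apply: cvgZl; apply: cvgN; exact: ch.
have c00 : c 0 = a0.
  by rewrite /c /h scale0r addr0 /a0 mu0 /= oppr0 scale0r addr0.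
have : nbhs (c 0) (([set a | complex.Im (mu a) = 0])°)%classic.
  by rewrite c00; apply: open_nbhs_nbhs; split=> //; exact: open_interior.
move=> /(cc 0)/nbhs_normP[e /= e0 He].
have [t /andP[t0 te] pt] := small_nonroot p0 e0.
have ct : (([set a | complex.Im (mu a) = 0])°)%classic (c t).
  by apply: He; rewrite /= sub0r normrN gtr0_norm.
have Imc : complex.Im (mu (c t)) = 0 by exact: (interior_subset ct).
have muc : mu (c t) = mu (a0 + t *: (b - a0)) + real_complex R (- h t).
  exact: (eigenvalue_shift nmu).
have Rec : complex.Re (mu (c t)) = 0 by rewrite muc raddfD /= subrr.
exists (set_jet1 f0 (c t)).
  split; [exact: smooth_set_jet1| |by rewrite jet1_set_jet1|exact: set_jet1_axis].
  by rewrite jet1_set_jet1 //; apply/eqP; rewrite eq_complex Rec Imc !eqxx.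
by apply/HC; rewrite jet1_set_jet1 // /c Psh hp.
Qed.

End TransferGenericity.

(** * Ranks of powers and of commuting matrices *)

Section MatrixPolynomials.
Variables (F : fieldType) (m : nat).
Implicit Types (C : 'M[F]_m.+1) (u w : 'rV[F]_m.+1) (p : {poly F}).

Lemma horner_mx_eigen C w x p : w *m C = x *: w -> w *m horner_mx C p = p.[x] *: w.
Proof.
move=> wC; elim/poly_ind: p => [|p c IH].
  by rewrite rmorph0 mulmx0 horner0 scale0r.
rewrite rmorphD rmorphM /= horner_mx_X horner_mx_C mulmxDr mulmxA IH -scalemxAl wC.
by rewrite mul_mx_scalar scalerA -scalerDl hornerMXaddC.
Qed.

(** Write the characteristic polynomial as [g X^a] with [a] at most the size and [g] prime to [X].
    Bezout puts [u] into the range of [g(C)], and Cayley-Hamilton does the rest. *)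
Lemma row_kernel_stable C u j : u *m C ^+ j = 0 -> u *m C ^+ m.+1 = 0.
Proof.
move=> uC; have c0 : char_poly C != 0 by rewrite monic_neq0 // char_poly_monic.
have [a [g /implyP/(_ c0) g0 E]] := multiplicity_XsubC (char_poly C) 0.
rewrite polyC0 subr0 in E.
have gn0 : g != 0 by apply: contraNneq g0 => ->; rewrite root0.
have am : (a <= m.+1)%N.
  have := size_char_poly C; rewrite E size_mulXn ?gn0 //.
  move=> h; rewrite -ltnS -h -[X in (X < _)%N]addn0 ltn_add2l size_poly_gt0.
  by apply: contraNneq g0 => ->; rewrite root0.
have cop : coprimep ('X^j) g.
  rewrite coprimep_expl // coprimep_sym -['X]subr0 coprimep_XsubC //.
have [[v1 v2] /= vE] := Bezout_eq1_coprimepP _ _ cop.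
have uE : u = u *m horner_mx C (v2 * g).
  have : u *m horner_mx C (v1 * 'X^j + v2 * g) = u by rewrite vE rmorph1 mulmx1.
  rewrite rmorphD /= mulmxDr [v1 * _]mulrC [horner_mx C ('X^j * v1)]rmorphM /= mulmxA.
  by rewrite rmorphXn /= horner_mx_X uC mul0mx add0r => {1}<-.
have XE : C ^+ m.+1 = horner_mx C 'X^(m.+1) by rewrite rmorphXn /= horner_mx_X.
rewrite uE -mulmxA XE -[X in _ *m X]rmorphM.
have -> : v2 * g * 'X^(m.+1) = char_poly C * (v2 * 'X^(m.+1 - a)).
  by rewrite E -{1}(subnK am) exprD; ring.
by rewrite rmorphM /= Cayley_Hamilton mul0r mulmx0.
Qed.

Lemma rank_stable C : \rank (C ^+ m.+1 *m C ^+ m.+1) = \rank (C ^+ m.+1).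
Proof.
apply/eqP; rewrite eqn_leq mxrankM_maxl /=.
have h : (kermx (C ^+ m.+1 *m C ^+ m.+1) <= kermx (C ^+ m.+1))%MS.
  apply/row_subP => i; apply/sub_kermxP.
  apply: (@row_kernel_stable C _ (m.+1 + m.+1)); rewrite exprD.
  by apply/sub_kermxP; exact: row_sub.
have := mxrankS h; rewrite !mxrank_ker.
have := rank_leq_row (C ^+ m.+1); set a := \rank (C ^+ m.+1); set b := \rank (_ *m _).
by clearbody a b; lia.
Qed.

(** The row [w] lies in the row space of [M] but not in that of [M0 *m M]: if [w = y M0 M], then
    [w M0 = 0] puts [y M] into the generalized kernel of [C], so [w = y M M0 = 0]. *)
Lemma commuting_rank C (M : 'M[F]_m.+1) w s : let M0 := C ^+ m.+1 in
  M0 *m M = M *m M0 -> w != 0 -> w *m M0 = 0 -> s != 0 -> w *m M = s *: w ->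
  (\rank (M0 *m M) < \rank M)%N.
Proof.
move=> M0 comm w0 wM0 s0 wM.
have subM : (col_mx (M0 *m M) w <= M)%MS.
  rewrite col_mx_sub submxMl /=; apply/submxP; exists (s^-1 *: w).
  by rewrite -scalemxAl wM scalerA mulVf // scale1r.
have wN : ~~ (w <= M0 *m M)%MS.
  apply/negP => /submxP[y wE].
  have y0 : y *m M *m C ^+ (m.+1 + m.+1) = 0.
    by rewrite exprD -/M0 -mulmxE mulmxA -[y *m M *m M0]mulmxA -comm -wE wM0.
  have := row_kernel_stable y0; rewrite -/M0 -mulmxA -comm -wE => w00.
  by rewrite w00 eqxx in w0.
apply: leq_trans (mxrankS subM).
rewrite -addsmxE; have : (M0 *m M < M0 *m M + w)%MS.
  by rewrite /ltmx addsmxSl addsmx_sub submx_refl.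
by rewrite ltmxErank => /andP[].
Qed.

(** With [det_rank], this turns a lower bound on a rank into the nonvanishing of a polynomial in the
    entries. *)
Lemma rank_witness n1 n2 (A : 'M[F]_(n1, n2)) :
  exists (X : 'M[F]_((\rank A)%N, n1)) (Y : 'M[F]_(n2, (\rank A)%N)), X *m A *m Y = 1%:M.
Proof.
exists (pinvmx (col_base A)), (pinvmx (row_base A)).
have -> : pinvmx (col_base A) *m A = row_base A.
  by rewrite -[X in _ *m X](mulmx_base A) mulmxA mulVpmx ?mul1mx // col_base_full.
by rewrite mulmxVp // row_base_free.
Qed.

Lemma det_rank n1 n2 r (A : 'M[F]_(n1, n2)) (X : 'M[F]_(r, n1)) (Y : 'M[F]_(n2, r)) :
  \det (X *m A *m Y) != 0 -> (r <= \rank A)%N.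
Proof.
move=> d0; have : X *m A *m Y \in unitmx by rewrite unitmxE unitfE.
move=> /mxrank_unit <-; apply: leq_trans (mxrankM_maxl _ _) (mxrankM_maxr _ _).
Qed.

End MatrixPolynomials.

Section PolynomialDependence.
Variables (R : realFieldType) (T : Type) (k : nat).
Variable jet : seq 'I_k.+2 -> T -> R.
Variable A : seq 'I_k.+2 -> Prop.
Local Notation PF := (polyfun jet A).

Definition pfmx n1 n2 (M : T -> 'M[R]_(n1, n2)) := forall i j, PF (fun t => M t i j).

Lemma pfmx_cst n1 n2 (M : 'M[R]_(n1, n2)) : pfmx (fun=> M).
Proof. by move=> i j; apply: pf_const. Qed.

Lemma pfmxM n1 n2 n3 (M : T -> 'M[R]_(n1, n2)) (M' : T -> 'M[R]_(n2, n3)) :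
  pfmx M -> pfmx M' -> pfmx (fun t => M t *m M' t).
Proof.
move=> h h' i j; rewrite (_ : (fun t => _) = (fun t => \sum_l M t i l * M' t l j)).
  by apply: pf_sum => l; apply: pf_mul.
by apply/funext => t; rewrite mxE.
Qed.

Lemma pfmxX n (M : T -> 'M[R]_n) l : pfmx M -> pfmx (fun t => M t ^+ l).
Proof.
move=> h; elim: l => [|l IH] i j; first by under eq_fun do rewrite expr0; exact: pf_const.
by under eq_fun do rewrite exprS; apply: pfmxM.
Qed.

Definition pfpoly (P : T -> {poly R}) := (exists n, forall t, (size (P t) <= n)%N) /\
  forall i, PF (fun t => (P t)`_i).

Lemma pfpoly_cst (p : {poly R}) : pfpoly (fun=> p).
Proof. by split=> [|i]; [exists (size p)|exact: pf_const]. Qed.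

Lemma pfpolyC (g : T -> R) : PF g -> pfpoly (fun t => (g t)%:P).
Proof.
move=> hg; split=> [|i]; first by exists 1%N => t; apply: size_polyC_leq1.
under eq_fun do rewrite coefC; case: (i == 0%N); [exact: hg|exact: pf_const].
Qed.

Lemma pfpolyD P P' : pfpoly P -> pfpoly P' -> pfpoly (fun t => P t + P' t).
Proof.
move=> [[n hn] h] [[n' hn'] h']; split=> [|i].
  exists (maxn n n') => t; apply: leq_trans (size_polyD _ _) _.
  by rewrite geq_max !leq_max hn hn' orbT.
under eq_fun do rewrite coefD; exact: pf_add.
Qed.

Lemma pfpolyM P P' : pfpoly P -> pfpoly P' -> pfpoly (fun t => P t * P' t).
Proof.
move=> [[n hn] h] [[n' hn'] h']; split=> [|i].
  exists (n + n')%N => t; apply: leq_trans (size_polyMleq _ _) _.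
  by rewrite (leq_trans (leq_pred _)) // leq_add.
under eq_fun do rewrite coefM; apply: pf_sum => j; exact: pf_mul.
Qed.

Lemma pfmx_horner n (B : T -> 'M[R]_n.+1) P : pfmx B -> pfpoly P ->
  pfmx (fun t => horner_mx (B t) (P t)).
Proof.
move=> hB [[l hl] hP] i j.
rewrite (_ : (fun t => _) = (fun t => \sum_(a < l) (P t)`_a * (B t ^+ a) i j)).
  by apply: pf_sum => a; apply: pf_mul => //; apply: pfmxX.
apply/funext => t.
have {1}-> : P t = \sum_(a < l) (P t)`_a *: 'X^a.
  rewrite -poly_def; apply/polyP => b; rewrite coef_poly; case: ltnP => // lb.
  by rewrite nth_default // (leq_trans (hl t)).
rewrite rmorph_sum summxE; apply: eq_bigr => a _.
by rewrite -mul_polyC rmorphM /= horner_mx_C rmorphXn /= horner_mx_X -mulmxE mul_scalar_mx mxE.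
Qed.

(** One-variable polynomials as an instance of [polyfun], so that the lemmas on determinants and
    matrices also apply to a real perturbation parameter. *)
Lemma ispoly_polyfun (h : R -> R) :
  @polyfun R R 0 (fun _ => id) (fun=> True) h -> exists p : {poly R}, forall x, h x = p.[x].
Proof.
elim=> [c|s _|? ? _ [p1 E1] _ [p2 E2]|? ? _ [p1 E1] _ [p2 E2]].
- by exists c%:P => x; rewrite hornerC.
- by exists 'X => x; rewrite hornerX.
- by exists (p1 + p2) => x; rewrite hornerD E1 E2.
- by exists (p1 * p2) => x; rewrite hornerM E1 E2.
Qed.

End PolynomialDependence.

Section SplitSelfDerivative.
Variables (R : realFieldType) (T : Type) (k : nat).
Variable jet : seq 'I_k.+2 -> T -> R.

Lemma polyfun_split (Th : T -> R) : polyfun jet (@nontriv_jet k) Th ->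
  exists P, pfpoly jet (@free_jet k) P /\ forall t, Th t = (P t).[jet [:: ord0] t].
Proof.
elim=> [c|s s0|? ? _ [P1 [h1 E1]] _ [P2 [h2 E2]]|? ? _ [P1 [h1 E1]] _ [P2 [h2 E2]]].
- by exists (fun=> c%:P); split=> [|t]; [exact: pfpoly_cst|rewrite hornerC].
- have [->|s1] := pselect (s = [:: ord0]).
    by exists (fun=> 'X); split=> [|t]; [exact: pfpoly_cst|rewrite hornerX].
  exists (fun t => (jet s t)%:P); split=> [|t]; last by rewrite hornerC.
  by apply: pfpolyC; apply: pf_jet.
- by exists (fun t => P1 t + P2 t); split=> [|t]; [exact: pfpolyD|rewrite hornerD E1 E2].
- by exists (fun t => P1 t * P2 t); split=> [|t]; [exact: pfpolyM|rewrite hornerM E1 E2].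
Qed.

End SplitSelfDerivative.

(** * Genericity of formal branches at singular jets *)

Section MainGenericity.
Variables (R : realType) (k m : nat) (Q : network m.+1 k) (r : 'I_m.+1 -> 'I_m.+1).
Hypothesis rr : forall p, r (r p) = r p.
Hypothesis rQ : forall l p, r (Q l p) = r (Q l (r p)).
Variable mu : 'rV[R]_k.+1 -> R[i].
Local Notation S := (@bif_problem R k mu).
Local Notation jt := (@jet R k).
Local Notation H f := (jordan_at Q r jt f).
Local Notation Good f := (formal_branch Q jt f).
Implicit Types (f g : dynamics R k) (P : dynamics R k -> {poly R}).

Let B f : 'M[R]_m.+1 :=
  \matrix_(p, q) - \sum_(i | i != ord0) (cell_arg Q p i == Some q)%:R * jt [:: i] f.

Let jacE f : jac Q jt f = (jt [:: ord0] f)%:M - B f.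
Proof.
apply/matrixP => p q; rewrite !mxE opprK (bigD1 ord0) //=; congr (_ + _).
rewrite /cell_arg (_ : ord0 = lift ord_max ord0); last exact: val_inj.
rewrite liftK unlift_none (inj_eq Some_inj); case: eqP => _; rewrite ?mul1r ?mul0r //.
Qed.

Let pfB : pfmx jt (@free_jet k) B.
Proof.
move=> p q; rewrite (_ : (fun f => _) = (fun f => -1 * \sum_(i | i != ord0)
   (if i != ord0 then (cell_arg Q p i == Some q)%:R * jt [:: i] f else 0))); last first.
  apply/funext => f; rewrite mxE mulN1r; congr (- _).
  by apply: eq_bigr => i ->.
apply: pf_mul; first exact: pf_const.
apply: pf_sum => i; case: (boolP (i != ord0)) => [i0|_]; last exact: pf_const.
apply: pf_mul; first exact: pf_const.
by apply: pf_jet; split=> // -[ii]; rewrite ii eqxx in i0.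
Qed.

(* [C P f] is [P f] with [f_0] replaced by [B f], of which [f_0] is an eigenvalue
   whenever the Jacobian is singular. The rank of its powers counts the
   eigenvalues of [B f] that are not roots of [P f]. Where this rank is maximal
   over all [P] in [FF], the root [f_0] could be removed by a perturbation, which
   is a contradiction, so that [f_0] is not a root. *)
Let C P f := horner_mx (B f) (P f).
Let rho P f := \rank (C P f ^+ m.+1).

(** Families whose value at [f_0] detects good dynamics. They are closed under linear combinations
    ([FFD]), since a nonzero combination has a nonzero term. *)
Let FF P := pfpoly jt (@free_jet k) P /\
  forall f, S f -> H f -> (P f).[jt [:: ord0] f] != 0 -> Good f.

Let FFD P P' (c : R) : FF P -> FF P' -> FF (fun f => P f + c *: P' f).
Proof.
move=> [h1 g1] [h2 g2]; split=> [|f Sf Hf].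
  rewrite (_ : (fun f => _) = (fun f => P f + c%:P * P' f)).
    by apply: pfpolyD => //; apply: pfpolyM => //; apply: pfpoly_cst.
  by apply/funext => f; rewrite mul_polyC.
rewrite hornerD hornerZ => nz.
have [e|nz'] := eqVneq (P f).[jt [:: ord0] f] 0; last exact: g1 f Sf Hf nz'.
apply: (g2 f Sf Hf); apply: contraNneq nz => ->; by rewrite e mulr0 addr0.
Qed.

Let S_line f g (t : R) : S f -> smooth g -> (forall u : R, g (u *: delta_mx 0 ord_max) = 0) ->
  (forall i, jt [:: i] g = jt [:: i] f) -> S (fun x => f x + t * (g x + -1 * f x)) /\
  forall i, jt [:: i] (fun x => f x + t * (g x + -1 * f x)) = jt [:: i] f.
Proof.
move=> [sf mu0 intf axf] sg axg jg.
have sd := smooth_lin (-1) sg sf.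
have J i : jt [:: i] (fun x => f x + t * (g x + -1 * f x)) = jt [:: i] f.
  by rewrite (jet_lin _ _ sf sd) (jet_lin _ _ sg sf) jg mulN1r subrr mulr0 addr0.
have J1 : jet1 (fun x => f x + t * (g x + -1 * f x)) = jet1 f.
  by apply/matrixP => a l; rewrite (ord1 a) !jet1E J.
split; last exact: J.
split; [exact: (smooth_lin t sf sd)|by rewrite J1|by rewrite J1|].
by move=> u; rewrite axf axg; ring.
Qed.

Let B_eq f g : (forall i, jt [:: i] g = jt [:: i] f) -> B g = B f.
Proof.
move=> E; apply/matrixP => p q; rewrite !mxE; congr (- _).
by apply: eq_bigr => i _; rewrite E.
Qed.

Let max_family : (exists f, S f) -> exists P0 g,
  [/\ FF P0, S g & forall P f, FF P -> S f -> (rho P f <= rho P0 g)%N].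
Proof.
move=> [f0 Sf0]; pose q n := `[< exists P f, [/\ FF P, S f & rho P f = n] >].
have F0 : FF (fun=> 0).
  split=> [|f _ _]; first exact: pfpoly_cst.
  by rewrite horner0 eqxx.
have q0 : exists n, q n.
  by exists (rho (fun=> 0) f0); apply/asboolP; exists (fun=> 0), f0.
have qb n : q n -> (n <= m.+1)%N.
  by move=> /asboolP[P [f [_ _ <-]]]; apply: rank_leq_row.
case: (ex_maxnP q0 qb) => n /asboolP[P0 [g [h1 h2 <-]]] hmax.
exists P0, g; split; [exact: h1|exact: h2|move=> P f hP hf; apply: hmax].
by apply/asboolP; exists P, f; split; [exact: hP|exact: hf|].
Qed.

(** Both [f] and [P0] are perturbed, [f] towards [g] on the segment [ft], which leaves [B f] fixed,
    and [P0] by a multiple of [P1]. The nonzero eigenvalues counted by [rho P0 f] stay counted, and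
    the eigenvector [w], killed by the old matrix, is now an eigenvector for a nonzero
    eigenvalue. *)
Let improve P0 P1 f g (w : 'rV[R]_m.+1) : FF P0 -> FF P1 -> S f -> smooth g ->
  (forall u : R, g (u *: delta_mx 0 ord_max) = 0) ->
  (forall i, jt [:: i] g = jt [:: i] f) ->
  w != 0 -> w *m B f = jt [:: ord0] f *: w ->
  (P0 f).[jt [:: ord0] f] = 0 -> (P1 g).[jt [:: ord0] f] != 0 ->
  exists P h, [/\ FF P, S h & (rho P0 f < rho P h)%N].
Proof.
move=> F0 F1 Sf sg axg jg w0 wB P00 P1g; set z := jt [:: ord0] f in wB P00 P1g.
have [sf _ _ _] := Sf; have sd := smooth_lin (-1) sg sf.
pose ft (t : R) : dynamics R k := fun x => f x + t * (g x + -1 * f x).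
have Sft t : S (ft t) by have [] := S_line t Sf sg axg jg.
have Bft t : B (ft t) = B f by apply: B_eq; have [] := S_line t Sf sg axg jg.
have ft0 : ft 0 = f by apply/funext => x; rewrite /ft mul0r addr0.
have ft1 : ft 1 = g by apply/funext => x; rewrite /ft; ring.
pose M0 := C P0 f ^+ m.+1; pose C' t d := C P0 (ft t) + d *: C P1 (ft t).
have [X [Y XY]] := rank_witness (M0 *m M0).
(* As [phi 0 0 = 1], nonvanishing persists off finitely many roots, for [t] first and then for [d].
   It keeps the rank of [M0 *m M] at least that of [M0 *m M0], which is the rank of [M0] by
   [rank_stable]. *)
pose phi t d := \det (X *m (M0 *m C' t d ^+ m.+1) *m Y).
have phi00 : phi 0 0 = 1.
  by rewrite /phi /C' ft0 scale0r addr0 XY det1.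
have [p1 Hp1] : exists p : {poly R}, forall t, phi t 0 = p.[t].
  have : polyfun jt (@free_jet k) (fun h => \det (X *m (M0 *m C P0 h ^+ m.+1) *m Y)).
    apply: pf_det; apply: pfmxM; last exact: pfmx_cst.
    apply: pfmxM; first exact: pfmx_cst.
    apply: pfmxM; first exact: pfmx_cst.
    by apply: pfmxX; apply: pfmx_horner => //; case: F0.
  move=> /polyfun_line/(_ sf sd)[p hp]; exists p => t.
  by rewrite -hp /phi /C' scale0r addr0.
have [p2 Hp2] : exists p : {poly R}, forall t, (P1 (ft t)).[z] = p.[t].
  have [[[l hl] hP] _] := F1.
  have : polyfun jt (@free_jet k) (fun h => (P1 h).[z]).
    rewrite (_ : (fun h => _) = (fun h => \sum_(i < l) (P1 h)`_i * z ^+ i)).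
      by apply: pf_sum => i; apply: pf_mul => //; apply: pf_const.
    by apply/funext => h; rewrite (horner_coef_wide _ (hl h)).
  by move=> /polyfun_line/(_ sf sd)[p hp]; exists p => t; rewrite -hp.
have [t _ ht] : exists2 t : R, 0 < t < 1 & (p1 * p2).[t] != 0.
  apply: small_nonroot ltr01; rewrite mulf_neq0 //.
    by apply/eqP => h; move/eqP: phi00; rewrite Hp1 h horner0 eq_sym oner_eq0.
  by apply: contraNneq P1g => h; rewrite -ft1 Hp2 h horner0.
move: ht; rewrite hornerM -Hp1 -Hp2 mulf_eq0 negb_or => /andP[phit P1t].
have [q1 Hq1] : exists p : {poly R}, forall d, phi t d = p.[d].
  apply: ispoly_polyfun; apply: pf_det; apply: pfmxM; last exact: pfmx_cst.
  apply: pfmxM; first exact: pfmx_cst.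
  apply: pfmxM; first exact: pfmx_cst.
  apply: pfmxX => i j.
  have -> : (fun d => C' t d i j) = (fun d : R => C P0 (ft t) i j + d * C P1 (ft t) i j).
    by apply/funext => d; rewrite !mxE.
  apply: pf_add; first exact: pf_const.
  by apply: pf_mul; [exact: (@pf_jet R R 0 (fun=> id) (fun=> True) [::])|exact: pf_const].
pose q2 : {poly R} := ((P0 (ft t)).[z])%:P + (P1 (ft t)).[z] *: 'X.
have [d _ hd] : exists2 d : R, 0 < d < 1 & (q1 * q2).[d] != 0.
  apply: small_nonroot ltr01; rewrite mulf_neq0 //.
    by apply: contraNneq phit => h; rewrite Hq1 h horner0.
  apply: contraNneq P1t => /(congr1 (fun p : {poly R} => p`_1)).
  by rewrite coefD coefC coefZ coefX /= coef0 add0r mulr1 => ->.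
move: hd; rewrite hornerM -Hq1 mulf_eq0 negb_or => /andP[phid psid].
pose Pd f' := P0 f' + d *: P1 f'.
exists Pd, (ft t); split; [exact: FFD|exact: Sft|].
have CE : C Pd (ft t) = C' t d.
  by rewrite /C /Pd -mul_polyC rmorphD rmorphM /= horner_mx_C -mulmxE mul_scalar_mx.
pose M := C Pd (ft t) ^+ m.+1; pose psi := (Pd (ft t)).[z].
have psi0 : psi != 0.
  by apply: contra psid; rewrite /psi /Pd /q2 !hornerE mulrC.
have wC P f' : B f' = B f -> w *m C P f' ^+ m.+1 = (P f').[z] ^+ m.+1 *: w.
  move=> BE; rewrite /C -rmorphXn /= BE (horner_mx_eigen _ wB).
  by rewrite horner_exp.
have wM : w *m M = psi ^+ m.+1 *: w by apply: wC; apply: Bft.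
have wM0 : w *m M0 = 0 by rewrite /M0 wC // P00 expr0n scale0r.
have comm : M0 *m M = M *m M0.
  rewrite /M0 /M /C Bft -!rmorphXn /= -[LHS]rmorphM -[RHS]rmorphM /=.
  by rewrite mulrC.
have rk : (\rank (M0 *m M0) <= \rank (M0 *m M))%N.
  by apply: (@det_rank _ _ _ _ _ X Y); rewrite /M CE.
have r1 : rho P0 f = \rank (M0 *m M0) by rewrite /rho -rank_stable.
rewrite r1; apply: leq_ltn_trans rk _.
exact: (commuting_rank comm w0 wM0 (expf_neq0 _ psi0) wM).
Qed.

Lemma generic_formal_branch : generic S (fun f => H f -> Good f).
Proof.
have [neS|nS] := pselect (exists f, S f); last first.
  by apply: genericT => f Sf; case: nS; exists f.
have [P0 [g0 [F0 Sg0 hmax]]] := max_family neS.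
have [X [Y XY]] := rank_witness (C P0 g0 ^+ m.+1).
(* Where [Psi] is nonzero, [rho P0] attains its maximum, and [improve] leads to a contradiction. *)
pose Psi f := \det (X *m (C P0 f ^+ m.+1) *m Y).
have pfPsi : polyfun jt (@free_jet k) Psi.
  apply: pf_det; apply: pfmxM; last exact: pfmx_cst.
  apply: pfmxM; first exact: pfmx_cst.
  by apply: pfmxX; apply: pfmx_horner => //; case: F0.
have [Cd HC] := polyfun_nondeg pfPsi.
exists 1%N, (fun=> Cd); split.
  by move=> _; exists g0 => //; apply/HC; rewrite /Psi XY det1 oner_eq0.
move=> f Sf /(_ ord0)/HC Psif Hf.
have [P00|P00] := eqVneq (P0 f).[jt [:: ord0] f] 0; last by apply: F0.2.
have [sf _ _ axf] := Sf.
have [Th [pfTh goodTh [g [sg axg jg Thg]]]] :=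
  formal_branch_polyfun rr rQ (jet_axis axf) Hf.
have [P1 [pfP1 P1E]] := polyfun_split pfTh.
have F1 : FF P1.
  split=> // h Sh Hh; rewrite -P1E; apply: goodTh => //.
  by have [_ _ _ axh] := Sh; apply: jet_axis.
have [v1 [v2 [l0 [ls jd]]]] := Hf.
have l00 : l0 != 0.
  by apply: contraNneq (jd_l0v2 jd) => ->; rewrite mul0mx.
have lB : l0 *m B f = jt [:: ord0] f *: l0.
  have := jd_l0 jd; rewrite jacE mulmxBr mul_mx_scalar => /eqP.
  by rewrite subr_eq0 => /eqP.
have P1g : (P1 g).[jt [:: ord0] f] != 0 by rewrite -jg -P1E.
have [P [h [FP Sh lt]]] := improve F0 F1 Sf sg axg jg l00 lB P00 P1g.
have := leq_trans lt (hmax P h FP Sh); rewrite ltnNge => /negP[].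
exact: (det_rank Psif).
Qed.

End MainGenericity.

(** * Jordan blocks and synchrony *)

Section JordanBlock.
Variables (F : fieldType) (m : nat) (J : 'M[F]_m.+1) (v1 v2 : 'cV[F]_m.+1).
Hypothesis Jv2 : J *m v2 = v1.
Hypothesis Jv1 : J *m v1 = 0.
Hypothesis ker1 : forall y, J *m y = 0 -> exists s, y = s *: v1.
Hypothesis v2_range : forall z, J *m z <> v2.

(** The Jordan chain stops at [v2] because [v2] is not in the range of [J]. *)
Lemma generalized_kernel l (y : 'cV[F]_m.+1) : J ^+ l *m y = 0 ->
  exists a b, y = a *: v1 + b *: v2.
Proof.
elim: l y => [|l IH] y.
  by rewrite expr0 mul1mx => ->; exists 0, 0; rewrite !scale0r addr0.
rewrite exprSr -mulmxE -mulmxA => /IH[a [b E]].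
have [b0|b0] := eqVneq b 0; last first.
  case: (@v2_range (b^-1 *: (y - a *: v2))).
  by rewrite -scalemxAr mulmxBr E -scalemxAr Jv2 addrC addKr scalerA mulVf // scale1r.
have [|s yE] := @ker1 (y - a *: v2).
  by rewrite mulmxBr E b0 scale0r addr0 -scalemxAr Jv2 subrr.
by exists s, a; rewrite -yE subrK.
Qed.

Variable W : 'cV[F]_m.+1 -> Prop.
Hypothesis WD : forall x y, W x -> W y -> W (x + y).
Hypothesis WZ : forall s x, W x -> W (s *: x).
Hypothesis WJ : forall x, W x -> W (J *m x).
Hypothesis Wv2 : ~ W v2.
Hypothesis Wv1 : W v1.

Let W_horner p x : W x -> W (horner_mx J p *m x).
Proof.
move=> Wx; elim/poly_ind: p => [|p c IH].
  by rewrite rmorph0 mul0mx -(scale0r x); apply: WZ.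
rewrite [p * _]mulrC rmorphD rmorphM /= horner_mx_X horner_mx_C mulmxDl mul_scalar_mx.
by apply: WD; [rewrite -mulmxA; apply: WJ|apply: WZ].
Qed.

(* Write [char_poly J = g X^a] with [1 = u X + w g]. Then [y] is the sum of
   [J u(J) y] and [w(J) g(J) y]; the latter is in the generalized kernel, and has
   no component along [v2]. *)
Lemma invariant_decomposition y : W y -> exists z s, W z /\ y = J *m z + s *: v1.
Proof.
move=> Wy; have c0 : char_poly J != 0 by rewrite monic_neq0 // char_poly_monic.
have [a [g /implyP/(_ c0) g0 E]] := multiplicity_XsubC (char_poly J) 0.
rewrite polyC0 subr0 in E.
have cop : coprimep 'X g by rewrite coprimep_sym -['X]subr0 coprimep_XsubC.
have [[u w] /= vE] := Bezout_eq1_coprimepP _ _ cop.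
pose k := horner_mx J (w * g) *m y; pose z := horner_mx J u *m y.
have yE : y = J *m z + k.
  have {1}-> : y = horner_mx J (u * 'X + w * g) *m y by rewrite vE rmorph1 mul1mx.
  rewrite [u * _]mulrC rmorphD /= [horner_mx J ('X * u)]rmorphM /= horner_mx_X mulmxDl.
  by rewrite -mulmxA.
have [|s [b kE]] := @generalized_kernel a k.
  have -> : J ^+ a = horner_mx J 'X^a by rewrite rmorphXn /= horner_mx_X.
  rewrite /k mulmxA mulmxE -rmorphM /=.
  have -> : 'X^a * (w * g) = w * char_poly J by rewrite E; ring.
  by rewrite rmorphM /= Cayley_Hamilton mulr0 mul0mx.
have b0 : b = 0.
  apply/eqP; apply/negPn/negP => b0; apply: Wv2.
  have -> : v2 = b^-1 *: (k + (- s) *: v1).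
    by rewrite kE scaleNr addrAC subrr add0r scalerA mulVf // scale1r.
  by apply: WZ; apply: WD; [exact: W_horner|exact: WZ].
exists z, s; split; first exact: W_horner.
by rewrite {1}yE kE b0 scale0r addr0.
Qed.

End JordanBlock.

Section SingularMatrix.
Variables (F : fieldType) (m : nat) (J : 'M[F]_m) (v1 : 'cV[F]_m).
Hypothesis Jv1 : J *m v1 = 0.
Hypothesis v10 : v1 != 0.
Hypothesis ker1 : forall y, J *m y = 0 -> exists s, y = s *: v1.

Lemma left_kernel_ex : exists2 l0 : 'rV[F]_m, l0 != 0 & l0 *m J = 0.
Proof.
apply/det0P; rewrite -det_tr; apply/det0P; exists v1^T.
  by apply: contraNneq v10 => /(congr1 trmx); rewrite trmxK trmx0 => ->.
by rewrite -trmx_mul Jv1 trmx0.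
Qed.

Lemma left_kernel_unique (l0 l : 'rV[F]_m) : l0 != 0 -> l0 *m J = 0 -> l *m J = 0 ->
  exists s, l = s *: l0.
Proof.
move=> l00 l0J lJ; apply/sub_rVP.
have rk : (\rank (kermx J) <= 1)%N.
  have h : (kermx J^T <= v1^T)%MS.
    apply/row_subP => i; apply/sub_rVP.
    have /sub_kermxP E := row_sub i (kermx J^T).
    have [|s sE] := @ker1 (row i (kermx J^T))^T.
      by rewrite -[LHS]trmxK trmx_mul trmxK E trmx0.
    by exists s; rewrite -[LHS]trmxK sE linearZ.
  have := leq_trans (mxrankS h) (rank_leq_row _).
  by rewrite !mxrank_ker mxrank_tr.
have h0 : (l0 <= kermx J)%MS by apply/sub_kermxP.
have hl : (l <= kermx J)%MS by apply/sub_kermxP.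
apply: submx_trans hl _; rewrite -(geq_leqif (mxrank_leqif_sup h0)).
by rewrite (leq_trans rk) // lt0n mxrank_eq0.
Qed.

Lemma in_range (l0 : 'rV[F]_m) (y : 'cV[F]_m) : l0 != 0 -> l0 *m J = 0 -> l0 *m y = 0 ->
  exists z, J *m z = y.
Proof.
move=> l00 l0J l0y; have : (y^T <= J^T)%MS.
  rewrite submxE; apply/eqP/matrixP => a j; rewrite (ord1 a) [RHS]mxE.
  have cJ : (col j (cokermx J^T))^T *m J = 0.
    by rewrite -[LHS]trmxK trmx_mul trmxK colE mulmxA mulmx_coker mul0mx trmx0.
  have [s sE] := left_kernel_unique l00 l0J cJ.
  have : (y^T *m col j (cokermx J^T)) 0 0 = 0.
    rewrite -[col j _]trmxK sE linearZ /= -scalemxAr -trmx_mul l0y trmx0.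
    by rewrite scaler0 mxE.
  by rewrite !mxE => h; rewrite -[RHS]h; apply: eq_bigr => i _; congr (_ * _); rewrite [RHS]mxE.
move=> /submxP[z E]; exists z^T.
by rewrite -[LHS]trmxK trmx_mul trmxK -E trmxK.
Qed.

End SingularMatrix.

Section QuotientJacobian.
Variables (R : realType) (n k m : nat) (N : network n k) (Q : network m k).
Variables (D : set 'cV[R]_n) (c : 'I_n -> 'I_m).
Hypothesis qD : quotient_network N D Q c.

(** Linear dynamics realize all network matrices, so invariance under admissible fields entails
    invariance under adjacency matrices and Jacobians. *)
Lemma admissible_lin_dyn n' (N' : network n' k) a (x : 'cV[R]_n') t :
  admissible N' (lin_dyn a) x t = netmx N' a *m x.
Proof.
apply/matrixP => i j; rewrite (ord1 j) [LHS]mxE lin_dynE [RHS]mxE.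
have -> : \sum_q netmx N' a i q * x q 0 = a 0 ord0 * x i 0 +
    \sum_(l < k) a 0 (lift ord0 l) * x (N' l i) 0.
  under eq_bigr do rewrite netmx_coordE mulrDl.
  rewrite big_split /= (bigD1 i) //= eqxx mul1r big1 ?addr0; last first.
    by move=> q /negbTE qi; rewrite eq_sym qi !mul0r.
  congr (_ + _); under eq_bigr do rewrite mulr_suml.
  rewrite exchange_big; apply: eq_bigr => l _ /=.
  rewrite (bigD1 (N' l i)) //= eqxx mul1r big1 ?addr0 // => q /negbTE qi.
  by rewrite eq_sym qi !mul0r.
rewrite (bigD1 ord_max) //= unlift_none mul0r add0r.
rewrite (reindex_omap (lift ord_max) (unlift ord_max)) /=; last first.
  by move=> i' hi; case: unliftP hi => [j' ->|->] //; rewrite eqxx.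
under eq_bigl => i' do rewrite eq_sym neq_lift liftK eqxx /=.
rewrite big_ord_recl liftK !mxE liftK unlift_none; congr (_ + _).
by apply: eq_bigr => l _; rewrite !liftK !mxE !liftK.
Qed.

Lemma sync_netmx a (y : 'cV[R]_m) :
  sync_incl c (netmx Q a *m y) = netmx N a *m sync_incl c y.
Proof. by rewrite -!(admissible_lin_dyn _ _ _ 0) (admissible_sync_incl _ qD). Qed.

Lemma synchrony_netmx (D' : set 'cV[R]_n) a x : synchrony N D' -> D' x -> D' (netmx N a *m x).
Proof.
move=> [_ h] Dx; rewrite -(admissible_lin_dyn _ _ _ 0).
by apply: h => //; apply: smooth_lin_dyn.
Qed.

Lemma polydiagonalD (D' : set 'cV[R]_n) x y : polydiagonal D' -> D' x -> D' y -> D' (x + y).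
Proof. by move=> [e ->] hx hy i j eij; rewrite !mxE (hx i j eij) (hy i j eij). Qed.

Lemma polydiagonalZ (D' : set 'cV[R]_n) s x : polydiagonal D' -> D' x -> D' (s *: x).
Proof. by move=> [e ->] hx i j eij; rewrite !mxE (hx i j eij). Qed.

Lemma jac_net_jacobian (f : dynamics R k) : jac Q (@jet R k) f = net_jacobian Q f.
Proof.
apply/matrixP => p q; rewrite mxE /net_jacobian netmx_coordE.
rewrite (bigD1 ord_max) //= /cell_arg unlift_none mul0r add0r.
rewrite (reindex_omap (lift ord_max) (unlift ord_max)) /=; last first.
  by move=> i' hi; case: unliftP hi => [j' ->|->] //; rewrite eqxx.
under eq_bigl => i' do rewrite eq_sym neq_lift liftK eqxx /=.
rewrite big_ord_recl liftK unlift_none jet1E; congr (_ + _).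
by apply: eq_bigr => l _; rewrite !liftK jet1E.
Qed.

(** Cells of the quotient are equivalent when they agree on [D1]. The equivalence is balanced
    because [D1] is invariant under the adjacency matrices: permuting a state of [D1] along the
    inputs of type [l] gives again a state of [D1]. *)
Lemma synchrony_representatives (D1 : set 'cV[R]_n) : synchrony N D1 ->
  exists r : 'I_m -> 'I_m, [/\ forall p, r (r p) = r p,
    forall l p, r (Q l p) = r (Q l (r p)) &
    forall y : 'cV[R]_m, vsync r y <-> D1 (sync_incl c y)].
Proof.
move=> [[e D1E] inv]; have [cs _ Qc] := qD.
pose E p q := forall y : 'cV[R]_m, D1 (sync_incl c y) -> y p 0 = y q 0.
have Es p q : E p q -> E q p by move=> h y Dy; rewrite h.
have Et p q s : E p q -> E q s -> E p s by move=> h1 h2 y Dy; rewrite h1 ?h2.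
(* The pick depends only on the class of [p], so [r] is constant on classes; the default is never
   reached, since [p] is equivalent to itself. *)
pose r p := odflt p [pick q | `[< E p q >]].
have rE p : E p (r p).
  by rewrite /r; case: pickP => [q /asboolP|/(_ p)/asboolP] //= h; case: h.
have rEq p q : E p q -> r p = r q.
  move=> pq; rewrite /r.
  have -> : [pick q0 | `[< E p q0 >]] = [pick q0 | `[< E q q0 >]].
    by apply: eq_pick => s; apply/asboolP/asboolP => h; [apply: Et h; exact: Es|exact: Et h].
  by case: pickP => //= /(_ q)/asboolP[].
exists r; split.
- by move=> p; apply: rEq; apply: Es.
- move=> l p; apply: rEq => y Dy.
  have Dy' : D1 (sync_incl c (\col_q y (Q l q) 0)).
    pose f : dynamics R k := lin_dyn (delta_mx 0 (lift ord0 l)).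
    have := inv f (smooth_lin_dyn _) _ 0 Dy; rewrite admissible_lin_dyn.
    congr D1; apply/matrixP => i j; rewrite (ord1 j) mxE.
    rewrite (bigD1 (N l i)) //= netmx_coordE !mxE /= mulr0 add0r (bigD1 l) //= !mxE !eqxx mul1r.
    rewrite Qc big1 => [|l' ll']; last by rewrite !mxE (inj_eq lift_inj) (negbTE ll') mulr0.
    rewrite addr0 mul1r big1 ?addr0 // => j' jN.
    rewrite netmx_coordE !mxE /= mulr0 add0r big1 ?mul0r // => l' _; rewrite !mxE (inj_eq lift_inj).
    have [->|_] := eqVneq l' l; last by rewrite mulr0.
    by rewrite eq_sym (negbTE jN) mul0r.
  by have := rE p _ Dy'; rewrite !mxE.
- move=> y; split=> [ry|Dy p]; last by rewrite -(rE p y Dy).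
  rewrite D1E => i j eij; rewrite !mxE.
  have cij : E (c i) (c j).
    by move=> y'; rewrite D1E => /(_ i j eij); rewrite !mxE.
  by rewrite -(ry (c i)) (rEq _ _ cij) ry.
Qed.

End QuotientJacobian.

Section BranchAt.
Variables (R : realType) (n k m : nat) (N : network n k) (Q : network m.+1 k).
Variables (D : set 'cV[R]_n) (c : 'I_n -> 'I_m.+1) (f : dynamics R k).
Hypothesis qD : quotient_network N D Q c.
Hypothesis sD : synchrony N D.
Hypothesis sf : smooth f.
Hypothesis axf : forall t : R, f (t *: delta_mx 0 ord_max) = 0.
Local Notation J := (net_jacobian Q f).
Hypothesis ker_line : forall x y : 'cV[R]_n, D x -> D y -> net_jacobian N f *m x = 0 ->
  net_jacobian N f *m y = 0 -> x != 0 -> exists s, y = s *: x.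
Hypothesis submax : forall D', synchrony N D' -> D' `<` D ->
  D' `&` gen_kernel N f `<` D `&` gen_kernel N f.
Hypothesis good : forall r : 'I_m.+1 -> 'I_m.+1, (forall p, r (r p) = r p) ->
  (forall l p, r (Q l p) = r (Q l (r p))) -> jordan_at Q r (@jet R k) f ->
  formal_branch Q (@jet R k) f.
Variables (D1 : set 'cV[R]_n) (v1 v2 v1s : 'cV[R]_m.+1).
Hypothesis sD1 : synchrony N D1.
Hypothesis D1D : D1 `<` D.
Hypothesis J2v2 : J *m J *m v2 = 0.
Hypothesis Jv2 : J *m v2 = v1.
Hypothesis v1s_orth : orthc (rangemx (J *m J)) v1s.
Hypothesis D1v1 : D1 (sync_incl c v1).
Hypothesis v1sv1 : dot v1s v1 = 1.

Let inD y : D (sync_incl c y). Proof. by have [_ -> _] := qD; exists y. Qed.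

Let Jv1 : J *m v1 = 0. Proof. by rewrite -Jv2 mulmxA. Qed.

Let v10 : v1 != 0.
Proof.
apply/eqP => h; have := v1sv1; rewrite h /dot big1 => [/eqP|i _].
  by rewrite eq_sym oner_eq0.
by rewrite mxE mulr0.
Qed.

Let ls : 'rV[R]_m.+1 := v1s^T.

Let lsE (y : 'cV[R]_m.+1) : (ls *m y) 0 0 = dot v1s y.
Proof. by rewrite mxE; apply: eq_bigr => i _; rewrite mxE. Qed.

Let lsJ2 (y : 'cV[R]_m.+1) : ls *m (J *m (J *m y)) = 0.
Proof.
apply/matrixP => i j; rewrite (ord1 i) (ord1 j) lsE [RHS]mxE; apply: v1s_orth.
by exists y => //; rewrite mulmxA.
Qed.

(** If [J z = v2], then [v1 = J (J z)] is orthogonal to [v1s], against the normalization of their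
    product. *)
Let v2_range (z : 'cV[R]_m.+1) : J *m z <> v2.
Proof.
move=> h; have := lsE v1; rewrite v1sv1 -Jv2 -h lsJ2 mxE => /eqP.
by rewrite eq_sym oner_eq0.
Qed.

Let sync0 : sync_incl c (0 : 'cV[R]_m.+1) = 0.
Proof. by apply/matrixP => i j; rewrite !mxE. Qed.

Let ker1 (y : 'cV[R]_m.+1) : J *m y = 0 -> exists s, y = s *: v1.
Proof.
move=> Jy; have K z : J *m z = 0 -> net_jacobian N f *m sync_incl c z = 0.
  by move=> h; rewrite -(sync_netmx qD) h sync0.
have [|s E] := ker_line (inD v1) (inD y) (K _ Jv1) (K _ Jy).
  by apply: contraNneq v10 => h; apply/eqP; apply: (sync_incl_inj qD); rewrite h sync0.
by exists s; apply: (sync_incl_inj qD); rewrite E sync_inclZ.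
Qed.

Let gen_kernel_sync (y : 'cV[R]_m.+1) : gen_kernel N f (sync_incl c y) <-> exists l, J ^+ l *m y = 0.
Proof.
have E l : iter l (mulmx (net_jacobian N f)) (sync_incl c y) = sync_incl c (J ^+ l *m y).
  elim: l => [|l IH] /=; first by rewrite mul1mx.
  by rewrite IH -(sync_netmx qD) exprS -mulmxE mulmxA.
split=> -[l h]; exists l; last by rewrite E h sync0.
by apply: (sync_incl_inj qD); rewrite -E h sync0.
Qed.

Let W (D' : set 'cV[R]_n) (y : 'cV[R]_m.+1) := D' (sync_incl c y).

Section Invariant.
Variable D' : set 'cV[R]_n.
Hypothesis sD' : synchrony N D'.
Hypothesis D'D : D' `<` D.
Hypothesis D'v1 : D' (sync_incl c v1).

Let pD' : polydiagonal D'. Proof. by case: sD'. Qed.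

Lemma WD x y : W D' x -> W D' y -> W D' (x + y).
Proof.
rewrite /W; have -> : sync_incl c (x + y) = sync_incl c x + sync_incl c y.
  by apply/matrixP => i j; rewrite !mxE.
exact: polydiagonalD.
Qed.

Lemma WZ s x : W D' x -> W D' (s *: x).
Proof. by rewrite /W sync_inclZ; apply: polydiagonalZ. Qed.

Lemma WJ x : W D' x -> W D' (J *m x).
Proof. by rewrite /W (sync_netmx qD); apply: synchrony_netmx. Qed.

(** A proper synchrony subspace containing [v1] and [v2] would contain the whole generalized kernel
    in [D], against submaximality. *)
Lemma Wv2 : ~ W D' v2.
Proof.
move=> Wv2; have [_ h] := submax sD' D'D; apply: h => x [Dx gx]; split=> //.
have [_ DE _] := qD; move: Dx gx; rewrite DE => -[y _ <-].
move=> /gen_kernel_sync[l /(generalized_kernel Jv2 ker1 v2_range)[a [b ->]]].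
by apply: WD; apply: WZ.
Qed.

Lemma W_decomposition y : W D' y -> exists z s, W D' z /\ y = J *m z + s *: v1.
Proof. exact: (invariant_decomposition Jv2 ker1 v2_range WD WZ WJ Wv2). Qed.

Lemma W_left_kernel (l0 : 'rV[R]_m.+1) : l0 *m J = 0 -> forall y, W D' y -> l0 *m y = 0.
Proof.
move=> l0J y /W_decomposition[z [s [_ ->]]].
by rewrite -Jv2 mulmxDr -scalemxAr !mulmxA l0J !mul0mx scaler0 addr0.
Qed.

End Invariant.

Lemma branch_at : has_branch_with_synchrony N f D.
Proof.
have [r [rr rQ rD1]] := synchrony_representatives qD sD1.
have [l0 l00 l0J] := left_kernel_ex Jv1 v10.
have l0v2 : l0 *m v2 != 0.
  apply/eqP => h; have [z Jz] := in_range ker1 l00 l0J h.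
  exact: v2_range Jz.
have jd : jordan_data r (jac Q (@jet R k) f) v1 v2 l0 ls.
  rewrite jac_net_jacobian; split.
  - exact: Jv1.
  - exact: v10.
  - exact/rD1.
  - exact: ker1.
  - exact: l0J.
  - by move=> y /rD1; apply: W_left_kernel.
  - by move=> l; apply: (left_kernel_unique ker1).
  - exact: Jv2.
  - exact: l0v2.
  (* From [J y = J z + s v1 = J (z + s v2)] it follows that [y - z - s v2] is a multiple of [v1],
     which is synchronous. *)
  - move=> y /rD1/(W_decomposition sD1 D1D D1v1)[z [s [Wz E]]].
    have [|t yE] := ker1 (y := y - z - s *: v2).
      by rewrite !mulmxBr -scalemxAr Jv2 E addrAC addrK subrr.
    exists s, (z + t *: v1); split.
      by apply/rD1; apply: (WD sD1) => //; apply: (WZ sD1).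
    by rewrite -yE addrCA [s *: v2 + _]addrC subrK addrC subrK.
  - move=> y /rD1/(W_decomposition sD1 D1D D1v1)[z [s [_ ->]]].
    by rewrite mulmxDr mulmxDr -!scalemxAr Jv1 lsJ2 mulmx0 scaler0 addr0.
  - apply/eqP => /matrixP/(_ 0 0); rewrite lsE v1sv1 mxE => /eqP.
    by rewrite oner_eq0.
have fb : formal_branch Q (@jet R k) f by apply: good rr rQ _; exists v1, v2, l0, ls.
have [delta [y [Lam [u rb]]]] := real_branch_of_formal sf axf fb.
apply: (branch_with_synchrony qD sD rb (v1 := v1) (l0 := l0)).
- by rewrite jac_net_jacobian; exact: ker1.
- exact: l00.
- by rewrite jac_net_jacobian.
- by move=> D' sD' D'D D'v1 y' Wy; apply: (W_left_kernel sD' D'D D'v1 l0J Wy).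
Qed.

End BranchAt.

(** * Conditions for all synchrony subspaces and quotients at once *)

Section FiniteFamilies.
Variables (R : realType) (n k : nat) (N : network n k) (mu : 'rV[R]_k.+1 -> R[i]).
Hypothesis nmu : network_eigenvalue N mu.
Local Notation S := (@bif_problem R k mu).

(** Polydiagonals are coded by finite functions: there are finitely many of them, so their generic
    conditions can be combined before [f] is chosen. *)
Definition poly_set (e : {ffun 'I_n * 'I_n -> bool}) : set 'cV[R]_n :=
  [set x | forall i j, e (i, j) -> x i 0 = x j 0].

Lemma polydiagonal_poly_set (D : set 'cV[R]_n) : polydiagonal D -> exists e, D = poly_set e.
Proof.
move=> [e ->]; exists [ffun ij => e ij.1 ij.2].
by apply/seteqP; split=> x h i j; have := h i j; rewrite ffunE.
Qed.

Lemma generic_submaximal : generic S (fun f => forall e, mu_submaximal N mu (poly_set e) ->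
  forall D', synchrony N D' -> D' `<` poly_set e ->
    D' `&` gen_kernel N f `<` poly_set e `&` gen_kernel N f).
Proof.
apply: generic_forall => e.
have [[j [_ [_ _ _ h]]]|nh] := pselect (mu_submaximal N mu (poly_set e)).
  by apply: generic_sub h.
exact: genericT.
Qed.

Lemma generic_geometric : generic S (fun f => forall e,
  multiplicity_on N (poly_set e) mu 1 2 ->
  exists m (Q : network m k) c, quotient_network N (poly_set e) Q c /\ geom_mult Q f 0 = 1%N).
Proof.
apply: generic_forall => e.
have [[m [Q [c [qD h]]]]|nh] := pselect (multiplicity_on N (poly_set e) mu 1 2); last exact: genericT.
have := generic_transfer nmu (P := fun a =>
  \rank (eigenspace (map_mx (real_complex R) (netmx Q a))^T (mu a)) = 1%N).
move=> H; apply: generic_sub (H _) => [f [_ mu0 _ _] rk _|].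
  by exists m, Q, c; split; [exact: qD|rewrite mu0 in rk; exact: rk].
by apply: generic_sub h => f _ [].
Qed.

Lemma generic_branches : generic S (fun f => forall m (Q : network m.+1 k) (r : 'I_m.+1 -> 'I_m.+1),
  (m < n)%N -> (forall p, r (r p) = r p) -> (forall l p, r (Q l p) = r (Q l (r p))) ->
  jordan_at Q r (@jet R k) f -> formal_branch Q (@jet R k) f).
Proof.
pose net (m : nat) (q : {ffun 'I_k * 'I_m.+1 -> 'I_m.+1}) : network m.+1 k :=
  fun l p => q (l, p).
have : generic S (fun f => forall (m : 'I_n)
    (qr : {ffun 'I_k * 'I_m.+1 -> 'I_m.+1} * {ffun 'I_m.+1 -> 'I_m.+1}),
  (forall p, qr.2 (qr.2 p) = qr.2 p) ->
  (forall l p, qr.2 (net m qr.1 l p) = qr.2 (net m qr.1 l (qr.2 p))) ->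
  jordan_at (net m qr.1) qr.2 (@jet R k) f -> formal_branch (net m qr.1) (@jet R k) f).
  apply: generic_forall => m; apply: generic_forall => -[q r] /=.
  have [rr|nrr] := pselect (forall p, r (r p) = r p); last exact: genericT.
  have [rQ|nrQ] := pselect (forall l p, r (net m q l p) = r (net m q l (r p))); last exact: genericT.
  by apply: generic_sub (generic_formal_branch rr rQ mu).
apply: generic_sub => f _ H m Q r mn rr rQ.
have := H (Ordinal mn) ([ffun lp => Q lp.1 lp.2], [ffun p => r p]) => /=.
have -> : net m [ffun lp => Q lp.1 lp.2] = Q.
  by apply/funext => l; apply/funext => p; rewrite /net ffunE.
have -> : ([ffun p => r p] : 'I_m.+1 -> 'I_m.+1) = r by apply/funext => p; rewrite ffunE.
exact.
Qed.

End FiniteFamilies.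

Section KernelDimension.
Variables (R : realType) (n k : nat) (N : network n k).

(** The conclusion lives in the ambient space and so does not depend on the numbering of the cells;
    it passes from the quotient given by [multiplicity_on] to any other one. *)
Lemma kernel_line m (Q : network m k) (D : set 'cV[R]_n) c (f : dynamics R k) :
  quotient_network N D Q c -> geom_mult Q f 0 = 1%N ->
  forall x y : 'cV[R]_n, D x -> D y -> net_jacobian N f *m x = 0 ->
    net_jacobian N f *m y = 0 -> x != 0 -> exists s, y = s *: x.
Proof.
move=> qD; rewrite /geom_mult /eigenspace /cjacobian raddf0 subr0 map_trmx -map_kermx mxrank_map.
move=> rk x y; have [_ -> _] := qD => -[x' _ <-] [y' _ <-].
have sync0 : sync_incl c (0 : 'cV[R]_m) = 0 by apply/matrixP => i j; rewrite !mxE.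
have K (z : 'cV[R]_m) : net_jacobian N f *m sync_incl c z = 0 ->
    (z^T <= kermx (net_jacobian Q f)^T)%MS.
  rewrite -(sync_netmx qD) => h; apply/sub_kermxP; rewrite -trmx_mul.
  by rewrite (sync_incl_inj qD (etrans h (esym sync0))) trmx0.
move=> /K hx /K hy x0.
have x'0 : x'^T != 0.
  apply: contraNneq x0 => h; rewrite -[x']trmxK h trmx0 sync0 //.
have : (y'^T <= x'^T)%MS.
  apply: submx_trans hy _; rewrite -(geq_leqif (mxrank_leqif_sup hx)) rk.
  by rewrite lt0n mxrank_eq0.
move=> /sub_rVP[s E]; exists s; rewrite -sync_inclZ; congr sync_incl.
by rewrite -[LHS]trmxK E linearZ /= trmxK.
Qed.

Lemma quotient_size m (Q : network m k) (D : set 'cV[R]_n) c :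
  quotient_network N D Q c -> (m <= n)%N.
Proof.
move=> [cs _ _]; have /choice[g gK] : forall q, exists i, c i = q by exact: cs.
by have := leq_card g (can_inj gK); rewrite !card_ord.
Qed.

End KernelDimension.

Theorem theorem3p10 (R : realType) (n k : nat) (N : network n k)
    (mu : 'rV[R]_k.+1 -> R[i]) :
  net_connected N ->
  network_eigenvalue N mu ->
  defective N mu ->
  generic (bif_problem mu) (fun f : dynamics R k =>
    forall D : set 'cV[R]_n,
    mu_submaximal N mu D ->
    multiplicity_on N D mu 1 2 ->
    forall (m : nat) (Q : network m k) (c : 'I_n -> 'I_m),
    quotient_network N D Q c ->
    let J : 'M[R]_m := net_jacobian Q f in
    let U : set 'cV[R]_m := rangemx (J *m J) in
    forall D1 : set 'cV[R]_n,
    D1 `<` D ->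
    mu_maximal N mu D1 ->
    forall v1 v2 v1s v2s : 'cV[R]_m,
    J *m J *m v1 = 0 ->
    J *m J *m v2 = 0 ->
    orthc U v1s ->
    orthc U v2s ->
    D1 (sync_incl c v1) ->
    D1 (sync_incl c v1s) ->
    J *m v2 = v1 ->
    dot v1s v1 = 1 ->
    dot v2s v2 = 1 ->
    dot v1s v2s = 0 ->
    forall P : 'M[R]_m,
    is_projection P U (orthc U) ->
    forall PJinv : 'M[R]_m,
    is_inverse_on U (P *m J) PJinv ->
    let w : 'cV[R]_m := v2 - PJinv *m (P *m v1) in
    (exists p q : 'I_k.+1,
       dot v2s (cmul (adjmx0 R Q p *m w) (adjmx0 R Q q *m w)) != 0) ->
    has_branch_with_synchrony N f D).
Proof.
move=> _ nmu _.
apply: generic_sub (generic_and (generic_submaximal N mu)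
  (generic_and (generic_geometric nmu) (generic_branches n mu))) => f Sf [G1 [G2 G3]].
have [sf _ _ axf] := Sf.
move=> D sub mult [|m] Q c qD J U D1 D1D [sD1 _ _] v1 v2 v1s v2s _ J2v2 ort _ D1v1 _ Jv2 v1sv1
  _ _ P _ PJ _ w _.
  (* A quotient without cells is excluded, as the empty inner product is 0. *)
  by move/eqP: v1sv1; rewrite /dot big_ord0 eq_sym oner_eq0.
have [_ [_ [sD _ _ _]]] := sub; have [e De] := polydiagonal_poly_set sD.1.
rewrite De in sub mult; have [m' [Q' [c' [qD' gm]]]] := G2 e mult.
have mn := quotient_size qD.
apply: (branch_at qD sD sf axf _ _ _ sD1 D1D J2v2 Jv2 ort D1v1 v1sv1).
- by rewrite De; apply: kernel_line qD' gm.
- by rewrite De; apply: G1.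
- by move=> r; apply: G3.
Qed.
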